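(* Let $\alpha\in(0,2)$, $N>\alpha$, $T>0$, and $\mu_\alpha(\mathrm{d}z):=\frac{c_{N,\alpha}\,\mathrm{d}z}{|z|^{N+\alpha}}$. Then the space $$L^2(0,T;\dot H^{\alpha/2}(\mathbb{R}^N)):=L^2\big(0,T;L^{\frac{2N}{N-\alpha}}(\mathbb{R}^N)\big)\cap L^2(0,T;E_{\mu_\alpha}(\mathbb{R}^N))$$ is a Hilbert space with inner product $$\langle\psi,\phi\rangle:=\int_0^T\int_{\mathbb{R}^N}|\xi|^\alpha\,\mathcal{F}\{\psi(\cdot,t)\}(\xi)\,\overline{\mathcal{F}\{\phi(\cdot,t)\}(\xi)}\,\mathrm{d}\xi\,\mathrm{d}t=\kappa\int_0^T\mathcal{E}_{\mu_\alpha}[\psi(\cdot,t),\phi(\cdot,t)]\,\mathrm{d}t,$$ where $\kappa>0$ is a constant depending only on $N$, $\alpha$ and the normalization of the Fourier transform. Moreover, $$L^2(0,T;\dot H^{\alpha/2}(\mathbb{R}^N))=\overline{C_c^\infty(\mathbb{R}^N\times[0,T))}^{\sqrt{\langle\cdot,\cdot\rangle}}.$$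
   Context: $Q_T:=\mathbb{R}^N\times(0,T)$; functions are real-valued and identified when equal a.e.; $\mathcal{F}$ is the Fourier transform in $x$ (of tempered distributions); $c_{N,\alpha}>0$ is the normalization constant for which $\mu_\alpha$ is the L\'evy measure of $-(-\Delta)^{\alpha/2}$. For $q\in(1,\infty)$, $L^2(0,T;L^q(\mathbb{R}^N)):=\{f:\mathbb{R}^N\times(0,T)\to\mathbb{R}\text{ measurable}:\int_0^T\|f(\cdot,t)\|_{L^q}^2\mathrm{d}t<\infty\}$ (an iterated $L^p$-space). $\mathcal{E}_{\mu_\alpha}[f,g]:=\frac12\int_{\mathbb{R}^N}\int_{|z|>0}(f(x+z)-f(x))(g(x+z)-g(x))\,\mu_\alpha(\mathrm{d}z)\mathrm{d}x$ and $L^2(0,T;E_{\mu_\alpha}(\mathbb{R}^N)):=\{f:Q_T\to\mathbb{R}\text{ measurable}:\int_0^T\mathcal{E}_{\mu_\alpha}[f(\cdot,t),f(\cdot,t)]\mathrm{d}t<\infty\}$. The last identity means that $C_c^\infty(\mathbb{R}^N\times[0,T))$ (restricted to $Q_T$) is a dense subset of the space in the norm $\sqrt{\langle\cdot,\cdot\rangle}$. *)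

(* Defs.v *)
From HB Require Import structures.
From mathcomp Require Import all_boot all_order all_algebra.
From mathcomp Require Import complex.
From mathcomp Require Import all_classical all_reals all_analysis.

Set Implicit Arguments.
Unset Strict Implicit.
Unset Printing Implicit Defensive.

Import Order.TTheory GRing.Theory Num.Theory.
Import numFieldNormedType.Exports.

Local Open Scope classical_set_scope.
Local Open Scope ring_scope.

(* The sigma-algebra of R^n is generated by the coordinates; it is the Borel
   sigma-algebra.  Every Lebesgue measurable function is a.e. equal to a Borel
   one, so this gives the usual classes of functions modulo a.e. equality. *)
Definition rV_display : measure_display -> measure_display.
Proof. exact. Qed.

Section measurable_rV.
Context {d} {T : sigmaRingType d}.
Variable n : nat.

Let coords : 'I_n -> 'rV[T]_n -> T := fun i x => x ord0 i.

Let rV_set0 : g_sigma_preimage coords set0.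
Proof. exact: sigma_algebra0. Qed.

Let rV_setC A : g_sigma_preimage coords A -> g_sigma_preimage coords (~` A).
Proof. exact: sigma_algebraC. Qed.

Let rV_bigcup (F : (set 'rV[T]_n)^nat) :
  (forall i, g_sigma_preimage coords (F i)) ->
  g_sigma_preimage coords (\bigcup_i (F i)).
Proof. exact: sigma_algebra_bigcup. Qed.

HB.instance Definition _ := @isMeasurable.Build (rV_display d)
  'rV[T]_n (g_sigma_preimage coords) rV_set0 rV_setC rV_bigcup.

End measurable_rV.

Section lebesgue_rV.
Variable R : realType.

Definition rV_cons n (p : R * 'rV[R]_n) : 'rV[R]_n.+1 :=
  \row_(i < n.+1) oapp (p.2 ord0) p.1 (unlift ord0 i).

Lemma measurable_rV_coord n (i : 'I_n) :
  measurable_fun [set: 'rV[R]_n] (fun x => x ord0 i).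
Proof.
move=> _ Y mY; rewrite setTI; apply: sub_sigma_algebra => /=.
rewrite -bigcup_seq /=; exists i => /=; first by rewrite mem_index_enum.
by exists Y => //; rewrite setTI.
Qed.

Lemma measurable_fun_rVP d (X : measurableType d) n (f : X -> 'rV[R]_n) :
  (forall i, measurable_fun [set: X] (fun x => f x ord0 i)) ->
  measurable_fun [set: X] f.
Proof.
move=> mf.
have sub : g_sigma_preimage (fun i => (fun y : 'rV[R]_n => y ord0 i) \o f)
           `<=` measurable.
  apply: smallest_sub; first exact: sigma_algebra_measurable.
  case: n => [|n] in f mf *; first by rewrite big_ord0.
  rewrite -bigcup_mkord_ord; apply: bigcup_sub => i Ii A [B mB <-].
  exact: mf.
rewrite g_sigma_preimage_comp in sub.
by move=> _ A mA; apply: sub; exists A.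
Qed.

Lemma measurable_rV_cons n : measurable_fun setT (@rV_cons n).
Proof.
apply: measurable_fun_rVP => i.
under eq_fun do rewrite mxE.
case: (unliftP ord0 i) => [j|] _ /=; last exact: measurable_fst.
apply: measurableT_comp (measurable_rV_coord j) _; exact: measurable_snd.
Qed.

Definition rV_uncons n (x : 'rV[R]_n.+1) : R * 'rV[R]_n :=
  (x ord0 ord0, \row_(i < n) x ord0 (lift ord0 i)).

Lemma rV_consK n : cancel (@rV_cons n) (@rV_uncons n).
Proof.
case=> s x; rewrite /rV_uncons /rV_cons mxE unlift_none /=; congr pair.
by apply/rowP => i; rewrite !mxE liftK /=.
Qed.

Lemma measurable_rV_uncons n : measurable_fun setT (@rV_uncons n).
Proof.
apply/measurable_fun_prod => /=; first exact: measurable_rV_coord.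
apply: measurable_fun_rVP => i; under eq_fun do rewrite mxE.
exact: measurable_rV_coord.
Qed.

Section step.
Variables (n : nat) (m : {sigma_finite_measure set 'rV[R]_n -> \bar R}).

Definition lebesgue_rVS : set 'rV[R]_n.+1 -> \bar R :=
  pushforward (@lebesgue_measure R \x m)%E (@rV_cons n).

Let lebesgue_rVS0 : lebesgue_rVS set0 = 0%E.
Proof. by rewrite /lebesgue_rVS /pushforward preimage_set0 measure0. Qed.

Let lebesgue_rVS_ge0 A : (0 <= lebesgue_rVS A)%E.
Proof. by rewrite /lebesgue_rVS /pushforward measure_ge0. Qed.

Let lebesgue_rVS_sigma_additive : semi_sigma_additive lebesgue_rVS.
Proof.
move=> F mF tF mUF; rewrite /lebesgue_rVS /pushforward preimage_bigcup.
apply: measure_semi_sigma_additive.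
- by move=> k; rewrite -[X in measurable X]setTI; exact: measurable_rV_cons.
- apply/trivIsetP => /= i j _ _ ij; rewrite -preimage_setI.
  by move/trivIsetP : tF => /(_ _ _ _ _ ij) -> //; rewrite preimage_set0.
- rewrite -preimage_bigcup -[X in measurable X]setTI.
  exact: measurable_rV_cons.
Qed.

HB.instance Definition _ := isMeasure.Build _ _ _ lebesgue_rVS
  lebesgue_rVS0 lebesgue_rVS_ge0 lebesgue_rVS_sigma_additive.

Let lebesgue_rVS_sigma_finite : sigma_finite setT lebesgue_rVS.
Proof.
have /sigma_finiteP[F [TF ndF Foo]] := sigma_finiteT (@lebesgue_measure R).
have /sigma_finiteP[G [TG ndG Goo]] := sigma_finiteT m.
exists (fun k => @rV_uncons n @^-1` (F k `*` G k)).
  apply/esym/seteqP; split => // x _.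
  have [k _ Fk] : (\bigcup_i F i) (rV_uncons x).1 by rewrite -TF.
  have [l _ Gl] : (\bigcup_i G i) (rV_uncons x).2 by rewrite -TG.
  exists (maxn k l) => //; split.
    by move: Fk; exact/subsetPset/ndF/leq_maxl.
  by move: Gl; exact/subsetPset/ndG/leq_maxr.
move=> k; have [mF Fkoo] := Foo k; have [mG Gkoo] := Goo k; split.
  rewrite -[X in measurable X]setTI; apply: measurable_rV_uncons => //.
  exact: measurableX.
rewrite /lebesgue_rVS /pushforward -comp_preimage.
rewrite (_ : _ \o _ = id); last by rewrite funeqE => p /=; rewrite rV_consK.
by rewrite preimage_id product_measure1E// lte_mul_pinfty// ge0_fin_numE.
Qed.

HB.instance Definition _ := Measure_isSigmaFinite.Build _ _ _ lebesgue_rVS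
  lebesgue_rVS_sigma_finite.

End step.

(* lebesgue_rV n is the n-fold product of the Lebesgue measure of the line,
   carried over to row vectors. *)
Fixpoint lebesgue_rV n : {sigma_finite_measure set 'rV[R]_n -> \bar R} :=
  match n return {sigma_finite_measure set 'rV[R]_n -> \bar R} with
  | 0 => dirac (0 : 'rV[R]_0)
  | n'.+1 => lebesgue_rVS (lebesgue_rV n')
  end.

End lebesgue_rV.

Section euclidean.
Variables (R : realType) (n : nat).
Implicit Types x y : 'rV[R]_n.

Definition dotp x y : R := \sum_(i < n) x ord0 i * y ord0 i.

(* The library norm `|x| on row vectors is the maximum norm. *)
Definition enorm x : R := Num.sqrt (dotp x x).

End euclidean.

Section smooth.
Variables (R : realType) (V : normedModType R).

Definition iter_derive (f : V -> R) (vs : seq V) : V -> R :=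
  foldr (fun v g => 'D_v g) f vs.

Definition smooth (f : V -> R) : Prop := forall vs : seq V,
  continuous (iter_derive f vs) /\
  forall v x, derivable (iter_derive f vs) x v.

End smooth.

Section complex_integral.
Context {d} {T : measurableType d} {R : realType}.
Variable mu : {measure set T -> \bar R}.

Definition cintegrable (D : set T) (f : T -> R[i]) : Prop :=
  mu.-integrable D (EFin \o (fun x => complex.Re (f x))) /\
  mu.-integrable D (EFin \o (fun x => complex.Im (f x))).

(* Integrability with respect to the completion of mu. *)
Definition ae_cintegrable (D : set T) (f : T -> R[i]) : Prop :=
  exists2 g : T -> R[i], cintegrable D g & ae_eq mu D f g.

Definition cintegral (D : set T) (f : T -> R[i]) : R[i] :=
  Complex (\int[mu]_(x in D) complex.Re (f x))
          (\int[mu]_(x in D) complex.Im (f x)).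

End complex_integral.

Section fourier.
Local Open Scope complex_scope.
Variables (R : realType) (N : nat).
Local Notation leb := (@lebesgue_rV R N).

Definition schwartz_real (eta : 'rV[R]_N -> R) : Prop :=
  smooth eta /\
  forall (k : nat) (vs : seq 'rV[R]_N), exists C : R, forall x,
    (1 + enorm x) ^+ k * `|iter_derive eta vs x| <= C.

Definition schwartz (eta : 'rV[R]_N -> R[i]) : Prop :=
  schwartz_real (fun x => complex.Re (eta x)) /\
  schwartz_real (fun x => complex.Im (eta x)).

Definition cexpi (theta : R) : R[i] := cos theta +i* sin theta.

(* a and b are the normalization of the transform:
   F eta (xi) = a * \int eta(x) exp(- i b x.xi) dx. *)
Variables a b : R.

Definition fourier_schwartz (eta : 'rV[R]_N -> R[i]) (xi : 'rV[R]_N) : R[i] :=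
  a%:C * cintegral leb setT (fun x => eta x * cexpi (- (b * dotp x xi))).

(* The Fourier transform of f, as a tempered distribution, is the function g:
   <F f, eta> = <f, F eta> for every Schwartz function eta. *)
Definition is_fourier (f : 'rV[R]_N -> R) (g : 'rV[R]_N -> R[i]) : Prop :=
  forall eta, schwartz eta ->
  [/\ cintegrable leb setT (fun x => (f x)%:C * fourier_schwartz eta x),
      cintegrable leb setT (fun xi => g xi * eta xi) &
      cintegral leb setT (fun xi => g xi * eta xi) =
      cintegral leb setT (fun x => (f x)%:C * fourier_schwartz eta x)].

(* Such a g is unique up to a.e. equality; the value is the zero function when
   the distribution F f is not a function. *)
Definition fourier (f : 'rV[R]_N -> R) : 'rV[R]_N -> R[i] :=
  xget (fun=> 0) [set g | is_fourier f g].

End fourier.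

Section spaces.
Variables (R : realType) (N : nat).
Local Notation leb := (@lebesgue_rV R N).
Local Notation lebt := (@lebesgue_measure R).

Definition slice (f : 'rV[R]_N * R -> R) (t : R) : 'rV[R]_N -> R :=
  fun x => f (x, t).

Definition QT (T : R) : set ('rV[R]_N * R) := setT `*` `]0, T[.

Definition ae_eq_QT (T : R) (f g : 'rV[R]_N * R -> R) : Prop :=
  ae_eq (leb \x lebt)%E (QT T) f g.

Definition L2Lq (q T : R) : set ('rV[R]_N * R -> R) :=
  [set f | measurable_fun (QT T) f /\
    (\int[lebt]_(t in `]0%R, T[)
       (Lnorm leb q%:E (EFin \o slice f t) ^+ 2) < +oo)%E].

(* The density of mu_alpha with respect to the Lebesgue measure. *)
Definition levy_density (alpha c : R) (z : 'rV[R]_N) : R :=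
  c / enorm z `^ (N%:R + alpha).

(* c is the constant c_{N,alpha}.  The operator with Levy measure mu_alpha has
   symbol - \int (1 - cos (z.xi)) mu_alpha(dz) (Levy-Khintchine), and the
   operator - (- Delta)^{alpha/2} has symbol - |xi|^alpha. *)
Definition levy_normalization (alpha c : R) : Prop :=
  0 < c /\
  forall xi : 'rV[R]_N,
    (\int[leb]_(z in [set z | z != 0%R])
       ((1 - cos (dotp z xi)) * levy_density alpha c z)%:E)%E
    = (enorm xi `^ alpha)%:E.

Definition energy (alpha c : R) (f g : 'rV[R]_N -> R) : \bar R :=
  ((2^-1)%:E * \int[leb]_x \int[leb]_(z in [set z | z != 0%R])
     ((f (x + z)%R - f x) * (g (x + z)%R - g x) * levy_density alpha c z)%:E)%E.

Definition energy_T (alpha c T : R) (f g : 'rV[R]_N * R -> R) : \bar R :=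
  (\int[lebt]_(t in `]0%R, T[) energy alpha c (slice f t) (slice g t))%E.

Definition L2E (alpha c T : R) : set ('rV[R]_N * R -> R) :=
  [set f | measurable_fun (QT T) f /\ (energy_T alpha c T f f < +oo)%E].

Definition L2Hdot (alpha c T : R) : set ('rV[R]_N * R -> R) :=
  L2Lq (2 * N%:R / (N%:R - alpha)) T `&` L2E alpha c T.

(* Smooth functions on R^N x R whose support is a compact subset of
   R^N x (-oo, T); their restrictions to R^N x [0, T) are the elements of
   C_c^oo(R^N x [0, T)). *)
Definition test_fun (T : R) : set ('rV[R]_N * R -> R) :=
  [set f | [/\ smooth f, compact (closure [set p | f p != 0]) &
               closure [set p | f p != 0] `<=` [set p | p.2 < T]]].

Section fourier_form.
Local Open Scope complex_scope.
Variables alpha a b : R.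

Definition fourier_integrand (f g : 'rV[R]_N -> R) (xi : 'rV[R]_N) : R[i] :=
  (enorm xi `^ alpha)%:C * fourier a b f xi * (fourier a b g xi)^*.

Definition fourier_form_x (f g : 'rV[R]_N -> R) : R[i] :=
  cintegral leb setT (fourier_integrand f g).

Definition fourier_form (T : R) (f g : 'rV[R]_N * R -> R) : R[i] :=
  cintegral lebt `]0, T[ (fun t => fourier_form_x (slice f t) (slice g t)).

(* Every expression in the definition of fourier_form T f g is meaningful. *)
Definition fourier_form_defined (T : R) (f g : 'rV[R]_N * R -> R) : Prop :=
  [/\ {ae lebt, forall t, `]0, T[%classic t ->
         [/\ exists F, is_fourier a b (slice f t) F,
             exists G, is_fourier a b (slice g t) G &
             cintegrable leb setT
               (fourier_integrand (slice f t) (slice g t))]} &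
      ae_cintegrable lebt `]0, T[
        (fun t => fourier_form_x (slice f t) (slice g t))].

End fourier_form.

End spaces.

Section hilbert.
Variables (R : realType) (X : Type).

(* The functions in V, identified when they are equivalent for eqv, form a real
   Hilbert space for the inner product ip. *)
Record hilbert_space (V : set (X -> R)) (eqv : (X -> R) -> (X -> R) -> Prop)
    (ip : (X -> R) -> (X -> R) -> R) : Prop := {
  hilbert0 : V (cst 0) ;
  hilbertD : forall f g, V f -> V g -> V (f \+ g) ;
  hilbertZ : forall k f, V f -> V (k \*o f) ;
  ip_eqv : forall f f' g, V f -> V f' -> V g -> eqv f f' -> ip f g = ip f' g ;
  ipC : forall f g, V f -> V g -> ip f g = ip g f ;
  ipDl : forall f g h, V f -> V g -> V h -> ip (f \+ g) h = ip f h + ip g h ;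
  ipZl : forall k f g, V f -> V g -> ip (k \*o f) g = k * ip f g ;
  ip_ge0 : forall f, V f -> 0 <= ip f f ;
  ip_eq0 : forall f, V f -> ip f f = 0 -> eqv f (cst 0) ;
  hilbert_complete : forall u : nat -> X -> R, (forall n, V (u n)) ->
    (forall e, 0 < e -> exists n0 : nat, forall m n, (n0 <= m)%N -> (n0 <= n)%N ->
       Num.sqrt (ip (u m \- u n) (u m \- u n)) < e) ->
    exists2 f, V f &
      Num.sqrt (ip (u n \- f) (u n \- f)) @[n --> \oo] --> (0 : R)
}.

Definition ip_dense (V A : set (X -> R)) (ip : (X -> R) -> (X -> R) -> R) :=
  A `<=` V /\
  forall f e, V f -> 0 < e ->
    exists2 g, A g & Num.sqrt (ip (f \- g) (f \- g)) < e.

End hilbert.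

(* Main.v *)
(* Fix a time and write E for the energy.  A pointwise argument, averaging
   f(x)^2 <= 2 (f(x+z) - f(x))^2 + 2 f(x+z)^2 over cubes and optimising their
   size, gives the Sobolev inequality ||f||_q^2 <= C E[f,f].  For integrable and
   square-integrable f, Gaussian regularisation gives Plancherel's identity;
   applied to the increments of f and integrated against the Levy measure it
   reads \int |xi|^alpha |F f|^2 = const * E[f,f], by the normalisation of the
   Levy constant.  Soft thresholding approximates a general f in energy by such
   functions, whose transforms are then Cauchy in L^2(|xi|^alpha) and converge to
   the distributional transform of f.  Completeness follows from the same
   Sobolev inequality: Cauchy sequences converge in a weighted L^2, hence a.e.
   along a subsequence, and Fatou's lemma bounds the energy of the limit.

   For the density, let h be orthogonal to all test functions.  Testing against
   phi(x - y) theta(t) gives E[h(.,t), phi(. - y)] = 0 for a.e. (y, t).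
   Integrated against an integrable g(y), this is a Fourier integral in which
   phi enters only through a multiplier tending to 1 as phi concentrates at 0;
   so E[h(.,t), g] = 0, and for g a soft threshold of h(.,t) this dominates
   E[g, g].  Removing the threshold, E[h(.,t), h(.,t)] = 0. *)

From HB Require Import structures.
Require Import Defs.
From mathcomp Require Import all_boot all_order all_algebra.
From mathcomp Require Import complex.
From mathcomp Require Import all_classical all_reals all_analysis.
From mathcomp Require Import measurable_realfun.
From mathcomp Require Import lra ring.

Set Implicit Arguments.
Unset Strict Implicit.
Unset Printing Implicit Defensive.

Import Order.TTheory GRing.Theory Num.Theory.
Import numFieldNormedType.Exports.

Local Open Scope classical_set_scope.
Local Open Scope ring_scope.

(** The functions only have the critical integrability exponent q > 2, so neither the Fourier
    integral nor Plancherel's identity applies to them directly. Soft thresholding suits a nonlocal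
    form: by a Chebyshev estimate the result is integrable and square-integrable, and since the
    threshold and its complement are both nondecreasing, every increment splits into two parts of
    the same sign, which bounds the energy of each part without a product rule. In Plancherel's
    identity the Gaussian kernel of width d is at most a constant times d^alpha times the Levy
    density, so finite energy itself makes the defect vanish. Polar coordinates never occur:
    integrals of the Levy density come from the symbol identity in [levy_normalization], those of
    the Riesz weight from dyadic cubes. Transforms are split into real cosine and sine parts, and
    the imaginary part of the form cancels by parity. Finite energy alone would admit nonzero
    constants. The finite [Lq] norm of almost every slice excludes them; in the completeness proof
    it passes to the limit along subsequences that depend on the time. *)

Lemma norm_mul_le_sqr {R : realType} (x y : R) : `|x * y| <= x ^+ 2 + y ^+ 2.
Proof.
rewrite normrM -(real_normK (num_real x)) -(real_normK (num_real y)).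
have := sqr_ge0 (`|x| - `|y|); have := sqr_ge0 `|x|; have := sqr_ge0 `|y|.
by move: `|x| `|y| => u v; nra.
Qed.

Lemma sqrD_le {R : realType} (x y : R) : (x + y) ^+ 2 <= 2 * x ^+ 2 + 2 * y ^+ 2.
Proof. by have := sqr_ge0 (x - y); nra. Qed.

Lemma cvg0_le {R : realType} (u v : nat -> R) : (forall n, `|u n| <= v n) ->
  v n @[n --> \oo] --> 0 -> u n @[n --> \oo] --> 0.
Proof.
move=> uv /cvgrPdist_lt v0; apply/cvgrPdist_lt => e e0.
have := v0 e e0; apply: filterS => n; rewrite !sub0r !normrN => vn.
by apply: le_lt_trans vn; apply: le_trans (uv n) (ler_norm _).
Qed.

(** * Measure and integration *)

Section general_measure.
Context {d} {X : measurableType d} {R : realType}.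
Variable mu : {measure set X -> \bar R}.

Import HBNNSimple.

(* Neither function has to be measurable: an nnsfun below f can be cut off on
   the measurable null set where f and g differ. *)
Lemma ae_eq_integral_nomeas (D : set X) (f g : X -> \bar R) :
  ae_eq mu D f g -> (\int[mu]_(x in D) f x = \int[mu]_(x in D) g x)%E.
Proof.
move=> [A [mA A0 sA]].
have key (u v : X -> \bar R) : (forall x, 0 <= v x)%E ->
    (forall x, ~ A x -> u x = v x) ->
    (ereal_sup [set sintegral mu h |
       h in [set h : {nnsfun X >-> R} | forall x, (h x)%:E <= u x]] <=
     ereal_sup [set sintegral mu h |
       h in [set h : {nnsfun X >-> R} | forall x, (h x)%:E <= v x]])%E.
  move=> v0 uv; apply: ge_ereal_sup => _ [h hu <-].
  have mAC : measurable (~` A) by exact: measurableC.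
  apply: ereal_sup_ubound; exists (proj_nnsfun h mAC) => /=.
    move=> x; rewrite mindicE.
    case: (boolP (x \in ~` A)) => [|_]; last by rewrite mulr0.
    by rewrite inE/= => Ax; rewrite mulr1 -uv.
  rewrite -!integralT_nnsfun; apply: ae_eq_integral => //.
    - exact/measurable_EFinP.
    - exact/measurable_EFinP.
  exists A; split => // x /= /not_implyP[_] hx; apply: contrapT => Ax; apply: hx.
  by rewrite mindicE mem_set// mulr1.
have fg x : ~ A x -> (f \_ D) x = (g \_ D) x.
  move=> Ax; rewrite !patchE; case: ifPn => //; rewrite inE => Dx.
  apply: contrapT => fgx; apply: Ax; apply: sA => /= /(_ Dx); exact: fgx.
rewrite /integral; congr (_ - _)%E; apply/eqP; rewrite eq_le; apply/andP; split;
  apply: key => // x Ax; by rewrite ?funeposE ?funenegE fg.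
Qed.

(** The sets over which [h] integrates to zero form a Dynkin system; the vanishing total integral is
    what gives stability under complements. An integrable function with zero integral over every
    measurable set vanishes almost everywhere. *)
Lemma pi_system_ae_eq0 (h : X -> R) (G : set (set X)) :
  @measurable _ X = <<s G >> -> setI_closed G ->
  mu.-integrable setT (EFin \o h) ->
  (\int[mu]_x (h x)%:E = 0)%E ->
  (forall A, G A -> (\int[mu]_(x in A) (h x)%:E = 0)%E) ->
  {ae mu, forall x, h x = 0}.
Proof.
move=> mG GI hi hT hG.
have key (E : set X) : measurable E -> (\int[mu]_(x in E) (h x)%:E = 0)%E.
  rewrite mG; move: E.
  apply: (dynkin_induction mG GI) => [//|A GA|A mA A0|F mF tF F0].
  - exact: hG.
  - have := hT.
    rewrite -(setUv A) integral_setU//; last 3 first.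
    + exact: measurableC.
    + by rewrite setUv; exact: measurable_int hi.
    + by apply/disj_set2P; rewrite setICr.
    by rewrite A0 add0e.
  - rewrite integral_bigcup//; last first.
      apply: integrableS hi => //; exact: bigcupT_measurable.
    exact: eseries0.
have : ae_eq mu setT (EFin \o h) (cst 0%E).
  apply: integral_ae_eq => // E _ mE.
  by rewrite key// integral0.
by apply: filterS => x /(_ I)[].
Qed.

Lemma integral_preserving (s : X -> X) (f : X -> \bar R) :
  measurable_fun setT s ->
  (forall A, measurable A -> mu (s @^-1` A) = mu A) ->
  measurable_fun setT f -> (forall x, 0 <= f x)%E ->
  (\int[mu]_x f (s x) = \int[mu]_x f x)%E.
Proof.
move=> ms s_inv mf f0.
have := @ge0_integral_pushforward _ _ _ _ R s ms mu setT f measurableT mf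
  (fun x _ => f0 x).
rewrite preimage_setT => <-.
by apply: eq_measure_integral => A mA _; exact: s_inv.
Qed.

Lemma fatou_cvg (f_ : nat -> X -> \bar R) (f : X -> \bar R) (C : \bar R) :
  (forall n, measurable_fun setT (f_ n)) -> (forall n x, 0 <= f_ n x)%E ->
  {ae mu, forall x, f_ n x @[n --> \oo] --> f x} ->
  (forall n, (\int[mu]_x f_ n x <= C)%E) -> (\int[mu]_x f x <= C)%E.
Proof.
move=> mf f0 ff fC.
have -> : (\int[mu]_x f x = \int[mu]_x limn_einf (f_^~ x))%E.
  apply: ae_eq_integral_nomeas; apply: filterS ff => x fx _.
  by have [-> _] := cvg_limn_einf_sup fx.
apply: le_trans (fatou mu measurableT mf (fun n x _ => f0 n x)) _.
rewrite limn_einf_lim; apply: lime_le; first exact: is_cvg_einfs.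
by apply: nearW => n; apply: le_trans (fC n); apply: ereal_inf_lbound; exists n => /=.
Qed.

Lemma monotone_cvg (f_ : nat -> X -> R) (f : X -> R) :
  (forall n, measurable_fun setT (f_ n)) -> (forall n x, 0 <= f_ n x) ->
  (forall x, {homo f_^~ x : m n / (m <= n)%N >-> m <= n}) ->
  (forall x, f_ n x @[n --> \oo] --> f x) ->
  ((\int[mu]_x (f_ n x)%:E)%E @[n --> \oo] --> \int[mu]_x (f x)%:E)%E.
Proof.
move=> mf f0 nd ff.
rewrite (_ : (\int[mu]_x (f x)%:E)%E =
  (\int[mu]_x (fun x0 => limn ((fun n x1 => (f_ n x1)%:E)^~ x0)) x)%E).
  apply: cvg_monotone_convergence => //.
  - by move=> n; exact/measurable_EFinP.
  - by move=> n x _; rewrite lee_fin.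
  - by move=> x _ m n mn; rewrite lee_fin; exact: nd.
apply: eq_integral => x _; apply/esym/cvg_lim => //.
by apply: cvg_EFin; [exact: nearW|exact: ff].
Qed.

Lemma Rintegral_ae_eq (f g : X -> R) :
  {ae mu, forall x, f x = g x} -> \int[mu]_x f x = \int[mu]_x g x.
Proof.
move=> fg; rewrite /Rintegral; congr fine; apply: ae_eq_integral_nomeas.
by apply: filterS fg => x fgx _; rewrite fgx.
Qed.

Lemma Rintegral_EFin (f : X -> R) : mu.-integrable setT (EFin \o f) ->
  (\int[mu]_x (f x)%:E)%E = (\int[mu]_x f x)%:E.
Proof.
by move=> fi; rewrite /Rintegral fineK//; exact: integrable_fin_num fi.
Qed.

Lemma Rdominated_cvg (f_ : nat -> X -> R) (f g : X -> R) :
  (forall n, measurable_fun setT (f_ n)) -> measurable_fun setT f ->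
  {ae mu, forall x, f_ n x @[n --> \oo] --> f x} ->
  mu.-integrable setT (EFin \o g) ->
  (forall n x, `|f_ n x| <= g x) ->
  mu.-integrable setT (EFin \o f) /\
  \int[mu]_x f_ n x @[n --> \oo] --> \int[mu]_x f x.
Proof.
move=> mf_ mf ff gi fg.
have fni n : mu.-integrable setT (EFin \o f_ n).
  apply: le_integrable gi => //; first exact/measurable_EFinP.
  by move=> x _; rewrite /= lee_fin (le_trans (fg n x))// ler_norm.
have [|||//||fi _ h] := @dominated_convergence _ _ _ mu setT measurableT
    (fun n => EFin \o f_ n) (EFin \o f) (EFin \o g).
- by move=> n; exact/measurable_EFinP.
- exact/measurable_EFinP.
- by apply: filterS ff => x fx _; apply: cvg_EFin => //; exact: nearW.
- by apply: nearW => x n _; rewrite /= lee_fin.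
split => //.
have := h; rewrite /= (Rintegral_EFin fi).
under eq_fun do rewrite (Rintegral_EFin (fni _)).
by move/fine_cvg.
Qed.

Lemma integrable_le (f g : X -> R) : mu.-integrable setT (EFin \o g) ->
  measurable_fun setT f -> (forall x, `|f x| <= g x) ->
  mu.-integrable setT (EFin \o f).
Proof.
move=> gi mf fg; apply: le_integrable gi => //; first exact/measurable_EFinP.
by move=> x _; rewrite /= lee_fin (le_trans (fg x))// ler_norm.
Qed.

Lemma integrable_addR (f g : X -> R) : mu.-integrable setT (EFin \o f) ->
  mu.-integrable setT (EFin \o g) ->
  mu.-integrable setT (EFin \o (fun x => f x + g x)).
Proof. by move=> fi gi; have := integrableD measurableT fi gi. Qed.

Lemma integrable_subR (f g : X -> R) : mu.-integrable setT (EFin \o f) ->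
  mu.-integrable setT (EFin \o g) ->
  mu.-integrable setT (EFin \o (fun x => f x - g x)).
Proof. by move=> fi gi; have := integrableB measurableT fi gi. Qed.

Lemma integrable_scaleR k (f : X -> R) : mu.-integrable setT (EFin \o f) ->
  mu.-integrable setT (EFin \o (fun x => k * f x)).
Proof. by move=> fi; have := integrableZl measurableT k fi. Qed.

Lemma RintegralN (f : X -> R) : mu.-integrable setT (EFin \o f) ->
  \int[mu]_x (- f x) = - \int[mu]_x f x.
Proof.
by move=> fi; under eq_Rintegral do rewrite -mulN1r; rewrite RintegralZl// mulN1r.
Qed.

Lemma integrable_lty_ge0 (f : X -> R) : measurable_fun setT f ->
  (forall x, 0 <= f x) -> (\int[mu]_x (f x)%:E < +oo)%E ->
  mu.-integrable setT (EFin \o f).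
Proof.
move=> mf f0 foo; apply/integrableP; split; first exact/measurable_EFinP.
by under eq_integral do rewrite /= ger0_norm//.
Qed.

Lemma integral_lty_ge0 (f : X -> R) : (forall x, 0 <= f x) ->
  mu.-integrable setT (EFin \o f) -> (\int[mu]_x (f x)%:E < +oo)%E.
Proof.
move=> f0 /integrableP[_]; congr (_ < _)%E.
by apply: eq_integral => x _; rewrite /= ger0_norm.
Qed.

Lemma le_integral_ge0 (f g : X -> \bar R) :
  measurable_fun setT f -> measurable_fun setT g ->
  (forall x, 0 <= f x)%E -> (forall x, f x <= g x)%E ->
  (\int[mu]_x f x <= \int[mu]_x g x)%E.
Proof. by move=> mf mg f0 fg; apply: ge0_le_integral => //. Qed.

Lemma ge0_integral_eq0_ae (f : X -> \bar R) : measurable_fun setT f ->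
  (forall x, 0 <= f x)%E -> (\int[mu]_x f x = 0)%E ->
  {ae mu, forall x, f x = 0%E}.
Proof.
move=> mf f0 If; have [|A [mA A0 sA]] := (ae_eq_integral_abs mu measurableT mf).1.
  by rewrite -If; apply: eq_integral => x _; rewrite gee0_abs.
by exists A; split => // x /= fx; apply: sA => /= /(_ I).
Qed.

Lemma ge0_ae_lty (f : X -> \bar R) : measurable_fun setT f ->
  (forall x, 0 <= f x)%E -> (\int[mu]_x f x < +oo)%E ->
  {ae mu, forall x, (f x < +oo)%E}.
Proof.
move=> mf f0 If; have : mu.-integrable setT f.
  apply/integrableP; split => //; congr (_ < _)%E: If.
  by apply: eq_integral => x _; rewrite gee0_abs.
move=> /integrable_ae => /(_ measurableT).
by apply: filterS => x /(_ I); rewrite ge0_fin_numE.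
Qed.

End general_measure.

Section product_sigma_finite.
Context {d1 d2} {X : measurableType d1} {Y : measurableType d2} {R : realType}.
Variables (m1 : {sigma_finite_measure set X -> \bar R})
  (m2 : {sigma_finite_measure set Y -> \bar R}).

Let product_measure1_sigma_finite : sigma_finite setT (m1 \x m2)%E.
Proof.
have /sigma_finiteP[F [TF ndF Foo]] := sigma_finiteT m1.
have /sigma_finiteP[G [TG ndG Goo]] := sigma_finiteT m2.
exists (fun k => F k `*` G k).
  apply/esym/seteqP; split => // x _.
  have [k _ Fk] : (\bigcup_i F i) x.1 by rewrite -TF.
  have [l _ Gl] : (\bigcup_i G i) x.2 by rewrite -TG.
  exists (maxn k l) => //; split.
    by move: Fk; exact/subsetPset/ndF/leq_maxl.
  by move: Gl; exact/subsetPset/ndG/leq_maxr.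
move=> k; have [mF Fkoo] := Foo k; have [mG Gkoo] := Goo k; split.
  exact: measurableX.
by rewrite product_measure1E// lte_mul_pinfty// ge0_fin_numE.
Qed.

Let sigma_finite_factory := Measure_isSigmaFinite.Build _ _ _ (m1 \x m2)%E
  product_measure1_sigma_finite.

(** The underlying set function is the product measure itself; carrying sigma-finiteness along
    allows Fubini's theorem on triple products, such as frequency or time against pairs of
    points. *)
Definition product_sigma_finite : {sigma_finite_measure set (X * Y)%type -> \bar R} :=
  HB.pack (m1 \x m2)%E sigma_finite_factory.

End product_sigma_finite.

Section fubini.
Context {d1 d2} {X : measurableType d1} {Y : measurableType d2} {R : realType}.
Variables (m1 : {sigma_finite_measure set X -> \bar R})
  (m2 : {sigma_finite_measure set Y -> \bar R}).

Lemma measurable_tonelli (f : X * Y -> R) : measurable_fun setT f ->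
  (forall p, 0 <= f p) ->
  measurable_fun setT (fun x => \int[m2]_y (f (x, y))%:E)%E.
Proof.
move=> mf f0; apply: (measurable_fun_fubini_tonelli_F (EFin \o f)) => //.
exact/measurable_EFinP.
Qed.

Lemma tonelliE (f : X * Y -> R) : measurable_fun setT f -> (forall p, 0 <= f p) ->
  (\int[m1 \x m2]_p (f p)%:E = \int[m1]_x \int[m2]_y (f (x, y))%:E)%E.
Proof.
move=> mf f0; rewrite (fubini_tonelli1 (EFin \o f))//.
exact/measurable_EFinP.
Qed.

Lemma tonelliC (f : X * Y -> R) : measurable_fun setT f -> (forall p, 0 <= f p) ->
  (\int[m1]_x \int[m2]_y (f (x, y))%:E = \int[m2]_y \int[m1]_x (f (x, y))%:E)%E.
Proof.
move=> mf f0; apply: (fubini_tonelli (EFin \o f)) => //.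
exact/measurable_EFinP.
Qed.

Lemma Rfubini (f : X * Y -> R) : (m1 \x m2)%E.-integrable setT (EFin \o f) ->
  \int[m1]_x \int[m2]_y f (x, y) = \int[(m1 \x m2)%E]_p f p.
Proof.
move=> fi; rewrite [RHS]/Rintegral -(integral12_prod_meas1 fi) [LHS]/Rintegral.
(* Almost every section is integrable, so there the [fine] hidden in the inner real integral loses
   nothing; the other sections form a null set. *)
congr fine; apply: ae_eq_integral_nomeas.
by apply: filterS (ae_integrable1 fi) => x fx _; rewrite /fubini_F Rintegral_EFin.
Qed.

Lemma RfubiniC (f : X * Y -> R) : (m1 \x m2)%E.-integrable setT (EFin \o f) ->
  \int[m1]_x \int[m2]_y f (x, y) = \int[m2]_y \int[m1]_x f (x, y).
Proof.
move=> fi; rewrite Rfubini// [LHS]/Rintegral -(integral21_prod_meas1 fi) [RHS]/Rintegral.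
congr fine; apply: ae_eq_integral_nomeas.
by apply: filterS (ae_integrable2 fi) => x fx _; rewrite /fubini_G Rintegral_EFin.
Qed.

(* No integrability of f is needed for the measurability of its partial
   integrals. *)
Lemma measurable_Rintegral (f : X * Y -> R) : measurable_fun setT f ->
  measurable_fun setT (fun x => \int[m2]_y f (x, y)).
Proof.
move=> mf; apply: measurableT_comp => //.
under eq_fun do rewrite integralE.
apply: emeasurable_funB.
- have h := measurable_fun_fubini_tonelli_F (m2 := m2) (EFin \o f)^\+%E
    (measurable_funepos ((measurable_EFinP _ _).2 mf)) (fun=> funepos_ge0 _ _).
  apply: eq_measurable_fun h => x _; rewrite /fubini_F; apply: eq_integral => y _.
  by rewrite !funeposE.
- have h := measurable_fun_fubini_tonelli_F (m2 := m2) (EFin \o f)^\-%E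
    (measurable_funeneg ((measurable_EFinP _ _).2 mf)) (fun=> funeneg_ge0 _ _).
  apply: eq_measurable_fun h => x _; rewrite /fubini_F; apply: eq_integral => y _.
  by rewrite !funenegE.
Qed.

Lemma ae_prodW (P : set (X * Y)) : measurable P ->
  {ae (m1 \x m2)%E, forall p, P p} -> {ae m1, forall x, {ae m2, forall y, P (x, y)}}.
Proof.
move=> mP aeP; have mCP := measurableC mP.
have P0 : ((m1 \x m2)%E (~` P) = 0)%E by exact/negligibleP.
have mi : measurable_fun setT (\1_(~` P) : X * Y -> R) by exact: measurable_indic.
have i0 p : 0 <= (\1_(~` P) p : R) by rewrite indicE.
have I0 : (\int[m1]_x \int[m2]_y (\1_(~` P) (x, y) : R)%:E = 0)%E.
  by rewrite -tonelliE// integral_indic ?setIT.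
have I1 x : (0 <= \int[m2]_y (\1_(~` P) (x, y) : R)%:E)%E by exact: integral_ge0.
apply: filterS (ge0_integral_eq0_ae (measurable_tonelli mi i0) I1 I0) => x Ix.
apply: filterS (ge0_integral_eq0_ae ((measurable_EFinP _ _).2
  (measurableT_comp mi (pair1_measurable x))) (fun y => i0 (x, y)) Ix) => y [] /=; rewrite indicE.
case: (boolP (_ \in _)) => [_ /eqP|]; first by rewrite oner_eq0.
by rewrite notin_setE => /= /contrapT.
Qed.

End fubini.

(** * Lebesgue measure on row vectors *)

Section line_invariance.
Context {R : realType}.
Local Notation leb := (@lebesgue_measure R).

(** Common property of translations and of the reflection of the line: a single induction on the
    dimension, [integral_coord_map], then yields both invariances of the measure on row vectors. *)
Definition line_invariant (s : R -> R) :=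
  measurable_fun [set: measurableTypeR R] (s : measurableTypeR R -> measurableTypeR R) /\
  forall A : set (measurableTypeR R), measurable A -> leb (s @^-1` A) = leb A.

Lemma line_invariant_shift (y : R) : line_invariant (fun x => x + y).
Proof.
have m : measurable_fun [set: measurableTypeR R]
   ((fun x : R => x + y) : measurableTypeR R -> measurableTypeR R).
  exact: measurable_funD.
split => // A mA.
apply/esym; apply: (@lebesgue_measure_unique R
  (measure_function_pushforward__canonical__measure_function_Measure leb m)) => // _ [[a b]] _ <- /=.
rewrite /pushforward.
rewrite (_ : _ @^-1` _ = `]a - y, b - y]%classic).
  rewrite !lebesgue_measure_itv/= !lte_fin ltrD2r; case: ifP => // _.
  by congr (_%:E); ring.
by apply/seteqP; split => x /=; rewrite !in_itv/= ltrBlDr lerBrDr.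
Qed.

Lemma line_invariant_opp : line_invariant (fun x => - x).
Proof.
split; first exact: oppr_measurable.
by move=> A mA; exact: lebesgue_measureN.
Qed.

Lemma line_invariant_integral (s : R -> R) (f : R -> \bar R) :
  line_invariant s ->
  measurable_fun [set: measurableTypeR R] (f : measurableTypeR R -> \bar R) -> (forall x, 0 <= f x)%E ->
  (\int[leb]_x f (s x) = \int[leb]_x f x)%E.
Proof.
by move=> [ms s_inv] mf f0; exact: (integral_preserving (mu := leb) ms s_inv).
Qed.

End line_invariance.

Section row_vectors.
Context {R : realType}.
Local Notation leb1 := (@lebesgue_measure R).
Local Notation leb := (lebesgue_rV R).

Lemma measurable_fun_rV_cons {d} {Y : measurableType d} n (f : 'rV[R]_n.+1 -> Y) :
  measurable_fun setT f ->
  measurable_fun setT (fun p : measurableTypeR R * 'rV[R]_n => f (rV_cons p)).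
Proof.
have mc : measurable_fun setT (fun p : measurableTypeR R * 'rV[R]_n => rV_cons p).
  exact: (measurable_rV_cons (R:=R) (n:=n)).
by move=> mf; exact: measurableT_comp mf mc.
Qed.

Lemma integral_rVS n (f : 'rV[R]_n.+1 -> \bar R) :
  measurable_fun setT f -> (forall x, 0 <= f x)%E ->
  (\int[leb n.+1]_x f x = \int[leb1]_s \int[leb n]_x f (rV_cons (s, x)))%E.
Proof.
move=> mf f0.
have h := @ge0_integral_pushforward _ _ (measurableTypeR R * 'rV[R]_n)%type _ R
  _ (measurable_rV_cons (R:=R) (n:=n))
  (leb1 \x leb n)%E setT f measurableT mf (fun x _ => f0 x).
transitivity (\int[(leb1 \x leb n)%E]_p f (rV_cons p))%E.
  rewrite preimage_setT in h; rewrite -h.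
  by apply: eq_measure_integral; first exact: measurable_rV_cons.
have mfc : measurable_fun setT (fun p : measurableTypeR R * 'rV[R]_n => f (rV_cons p)).
  exact: measurable_fun_rV_cons mf.
exact: (fubini_tonelli1 (m1 := leb1) (m2 := leb n) _ mfc (fun p => f0 (rV_cons p))).
Qed.

Lemma integral_rVS_integrable n (f : 'rV[R]_n.+1 -> \bar R) :
  (leb n.+1).-integrable setT f ->
  (\int[leb n.+1]_x f x = \int[leb1]_s \int[leb n]_x f (rV_cons (s, x)))%E.
Proof.
move=> fi; have mf := measurable_int _ fi.
have mfc : measurable_fun setT (fun p : measurableTypeR R * 'rV[R]_n => f (rV_cons p)).
  exact: measurable_fun_rV_cons mf.
have fci : (leb1 \x leb n)%E.-integrable setT
    (fun p : measurableTypeR R * 'rV[R]_n => f (rV_cons p)).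
  apply/integrable12ltyP => //=.
  have -> := esym (@integral_rVS n (abse \o f) (measurableT_comp (@abse_measurable R setT) mf) (fun=> abse_ge0 _)).
  by case/integrableP : fi.
rewrite [LHS]integralE.
rewrite integral_rVS//; last exact: measurable_funepos.
rewrite integral_rVS//; last exact: measurable_funeneg.
have := integral12_prod_meas1 fci; rewrite /fubini_F => ->.
have posE : ((fun p : measurableTypeR R * 'rV[R]_n => f (rV_cons p))^\+ =
    fun p => f^\+ (rV_cons p))%E by apply/funext => p; rewrite !funeposE.
have negE : ((fun p : measurableTypeR R * 'rV[R]_n => f (rV_cons p))^\- =
    fun p => f^\- (rV_cons p))%E by apply/funext => p; rewrite !funenegE.
rewrite [RHS]integralE posE negE; congr (_ - _)%E.
  exact/esym/(fubini_tonelli1 (m1 := leb1) (m2 := leb n) _ (measurable_fun_rV_cons (measurable_funepos mf)) (fun p => funepos_ge0 _ _)).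
exact/esym/(fubini_tonelli1 (m1 := leb1) (m2 := leb n) _ (measurable_fun_rV_cons (measurable_funeneg mf)) (fun p => funeneg_ge0 _ _)).
Qed.

Definition coord_map n (s : 'I_n -> R -> R) (x : 'rV[R]_n) : 'rV[R]_n :=
  \row_i s i (x ord0 i).

Lemma measurable_coord_map n (s : 'I_n -> R -> R) :
  (forall i, line_invariant (s i)) -> measurable_fun setT (coord_map s).
Proof.
move=> si; apply: measurable_fun_rVP => i; under eq_fun do rewrite mxE.
apply: measurableT_comp; first exact: (si i).1.
exact: measurable_rV_coord.
Qed.

Lemma coord_map_cons n (s : 'I_n.+1 -> R -> R) t x :
  coord_map s (rV_cons (t, x)) =
  rV_cons (s ord0 t, coord_map (fun i => s (lift ord0 i)) x).
Proof.
apply/rowP => i; rewrite !mxE; case: (unliftP ord0 i) => [j ->|->] /=.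
  by rewrite mxE.
by [].
Qed.

Lemma integral_coord_map n (s : 'I_n -> R -> R) (f : 'rV[R]_n -> \bar R) :
  (forall i, line_invariant (s i)) ->
  measurable_fun setT f -> (forall x, 0 <= f x)%E ->
  (\int[leb n]_x f (coord_map s x) = \int[leb n]_x f x)%E.
Proof.
elim: n s f => [|n IH] s f si mf f0.
  by apply: eq_integral => x _; congr f; rewrite (thinmx0 x) (thinmx0 (coord_map _ _)).
have mfs : measurable_fun setT (fun x => f (coord_map s x)).
  by apply: measurableT_comp => //; exact: measurable_coord_map.
have mc : measurable_fun setT (fun p : measurableTypeR R * 'rV[R]_n => f (rV_cons p)).
  exact: measurable_fun_rV_cons mf.
rewrite (integral_rVS mfs (fun=> f0 _)) [RHS](integral_rVS mf f0).
have := @line_invariant_integral R (s ord0)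
  (fun t => \int[leb n]_x f (rV_cons (t, x)))%E (si ord0).
move=> <-; last 2 first.
- have := measurable_fun_fubini_tonelli_F (m2 := leb n) _ mc (fun p => f0 (rV_cons p)).
  exact.
- by move=> t; exact: integral_ge0.
apply: eq_integral => t _.
under eq_integral do rewrite coord_map_cons.
rewrite (IH (fun i => s (lift ord0 i)) (fun x => f (rV_cons (s ord0 t, x))))//.
exact: (measurableT_comp mc (pair1_measurable _)).
Qed.

Lemma integral_rV_shift n (y : 'rV[R]_n) (f : 'rV[R]_n -> \bar R) :
  measurable_fun setT f -> (forall x, 0 <= f x)%E ->
  (\int[leb n]_x f (x + y)%R = \int[leb n]_x f x)%E.
Proof.
move=> mf f0; rewrite -(integral_coord_map (fun i => line_invariant_shift (y ord0 i)) mf f0).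
by apply: eq_integral => x _; congr f; apply/rowP => i; rewrite !mxE.
Qed.

Lemma integral_rV_opp n (f : 'rV[R]_n -> \bar R) :
  measurable_fun setT f -> (forall x, 0 <= f x)%E ->
  (\int[leb n]_x f (- x)%R = \int[leb n]_x f x)%E.
Proof.
move=> mf f0; rewrite -(integral_coord_map (fun i => line_invariant_opp) mf f0).
by apply: eq_integral => x _; congr f; apply/rowP => i; rewrite !mxE.
Qed.

Lemma measurable_rV_tensor n (u : 'I_n -> R -> R) :
  (forall i, measurable_fun [set: measurableTypeR R] (u i : measurableTypeR R -> R)) ->
  measurable_fun setT (fun x : 'rV[R]_n => \prod_i u i (x ord0 i)).
Proof.
move=> mu; apply: measurable_prod => i _.
exact: (measurableT_comp (mu i) (measurable_rV_coord i)).
Qed.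

Lemma rV_tensor_cons n (u : 'I_n.+1 -> R -> R) t x :
  \prod_i u i (rV_cons (t, x) ord0 i) =
  u ord0 t * \prod_i u (lift ord0 i) (x ord0 i).
Proof.
rewrite big_ord_recl mxE unlift_none/=; congr (_ * _).
by apply: eq_bigr => i _; rewrite mxE liftK.
Qed.

Lemma integral_rV_tensor n (u : 'I_n -> R -> R) :
  (forall i, measurable_fun [set: measurableTypeR R] (u i : measurableTypeR R -> R)) -> (forall i s, 0 <= u i s) ->
  (\int[leb n]_x (\prod_i u i (x ord0 i))%:E =
   \prod_i \int[leb1]_s (u i s)%:E)%E.
Proof.
elim: n u => [|n IH] u mu u0.
  under eq_integral do rewrite big_ord0.
  by rewrite big_ord0 integral_dirac// diracT mul1e.
rewrite integral_rVS; last 2 first.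
- by apply/measurable_EFinP; exact: measurable_rV_tensor.
- by move=> x; rewrite lee_fin prodr_ge0.
rewrite big_ord_recl -IH//.
under eq_integral => t _ do under eq_integral => x _ do rewrite rV_tensor_cons EFinM.
under eq_integral => t _.
  rewrite ge0_integralZl//; last 3 first.
  - by apply/measurable_EFinP; exact: (measurable_rV_tensor (u := fun i => u (lift ord0 i))).
  - by move=> x _; rewrite lee_fin prodr_ge0.
  - by rewrite lee_fin.
  over.
rewrite ge0_integralZr//.
- by apply/measurable_EFinP; exact: (mu ord0).
- by move=> t _; rewrite lee_fin.
- by apply: integral_ge0 => x _; rewrite lee_fin prodr_ge0.
Qed.

(** The indicator of a cube factors over the coordinates, so its volume follows from the tensor
    formula; for this reason averages are taken over cubes instead of Euclidean balls. *)
Definition cube n (r : R) : set 'rV[R]_n := [set z | forall i, `|z ord0 i| <= r].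

Arguments cube : clear implicits.

Lemma indic_cube n r (z : 'rV[R]_n) :
  \1_(cube n r) z = \prod_i \1_(`[- r, r]) (z ord0 i) :> R.
Proof.
rewrite indicE; case: (boolP (z \in cube n r)) => /=.
  rewrite inE => zr; rewrite big1// => i _; rewrite indicE mem_set//=.
  by rewrite in_itv/= -ler_norml.
move=> zr; apply/esym/eqP/prodf_eq0.
have [i zi] : exists i, ~ `|z ord0 i| <= r.
  by apply: contrapT => /forallNP h; move: zr; rewrite notin_setE; apply => i;
    apply: contrapT => /(h i).
by exists i => //; rewrite indicE memNset//= in_itv/= -ler_norml.
Qed.

Lemma measurable_cube n r : measurable (cube n r).
Proof.
apply/(@measurable_indicP _ _ R); rewrite (_ : \1_ _ =
  (fun z : 'rV[R]_n => \prod_i \1_(`[- r, r]) (z ord0 i) : R)).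
  apply: (measurable_rV_tensor (u := fun=> \1_(`[- r, r]))) => i.
  exact: measurable_indic.
by apply/funext => z; rewrite indic_cube.
Qed.

Lemma lebesgue_cube n (r : R) : 0 <= r -> leb n (cube n r) = ((2 * r) ^+ n)%:E.
Proof.
move=> r0; 
rewrite -[X in leb n X](setIT (cube n r)).
rewrite -integral_indic//; last exact: measurable_cube.
under eq_integral do rewrite indic_cube.
rewrite (integral_rV_tensor (u := fun=> \1_(`[- r, r]))); last 2 first.
- by move=> i; exact: measurable_indic.
- by move=> i s; rewrite indicE.
under eq_bigr => i _.
  rewrite integral_indic//= setIT lebesgue_measure_itv/= lte_fin.
  rewrite (_ : (if _ then _ else _) = (2 * r)%:E); last first.
    case: ltP => h; first by congr _%:E; ring.
    by congr _%:E; lra.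
  over.
by rewrite prodEFin prodr_const card_ord.
Qed.

Lemma measurable_rVD n :
  measurable_fun setT (fun p : 'rV[R]_n * 'rV[R]_n => p.1 + p.2).
Proof.
apply: measurable_fun_rVP => i; under eq_fun do rewrite mxE.
by apply: measurable_funD; apply: (measurableT_comp (measurable_rV_coord i)).
Qed.

Lemma measurable_rV_shift n (y : 'rV[R]_n) :
  measurable_fun setT (fun x : 'rV[R]_n => x + y).
Proof.
apply: measurable_fun_rVP => i; under eq_fun do rewrite mxE.
by apply: measurable_funD => //; exact: measurable_rV_coord.
Qed.

Lemma measurable_rV_opp n : measurable_fun setT (fun x : 'rV[R]_n => - x).
Proof.
apply: measurable_fun_rVP => i; under eq_fun do rewrite mxE.
by apply: measurableT_comp => //; exact: measurable_rV_coord.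
Qed.

Lemma measurable_dotp n :
  measurable_fun setT (fun p : 'rV[R]_n * 'rV[R]_n => dotp p.1 p.2).
Proof.
rewrite /dotp; apply: measurable_sum => i.
by apply: measurable_funM; apply: (measurableT_comp (measurable_rV_coord i)).
Qed.

Lemma measurable_dotpr n (x : 'rV[R]_n) : measurable_fun setT (dotp x).
Proof. exact: (measurableT_comp (measurable_dotp (n:=n)) (pair1_measurable x)). Qed.

Lemma measurable_enorm n : measurable_fun setT (@enorm R n).
Proof.
apply: measurableT_comp.
  by apply: continuous_measurable_fun; exact: sqrt_continuous.
rewrite /dotp; apply: measurable_sum => i.
by apply: measurable_funM; exact: measurable_rV_coord.
Qed.

Section pointwise_measurable.
Context {d} {Y : measurableType d} {n : nat}.
Implicit Types u v : Y -> 'rV[R]_n.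

Lemma measurable_fun_coord u i : measurable_fun setT u ->
  measurable_fun setT (fun y => u y ord0 i).
Proof. by move=> mu; exact: (measurableT_comp (measurable_rV_coord i) mu). Qed.

Lemma measurable_fun_addrV u v : measurable_fun setT u -> measurable_fun setT v ->
  measurable_fun setT (fun y => u y + v y).
Proof.
move=> mu mv; apply: measurable_fun_rVP => i; under eq_fun do rewrite mxE.
by apply: measurable_funD; exact: measurable_fun_coord.
Qed.

Lemma measurable_fun_opprV u : measurable_fun setT u -> measurable_fun setT (fun y => - u y).
Proof.
move=> mu; apply: measurable_fun_rVP => i; under eq_fun do rewrite mxE.
by apply: measurableT_comp => //; exact: measurable_fun_coord.
Qed.

Lemma measurable_fun_dotp u v : measurable_fun setT u -> measurable_fun setT v ->
  measurable_fun setT (fun y => dotp (u y) (v y)).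
Proof.
move=> mu mv; rewrite /dotp; apply: measurable_sum => i.
by apply: measurable_funM; exact: measurable_fun_coord.
Qed.

End pointwise_measurable.

End row_vectors.

Section boxes.
Context {R : realType}.
Local Notation leb := (lebesgue_rV R).

Definition box n (p q : 'I_n -> R) : set 'rV[R]_n :=
  [set x | forall i, p i < x ord0 i < q i].

Lemma measurable_forall_ord {d} {T : measurableType d} n (A : 'I_n -> set T) :
  (forall i, measurable (A i)) -> measurable [set x | forall i, A i x].
Proof.
move=> mA; rewrite (_ : [set x | _] = \bigcap_(i in [set: 'I_n]) A i).
  by apply: fin_bigcap_measurable => //; exact: finite_finset.
by apply/seteqP; split => x /= h i //; exact: h.
Qed.

Lemma measurable_box n (p q : 'I_n -> R) : measurable (box p q).
Proof.
apply: (measurable_forall_ord (A := fun i => [set x : 'rV[R]_n | p i < x ord0 i < q i])) => i.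
rewrite (_ : [set x | _] = (fun x : 'rV[R]_n => x ord0 i) @^-1` `]p i, q i[%classic).
  by rewrite -[X in measurable X]setTI; apply: measurable_rV_coord.
by apply/seteqP; split => x /=; rewrite in_itv.
Qed.

Definition boxes n : set (set 'rV[R]_n) := [set box pq.1 pq.2 | pq in setT].

Arguments boxes : clear implicits.

Lemma boxes_setI_closed n : setI_closed (boxes n).
Proof.
move=> _ _ [[p q] _ <-] [[p' q'] _ <-] /=.
exists (fun i => Num.max (p i) (p' i), fun i => Num.min (q i) (q' i)) => //=.
apply/seteqP; split => [x h|x [h h'] i].
  by split => i; have := h i; rewrite gt_max lt_min => /andP[/andP[a b] /andP[c e]];
    apply/andP.
have /andP[a b] := h i; have /andP[c e] := h' i.
by rewrite gt_max lt_min a b c e.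
Qed.

(** Makes the boxes a generating pi-system, so that a function can be tested against boxes only. *)
Lemma measurable_boxesE n : @measurable _ 'rV[R]_n = <<s boxes n >>.
Proof.
apply/seteqP; split; last first.
  apply: smallest_sub; first exact: sigma_algebra_measurable.
  by move=> _ [[p q] _ <-]; exact: measurable_box.
pose S := <<s boxes n >>.
have SU (F : (set 'rV[R]_n)^nat) : (forall k, S (F k)) -> S (\bigcup_k F k).
  exact: sigma_algebra_bigcup.
have SC A : S A -> S (~` A) by exact: sigma_algebraC.
have key i (B : set R) : measurable B -> S ((fun x : 'rV[R]_n => x ord0 i) @^-1` B).
  move=> mB; have : <<s [set A | exists x, A = `]x, +oo[%classic] >> B.
    have -> : <<s [set A | exists x, A = `]x, +oo[%classic] >> =
      (@ocitv R).-sigma.-measurable := esym (RGenOInfty.measurableE R).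
    exact: mB.
  move: B {mB}; apply: smallest_sub => [|_ [a ->]].
    split.
    - by rewrite preimage_set0; exact: sigma_algebra0.
    - by move=> A SA; rewrite setTD preimage_setC; exact: SC.
    - by move=> F SF; rewrite preimage_bigcup; exact: SU.
  (* The half-space where the i-th coordinate exceeds [a] is the union of boxes with sides (a, k) in
     direction i and (-k, k) in the other directions. *)
  rewrite (_ : _ @^-1` _ = \bigcup_k
      box (fun j => if j == i then a else - k%:R) (fun=> k%:R)).
    by apply: SU => k; apply: sub_sigma_algebra; eexists (_, _).
  apply/seteqP; split => [x /=|x [k _ /(_ i)]]; last first.
    by rewrite eqxx /= in_itv/= andbT => /andP[].
  rewrite in_itv/= andbT => ax.
  pose M := \sum_j `|x ord0 j|.
  have xM j : `|x ord0 j| <= M by rewrite /M (bigD1 j)//= lerDl sumr_ge0.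
  exists (Num.bound M) => // j.
  have : `|x ord0 j| < (Num.bound M)%:R.
    by apply: le_lt_trans (xM j) _; apply: archi_boundP; apply: le_trans (xM j).
  by rewrite ltr_norml => /andP[h1 ->]; rewrite andbT; case: eqP => [->|].
apply: smallest_sub; first exact: smallest_sigma_algebra.
case: n @S SU SC key => [|n] S SU SC key; first by rewrite big_ord0.
rewrite -bigcup_mkord_ord; apply: bigcup_sub => i Ii A [B mB <-].
by rewrite setTI; exact: key.
Qed.

(** The whole space is not a box; its integral is obtained by dominated convergence along growing
    boxes, after which [pi_system_ae_eq0] applies. *)
Lemma rV_box_ae_eq0 n (h : 'rV[R]_n -> R) :
  (leb n).-integrable setT (EFin \o h) ->
  (forall p q, (\int[leb n]_(x in box p q) (h x)%:E = 0)%E) ->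
  {ae leb n, forall x, h x = 0}.
Proof.
move=> hi h0; apply: (pi_system_ae_eq0 (measurable_boxesE n)) => //.
- exact: boxes_setI_closed.
- pose B k := box (fun=> - k%:R) (fun=> k%:R) : set 'rV[R]_n.
  have := @dominated_cvg _ _ _ (leb n) setT measurableT
    (fun k => (EFin \o h) \_ (B k)) (EFin \o h) (abse \o (EFin \o h)).
  have I0 k : (\int[leb n]_x ((EFin \o h) \_ (B k)) x = 0)%E.
    by rewrite -integral_mkcond; exact: h0.
  move=> /(_ _ _ _ _ _)/cvg_lim <- //.
  + by under eq_fun do rewrite I0; rewrite lim_cst.
  + move=> k; apply/measurable_restrict => //; first exact: measurable_box.
    by rewrite setTI; apply: measurable_funTS; exact: measurable_int hi.
  + move=> x _; apply: cvg_near_cst.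
    pose M := \sum_j `|x ord0 j|.
    have xM j : `|x ord0 j| <= M by rewrite /M (bigD1 j)//= lerDl sumr_ge0.
    exists (Num.bound M) => // k /= Mk; rewrite patchE mem_set// => j.
    rewrite -ltr_norml; apply: le_lt_trans (xM j) _.
    apply: lt_le_trans (archi_boundP _) _; first by apply: sumr_ge0.
    by rewrite ler_nat.
  + by apply: integrable_abse.
  + move=> k x _; rewrite patchE; case: ifP => _ //=.
    by rewrite lee_fin normr0.
- by move=> _ [[p q] _ <-]; exact: h0.
Qed.

End boxes.

(** * Borel measurability of continuous functions on space-time *)

Section continuous_measurable.
Context {R : realType} (n : nat).
Local Notation E := ('rV[R]_n * R)%type.

(** A countable family of boxes with rational centres, linking the topology of space-time to a
    sigma-algebra that is built from the coordinates. *)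
Let smallbox (j : 'rV[rat]_n * rat * nat) : set E :=
  [set p : E | (forall i, `|p.1 ord0 i - ratr (j.1.1 ord0 i)| < j.2.+1%:R^-1) /\
           `|p.2 - ratr j.1.2| < j.2.+1%:R^-1].

Let measurable_smallbox j :
  @measurable _ ('rV[R]_n * measurableTypeR R)%type (smallbox j).
Proof.
have m1 i : measurable_fun setT
    (fun p : 'rV[R]_n * measurableTypeR R => `|p.1 ord0 i - ratr (j.1.1 ord0 i)|).
  apply: measurableT_comp => //; apply: measurable_funB => //.
  exact: (measurableT_comp (measurable_rV_coord i)).
have m2 : measurable_fun setT
    (fun p : 'rV[R]_n * measurableTypeR R => `|p.2 - ratr j.1.2|).
  by apply: measurableT_comp => //; apply: measurable_funB.
apply: measurableI.
  apply: measurable_forall_ord => i.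
  have := measurable_fun_ltr (m1 i) (measurable_cst (j.2.+1%:R^-1 : R)).
  by move=> /(_ measurableT [set true]); rewrite setTI; apply.
have := measurable_fun_ltr m2 (measurable_cst (j.2.+1%:R^-1 : R)).
by move=> /(_ measurableT [set true]); rewrite setTI; apply.
Qed.

Lemma measurable_open_rVR (U : set E) : open U ->
  @measurable _ ('rV[R]_n * measurableTypeR R)%type U.
Proof.
move=> oU.
(* [unpickle] enumerates the index type; an index whose box is not contained in [U] contributes the
   empty set. *)
rewrite (_ : U = \bigcup_k (if @unpickle ('rV[rat]_n * rat * nat)%type k is Some j then
   if `[< smallbox j `<=` U >] then smallbox j else set0 else set0)).
  apply: bigcupT_measurable => k; case: unpickle => [j|] //.
  by case: ifP => // _; exact: measurable_smallbox.
apply/seteqP; split => [p Up|p [k _]]; last first.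
  by case: unpickle => [j|] //; case: ifP => // /asboolP h /h.
have [e /= e0 pe] : exists2 e : R, 0 < e & ball p e `<=` U.
  by apply/nbhs_ballP; exact: open_nbhs_nbhs.
have [k ke] : exists k : nat, (k.+1%:R^-1 : R) < e / 2.
  exists (Num.bound (e / 2)^-1).
  rewrite invf_plt ?posrE ?divr_gt0//.
  apply: lt_trans (archi_boundP _) _; first by rewrite invr_ge0 ltW// divr_gt0.
  by rewrite ltr_nat.
have near_rat (x : R) : {r : rat | `|x - ratr r| < k.+1%:R^-1}.
  apply: cid; have [|r /andP[h1 h2]] := @rat_in_itvoo R (x - k.+1%:R^-1) (x + k.+1%:R^-1).
    by rewrite ltrD2l gtrN// invr_gt0.
  move: h1 h2; rewrite !bnd_simp => h1 h2.
  by exists r; rewrite distrC ltr_distl h1 h2.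
pose j := (\row_i (sval (near_rat (p.1 ord0 i))), sval (near_rat p.2), k).
exists (pickle j); first exact: I.
rewrite pickleK.
have jU : smallbox j `<=` U.
  move=> y [h1 h2]; apply: pe; split => /=.
    split => // i' i; rewrite (ord1 i') /ball/=.
    have h1' := h1 i; rewrite /= mxE in h1'.
    have hr := svalP (near_rat (p.1 ord0 i)).
    rewrite -(subrKA (ratr (sval (near_rat (p.1 ord0 i))))); apply: le_lt_trans (ler_normD _ _) _.
    rewrite [X in _ + X]distrC; apply: lt_trans (ltrD hr h1') _.
    by have := ltrD ke ke; rewrite -splitr.
  rewrite /= in h2; have hr := svalP (near_rat p.2).
  rewrite /ball/= -(subrKA (ratr (sval (near_rat p.2)))); apply: le_lt_trans (ler_normD _ _) _.
  rewrite [X in _ + X]distrC; apply: lt_trans (ltrD hr h2) _.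
  by have := ltrD ke ke; rewrite -splitr.
rewrite asboolT//; split => [i|] /=; last exact: svalP (near_rat p.2).
by rewrite mxE; exact: svalP (near_rat _).
Qed.

Lemma continuous_measurable_rVR (f : E -> R) : continuous f ->
  measurable_fun [set: 'rV[R]_n * measurableTypeR R] f.
Proof.
move=> cf.
apply: (@measurability _ _ ('rV[R]_n * measurableTypeR R)%type (measurableTypeR R) setT f _
  (RGenOInfty.measurableE R)) => _ [_ [a ->] <-].
rewrite setTI; apply: measurable_open_rVR; exact: open_comp.
Qed.

Lemma continuous_measurable_rV (f : 'rV[R]_n -> R) : continuous f ->
  measurable_fun setT f.
Proof.
move=> cf; have cf1 : continuous (fun p : E => f p.1).
  by move=> p; apply: continuous_comp; [exact: cvg_fst|exact: cf].
exact: (measurableT_comp (continuous_measurable_rVR cf1) (pair2_measurable (0 : measurableTypeR R))).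
Qed.

End continuous_measurable.

(** * Gaussian integrals *)

Section line_gaussian.
Context {R : realType}.
Local Notation leb := (@lebesgue_measure R).

Lemma Rintegral_derive_eq0 (H h : R -> R) :
  (forall s : R, is_derive s 1 H (h s)) -> continuous h ->
  leb.-integrable setT (EFin \o h) ->
  H n%:R @[n --> \oo] --> 0 -> H (- n%:R) @[n --> \oo] --> 0 ->
  \int[leb]_s h s = 0.
Proof.
move=> dH ch hi H1 H2.
have cH : continuous H.
  by move=> s; apply/differentiable_continuous/derivable1_diffP; apply: ex_derive.
(* The shift to [n.+1] keeps the interval nondegenerate, as the fundamental theorem of calculus
   requires. *)
pose D (n : nat) : set (measurableTypeR R) := `[- n.+1%:R, n.+1%:R]%classic.
have E n : \int[leb]_s (h \_ (D n)) s = H n.+1%:R - H (- n.+1%:R) :> R.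
  rewrite -Rintegral_mkcond /Rintegral (@continuous_FTC2 _ h H)//.
  - by rewrite gtrN.
  - exact: continuous_subspaceT.
  - split; [by move=> s _; apply: ex_derive| |].
    + by apply: cvg_at_right_filter; exact: cH.
    + by apply: cvg_at_left_filter; exact: cH.
  - by move=> s _; rewrite derive1E derive_val.
have [|||||_ lim1] := @Rdominated_cvg _ _ R leb (fun n => h \_ (D n)) h (fun s => `|h s|).
- move=> n; apply/(measurable_restrictT _ (measurable_itv _)).
  by apply: measurable_funTS; exact: continuous_measurable_fun.
- exact: continuous_measurable_fun.
- apply: nearW => s; apply: cvg_near_cst.
  exists (Num.bound `|s|) => // n /= sn; rewrite patchE mem_set// /D/= in_itv/=.
  rewrite -ler_norml; apply: le_trans (ltW (archi_boundP (normr_ge0 s))) _.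
  by rewrite ler_nat ltnW.
- exact: integrable_norm hi.
- by move=> n s; rewrite patchE; case: ifP; rewrite ?normr0.
have lim2 : \int[leb]_s (h \_ (D n)) s @[n --> \oo] --> (0 : R).
  under eq_fun do rewrite E; rewrite -(subrr (0 : R)); apply: cvgB.
    by rewrite (cvg_shiftS (fun n => H n%:R)).
  by rewrite (cvg_shiftS (fun n => H (- n%:R))).
exact: (cvg_unique _ lim1 lim2).
Qed.

Definition gauss (e s : R) : R := expR (- (e * s ^+ 2)).

Lemma gauss_ge0 (e s : R) : 0 <= gauss e s. Proof. exact: expR_ge0. Qed.

Lemma continuous_gauss (e : R) : continuous (gauss e).
Proof.
move=> s; apply: (@continuous_comp _ _ _ (fun s : R => - (e * s ^+ 2)) expR).
  by apply: cvgN; apply: cvgM; [exact: cvg_cst|exact: exprn_continuous].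
exact: continuous_expR.
Qed.

Lemma measurable_gauss (e : R) :
  measurable_fun [set: measurableTypeR R] (gauss e : measurableTypeR R -> R).
Proof. exact: (continuous_measurable_fun (@continuous_gauss e)). Qed.

Lemma integral_gauss (e : R) : 0 < e ->
  (\int[leb]_s (gauss e s)%:E = (Num.sqrt (pi / e))%:E)%E.
Proof.
move=> e0; pose k := Num.sqrt e; have k0 : 0 < k by rewrite sqrtr_gt0.
have dF (s : R) : is_derive s 1 ( *%R k) k.
  by have := is_deriveZ (f := id) k (is_derive_id s (1 : R)); rewrite scaler1.
have F' : derive1 ( *%R k) = cst k.
  by apply/funext => s; rewrite derive1E derive_val.
have := @increasing_ge0_integration_by_substitutionT R ( *%R k) gauss_fun.
rewrite F' integralT_gauss => /(_ _ _ _ _ _ _ _ _ _) h.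
have {h} h : ((Num.sqrt pi)%:E = \int[leb]_s (gauss e s * k)%:E)%E.
  rewrite h; last 9 first.
  - by move=> x y xy; rewrite ltr_pM2l.
  - exact: cst_continuous.
  - exact: is_cvg_cst.
  - exact: is_cvg_cst.
  - by move=> s; apply: ex_derive.
  - by apply/gt0_cvgMrNy.
  - by apply/gt0_cvgMry.
  - exact: continuous_gauss_fun.
  - exact: gauss_fun_ge0.
  apply: eq_integral => s _; rewrite /= /gauss_fun /gauss /=.
  by congr (expR _ * _)%:E; rewrite exprMn sqr_sqrtr ?ltW.
have : ((Num.sqrt pi)%:E = (\int[leb]_s (gauss e s)%:E) * k%:E)%E.
  rewrite h; under eq_integral do rewrite EFinM.
  rewrite ge0_integralZr//.
  - by apply/measurable_EFinP; exact: measurable_gauss.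
  - by move=> s _; rewrite lee_fin gauss_ge0.
  - by rewrite lee_fin ltW.
rewrite sqrtrM ?pi_ge0// sqrtrV ?ltW// EFinM => ->.
by rewrite -muleA -EFinM mulfV ?gt_eqF// mule1.
Qed.

Lemma integrable_gauss (e : R) : 0 < e -> leb.-integrable setT (EFin \o gauss e).
Proof.
move=> e0; apply: integrable_lty_ge0; first exact: measurable_gauss.
- exact: gauss_ge0.
- by rewrite integral_gauss// ltry.
Qed.

Lemma id_gauss_le (e s : R) : 0 < e -> `|s| * gauss e s <= (1 + e^-1) * gauss (e / 2) s.
Proof.
move=> e0.
have h : 1 + e / 2 * s ^+ 2 <= expR (e / 2 * s ^+ 2) by exact: expR_ge1Dx.
have e1 : 0 < e^-1 by rewrite invr_gt0.
(* Half of the exponent pays for the factor |s|, through exp(x) >= 1 + x; the product on the right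
   contains 1 + s^2/2, which already exceeds |s|. *)
have es : `|s| <= (1 + e^-1) * (1 + e / 2 * s ^+ 2).
  have -> : (1 + e^-1) * (1 + e / 2 * s ^+ 2) =
      1 + 2^-1 * s ^+ 2 + (e^-1 + e / 2 * s ^+ 2).
    by field; rewrite gt_eqF.
  rewrite -(real_normK (num_real s)).
  have := normr_ge0 s; move: `|s| => t t0.
  have : 0 <= e / 2 * t ^+ 2 by rewrite mulr_ge0 ?sqr_ge0// divr_ge0// ltW.
  have := sqr_ge0 (t - 1); rewrite sqrrB1 => h1 h2; lra.
have -> : gauss e s = expR (- (e / 2 * s ^+ 2)) * gauss (e / 2) s.
  by rewrite /gauss -expRD; congr expR; field.
rewrite mulrA ler_wpM2r ?gauss_ge0//.
rewrite expRN ler_pdivrMr ?expR_gt0//.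
by apply: le_trans es _; rewrite ler_wpM2l// addr_ge0// ltW.
Qed.

Lemma integrable_id_gauss (e : R) : 0 < e ->
  leb.-integrable setT (EFin \o (fun s => `|s| * gauss e s)).
Proof.
move=> e0; apply: (@integrable_le _ _ _ leb _ (fun s => (1 + e^-1) * gauss (e / 2) s)).
- by have := integrableZl measurableT (1 + e^-1) (integrable_gauss (divr_gt0 e0 (ltr0Sn _ 1))).
- by apply: measurable_funM; [exact: normr_measurable|exact: measurable_gauss].
- move=> s; rewrite ger0_norm; first exact: id_gauss_le.
  by rewrite mulr_ge0 ?gauss_ge0.
Qed.

Lemma measurable_gauss_tr (tr : R -> R) (e z : R) : continuous tr ->
  measurable_fun [set: measurableTypeR R]
    ((fun s => tr (z * s) * gauss e s) : measurableTypeR R -> R).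
Proof.
move=> ct; apply: measurable_funM; last exact: measurable_gauss.
apply: (measurableT_comp (continuous_measurable_fun ct)).
exact: (mulrl_measurable z).
Qed.

Lemma integrable_gauss_tr (tr : R -> R) (e z : R) : continuous tr ->
  (forall s, `|tr s| <= 1) -> 0 < e ->
  leb.-integrable setT (EFin \o (fun s => tr (z * s) * gauss e s)).
Proof.
move=> ct tr1 e0; apply: integrable_le (integrable_gauss e0) _ _.
  exact: measurable_gauss_tr.
by move=> s; rewrite normrM (ger0_norm (gauss_ge0 _ _)) ler_piMl ?gauss_ge0.
Qed.

Lemma cos_norm_le1 (s : R) : `|cos s| <= 1.
Proof. by rewrite ler_norml cos_geN1 cos_le1. Qed.

Lemma sin_norm_le1 (s : R) : `|sin s| <= 1.
Proof. by rewrite ler_norml sin_geN1 sin_le1. Qed.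

Lemma Rintegral_sin_gauss (e z : R) : 0 < e -> \int[leb]_s (sin (z * s) * gauss e s) = 0.
Proof.
move=> e0.
have fi := integrable_gauss_tr z (@continuous_sin R) sin_norm_le1 e0.
suff : \int[leb]_s (sin (z * s) * gauss e s) = \int[leb]_s (- (sin (z * s) * gauss e s)).
  by rewrite RintegralN// => /esym/eqP; rewrite eqNr => /eqP.
have gN s : gauss e (- s) = gauss e s by rewrite /gauss sqrrN.
rewrite /Rintegral; congr fine; rewrite [LHS]integralE [RHS]integralE; congr (_ - _)%E.
  rewrite -(line_invariant_integral line_invariant_opp) //.
  + by apply: eq_integral => s _; rewrite !funeposE mulrN sinN mulNr gN.
  + by apply: measurable_funepos; exact: measurable_int fi.
rewrite -(line_invariant_integral line_invariant_opp) //.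
+ by apply: eq_integral => s _; rewrite !funenegE mulrN sinN mulNr gN.
+ by apply: measurable_funeneg; exact: measurable_int fi.
Qed.

Let tr_gauss (tr : R -> R) (e z : R) := fun s : R => tr (z * s) * gauss e s.

Let is_derive_gauss (e s : R) : is_derive s 1 (gauss e) (- (2 * e * s) * gauss e s).
Proof.
have h : is_derive s 1 (fun s : R => - (e * s ^+ 2)) (- (2 * e * s)).
  have h2 := is_deriveX (f := id) 2 (is_derive_id s (1 : R)).
  have h3 : is_derive s 1 (fun s : R => - (e * s ^+ 2)) _ := is_deriveN (is_deriveZ e h2).
  apply: is_derive_eq h3 _; rewrite /GRing.scale/= expr1; ring.
have := @is_derive1_comp R expR (fun s => - (e * s ^+ 2)) s _ _ (is_derive_expR _) h.
by move=> h4; apply: is_derive_eq h4 _; rewrite /gauss mulrC.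
Qed.

Let is_derive_mul (c s : R) : is_derive s 1 ( *%R c) c.
Proof. by have := is_deriveZ (f := id) c (is_derive_id s (1 : R)); rewrite scaler1. Qed.

Let integrable_id_tr_gauss (tr : R -> R) (e z : R) : continuous tr ->
  (forall s, `|tr s| <= 1) -> 0 < e ->
  leb.-integrable setT (EFin \o (fun s => s * tr_gauss tr e z s)).
Proof.
move=> ct tr1 e0; apply: integrable_le (integrable_id_gauss e0) _ _.
  by apply: measurable_funM => //; exact: measurable_gauss_tr.
move=> s; rewrite !normrM (ger0_norm (gauss_ge0 _ _)).
by rewrite ler_wpM2l// ler_piMl ?gauss_ge0.
Qed.

(* Integrating the derivative of sin (z s) exp (- e s^2) over the line. *)
Let gauss_parts (e z : R) : 0 < e ->
  \int[leb]_s (s * tr_gauss sin e z s) = z / (2 * e) * \int[leb]_s tr_gauss cos e z s.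
Proof.
move=> e0.
have ci := integrable_gauss_tr z (@continuous_cos R) cos_norm_le1 e0.
have si := integrable_id_tr_gauss z (@continuous_sin R) sin_norm_le1 e0.
have ctr (tr : R -> R) : continuous tr -> continuous (tr_gauss tr e z).
  move=> ct s; apply: cvgM; last exact: continuous_gauss.
  apply: (@continuous_comp _ _ _ ( *%R z) tr); last exact: ct.
  exact: mulrl_continuous.
have to0 (u : nat -> R) : (forall n, u n ^+ 2 = n%:R ^+ 2) ->
    tr_gauss sin e z (u n) @[n --> \oo] --> 0.
  move=> un; apply: (@cvg0_le _ _ (fun n => expR (- (e * n%:R)))).
  - move=> n; rewrite normrM (ger0_norm (gauss_ge0 _ _)).
    apply: le_trans (_ : gauss e (u n) <= _); first by rewrite ler_piMl ?gauss_ge0// sin_norm_le1.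
    rewrite /gauss un ler_expR lerN2 ler_pM2l// -natrX ler_nat.
    by case: n => // n; rewrite leq_pmulr.
  - apply: (cvg_comp (fun n : nat => n%:R : R) (fun x => expR (- (e * x)))).
      exact: cvgr_idn.
    apply: (cvg_comp ( *%R e) (fun x => expR (- x))); last exact: cvgr_expR.
    by apply/gt0_cvgMry.
have := @Rintegral_derive_eq0 (tr_gauss sin e z)
  (fun s => z * tr_gauss cos e z s - 2 * e * (s * tr_gauss sin e z s)).
rewrite RintegralB//; last 2 first.
- exact: (integrable_scaleR z ci).
- exact: (integrable_scaleR (2 * e) si).
rewrite RintegralZl// RintegralZl// => h.
have /eqP : z * \int[leb]_s tr_gauss cos e z s -
    2 * e * \int[leb]_s (s * tr_gauss sin e z s) = 0.
  apply: h.
  - move=> s.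
    have d1 := @is_derive1_comp R sin ( *%R z) s _ _ (is_derive_sin _) (is_derive_mul z s).
    have d2 := is_deriveM d1 (is_derive_gauss e s).
    by apply: is_derive_eq d2 _; rewrite /tr_gauss /GRing.scale/=; ring.
  - move=> s; apply: cvgB; apply: cvgM; try exact: cvg_cst.
      exact: ctr (@continuous_cos R) s.
    by apply: cvgM; [exact: cvg_id|exact: ctr (@continuous_sin R) s].
  - exact: (integrable_subR (integrable_scaleR z ci) (integrable_scaleR (2 * e) si)).
  - by apply: to0.
  - by apply: to0 => n; rewrite sqrrN.
rewrite subr_eq0 => /eqP h'.
rewrite mulrAC h' mulrAC mulfV ?mul1r// mulf_neq0 ?pnatr_eq0//.
by rewrite gt_eqF.
Qed.

(** Differentiation under the integral produces a sine integral, which [gauss_parts] turns back into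
    the cosine integral: the transform of the Gaussian solves a linear first-order differential
    equation. *)
Let is_derive_gauss_fourier (e z : R) : 0 < e ->
  is_derive z 1 (fun z => \int[leb]_s tr_gauss cos e z s)
   (- (z / (2 * e)) * \int[leb]_s tr_gauss cos e z s).
Proof.
move=> e0; pose f x s : R := tr_gauss cos e x s.
have dE (x s : R) : is_derive x 1 (f ^~ s) (- (s * tr_gauss sin e x s)).
  have d1 := @is_derive1_comp R cos ( *%R s) x _ _ (is_derive_cos _) (is_derive_mul s x).
  have d2 := is_deriveM d1 (is_derive_cst (gauss e s) x (1 : R)).
  have -> : f ^~ s = (cos \o *%R s) * cst (gauss e s).
    by apply/funext => y; rewrite mulrfctE /f /tr_gauss /= (mulrC y).
  apply: is_derive_eq d2 _; rewrite /tr_gauss scaler0 add0r /GRing.scale/= (mulrC x); ring.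
have int x : leb.-integrable setT (EFin \o f x).
  exact: (integrable_gauss_tr x (@continuous_cos R) cos_norm_le1 e0).
have zI : `]z - 1, z + 1[%classic z by rewrite /= in_itv/= ltrBlDr ltrDl ltr01.
have pE x s : partial1of2 f x s = - (s * tr_gauss sin e x s).
  by rewrite partial1of2E; apply: derive_val.
have ub x s : `]z - 1, z + 1[%classic x -> setT s -> `|partial1of2 f x s| <= `|s| * gauss e s.
  move=> _ _; rewrite pE normrN !normrM (ger0_norm (gauss_ge0 _ _)).
  by rewrite ler_wpM2l// ler_piMl ?gauss_ge0// sin_norm_le1.
have dd x s : `]z - 1, z + 1[%classic x -> (setT : set (measurableTypeR R)) s -> derivable (f ^~ s) x 1.
  by move=> _ _; apply: ex_derive.
have g0 (s : measurableTypeR R) : 0 <= `|s| * gauss e s by rewrite mulr_ge0 ?gauss_ge0.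
have D1 := derivable_under_integral measurableT zI (fun x _ => int x) dd g0
  (integrable_id_gauss e0) ub.
have D2 := differentiation_under_integral measurableT zI (fun x _ => int x) dd g0
  (integrable_id_gauss e0) ub.
apply: DeriveDef; first exact: D1.
rewrite -derive1E D2.
under eq_Rintegral do rewrite pE.
rewrite RintegralN; last exact: (integrable_id_tr_gauss z (@continuous_sin R) sin_norm_le1 e0).
by rewrite gauss_parts// mulNr.
Qed.

Lemma Rintegral_cos_gauss (e z : R) : 0 < e ->
  \int[leb]_s (cos (z * s) * gauss e s) = Num.sqrt (pi / e) * expR (- (z ^+ 2 / (4 * e))).
Proof.
move=> e0; pose I z := \int[leb]_s tr_gauss cos e z s.
pose k := (4 * e)^-1.
(* [gauss (- k)] is exp(k z^2), the reciprocal of the expected solution, so the product has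
   derivative zero and equals its value at 0. *)
have c (z0 : R) : is_derive z0 1 (I * gauss (- k)) 0.
  have := is_deriveM (is_derive_gauss_fourier z0 e0) (is_derive_gauss (- k) z0).
  move=> d; apply: is_derive_eq d _; rewrite /GRing.scale/= -/(I z0) /k.
  by field; rewrite gt_eqF.
have := is_derive_0_is_cst z 0 c.
rewrite mulrfctE /I /tr_gauss.
have -> : \int[leb]_s (cos (0 * s) * gauss e s) = Num.sqrt (pi / e).
  under eq_Rintegral do rewrite mul0r cos0 mul1r.
  by rewrite /Rintegral integral_gauss.
have -> : gauss (- k) 0 = 1 by rewrite /gauss expr0n/= mulr0 oppr0 expR0.
rewrite mulr1 => <-; rewrite -mulrA /gauss -expRD.
rewrite [X in expR X](_ : _ = 0) ?expR0 ?mulr1// /k.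
by field; rewrite gt_eqF.
Qed.

End line_gaussian.

Section rV_gaussian.
Context {R : realType}.
Local Notation leb := (lebesgue_rV R).

Definition gaussN n (e : R) (x : 'rV[R]_n) : R := expR (- (e * dotp x x)).

Lemma gaussN_ge0 n e (x : 'rV[R]_n) : 0 <= gaussN e x. Proof. exact: expR_ge0. Qed.

Lemma gaussN_gt0 n e (x : 'rV[R]_n) : 0 < gaussN e x. Proof. exact: expR_gt0. Qed.

Lemma dotp_ge0 n (x : 'rV[R]_n) : 0 <= dotp x x.
Proof. by apply: sumr_ge0 => i _; rewrite -expr2 sqr_ge0. Qed.

Lemma gaussN_le1 n (e : R) (x : 'rV[R]_n) : 0 <= e -> gaussN e x <= 1.
Proof. by move=> e0; rewrite -expR0 ler_expR oppr_le0 mulr_ge0 ?dotp_ge0. Qed.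

Lemma gaussNE n e (x : 'rV[R]_n) : gaussN e x = \prod_i gauss e (x ord0 i).
Proof. by rewrite /gaussN /dotp mulr_sumr -sumrN expR_sum. Qed.

Lemma dotp_cons n (z : 'rV[R]_n.+1) s (x : 'rV[R]_n) :
  dotp z (rV_cons (s, x)) = z ord0 ord0 * s + dotp (rV_uncons z).2 x.
Proof.
rewrite /dotp big_ord_recl mxE unlift_none/=; congr (_ + _).
by apply: eq_bigr => i _; rewrite !mxE liftK.
Qed.

Lemma gaussN_cons n e s (x : 'rV[R]_n) :
  gaussN e (rV_cons (s, x)) = gauss e s * gaussN e x.
Proof. by rewrite !gaussNE (rV_tensor_cons (fun=> gauss e)). Qed.

Lemma measurable_gaussN n (e : R) : measurable_fun setT (@gaussN n e).
Proof.
rewrite (_ : @gaussN n e = fun x => \prod_i gauss e (x ord0 i)).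
  by apply: (measurable_rV_tensor (u := fun=> gauss e)) => _; exact: measurable_gauss.
by apply/funext => x; rewrite gaussNE.
Qed.

Lemma integral_gaussN n (e : R) : 0 < e ->
  (\int[leb n]_x (gaussN e x)%:E = (Num.sqrt (pi / e) ^+ n)%:E)%E.
Proof.
move=> e0; under eq_integral do rewrite gaussNE.
rewrite (integral_rV_tensor (u := fun=> gauss e)); last 2 first.
- by move=> _; exact: measurable_gauss.
- by move=> _ s; exact: gauss_ge0.
under eq_bigr do rewrite integral_gauss//.
by rewrite prodEFin prodr_const card_ord.
Qed.

Lemma integrable_gaussN n (e : R) : 0 < e ->
  (leb n).-integrable setT (EFin \o gaussN e).
Proof.
move=> e0; apply: integrable_lty_ge0; first exact: measurable_gaussN.
- exact: gaussN_ge0.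
- by rewrite integral_gaussN// ltry.
Qed.

Lemma measurable_tr_dotp n (tr : R -> R) (z : 'rV[R]_n) : continuous tr ->
  measurable_fun setT (fun x => tr (dotp z x)).
Proof.
move=> ct; apply: measurableT_comp; first exact: continuous_measurable_fun.
exact: measurable_dotpr.
Qed.

Lemma integrable_tr_gaussN n (tr : R -> R) (e : R) (z : 'rV[R]_n) : continuous tr ->
  (forall s, `|tr s| <= 1) -> 0 < e ->
  (leb n).-integrable setT (EFin \o (fun x => tr (dotp z x) * gaussN e x)).
Proof.
move=> ct tr1 e0; apply: integrable_le (integrable_gaussN n e0) _ _.
  by apply: measurable_funM; [exact: measurable_tr_dotp|exact: measurable_gaussN].
by move=> x; rewrite normrM (ger0_norm (gaussN_ge0 _ _)) ler_piMl ?gaussN_ge0.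
Qed.

(** Both integrals go through one induction because splitting off a coordinate mixes cosine and sine
    by the addition formulas; the vanishing sine integrals remove the cross terms. *)
Lemma Rintegral_tr_gaussN n (e : R) (z : 'rV[R]_n) : 0 < e ->
  \int[leb n]_x (cos (dotp z x) * gaussN e x) =
    Num.sqrt (pi / e) ^+ n * expR (- (dotp z z / (4 * e))) /\
  \int[leb n]_x (sin (dotp z x) * gaussN e x) = 0.
Proof.
move=> e0; elim: n z => [|n IH] z.
  have z0 : z = 0 by rewrite (thinmx0 z).
  have d0 (x y : 'rV[R]_0) : dotp x y = 0 by rewrite /dotp big_ord0.
  split; rewrite /Rintegral; under eq_integral do rewrite d0 /gaussN d0.
    by rewrite integral_dirac// diracT mul1e/= cos0 d0 mulr0 mul0r oppr0 expr0 expR0.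
  by rewrite integral_dirac// diracT mul1e/= sin0 mul0r.
have [IC IS] := IH (rV_uncons z).2.
have ci := integrable_tr_gaussN (rV_uncons z).2 (@continuous_cos R) cos_norm_le1 e0.
have si := integrable_tr_gaussN (rV_uncons z).2 (@continuous_sin R) sin_norm_le1 e0.
have dzz : dotp z z = z ord0 ord0 ^+ 2 + dotp (rV_uncons z).2 (rV_uncons z).2.
  by rewrite {1}/dotp big_ord_recl -expr2; congr (_ + _); apply: eq_bigr => i _; rewrite !mxE.
split; rewrite /Rintegral integral_rVS_integrable.
- transitivity (fine (\int[lebesgue_measure]_s
      (\int[leb n]_x (cos (dotp (rV_uncons z).2 x) * gaussN e x) *
        (cos (z ord0 ord0 * s) * gauss e s))%:E)%E).
    congr fine; apply: eq_integral => s _.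
    under eq_integral => x _.
      rewrite dotp_cons gaussN_cons cosD.
      rewrite (_ : _ * _ =
        (cos (z ord0 ord0 * s) * gauss e s) * (cos (dotp (rV_uncons z).2 x) * gaussN e x) -
        (sin (z ord0 ord0 * s) * gauss e s) * (sin (dotp (rV_uncons z).2 x) * gaussN e x));
        last by ring.
      over.
    rewrite Rintegral_EFin; last exact: (integrable_subR (integrable_scaleR _ ci) (integrable_scaleR _ si)).
    rewrite RintegralB//; [|exact: (integrable_scaleR _ ci)|exact: (integrable_scaleR _ si)].
    by rewrite RintegralZl// RintegralZl// IS mulr0 subr0 mulrC.
  rewrite -/(Rintegral _ _ _) RintegralZl//; last first.
    exact: integrable_gauss_tr (@continuous_cos R) cos_norm_le1 e0.
  rewrite IC Rintegral_cos_gauss// dzz (exprS _ n).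
  rewrite [X in _ = _ * expR (- X)]mulrDl opprD expRD; ring.
- exact: integrable_tr_gaussN (@continuous_cos R) cos_norm_le1 e0.
- transitivity (fine (\int[lebesgue_measure]_s
      (\int[leb n]_x (cos (dotp (rV_uncons z).2 x) * gaussN e x) *
        (sin (z ord0 ord0 * s) * gauss e s))%:E)%E).
    congr fine; apply: eq_integral => s _.
    under eq_integral => x _.
      rewrite dotp_cons gaussN_cons sinD.
      rewrite (_ : _ * _ =
        (sin (z ord0 ord0 * s) * gauss e s) * (cos (dotp (rV_uncons z).2 x) * gaussN e x) +
        (cos (z ord0 ord0 * s) * gauss e s) * (sin (dotp (rV_uncons z).2 x) * gaussN e x));
        last by ring.
      over.
    rewrite Rintegral_EFin; last exact: (integrable_addR (integrable_scaleR _ ci) (integrable_scaleR _ si)).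
    rewrite RintegralD//; [|exact: (integrable_scaleR _ ci)|exact: (integrable_scaleR _ si)].
    by rewrite RintegralZl// RintegralZl// IS mulr0 addr0 mulrC.
  rewrite -/(Rintegral _ _ _) RintegralZl//; last first.
    exact: integrable_gauss_tr (@continuous_sin R) sin_norm_le1 e0.
  by rewrite Rintegral_sin_gauss// mulr0.
- exact: integrable_tr_gaussN (@continuous_sin R) sin_norm_le1 e0.
Qed.

End rV_gaussian.

(* Unfolding the iterated product measure makes unification explode. *)
Opaque lebesgue_rV.

Section product_integrable.
Context {d1 d2} {X : measurableType d1} {Y : measurableType d2} {R : realType}.
Variables (m1 : {sigma_finite_measure set X -> \bar R})
  (m2 : {sigma_finite_measure set Y -> \bar R}).

Lemma measurable_prodR (u : X -> R) (v : Y -> R) : measurable_fun setT u ->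
  measurable_fun setT v -> measurable_fun setT (fun p : X * Y => u p.1 * v p.2).
Proof. by move=> mu mv; apply: measurable_funM; exact: measurableT_comp. Qed.

Lemma integrable_prodR (u : X -> R) (v : Y -> R) :
  m1.-integrable setT (EFin \o u) -> m2.-integrable setT (EFin \o v) ->
  (m1 \x m2)%E.-integrable setT (EFin \o (fun p => u p.1 * v p.2)).
Proof.
move=> ui vi.
have mu : measurable_fun setT u by apply/measurable_EFinP; exact: measurable_int ui.
have mv : measurable_fun setT v by apply/measurable_EFinP; exact: measurable_int vi.
apply/integrable12ltyP; first by apply/measurable_EFinP; exact: measurable_prodR.
under eq_integral => x _.
  under eq_integral => y _ do rewrite /= normrM EFinM.
  rewrite ge0_integralZl//; last by apply/measurable_EFinP; exact: measurableT_comp.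
  over.
rewrite ge0_integralZr//; last 2 first.
- by apply/measurable_EFinP; exact: measurableT_comp.
- exact: integral_ge0.
by rewrite lte_mul_pinfty//; [exact: integral_ge0|
  exact: integrable_fin_num (integrable_abse ui)|case/integrableP : vi].
Qed.

Lemma Rintegral_prodR (u : X -> R) (v : Y -> R) :
  m1.-integrable setT (EFin \o u) -> m2.-integrable setT (EFin \o v) ->
  \int[(m1 \x m2)%E]_p (u p.1 * v p.2) = (\int[m1]_x u x) * \int[m2]_y v y.
Proof.
move=> ui vi; rewrite -(Rfubini (integrable_prodR ui vi))/=.
under eq_Rintegral do rewrite RintegralZl//.
by rewrite RintegralZr.
Qed.

Lemma integrable_prod_lty (f : X * Y -> R) : measurable_fun setT f ->
  (forall p, 0 <= f p) -> (\int[m1]_x \int[m2]_y (f (x, y))%:E < +oo)%E ->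
  (m1 \x m2)%E.-integrable setT (EFin \o f).
Proof.
move=> mf f0 foo; apply: integrable_lty_ge0 => //; rewrite tonelliE//.
Qed.

End product_integrable.

Section rV_change_of_variables.
Context {R : realType} {n : nat}.
Local Notation leb := (lebesgue_rV R n).
Implicit Types f : 'rV[R]_n -> R.

Lemma Rintegral_shift f (y : 'rV[R]_n) : measurable_fun setT f ->
  \int[leb]_x f (x + y) = \int[leb]_x f x.
Proof.
move=> mf; rewrite /Rintegral; congr fine.
rewrite [LHS]integralE [RHS]integralE.
rewrite -(integral_rV_shift y (f := ((EFin \o f)^\+)%E))//; last first.
  by apply: measurable_funepos; exact/measurable_EFinP.
rewrite -(integral_rV_shift y (f := ((EFin \o f)^\-)%E))//; last first.
  by apply: measurable_funeneg; exact/measurable_EFinP.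
by congr (_ - _)%E; apply: eq_integral => x _; rewrite ?funeposE ?funenegE.
Qed.

Lemma Rintegral_opp f : measurable_fun setT f ->
  \int[leb]_x f (- x) = \int[leb]_x f x.
Proof.
move=> mf; rewrite /Rintegral; congr fine.
rewrite [LHS]integralE [RHS]integralE.
rewrite -(integral_rV_opp (f := ((EFin \o f)^\+)%E))//; last first.
  by apply: measurable_funepos; exact/measurable_EFinP.
rewrite -(integral_rV_opp (f := ((EFin \o f)^\-)%E))//; last first.
  by apply: measurable_funeneg; exact/measurable_EFinP.
by congr (_ - _)%E; apply: eq_integral => x _; rewrite ?funeposE ?funenegE.
Qed.

Lemma integrable_shift f (y : 'rV[R]_n) : leb.-integrable setT (EFin \o f) ->
  leb.-integrable setT (EFin \o (fun x => f (x + y))).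
Proof.
move=> /integrableP[mf fi]; apply/integrableP; split.
  exact: (measurableT_comp mf (measurable_rV_shift y)).
rewrite (_ : (\int[leb]_x _)%E = (\int[leb]_x `|(EFin \o f) x|)%E)//.
rewrite -(integral_rV_shift y (f := (fun x => `|(EFin \o f) x|)%E))//.
exact: measurableT_comp.
Qed.

Lemma measurable_add_fun f : measurable_fun setT f ->
  measurable_fun setT (fun p : 'rV[R]_n * 'rV[R]_n => f (p.1 + p.2)).
Proof. by move=> mf; exact: (measurableT_comp mf (measurable_rVD (R:=R) (n:=n))). Qed.

(** For fixed z the translation x -> x + z does not change the x-integral, so after Tonelli the
    double integral factors. *)
Lemma integral_rV_sqr_shift f (v : 'rV[R]_n -> R) :
  measurable_fun setT f -> measurable_fun setT v -> (forall x, 0 <= f x) ->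
  (forall x, 0 <= v x) ->
  (\int[leb]_x \int[leb]_z (f (x + z) * v z)%:E =
   (\int[leb]_x (f x)%:E) * (\int[leb]_z (v z)%:E))%E.
Proof.
move=> mf mv f0 v0.
have m : measurable_fun setT
    (fun p : 'rV[R]_n * 'rV[R]_n => f (p.1 + p.2) * v p.2).
  by apply: measurable_funM; [exact: measurable_add_fun|exact: measurableT_comp].
rewrite (@tonelliC _ _ _ _ _ leb leb (fun p => f (p.1 + p.2) * v p.2))//=; last first.
  by move=> p; rewrite mulr_ge0.
under eq_integral => z _.
  under eq_integral => x _ do rewrite EFinM.
  rewrite ge0_integralZr//; last 3 first.
  - by apply/measurable_EFinP; exact: (measurableT_comp mf (measurable_rV_shift z)).
  - by move=> x _; rewrite lee_fin.
  - by rewrite lee_fin.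
  rewrite (integral_rV_shift z (f := EFin \o f))//; last exact/measurable_EFinP.
  over.
rewrite /= ge0_integralZl//; first exact/measurable_EFinP.
- by move=> z _; rewrite lee_fin.
- by apply: integral_ge0 => x _; rewrite lee_fin.
Qed.

End rV_change_of_variables.

Section gaussian_bounds.
Context {R : realType}.

Lemma poly_expR_bound (p : nat) (l : R) : 0 < l ->
  exists2 M, 0 < M & forall t : R, 0 <= t -> (1 + t) ^+ p.+1 * expR (- (l * t ^+ 2)) <= M.
Proof.
move=> l0; pose k : R := p.+1%:R; have k0 : 0 < k by rewrite ltr0n.
(* Chosen so that C (1 + l t^2 / k) expands to 2 + k/l + 2 l t^2 / k + t^2, which is at least 1 + t;
   the k-th power of this inequality is the claim, since exp(l t^2) is the k-th power of exp(l t^2 /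
   k). *)
pose C : R := 2 + k / l; have kl : 0 < k / l by rewrite divr_gt0.
have C0 : 0 < C by rewrite addr_gt0.
exists (C ^+ p.+1); first exact: exprn_gt0.
move=> t t0; rewrite expRN ler_pdivrMr ?expR_gt0//.
have -> : expR (l * t ^+ 2) = expR (l * t ^+ 2 / k) ^+ p.+1.
  by rewrite -expRM_natl; congr expR; rewrite -/k; field; rewrite gt_eqF.
rewrite -exprMn lerXn2r// ?nnegrE ?addr_ge0// ?mulr_ge0 ?expR_ge0 ?(ltW C0)//.
apply: le_trans (_ : C * (1 + l * t ^+ 2 / k) <= _); last first.
  by rewrite ler_pM2l// expR_ge1Dx.
have -> : C * (1 + l * t ^+ 2 / k) = 2 + k / l + 2 * (l * t ^+ 2 / k) + t ^+ 2.
  by rewrite /C; field; rewrite !gt_eqF.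
have h1 : 0 <= l * t ^+ 2 / k by rewrite divr_ge0 ?mulr_ge0 ?sqr_ge0// ltW.
have := sqr_ge0 (t - 1); rewrite sqrrB1 => h2.
move: (k / l) kl h1 h2 => u; move: (l * t ^+ 2 / k) => v.
move: t t0; clear => t t0 u0 v0 h2.
have : 0 <= t ^+ 2 by exact: sqr_ge0.
by nra.
Qed.

Lemma enorm_ge0 n (x : 'rV[R]_n) : 0 <= enorm x. Proof. exact: sqrtr_ge0. Qed.

Lemma sqr_enorm n (x : 'rV[R]_n) : enorm x ^+ 2 = dotp x x.
Proof. by rewrite sqr_sqrtr// dotp_ge0. Qed.

Lemma enorm0 n : enorm (0 : 'rV[R]_n) = 0.
Proof.
by rewrite /enorm /dotp big1 ?sqrtr0// => i _; rewrite mxE mul0r.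
Qed.

Lemma enorm_eq0 n (x : 'rV[R]_n) : enorm x = 0 -> x = 0.
Proof.
move=> /eqP; rewrite sqrtr_eq0 => x0; apply/rowP => i; rewrite mxE.
have /psumr_eq0P h : dotp x x = 0 by apply/eqP; rewrite eq_le x0 dotp_ge0.
have /eqP := h (fun i _ => ltac:(by rewrite -expr2 sqr_ge0)) i isT.
by rewrite mulf_eq0 orbb => /eqP.
Qed.

Lemma enorm_gt0 n (x : 'rV[R]_n) : x != 0 -> 0 < enorm x.
Proof.
by move=> x0; rewrite lt_def enorm_ge0 andbT; apply: contra_neq x0 => /enorm_eq0.
Qed.

(** Substituting |z| = d t leaves d^alpha times a function of t alone, bounded uniformly in t. Since
    alpha < 2 the power n + alpha is at most n + 2, the degree supplied by [poly_expR_bound]. *)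
Lemma gaussN_power_bound n (alpha l : R) : 0 < alpha -> alpha < 2 -> 0 < l ->
  exists2 C, 0 < C & forall (d : R) (z : 'rV[R]_n), 0 < d ->
    d ^- n * gaussN (l / d ^+ 2) z * enorm z `^ (n%:R + alpha) <= C * d `^ alpha.
Proof.
move=> a0 a2 l0; have [M M0 hM] := poly_expR_bound n.+1 l0.
exists M => // d z d0; pose t := enorm z / d.
have t0 : 0 <= t by rewrite divr_ge0 ?enorm_ge0// ltW.
have zE : enorm z = d * t by rewrite /t mulrCA mulfV ?mulr1// gt_eqF.
have gE : gaussN (l / d ^+ 2) z = expR (- (l * t ^+ 2)).
  by rewrite /gaussN -sqr_enorm zE; congr expR; field; rewrite gt_eqF.
rewrite gE zE powRM ?(ltW d0)//.
have -> : d `^ (n%:R + alpha) = d `^ n%:R * d `^ alpha.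
  by rewrite powRD// (gt_eqF d0) implybT.
rewrite powR_mulrn ?(ltW d0)//.
have -> : d ^- n * expR (- (l * t ^+ 2)) * (d ^+ n * d `^ alpha * t `^ (n%:R + alpha)) =
   (t `^ (n%:R + alpha) * expR (- (l * t ^+ 2))) * d `^ alpha.
  by field; rewrite expf_neq0 ?gt_eqF.
rewrite ler_wpM2r ?powR_ge0//; apply: le_trans (hM t t0).
rewrite ler_wpM2r ?expR_ge0//.
apply: le_trans (_ : (1 + t) `^ (n%:R + alpha) <= _).
  by apply: ge0_ler_powR; rewrite ?nnegrE ?addr_ge0 ?(ltW a0)// ?lerDr ?ler0n.
rewrite -powR_mulrn ?addr_ge0//; apply: ler_powR; first by rewrite lerDl.
by rewrite -addn2 natrD lerD2l ltW.
Qed.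

End gaussian_bounds.

(** * Plancherel identity and energy *)

Section plancherel.
Context {R : realType} {n : nat}.
Variable b : R.
Hypothesis b0 : b != 0.
Local Notation leb := (lebesgue_rV R n).
Local Notation V := 'rV[R]_n.
Implicit Types (f g : V -> R) (tr : R -> R).

(** With [tr] equal to cosine or sine this is the real part, or minus the imaginary part, of the
    transform of a real [f] with kernel exp(- i b x.xi), before multiplication by the factor a. *)
Definition ft tr f (xi : V) : R := \int[leb]_x (f x * tr (b * dotp x xi)).

Lemma dotpC (x y : V) : dotp x y = dotp y x.
Proof. by apply: eq_bigr => i _; rewrite mulrC. Qed.

Lemma dotpDl (x y z : V) : dotp (x + y) z = dotp x z + dotp y z.
Proof. by rewrite /dotp -big_split; apply: eq_bigr => i _; rewrite !mxE mulrDl. Qed.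

Lemma dotpNl (x z : V) : dotp (- x) z = - dotp x z.
Proof. by rewrite /dotp -sumrN; apply: eq_bigr => i _; rewrite !mxE mulNr. Qed.

Lemma dotpZl k (x z : V) : dotp (k *: x) z = k * dotp x z.
Proof. by rewrite /dotp mulr_sumr; apply: eq_bigr => i _; rewrite !mxE mulrA. Qed.

Lemma measurable_tr_bdotp tr : continuous tr ->
  measurable_fun setT (fun p : V * V => tr (b * dotp p.1 p.2)).
Proof.
move=> ct; apply: (measurableT_comp (continuous_measurable_fun ct)).
by apply: measurable_funM => //; exact: measurable_dotp.
Qed.

Lemma measurable_tr_bdotpl tr (xi : V) : continuous tr ->
  measurable_fun setT (fun x : V => tr (b * dotp x xi)).
Proof.
move=> ct; exact: (measurableT_comp (measurable_tr_bdotp ct) (pair2_measurable xi)).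
Qed.

Lemma integrable_ft tr f xi : continuous tr -> (forall s, `|tr s| <= 1) ->
  leb.-integrable setT (EFin \o f) ->
  leb.-integrable setT (EFin \o (fun x => f x * tr (b * dotp x xi))).
Proof.
move=> ct tr1 fi; have mf : measurable_fun setT f.
  by apply/measurable_EFinP; exact: measurable_int fi.
apply: integrable_le (integrable_norm fi) _ _.
  by apply: measurable_funM => //; exact: measurable_tr_bdotpl.
by move=> x /=; rewrite normrM ler_piMr.
Qed.

Lemma measurable_ft tr f : continuous tr -> measurable_fun setT f ->
  measurable_fun setT (ft tr f).
Proof.
move=> ct mf; apply: (@measurable_Rintegral _ _ _ _ _ leb
  (fun p : V * V => f p.2 * tr (b * dotp p.2 p.1))).
apply: measurable_funM; first exact: measurableT_comp.
apply: (measurableT_comp (continuous_measurable_fun ct)).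
apply: measurable_funM => //.
by under eq_fun do rewrite dotpC; exact: measurable_dotp.
Qed.

Lemma ft_bound tr f xi : continuous tr -> (forall s, `|tr s| <= 1) ->
  leb.-integrable setT (EFin \o f) -> `|ft tr f xi| <= \int[leb]_x `|f x|.
Proof.
move=> ct tr1 fi; have fti := integrable_ft xi ct tr1 fi.
apply: le_trans (le_normr_Rintegral measurableT fti) _.
apply: le_Rintegral => //.
- exact: integrable_norm fti.
- exact: integrable_norm fi.
- by move=> x _; rewrite normrM ler_piMr.
Qed.

(** The Fourier transform of [gaussN e], by [kernE]. Its mass does not depend on [e] and it
    concentrates at the origin as [e] tends to 0. *)
Definition kern (e : R) (z : V) : R :=
  Num.sqrt (pi / e) ^+ n * gaussN (b ^+ 2 / (4 * e)) z.

Lemma kern_ge0 e z : 0 <= kern e z.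
Proof. by rewrite mulr_ge0 ?exprn_ge0 ?sqrtr_ge0 ?gaussN_ge0. Qed.

Lemma kernN e z : kern e (- z) = kern e z.
Proof. by rewrite /kern /gaussN dotpNl dotpC dotpNl opprK. Qed.

Lemma kernE e z : 0 < e ->
  \int[leb]_xi (cos (b * dotp z xi) * gaussN e xi) = kern e z.
Proof.
move=> e0; under eq_Rintegral do rewrite -dotpZl.
rewrite (Rintegral_tr_gaussN (b *: z) e0).1 /kern /gaussN; congr (_ * expR (- _)).
by rewrite dotpZl dotpC dotpZl; field; rewrite gt_eqF.
Qed.

Let bb_gt0 e : 0 < e -> 0 < b ^+ 2 / (4 * e).
Proof. by move=> e0; apply: divr_gt0; [rewrite exprn_even_gt0|rewrite mulr_gt0]. Qed.

Lemma measurable_kern e : measurable_fun setT (kern e).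
Proof. by apply: measurable_funM => //; exact: measurable_gaussN. Qed.

(** This is (2 pi / |b|)^n, the common mass of the kernels [kern e]. *)
Definition plancherel_cst : R := Num.sqrt (4 * pi ^+ 2 / b ^+ 2) ^+ n.

Lemma plancherel_cst_gt0 : 0 < plancherel_cst.
Proof.
rewrite exprn_gt0// sqrtr_gt0 divr_gt0 ?exprn_even_gt0// mulr_gt0//.
by rewrite exprn_gt0// pi_gt0.
Qed.

Lemma integral_kern e : 0 < e ->
  (\int[leb]_z (kern e z)%:E = plancherel_cst%:E)%E.
Proof.
move=> e0; under eq_integral do rewrite EFinM.
rewrite ge0_integralZl//; last 2 first.
- by apply/measurable_EFinP; exact: measurable_gaussN.
- by move=> z _; rewrite lee_fin gaussN_ge0.
rewrite integral_gaussN ?bb_gt0// -EFinM -exprMn -sqrtrM ?divr_ge0 ?pi_ge0 ?(ltW e0)//.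
congr (Num.sqrt _ ^+ _)%:E; field.
by rewrite b0 gt_eqF.
Qed.

Lemma integrable_kern e : 0 < e -> leb.-integrable setT (EFin \o kern e).
Proof.
move=> e0; apply: integrable_lty_ge0; first exact: measurable_kern.
  exact: kern_ge0.
by rewrite integral_kern// ltry.
Qed.

Lemma Rintegral_kern e : 0 < e -> \int[leb]_z kern e z = plancherel_cst.
Proof. by move=> e0; rewrite /Rintegral integral_kern. Qed.

Section square_integrable.
Variable g : V -> R.
Hypothesis gi : leb.-integrable setT (EFin \o g).
Hypothesis g2i : leb.-integrable setT (EFin \o (fun x => g x ^+ 2)).

Let mg : measurable_fun setT g.
Proof. by apply/measurable_EFinP; exact: measurable_int gi. Qed.

Let ftsq xi := ft cos g xi ^+ 2 + ft sin g xi ^+ 2.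

Let ftsqE xi : ftsq xi =
  \int[(leb \x leb)%E]_p (g p.1 * g p.2 * cos (b * dotp (p.1 - p.2) xi)).
Proof.
have ci := integrable_ft xi (@continuous_cos R) cos_norm_le1 gi.
have si := integrable_ft xi (@continuous_sin R) sin_norm_le1 gi.
rewrite /ftsq /ft !expr2 -(Rintegral_prodR ci ci) -(Rintegral_prodR si si).
rewrite -RintegralD//; last 2 first.
- exact: (integrable_prodR ci ci).
- exact: (integrable_prodR si si).
apply: eq_Rintegral => p _; rewrite dotpDl dotpNl mulrDr mulrN cosB; ring.
Qed.

Let ggi : (leb \x leb)%E.-integrable setT (EFin \o (fun p => `|g p.1 * g p.2|)).
Proof. exact: integrable_norm (integrable_prodR gi gi). Qed.

(** The squared modulus of the transform is a double integral of g(x) g(y) cos(b (x - y).xi). The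
    Gaussian weight makes the triple integral absolutely convergent, so the frequency can be
    integrated first. *)
Lemma plancherel_gauss e : 0 < e ->
  \int[leb]_xi (ftsq xi * gaussN e xi) =
  \int[(leb \x leb)%E]_p (g p.1 * g p.2 * kern e (p.1 - p.2)).
Proof.
move=> e0.
pose F (q : V * (V * V)) :=
  g q.2.1 * g q.2.2 * cos (b * dotp (q.2.1 - q.2.2) q.1) * gaussN e q.1.
have mF : measurable_fun setT F.
  apply: measurable_funM; last by apply: measurableT_comp => //; exact: measurable_gaussN.
  apply: measurable_funM.
    by apply: measurable_funM; apply: measurableT_comp mg _; exact: measurableT_comp.
  apply: (measurableT_comp (continuous_measurable_fun (@continuous_cos R))).
  apply: measurable_funM => //.
  apply: measurable_fun_dotp; last exact: measurable_fst.
  apply: measurable_fun_addrV; first exact: measurableT_comp.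
  by apply: measurable_fun_opprV; exact: measurableT_comp.
have Fi : (leb \x (leb \x leb)%E)%E.-integrable setT (EFin \o F).
  have h := integrable_prodR (m2 := product_sigma_finite leb leb) (integrable_gaussN n e0) ggi.
 apply: integrable_le h mF _ => q.
  rewrite /F normrM mulrC (ger0_norm (gaussN_ge0 _ _)) ler_wpM2l ?gaussN_ge0//.
  by rewrite normrM ler_piMr// cos_norm_le1.
transitivity (\int[leb]_xi \int[(leb \x leb)%E]_p F (xi, p)).
  apply: eq_Rintegral => xi _; rewrite ftsqE /F /= RintegralZr//.
  apply: integrable_le ggi _ _.
    have := measurableT_comp mF (pair1_measurable xi).
    rewrite /F /= => h.
    (* Measurability of the integrand is read off from a section of [F] by dividing out the positive
       Gaussian factor. *)
    rewrite (_ : (fun _ => _) = (fun p => (g p.1 * g p.2 * cos (b * dotp (p.1 - p.2) xi) *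
      gaussN e xi) * (gaussN e xi)^-1)); first exact: measurable_funM h _.
    by apply/funext => p; rewrite mulfK// gt_eqF// gaussN_gt0.
  by move=> p; rewrite normrM ler_piMr// cos_norm_le1.
rewrite (RfubiniC (m2 := product_sigma_finite leb leb) Fi); apply: eq_Rintegral => p _.
rewrite /F /= -kernE// -RintegralZl//.
  by apply: eq_Rintegral => xi _; rewrite mulrA.
have := integrable_tr_gaussN (b *: (p.1 - p.2)) (@continuous_cos R) cos_norm_le1 e0.
by apply: eq_integrable => // xi _; rewrite /= dotpZl.
Qed.

Let m1 e : measurable_fun setT (fun p : V * V => g (p.1 + p.2) ^+ 2 * kern e p.2).
Proof.
apply: measurable_funM; last by apply: measurableT_comp => //; exact: measurable_kern.
by apply: measurable_funX; exact: measurable_add_fun.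
Qed.

Let i1 e : 0 < e ->
  (leb \x leb)%E.-integrable setT (EFin \o (fun p => g (p.1 + p.2) ^+ 2 * kern e p.2)).
Proof.
move=> e0; apply: integrable_prod_lty => //.
  by move=> p; rewrite mulr_ge0 ?sqr_ge0 ?kern_ge0.
rewrite (integral_rV_sqr_shift (f := fun x => g x ^+ 2) (v := kern e))//.
- by rewrite integral_kern// (Rintegral_EFin g2i) -EFinM ltry.
- exact: measurable_funX.
- exact: measurable_kern.
- by move=> x; rewrite sqr_ge0.
- exact: kern_ge0.
Qed.

Let i2 e : 0 < e ->
  (leb \x leb)%E.-integrable setT (EFin \o (fun p : V * V => g p.1 ^+ 2 * kern e p.2)).
Proof. by move=> e0; exact: (integrable_prodR g2i (integrable_kern e0)). Qed.

Let i3 e : 0 < e ->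
  (leb \x leb)%E.-integrable setT (EFin \o (fun p => g p.1 * g (p.1 + p.2) * kern e p.2)).
Proof.
move=> e0; apply: integrable_le (integrable_addR (i1 e0) (i2 e0)) _ _.
  apply: measurable_funM; last by apply: measurableT_comp => //; exact: measurable_kern.
  by apply: measurable_funM; [exact: measurableT_comp|exact: measurable_add_fun].
move=> p; rewrite normrM (ger0_norm (kern_ge0 _ _)) -mulrDl ler_wpM2r ?kern_ge0//.
by rewrite [leRHS]addrC norm_mul_le_sqr.
Qed.

(** After the substitution y = x + z, the product 2 g(x) g(x + z) is the sum of the two squares
    minus the squared increment; each square integrates against the kernel to [plancherel_cst] times
    the squared norm of [g]. *)
Lemma plancherel_defect e : 0 < e ->
  2 * \int[leb]_xi (ftsq xi * gaussN e xi) =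
  2 * plancherel_cst * (\int[leb]_x g x ^+ 2) -
  \int[(leb \x leb)%E]_p ((g (p.1 + p.2) - g p.1) ^+ 2 * kern e p.2).
Proof.
move=> e0; have -> : \int[leb]_xi (ftsq xi * gaussN e xi) =
    \int[(leb \x leb)%E]_p (g p.1 * g (p.1 + p.2) * kern e p.2).
  have Ki : (leb \x leb)%E.-integrable setT
      (EFin \o (fun p => g p.1 * g p.2 * kern e (p.1 - p.2))).
    have K0 : 0 <= Num.sqrt (pi / e) ^+ n by rewrite exprn_ge0// sqrtr_ge0.
    have h := integrable_scaleR (Num.sqrt (pi / e) ^+ n) ggi.
    apply: integrable_le h _ _.
      apply: measurable_funM; first exact: measurable_prodR.
      apply: (measurableT_comp (measurable_kern e)).
      apply: measurable_fun_addrV; first exact: measurable_fst.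
      by apply: measurable_fun_opprV; exact: measurable_snd.
    move=> p; rewrite normrM mulrC ler_wpM2r// ger0_norm ?kern_ge0// /kern.
    by rewrite ler_piMr// gaussN_le1// ltW// bb_gt0.
  rewrite (plancherel_gauss e0) -(Rfubini Ki) -(Rfubini (i3 e0)).
  apply: eq_Rintegral => x _ /=.
  rewrite -(Rintegral_shift (f := fun y => g x * g y * kern e (x - y)) x).
    apply: eq_Rintegral => z _; rewrite (addrC z) opprD addrA subrr sub0r kernN.
    by rewrite (addrC x).
  apply: measurable_funM; first exact: measurable_funM.
  apply: (measurableT_comp (measurable_kern e)).
  apply: measurable_fun_addrV; first exact: measurable_cst.
  by apply: measurable_fun_opprV; exact: measurable_id.
have I1 : \int[(leb \x leb)%E]_p (g (p.1 + p.2) ^+ 2 * kern e p.2) =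
    plancherel_cst * \int[leb]_x g x ^+ 2.
  rewrite /Rintegral tonelliE//; last by move=> p; rewrite mulr_ge0 ?sqr_ge0 ?kern_ge0.
  rewrite (integral_rV_sqr_shift (f := fun x => g x ^+ 2) (v := kern e))//.
  - by rewrite integral_kern// Rintegral_EFin// -EFinM/= mulrC.
  - exact: measurable_funX.
  - exact: measurable_kern.
  - by move=> x; rewrite sqr_ge0.
  - exact: kern_ge0.
have I2 : \int[(leb \x leb)%E]_p (g p.1 ^+ 2 * kern e p.2) =
    plancherel_cst * \int[leb]_x g x ^+ 2.
  by rewrite (Rintegral_prodR g2i (integrable_kern e0)) Rintegral_kern// mulrC.
have -> : \int[(leb \x leb)%E]_p ((g (p.1 + p.2) - g p.1) ^+ 2 * kern e p.2) =
   \int[(leb \x leb)%E]_p ((g (p.1 + p.2) ^+ 2 * kern e p.2 + g p.1 ^+ 2 * kern e p.2) -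
      2 * (g p.1 * g (p.1 + p.2) * kern e p.2)).
  by apply: eq_Rintegral => p _; ring.
rewrite RintegralB//; last 2 first.
- exact: integrable_addR (i1 e0) (i2 e0).
- exact: integrable_scaleR (i3 e0).
rewrite RintegralD//; [|exact: i1|exact: i2].
rewrite (RintegralZl _ _ (i3 e0))// I1 I2; ring.
Qed.

End square_integrable.

End plancherel.

Section energy.
Context {R : realType} {n : nat}.
Variables (alpha c b : R).
Hypotheses (alpha_gt0 : 0 < alpha) (alpha_lt2 : alpha < 2)
  (c_levy : @levy_normalization R n alpha c) (b0 : b != 0).
Local Notation leb := (lebesgue_rV R n).
Local Notation V := 'rV[R]_n.
Local Notation rho := (@levy_density R n alpha c).
Implicit Types (f g : V -> R).

Let c_gt0 : 0 < c. Proof. by case: c_levy. Qed.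

Lemma levy_density_ge0 z : 0 <= rho z.
Proof. by rewrite divr_ge0 ?powR_ge0// ltW. Qed.

Lemma measurable_levy_density : measurable_fun setT rho.
Proof.
have m : measurable_fun [set: R] (fun r : R => c * (r `^ (- (n%:R + alpha)))).
  by apply: measurable_funM => //; exact: measurable_powR.
rewrite (_ : rho = fun z => c * (enorm z `^ (- (n%:R + alpha)))).
  exact: (measurableT_comp m (measurable_enorm (R:=R) (n:=n))).
by apply/funext => z; rewrite /levy_density powRN.
Qed.

(** Division by zero returns 0, so integrating over z != 0 and over all z gives the same result for
    integrands that carry the density as a factor. *)
Lemma levy_density0 : rho 0 = 0.
Proof.
by rewrite /levy_density enorm0 powR0 ?invr0 ?mulr0// gt_eqF// ltr_wpDl.
Qed.

Definition dif f (p : V * V) : R := (f (p.1 + p.2) - f p.1) ^+ 2 * rho p.2.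

Lemma dif_ge0 f p : 0 <= dif f p.
Proof. by rewrite mulr_ge0 ?sqr_ge0 ?levy_density_ge0. Qed.

Lemma measurable_increment f : measurable_fun setT f ->
  measurable_fun setT (fun p : V * V => f (p.1 + p.2) - f p.1).
Proof.
by move=> mf; apply: measurable_funB; [exact: measurable_add_fun|exact: measurableT_comp].
Qed.

Lemma measurable_dif f : measurable_fun setT f -> measurable_fun setT (dif f).
Proof.
move=> mf; apply: measurable_funM.
  by apply: measurable_funX; exact: measurable_increment.
by apply: measurableT_comp => //; exact: measurable_levy_density.
Qed.

(** Twice the energy, written as one integral over pairs (base point, increment) so that Tonelli's
    theorem can be used in either order. *)
Definition dif_int f : \bar R := (\int[(leb \x leb)%E]_p (dif f p)%:E)%E.

Lemma dif_int_ge0 f : (0 <= dif_int f)%E.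
Proof. by apply: integral_ge0 => p _; rewrite lee_fin dif_ge0. Qed.

Lemma dif_int_tonelli f : measurable_fun setT f ->
  (dif_int f = \int[leb]_x \int[leb]_z (dif f (x, z))%:E)%E.
Proof. by move=> mf; exact: (tonelliE leb leb (measurable_dif mf) (dif_ge0 f)). Qed.

Lemma dif_int_tonelliC f : measurable_fun setT f ->
  (dif_int f = \int[leb]_z \int[leb]_x (dif f (x, z))%:E)%E.
Proof.
move=> mf; exact: (etrans (dif_int_tonelli mf)
  (tonelliC leb leb (measurable_dif mf) (dif_ge0 f))).
Qed.

Lemma integral_ne0 (f : V -> \bar R) : f 0 = 0%E ->
  (\int[leb]_(z in [set z | z != 0%R]) f z = \int[leb]_z f z)%E.
Proof.
move=> f0; rewrite integral_mkcond; apply: eq_integral => z _.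
rewrite patchE; case: ifPn => //; rewrite notin_setE/= => /negP.
by rewrite negbK => /eqP ->.
Qed.

Lemma energyE f : measurable_fun setT f ->
  energy alpha c f f = ((2^-1)%:E * dif_int f)%E.
Proof.
move=> mf; rewrite (dif_int_tonelli mf) /energy.
suff -> : (\int[leb]_x \int[leb]_(z in [set z | z != 0%R])
    ((f (x + z)%R - f x) * (f (x + z)%R - f x) * rho z)%:E =
    \int[leb]_x \int[leb]_z (dif f (x, z))%:E)%E by [].
apply: eq_integral => x _.
rewrite integral_ne0; last by rewrite levy_density0 mulr0.
by apply: eq_integral => z _; rewrite /dif expr2.
Qed.

Lemma levy_symbol (xi : V) :
  (\int[leb]_z ((1 - cos (b * dotp z xi)) * rho z)%:E =
   (`|b| `^ alpha * enorm xi `^ alpha)%:E)%E.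
Proof.
case: c_levy => _ /(_ (b *: xi)) h.
have -> : `|b| `^ alpha * enorm xi `^ alpha = enorm (b *: xi) `^ alpha.
  rewrite -powRM ?enorm_ge0//; congr (_ `^ _).
  by rewrite /enorm dotpZl dotpC dotpZl mulrA -expr2 sqrtrM ?sqr_ge0// sqrtr_sqr.
rewrite -h integral_ne0; last by rewrite levy_density0 mulr0.
by apply: eq_integral => z _; rewrite (dotpC z (b *: xi)) dotpZl (dotpC xi).
Qed.

(** With regularisation parameter d^2 the kernel is dominated by d^alpha times the Levy density.
    This turns finite energy into a rate of decay for the Plancherel defect and takes the place of
    continuity of translations in L^2. *)
Lemma kern_le : exists2 C, 0 < C & forall (d : R) z, 0 < d -> z != 0 ->
  kern b (d ^+ 2) z <= C * d `^ alpha * rho z.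
Proof.
have l0 : 0 < b ^+ 2 / 4 by apply: divr_gt0 => //; rewrite exprn_even_gt0.
have [M M0 hM] := gaussN_power_bound n alpha_gt0 alpha_lt2 l0.
pose P : R := Num.sqrt pi ^+ n.
have P0 : 0 < P by rewrite exprn_gt0// sqrtr_gt0 pi_gt0.
exists (P * M / c); first by rewrite divr_gt0 ?mulr_gt0.
move=> d z d0 z0; have e0 := enorm_gt0 z0.
have p0 : 0 < enorm z `^ (n%:R + alpha) by rewrite powR_gt0.
have -> : P * M / c * d `^ alpha * rho z = P * (M * d `^ alpha) / enorm z `^ (n%:R + alpha).
  by rewrite /levy_density; field; rewrite !gt_eqF.
rewrite ler_pdivlMr//; apply: le_trans (_ : P * (d ^- n * gaussN (b ^+ 2 / 4 / d ^+ 2) z *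
   enorm z `^ (n%:R + alpha)) <= _); last by rewrite ler_pM2l// hM.
rewrite mulrA ler_pM2r// /kern.
have -> : b ^+ 2 / (4 * d ^+ 2) = b ^+ 2 / 4 / d ^+ 2 by rewrite invfM mulrA.
rewrite sqrtrM ?pi_ge0// sqrtrV ?sqr_ge0// sqrtr_sqr.
by rewrite (gtr0_norm d0) exprMn exprVn -/P mulrA.
Qed.

Lemma dif_increment_le f z p :
  dif (fun x => f (x + z) - f x) p <= 2 * dif f (p.1 + z, p.2) + 2 * dif f p.
Proof.
rewrite /dif /= mulrA mulrA -mulrDl ler_wpM2r ?levy_density_ge0//.
have -> : f (p.1 + p.2 + z) - f (p.1 + p.2) - (f (p.1 + z) - f p.1) =
  (f (p.1 + z + p.2) - f (p.1 + z)) + - (f (p.1 + p.2) - f p.1).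
  by rewrite (addrAC p.1); ring.
by apply: le_trans (sqrD_le _ _) _; rewrite sqrrN.
Qed.

Lemma dif_int_shift f z : measurable_fun setT f ->
  (\int[(leb \x leb)%E]_p (dif f (p.1 + z, p.2))%:E = dif_int f)%E.
Proof.
move=> mf; have m : measurable_fun setT (fun p : V * V => dif f (p.1 + z, p.2)).
  apply: (measurableT_comp (measurable_dif mf)); apply/measurable_fun_prod => //=.
  exact: (measurableT_comp (measurable_rV_shift z)).
rewrite (dif_int_tonelliC mf).
apply: (etrans (tonelliE leb leb m (fun p => dif_ge0 f _))).
apply: (etrans (tonelliC leb leb m (fun p => dif_ge0 f _))).
apply: eq_integral => w _.
rewrite (integral_rV_shift z (f := fun x => (dif f (x, w))%:E))//; last first.
  by move=> x; rewrite lee_fin dif_ge0.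
apply/measurable_EFinP; exact: (measurableT_comp (measurable_dif mf) (pair2_measurable w)).
Qed.

(** Plancherel's identity, whose proof consumes finite energy, will be applied to the increment of
    [f] by [z] rather than to [f]. *)
Lemma dif_int_increment_lty f z : measurable_fun setT f -> (dif_int f < +oo)%E ->
  (dif_int (fun x => f (x + z) - f x)%R < +oo)%E.
Proof.
move=> mf fE.
have mz : measurable_fun setT (fun x : V => f (x + z) - f x).
  by apply: measurable_funB => //; exact: (measurableT_comp mf (measurable_rV_shift z)).
have m : measurable_fun setT (fun p : V * V => dif f (p.1 + z, p.2)).
  apply: (measurableT_comp (measurable_dif mf)); apply/measurable_fun_prod => //=.
  exact: (measurableT_comp (measurable_rV_shift z)).
apply: (@le_lt_trans _ _ (\int[(leb \x leb)%E]_p (2 * dif f (p.1 + z, p.2) + 2 * dif f p)%:E)%E).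
  apply: le_integral_ge0.
  - by apply/measurable_EFinP; exact: measurable_dif.
  - apply/measurable_EFinP/measurable_funD; apply: measurable_funM => //.
    exact: measurable_dif.
  - by move=> p; rewrite lee_fin dif_ge0.
  - by move=> p; rewrite lee_fin dif_increment_le.
have i1 : (leb \x leb)%E.-integrable setT (EFin \o (fun p => dif f (p.1 + z, p.2))).
  apply: integrable_lty_ge0 => //; first by move=> p; exact: dif_ge0.
  by rewrite dif_int_shift.
have i2 : (leb \x leb)%E.-integrable setT (EFin \o dif f).
  by apply: integrable_lty_ge0 => //; [exact: measurable_dif|exact: dif_ge0].
apply: integral_lty_ge0.
  by move=> p; rewrite addr_ge0// mulr_ge0// dif_ge0.
exact: (integrable_addR (integrable_scaleR 2 i1) (integrable_scaleR 2 i2)).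
Qed.

Definition ftsq f xi := ft b cos f xi ^+ 2 + ft b sin f xi ^+ 2.

Lemma ftsq_ge0 f xi : 0 <= ftsq f xi.
Proof. by rewrite addr_ge0 ?sqr_ge0. Qed.

Lemma measurable_ftsq f : measurable_fun setT f -> measurable_fun setT (ftsq f).
Proof.
move=> mf; apply: measurable_funD; apply: measurable_funX; apply: measurable_ft => //.
  exact: continuous_cos.
exact: continuous_sin.
Qed.

Section finite_energy.
Variable g : V -> R.
Hypothesis gi : leb.-integrable setT (EFin \o g).
Hypothesis g2i : leb.-integrable setT (EFin \o (fun x => g x ^+ 2)).
Hypothesis gE : (dif_int g < +oo)%E.

Let mg : measurable_fun setT g.
Proof. by apply/measurable_EFinP; exact: measurable_int gi. Qed.

(** The exponent makes d^alpha exactly 1/(m+1), the rate in [kern_le]; since alpha < 2, the Gaussian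
    parameter d^2 also tends to 0. *)
Let d_ (m : nat) : R := m.+1%:R^-1 `^ alpha^-1.

Let d_gt0 m : 0 < d_ m. Proof. by rewrite powR_gt0// invr_gt0. Qed.

Let d_alpha m : d_ m `^ alpha = m.+1%:R^-1.
Proof. by rewrite /d_ -powRrM mulVf ?gt_eqF// powRr1// invr_ge0. Qed.

Let d_sqr m : d_ m ^+ 2 <= m.+1%:R^-1.
Proof.
rewrite -powR_mulrn ?powR_ge0// /d_ -powRrM.
have h : m.+1%:R^-1 <= 1 :> R by rewrite invf_le1// ler1n.
rewrite -[leRHS]powRr1 ?invr_ge0//; apply: ger_powR.
  by rewrite h invr_gt0 ltr0n.
by rewrite mulrC ler_pdivlMr// mul1r ltW.
Qed.

Let inv_cvg0 : (m.+1%:R^-1 : R) @[m --> \oo] --> 0.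
Proof. exact: cvg_harmonic. Qed.

Let d2_cvg0 : d_ m ^+ 2 @[m --> \oo] --> 0.
Proof. by apply: cvg0_le inv_cvg0 => m; rewrite ger0_norm ?sqr_ge0. Qed.

Let integrable_ftsq_gauss e : 0 < e ->
  leb.-integrable setT (EFin \o (fun xi => ftsq g xi * gaussN e xi)).
Proof.
move=> e0; pose B := \int[leb]_x `|g x|.
apply: integrable_le (integrable_scaleR (B ^+ 2 + B ^+ 2) (integrable_gaussN n e0)) _ _.
  by apply: measurable_funM; [exact: measurable_ftsq|exact: measurable_gaussN].
move=> xi; rewrite ger0_norm ?mulr_ge0 ?ftsq_ge0 ?gaussN_ge0//.
rewrite ler_wpM2r ?gaussN_ge0//.
have h tr : continuous tr -> (forall s, `|tr s| <= 1) -> ft b tr g xi ^+ 2 <= B ^+ 2.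
  move=> ct tr1; rewrite -(real_normK (num_real (ft _ _ _ _))).
  by rewrite lerXn2r ?nnegrE// ?ft_bound// (le_trans _ (ft_bound b xi ct tr1 gi)).
by rewrite lerD// h//; [exact: continuous_cos|exact: cos_norm_le1|exact: continuous_sin|exact: sin_norm_le1].
Qed.

(* The defect of [plancherel_defect] is at most [C d^alpha] times the energy. *)
Lemma plancherel : (\int[leb]_xi (ftsq g xi)%:E =
  (plancherel_cst (n:=n) b * \int[leb]_x g x ^+ 2)%:E)%E.
Proof.
have [C C0 hC] := kern_le.
have Ei : (leb \x leb)%E.-integrable setT (EFin \o dif g).
  by apply: integrable_lty_ge0 => //; [exact: measurable_dif|exact: dif_ge0].
pose L m : R := \int[leb]_xi (ftsq g xi * gaussN (d_ m ^+ 2) xi).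
pose I2 := \int[leb]_x g x ^+ 2.
pose r m : R := \int[(leb \x leb)%E]_p ((g (p.1 + p.2) - g p.1) ^+ 2 * kern b (d_ m ^+ 2) p.2).
have pt m p : (g (p.1 + p.2) - g p.1) ^+ 2 * kern b (d_ m ^+ 2) p.2 <=
    C * m.+1%:R^-1 * dif g p.
  have [z0|z0] := eqVneq p.2 0.
    by rewrite z0 addr0 subrr expr0n/= mul0r mulr_ge0 ?dif_ge0// mulr_ge0 ?invr_ge0// ltW.
  rewrite /dif [leRHS]mulrCA ler_wpM2l ?sqr_ge0//.
  by rewrite -d_alpha hC.
have mk m : measurable_fun setT
    (fun p : V * V => (g (p.1 + p.2) - g p.1) ^+ 2 * kern b (d_ m ^+ 2) p.2).
  apply: measurable_funM; first by apply: measurable_funX; exact: measurable_increment.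
  by apply: measurableT_comp => //; exact: measurable_kern.
have k0 m p : 0 <= (g (p.1 + p.2) - g p.1) ^+ 2 * kern b (d_ m ^+ 2) p.2.
  by rewrite mulr_ge0 ?sqr_ge0// kern_ge0.
have rle m : `|r m| <= C * (\int[(leb \x leb)%E]_p dif g p) * m.+1%:R^-1.
  have hi := integrable_scaleR (C * m.+1%:R^-1) Ei.
  rewrite ger0_norm; last by apply: Rintegral_ge0 => p _; exact: k0.
  rewrite mulrAC -(RintegralZl _ _ Ei)//; apply: le_Rintegral => //.
  by apply: integrable_le hi _ _ => // p; rewrite ger0_norm.
have r0 : r m @[m --> \oo] --> 0.
  apply: cvg0_le rle _.
  by rewrite -[X in _ --> X](mulr0 (C * \int[(leb \x leb)%E]_p dif g p)); apply: cvgMr.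
have Lr m : L m = plancherel_cst (n:=n) b * I2 - r m / 2.
  have := plancherel_defect b0 gi g2i (exprn_gt0 2 (d_gt0 m)).
  by rewrite -/(L m) -/I2 -/(r m); lra.
have L1 : L m @[m --> \oo] --> plancherel_cst (n:=n) b * I2.
  rewrite -[X in _ --> X]subr0; under eq_fun do rewrite Lr.
  apply: cvgB; first exact: cvg_cst.
  by rewrite -(mul0r (2^-1 : R)); apply: cvgMl.
have L2 : ((\int[leb]_xi (ftsq g xi * gaussN (d_ m ^+ 2) xi)%:E)%E @[m --> \oo] -->
    \int[leb]_xi (ftsq g xi)%:E)%E.
  (* The Gaussian weights increase to 1, so square integrability of the transform comes out as a
     conclusion. *)
  apply: monotone_cvg.
  - by move=> m; apply: measurable_funM; [exact: measurable_ftsq|exact: measurable_gaussN].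
  - by move=> m xi; rewrite mulr_ge0 ?ftsq_ge0 ?gaussN_ge0.
  - move=> xi m k mk'; rewrite ler_wpM2l ?ftsq_ge0// ler_expR lerN2 ler_wpM2r ?dotp_ge0//.
    rewrite lerXn2r ?nnegrE ?powR_ge0//.
    apply: ge0_ler_powR; rewrite ?nnegrE ?invr_ge0// ?(ltW alpha_gt0)//.
    by rewrite lef_pV2 ?posrE ?ltr0n// ler_nat.
  - move=> xi; rewrite -[X in _ --> X]mulr1; apply: cvgMr.
    rewrite -[X in _ --> X]expR0 -[X in expR X]oppr0 -[X in expR (- X)](mul0r (dotp xi xi)).
    apply: continuous_cvg; first exact: continuous_expR.
    by apply: cvgN; apply: cvgMl; exact: d2_cvg0.
have LE m : (\int[leb]_xi (ftsq g xi * gaussN (d_ m ^+ 2) xi)%:E = (L m)%:E)%E.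
  by rewrite Rintegral_EFin//; apply: integrable_ftsq_gauss; rewrite exprn_gt0.
move: L2; rewrite (funext LE) => L2.
have L3 : ((L m)%:E @[m --> \oo] --> (plancherel_cst (n:=n) b * I2)%:E)%E.
  by apply: cvg_EFin; [exact: nearW|exact: L1].
exact: (cvg_unique _ L2 L3).
Qed.

End finite_energy.

End energy.

(** * Fourier representation of the energy *)

Section energy_fourier.
Context {R : realType} {n : nat}.
Variables (alpha c b : R).
Hypotheses (alpha_gt0 : 0 < alpha) (alpha_lt2 : alpha < 2)
  (c_levy : @levy_normalization R n alpha c) (b0 : b != 0).
Local Notation leb := (lebesgue_rV R n).
Local Notation V := 'rV[R]_n.
Local Notation rho := (@levy_density R n alpha c).
Local Notation dif := (@dif R n alpha c).
Local Notation dif_int := (@dif_int R n alpha c).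
Local Notation ft := (@ft R n b).
Local Notation ftsq := (@ftsq R n b).
Implicit Types (f g : V -> R).

Let c_gt0 : 0 < c. Proof. by case: c_levy. Qed.
Let rho_ge0 := levy_density_ge0 c_levy.
Let mrho := @measurable_levy_density R n alpha c.

Lemma ft_shift_cos f z xi : leb.-integrable setT (EFin \o f) ->
  ft cos (fun x => f (x + z)) xi =
  cos (b * dotp z xi) * ft cos f xi + sin (b * dotp z xi) * ft sin f xi.
Proof.
move=> fi; have mf : measurable_fun setT f by apply/measurable_EFinP; exact: measurable_int fi.
have ci := integrable_ft b xi (@continuous_cos R) cos_norm_le1 fi.
have si := integrable_ft b xi (@continuous_sin R) sin_norm_le1 fi.
rewrite /ft.
rewrite -(Rintegral_shift (f := fun x => f (x + z) * cos (b * dotp x xi)) (- z)); last first.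
  apply: measurable_funM; first exact: (measurableT_comp mf (measurable_rV_shift z)).
  exact: (measurable_tr_bdotpl b xi (@continuous_cos R)).
rewrite -!RintegralZl// -RintegralD//; last 2 first.
- exact: integrable_scaleR.
- exact: integrable_scaleR.
apply: eq_Rintegral => x _; rewrite subrK dotpDl dotpNl mulrDr mulrN cosB; ring.
Qed.

Lemma ft_shift_sin f z xi : leb.-integrable setT (EFin \o f) ->
  ft sin (fun x => f (x + z)) xi =
  cos (b * dotp z xi) * ft sin f xi - sin (b * dotp z xi) * ft cos f xi.
Proof.
move=> fi; have mf : measurable_fun setT f by apply/measurable_EFinP; exact: measurable_int fi.
have ci := integrable_ft b xi (@continuous_cos R) cos_norm_le1 fi.
have si := integrable_ft b xi (@continuous_sin R) sin_norm_le1 fi.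
rewrite /ft.
rewrite -(Rintegral_shift (f := fun x => f (x + z) * sin (b * dotp x xi)) (- z)); last first.
  apply: measurable_funM; first exact: (measurableT_comp mf (measurable_rV_shift z)).
  exact: (measurable_tr_bdotpl b xi (@continuous_sin R)).
rewrite -!RintegralZl// -RintegralB//; last 2 first.
- exact: integrable_scaleR.
- exact: integrable_scaleR.
apply: eq_Rintegral => x _; rewrite subrK dotpDl dotpNl mulrDr mulrN sinB; ring.
Qed.

Lemma ftB tr f g xi : continuous tr -> (forall s, `|tr s| <= 1) ->
  leb.-integrable setT (EFin \o f) -> leb.-integrable setT (EFin \o g) ->
  ft tr (fun x => f x - g x) xi = ft tr f xi - ft tr g xi.
Proof.
move=> ct tr1 fi gi; rewrite /ft -RintegralB//; [|exact: integrable_ft..].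
by apply: eq_Rintegral => x _; rewrite mulrBl.
Qed.

(** A translation rotates the pair of cosine and sine transforms by the angle theta = b z.xi, and
    |exp(i theta) - 1|^2 = 2 (1 - cos theta). *)
Lemma ftsq_increment f z xi : leb.-integrable setT (EFin \o f) ->
  ftsq (fun x => f (x + z) - f x) xi = 2 * (1 - cos (b * dotp z xi)) * ftsq f xi.
Proof.
move=> fi; have fzi := integrable_shift z fi.
rewrite /ftsq !ftB//; [|exact: continuous_sin|exact: sin_norm_le1|exact: continuous_cos|exact: cos_norm_le1].
rewrite ft_shift_cos// ft_shift_sin//.
have := cos2Dsin2 (b * dotp z xi).
move: (cos _) (sin _) (ft cos f xi) (ft sin f xi) => C S A B CS.
have -> : (C * A + S * B - A) ^+ 2 + (C * B - S * A - B) ^+ 2 =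
   (C ^+ 2 + S ^+ 2 + 1 - 2 * C) * (A ^+ 2 + B ^+ 2) by ring.
by rewrite CS; ring.
Qed.

(** The 2 comes from |exp(i theta) - 1|^2 = 2 (1 - cos theta), and |b|^alpha from the Levy symbol
    evaluated at b xi. *)
Definition energy_cst : R := plancherel_cst (n:=n) b / (2 * `|b| `^ alpha).

Lemma energy_cst_gt0 : 0 < energy_cst.
Proof. apply: divr_gt0; first exact: plancherel_cst_gt0.
by apply: mulr_gt0 => //; apply: powR_gt0; rewrite normr_gt0. Qed.

Lemma integral_sqr_lty f : leb.-integrable setT (EFin \o f) ->
  leb.-integrable setT (EFin \o (fun x => f x ^+ 2)) -> forall z,
  leb.-integrable setT (EFin \o (fun x => (f (x + z) - f x) ^+ 2)).
Proof.
move=> fi f2i z; have f2zi := integrable_shift z f2i.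
have mf : measurable_fun setT f by apply/measurable_EFinP; exact: measurable_int fi.
apply: integrable_le (integrable_addR (integrable_scaleR 2 f2zi) (integrable_scaleR 2 f2i)) _ _.
  apply: measurable_funX; apply: measurable_funB => //.
  exact: (measurableT_comp mf (measurable_rV_shift z)).
by move=> x; rewrite ger0_norm ?sqr_ge0//; apply: le_trans (sqrD_le _ _) _; rewrite sqrrN.
Qed.

(** The double integral of [G] over increments and frequencies is computed twice: frequencies first
    gives, by Plancherel for the increments, a multiple of the energy; increments first gives the
    Levy symbol times the squared transform. *)
Lemma energy_fourier g : leb.-integrable setT (EFin \o g) ->
  leb.-integrable setT (EFin \o (fun x => g x ^+ 2)) -> (dif_int g < +oo)%E ->
  (\int[leb]_xi (enorm xi `^ alpha * ftsq g xi)%:E = energy_cst%:E * dif_int g)%E.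
Proof.
move=> gi g2i gE.
have mg : measurable_fun setT g by apply/measurable_EFinP; exact: measurable_int gi.
pose K := plancherel_cst (n:=n) b.
have K0 : 0 < K by exact: plancherel_cst_gt0.
pose G (p : V * V) : R := 2 * (1 - cos (b * dotp p.1 p.2)) * ftsq g p.2 * rho p.1.
have cos1 s : 0 <= 1 - cos s :> R by rewrite subr_ge0 cos_le1.
have G0 p : 0 <= G p.
  rewrite /G; apply: mulr_ge0; last exact: rho_ge0.
  apply: mulr_ge0; last exact: ftsq_ge0.
  by apply: mulr_ge0 => //; exact: cos1.
have mG : measurable_fun setT G.
  apply: measurable_funM; last exact: (measurableT_comp mrho measurable_fst).
  apply: measurable_funM; last exact: (measurableT_comp (measurable_ftsq b mg) measurable_snd).
  apply: measurable_funM => //; apply: measurable_funB => //.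
  exact: (measurable_tr_bdotp b (@continuous_cos R)).
have E1 z : (\int[leb]_xi (G (z, xi))%:E = K%:E * \int[leb]_x (dif g (x, z))%:E)%E.
  have gzi : leb.-integrable setT (EFin \o (fun x => g (x + z) - g x)).
    exact: (integrable_subR (integrable_shift z gi) gi).
  have g2zi := integral_sqr_lty gi g2i z.
  have := plancherel alpha_gt0 alpha_lt2 c_levy b0 gzi g2zi
    (dif_int_increment_lty c_levy z mg gE).
  move=> h.
  have -> : (\int[leb]_xi (G (z, xi))%:E = (rho z)%:E * \int[leb]_xi
      (ftsq (fun x => g (x + z) - g x) xi)%:E)%E.
    rewrite -ge0_integralZl//; last 3 first.
    - apply/measurable_EFinP; apply: measurable_ftsq.
      by apply/measurable_EFinP; exact: measurable_int gzi.
    - by move=> xi _; rewrite lee_fin ftsq_ge0.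
    - by rewrite lee_fin rho_ge0.
    by apply: eq_integral => xi _; rewrite -EFinM ftsq_increment// /G /= mulrC.
  rewrite h -/K.
  rewrite (_ : (K * _)%:E = (K%:E * \int[leb]_x ((g (x + z) - g x) ^+ 2)%:E)%E); last first.
    by rewrite (Rintegral_EFin g2zi) EFinM.
  rewrite muleCA; congr (_ * _)%E.
  rewrite -ge0_integralZl//; last 3 first.
  - exact: measurable_int g2zi.
  - by move=> x _; rewrite lee_fin sqr_ge0.
  - by rewrite lee_fin rho_ge0.
  by apply: eq_integral => x _; rewrite -EFinM /dif /= mulrC.
have E2 : (\int[leb]_z \int[leb]_xi (G (z, xi))%:E = K%:E * dif_int g)%E.
  rewrite (dif_int_tonelliC c_levy mg) -ge0_integralZl//; last 3 first.
  - pose G' (p : V * V) := dif g (p.2, p.1).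
    have mG' : measurable_fun setT G'.
      apply: (measurableT_comp (measurable_dif alpha c mg)).
      exact: measurable_fun_pair.
    exact: (measurable_tonelli leb mG' (fun p => dif_ge0 c_levy g _)).
  - by move=> z _; apply: integral_ge0 => x _; rewrite lee_fin (dif_ge0 c_levy).
  - by rewrite lee_fin ltW.
  by apply: eq_integral => z _; rewrite E1.
pose P : R := 2 * `|b| `^ alpha.
have P0 : 0 < P by rewrite mulr_gt0// powR_gt0// normr_gt0.
have mE : measurable_fun setT (fun xi => enorm xi `^ alpha * ftsq g xi).
  apply: measurable_funM; last exact: measurable_ftsq.
  exact: (measurableT_comp (@measurable_powR R alpha) (measurable_enorm (R:=R) (n:=n))).
have E0 xi : 0 <= enorm xi `^ alpha * ftsq g xi by rewrite mulr_ge0 ?powR_ge0 ?ftsq_ge0.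
have E3 : (\int[leb]_z \int[leb]_xi (G (z, xi))%:E =
    P%:E * \int[leb]_xi (enorm xi `^ alpha * ftsq g xi)%:E)%E.
  apply: (etrans (tonelliC leb leb mG G0)).
  rewrite -ge0_integralZl//; last 3 first.
  - exact/measurable_EFinP.
  - by move=> xi _; rewrite lee_fin.
  - by rewrite lee_fin ltW.
  apply: eq_integral => xi _.
  transitivity ((2 * ftsq g xi)%:E * \int[leb]_z ((1 - cos (b * dotp z xi)) * rho z)%:E)%E.
    rewrite -ge0_integralZl//; last 3 first.
    - apply/measurable_EFinP/measurable_funM => //; apply: measurable_funB => //.
      exact: (measurable_tr_bdotpl b xi (@continuous_cos R)).
    - by move=> z _; rewrite lee_fin mulr_ge0 ?rho_ge0.
    - by rewrite lee_fin mulr_ge0 ?ftsq_ge0.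
    by apply: eq_integral => z _; rewrite -EFinM /G /=; congr _%:E; ring.
  by rewrite (levy_symbol b alpha_gt0 c_levy) -!EFinM /P; congr _%:E; ring.
have : (P%:E * \int[leb]_xi (enorm xi `^ alpha * ftsq g xi)%:E = K%:E * dif_int g)%E.
  by rewrite -E3 E2.
move=> h; rewrite /energy_cst -/K -/P mulrC EFinM -muleA -h muleA -EFinM mulVf ?gt_eqF//.
by rewrite mul1e.
Qed.

End energy_fourier.

(** * Sobolev inequality *)

Section nonnegative_scaling.
Context {d} {X : measurableType d} {R : realType}.
Variable mu : {measure set X -> \bar R}.

Lemma integral_scale_ge0 k (f : X -> R) : measurable_fun setT f -> 0 <= k ->
  (forall x, 0 <= f x) ->
  (\int[mu]_x (k * f x)%:E = k%:E * \int[mu]_x (f x)%:E)%E.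
Proof.
move=> mf k0 f0; rewrite -ge0_integralZl//; first exact/measurable_EFinP.
by move=> x _; rewrite lee_fin.
Qed.

End nonnegative_scaling.

Section polynomial_weight.
Context {R : realType}.
Local Notation leb := (lebesgue_rV R).

(** A product of unnormalised Cauchy densities: positive, polynomially decaying, and integrable
    because each factor has integral pi. *)
Definition weight n (x : 'rV[R]_n) : R := \prod_i (1 + x ord0 i ^+ 2)^-1.

Lemma weight_gt0 n (x : 'rV[R]_n) : 0 < weight x.
Proof.
by apply: prodr_gt0 => i _; rewrite invr_gt0 ltr_pwDl// sqr_ge0.
Qed.

Lemma weight_ge0 n (x : 'rV[R]_n) : 0 <= weight x.
Proof. by rewrite ltW ?weight_gt0. Qed.

Lemma weight_le1 n (x : 'rV[R]_n) : weight x <= 1.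
Proof.
suff /andP[] : 0 <= weight x <= 1 by [].
rewrite /weight; apply: (big_ind (fun y : R => 0 <= y <= 1)) => [||i _].
- by rewrite ler01 lexx.
- by move=> y z /andP[y0 y1] /andP[z0 z1]; rewrite mulr_ge0//= mulr_ile1.
by rewrite invr_ge0 addr_ge0 ?sqr_ge0//= invf_le1 ?ltr_pwDl ?sqr_ge0// lerDl sqr_ge0.
Qed.

Let measurable_oneDsqrV :
  measurable_fun [set: measurableTypeR R] ((fun s : R => (1 + s ^+ 2)^-1) : measurableTypeR R -> R).
Proof. by apply: continuous_measurable_fun; exact: (@continuous_oneDsqrV R). Qed.

Lemma measurable_weight n : measurable_fun setT (@weight n).
Proof.
exact: (measurable_rV_tensor (u := fun _ s => (1 + s ^+ 2)^-1) (fun=> measurable_oneDsqrV)).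
Qed.

Lemma integrable_weight n : (leb n).-integrable setT (EFin \o @weight n).
Proof.
apply: integrable_lty_ge0; [exact: measurable_weight|exact: weight_ge0|].
rewrite /weight (integral_rV_tensor (u := fun _ s => (1 + s ^+ 2)^-1))//; last first.
  by move=> _ s; rewrite invr_ge0 addr_ge0// sqr_ge0.
have -> : (\int[@lebesgue_measure R]_s ((1 + s ^+ 2)^-1)%:E = pi%:E)%E.
  rewrite ge0_symfun_integralT.
  - rewrite -set_itvcy (@integral0y_oneDsqr R) -EFinM; congr _%:E.
    by rewrite mulrCA divff ?mulr1.
  - by move=> s; rewrite invr_ge0 addr_ge0// sqr_ge0.
  - exact: (@continuous_oneDsqrV R).
  - by move=> s /=; rewrite sqrrN.
by rewrite prodEFin ltry.
Qed.

End polynomial_weight.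

Lemma enorm_cube {R : realType} n (r : R) (z : 'rV[R]_n) : 0 <= r -> cube r z -> enorm z <= Num.sqrt n%:R * r.
Proof.
move=> r0 zr; rewrite -(@ler_pXn2r _ 2)// ?nnegrE ?enorm_ge0 ?mulr_ge0 ?sqrtr_ge0//.
rewrite sqr_enorm exprMn sqr_sqrtr ?ler0n// /dotp.
have -> : n%:R * r ^+ 2 = \sum_(i < n) r ^+ 2 by rewrite sumr_const card_ord mulr_natl.
by apply: ler_sum => i _; rewrite -expr2 -(real_normK (num_real (z ord0 i))) lerXn2r ?nnegrE.
Qed.

Section sobolev.
Context {R : realType} {n : nat}.
Variables (alpha c : R).
Hypotheses (alpha_gt0 : 0 < alpha) (alpha_ltN : alpha < n%:R)
  (c_levy : @levy_normalization R n alpha c).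
Local Notation leb := (lebesgue_rV R n).
Local Notation V := 'rV[R]_n.
Local Notation rho := (@levy_density R n alpha c).
Local Notation dif := (@dif R n alpha c).
Local Notation dif_int := (@dif_int R n alpha c).
Local Notation q := (2 * n%:R / (n%:R - alpha)).
Local Notation beta := (alpha / n%:R).
Implicit Types (f g : V -> R).

Let c_gt0 : 0 < c. Proof. by case: c_levy. Qed.
Let n_gt0 : 0 < n%:R :> R. Proof. exact: lt_trans alpha_gt0 alpha_ltN. Qed.
Let na_gt0 : 0 < n%:R - alpha. Proof. by rewrite subr_gt0. Qed.

Lemma sobolev_exponent_gt2 : 2 < q.
Proof. by rewrite ltr_pdivlMr// ltr_pM2l// ltrBlDr ltrDl. Qed.

Let q_gt0 : 0 < q. Proof. by apply: lt_trans sobolev_exponent_gt2. Qed.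

Lemma sobolev_exponentE : 2 + q * beta = q.
Proof.
have n0 : n%:R != 0 :> R by rewrite gt_eqF.
have na0 : n%:R - alpha != 0 by rewrite gt_eqF.
by field; rewrite n0 na0.
Qed.

Definition Lq f : \bar R := (\int[leb]_x (`|f x| `^ q)%:E)%E.

Lemma Lq_ge0 f : (0 <= Lq f)%E.
Proof. by apply: integral_ge0 => x _; rewrite lee_fin powR_ge0. Qed.

Lemma measurable_powq f : measurable_fun setT f -> measurable_fun setT (fun x => `|f x| `^ q).
Proof.
move=> mf; apply: (measurableT_comp (@measurable_powR R q)).
exact: measurableT_comp.
Qed.

(** Where |s| exceeds [lam], s^2 = |s|^(2-q) |s|^q and the exponent 2 - q is negative. The free
    level [lam] lets the L^q integral control an average of squares without Holder's inequality. *)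
Lemma young_power (lam s : R) : 0 < lam -> s ^+ 2 <= lam ^+ 2 + lam `^ (2 - q) * `|s| `^ q.
Proof.
move=> l0; have [sl|ls] := leP `|s| lam.
  rewrite -(real_normK (num_real s)) -[leLHS]addr0 lerD// ?mulr_ge0 ?powR_ge0//.
  by rewrite lerXn2r ?nnegrE ?(ltW l0).
have s0 : 0 < `|s| by exact: lt_trans ls.
rewrite -(real_normK (num_real s)) -[leLHS]add0r lerD ?sqr_ge0//.
rewrite -(powR_mulrn 2 (ltW s0)).
have -> : `|s| `^ 2%:R = `|s| `^ (2 - q) * `|s| `^ q.
  by rewrite -powRD ?subrK// (gt_eqF s0) implybT.
rewrite ler_wpM2r ?powR_ge0//.
have -> : 2 - q = - (q - 2) by rewrite opprB.
rewrite !powRN lef_pV2 ?posrE ?powR_gt0//.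
by apply: ge0_ler_powR; rewrite ?nnegrE ?subr_ge0 ?(ltW sobolev_exponent_gt2) ?(ltW l0) ?(ltW s0) ?(ltW ls).
Qed.

(** On the cube of half-side r one has |z| <= sqrt(n) r, hence A r^(n+alpha) times the Levy density
    is at least 1 away from the origin. *)
Let A : R := Num.sqrt n%:R `^ (n%:R + alpha) / c.

Let A_gt0 : 0 < A.
Proof. by rewrite divr_gt0// powR_gt0// sqrtr_gt0. Qed.

Let increment_le f x z (r : R) : 0 < r -> cube r z ->
  (f (x + z) - f x) ^+ 2 <= A * r `^ (n%:R + alpha) * dif f (x, z).
Proof.
move=> r0 zr; have [->|z0] := eqVneq z 0.
  by rewrite addr0 subrr expr0n/= mulr_ge0 ?(dif_ge0 c_levy)// mulr_ge0 ?powR_ge0 ?(ltW A_gt0).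
have e0 : 0 < enorm z := enorm_gt0 z0.
have -> : dif f (x, z) = (f (x + z) - f x) ^+ 2 * rho z by [].
rewrite mulrCA ler_peMr ?sqr_ge0// /levy_density /A.
have E : enorm z `^ (n%:R + alpha) <= Num.sqrt n%:R `^ (n%:R + alpha) * r `^ (n%:R + alpha).
  rewrite -powRM ?sqrtr_ge0 ?(ltW r0)//; apply: ge0_ler_powR.
  - by rewrite addr_ge0 ?(ltW alpha_gt0)// (ltW n_gt0).
  - by rewrite nnegrE enorm_ge0.
  - by rewrite nnegrE mulr_ge0 ?sqrtr_ge0 ?(ltW r0).
  - exact: enorm_cube (ltW r0) zr.
have p0 : 0 < enorm z `^ (n%:R + alpha) by exact: powR_gt0.
have c0 : c != 0 by rewrite gt_eqF.
move: E p0; move: (enorm z `^ _) (Num.sqrt _ `^ _) (r `^ _) => u v w E u0.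
have -> : v / c * w * (c / u) = v * w / u.
  by field; rewrite c0 gt_eqF.
by rewrite ler_pdivlMr// mul1r.
Qed.

(* Average over z in the cube of half-side r. *)
Lemma local_bound f x (r lam : R) : measurable_fun setT f -> 0 < r -> 0 < lam ->
  ((f x ^+ 2 * (2 * r) ^+ n)%:E <=
   (2 * A * r `^ (n%:R + alpha))%:E * \int[leb]_z (dif f (x, z))%:E +
   (2 * lam ^+ 2 * (2 * r) ^+ n)%:E + (2 * lam `^ (2 - q))%:E * Lq f)%E.
Proof.
move=> mf r0 l0.
pose K1 : R := 2 * A * r `^ (n%:R + alpha).
pose K2 : R := 2 * lam ^+ 2.
pose K3 : R := 2 * lam `^ (2 - q).
have K10 : 0 <= K1 by rewrite /K1 mulr_ge0 ?powR_ge0 // mulr_ge0// ltW.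
have K20 : 0 <= K2 by rewrite /K2 mulr_ge0 ?sqr_ge0.
have K30 : 0 <= K3 by rewrite /K3 mulr_ge0 ?powR_ge0.
have mfz : measurable_fun setT (fun z => f (x + z)).
  by apply: (measurableT_comp mf); apply: measurable_fun_addrV.
have m1 : measurable_fun setT (fun z => dif f (x, z)).
  exact: (measurableT_comp (measurable_dif alpha c mf) (pair1_measurable x)).
have m2 : measurable_fun setT (fun z : V => \1_(cube r) z : R) by apply: (measurable_indic (R:=R)); exact: measurable_cube.
have m3 := measurable_powq mfz.
have EI : (\int[leb]_z (\1_(cube r) z)%:E = ((2 * r) ^+ n)%:E)%E.
  rewrite integral_indic//; last exact: measurable_cube.
  by rewrite setIT; exact: lebesgue_cube (ltW r0).
have E1 : ((f x ^+ 2 * (2 * r) ^+ n)%:E = \int[leb]_z (f x ^+ 2 * \1_(cube r) z)%:E)%E.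
  by rewrite (integral_scale_ge0 leb m2 (sqr_ge0 _))// EI -EFinM.
have E2 : (\int[leb]_z (K2 * \1_(cube r) z)%:E = (K2 * (2 * r) ^+ n)%:E)%E.
  by rewrite (integral_scale_ge0 leb m2 K20)// EI -EFinM.
have E3 : (\int[leb]_z (K3 * `|f (x + z)| `^ q)%:E = K3%:E * Lq f)%E.
  rewrite (integral_scale_ge0 leb m3 K30 (fun z => powR_ge0 _ _)); congr (_ * _)%E.
  rewrite /Lq -(@integral_rV_shift _ _ x (fun z => (`|f z| `^ q)%:E)).
  - by apply: eq_integral => z _; rewrite addrC.
  - by apply/measurable_EFinP; exact: measurable_powq.
  - by move=> z; rewrite lee_fin powR_ge0.
have E0 : (\int[leb]_z (K1 * dif f (x, z))%:E = K1%:E * \int[leb]_z (dif f (x, z))%:E)%E.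
  exact: (integral_scale_ge0 leb m1 K10 (fun z => dif_ge0 c_levy f _)).
rewrite E1 -/K1 -/K2 -/K3 -E0 -E2 -E3.
have p1 z : 0 <= K1 * dif f (x, z) by rewrite mulr_ge0// (dif_ge0 c_levy).
have p2 z : 0 <= K2 * \1_(cube r) z by rewrite mulr_ge0.
have p3 z : 0 <= K3 * `|f (x + z)| `^ q by rewrite mulr_ge0// powR_ge0.
have M1 : measurable_fun setT (fun z => K1 * dif f (x, z)) by exact: measurable_funM.
have M2 : measurable_fun setT (fun z : V => K2 * \1_(cube r) z) by exact: measurable_funM.
have M3 : measurable_fun setT (fun z => K3 * `|f (x + z)| `^ q) by exact: measurable_funM.
rewrite -ge0_integralD//; last 4 first.
- by move=> z _; rewrite lee_fin p1.
- exact/measurable_EFinP.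
- by move=> z _; rewrite lee_fin p2.
- exact/measurable_EFinP.
rewrite -ge0_integralD//; last 4 first.
- by move=> z _; rewrite adde_ge0// lee_fin ?p1 ?p2.
- by apply: emeasurable_funD; exact/measurable_EFinP.
- by move=> z _; rewrite lee_fin p3.
- exact/measurable_EFinP.
apply: le_integral_ge0.
- by apply/measurable_EFinP; exact: measurable_funM.
- by do 2?[apply: emeasurable_funD]; exact/measurable_EFinP.
- by move=> z; rewrite lee_fin mulr_ge0 ?sqr_ge0.
move=> z; rewrite -!EFinD lee_fin indicE.
case: (boolP (z \in cube r)) => /= [/[1!inE] zr|_]; last first.
  by rewrite mulr0 addr_ge0 ?p3// mulr0 addr0.
rewrite !mulr1; have := sqrD_le (f x - f (x + z)) (f (x + z)).
rewrite subrK -[(f x - f (x + z)) ^+ 2]sqrrN opprB => /le_trans; apply.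
have h1 := increment_le f x r0 zr; have h2 := young_power (f (x + z)) l0.
have -> : K1 * dif f (x, z) + K2 + K3 * `|f (x + z)| `^ q =
  2 * (A * r `^ (n%:R + alpha) * dif f (x, z)) +
  2 * (lam ^+ 2 + lam `^ (2 - q) * `|f (x + z)| `^ q).
  by rewrite /K1 /K2 /K3; ring.
by rewrite lerD// ler_wpM2l.
Qed.

Let absorb_fractions (X Z : R) : X <= 2 * Z + X / 2 + X / 4 -> X <= 8 * Z.
Proof. lra. Qed.

(* The radius r in [local_bound] is chosen to balance the two terms. *)
Lemma sobolev_pointwise : exists2 C, 0 < C & forall f (F : R), measurable_fun setT f -> 0 < F ->
  Lq f = F%:E -> forall x,
  ((`|f x| `^ q)%:E <= (C * F `^ beta)%:E * \int[leb]_z (dif f (x, z))%:E)%E.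
Proof.
pose B : R := 8 * 2 `^ (q - 2).
have B0 : 0 < B by rewrite mulr_gt0// powR_gt0.
pose C : R := 8 * A * 2 `^ (- (n%:R + alpha)) * B `^ beta.
have C0 : 0 < C.
  have A8 : 0 < 8 * A by apply: mulr_gt0.
  by apply: mulr_gt0 (powR_gt0 _ B0); apply: mulr_gt0 A8 (powR_gt0 _ _).
exists C => // f F mf F0 FE x.
have D0 : (0 <= \int[leb]_z (dif f (x, z))%:E)%E.
  by apply: integral_ge0 => z _; rewrite lee_fin (dif_ge0 c_levy).
have CF : 0 < C * F `^ beta by rewrite mulr_gt0// powR_gt0.
have [->|f0] := eqVneq (f x) 0.
  by rewrite normr0 powR0 ?gt_eqF// mule_ge0// lee_fin ltW.
pose s := `|f x|; have s0 : 0 < s by rewrite normr_gt0.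
(* [m] is the volume of the cube and [s / 2] the level in [local_bound]. The last two terms of that
   bound are then half and, by the choice of [B], a quarter of s^2 m, so the difference term must
   account for the remaining quarter. *)
pose m : R := B * s `^ (- q) * F.
have m0 : 0 < m by rewrite /m !mulr_gt0 ?powR_gt0.
pose r : R := m `^ (n%:R^-1) / 2.
have r0 : 0 < r by rewrite /r divr_gt0// powR_gt0.
have rm : (2 * r) ^+ n = m.
  rewrite /r mulrC divfK// -powR_mulrn ?powR_ge0// -powRrM mulVf ?gt_eqF//.
  by rewrite powRr1// ltW.
have l0 : 0 < s / 2 by rewrite divr_gt0.
have := local_bound x mf r0 l0; rewrite FE rm.
case: (\int[leb]_z (dif f (x, z))%:E)%E D0 => [d| |//] D0; last by move=> _; rewrite gt0_muley// ?leey// lte_fin.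
rewrite -!EFinM -!EFinD !lee_fin.
have -> : f x ^+ 2 = s ^+ 2 by rewrite /s real_normK ?num_real.
have E3 : 2 * (s / 2) `^ (2 - q) * F = s ^+ 2 * m / 4.
  have -> : (s / 2) `^ (2 - q) = s ^+ 2 * s `^ (- q) * 2 `^ (q - 2).
    rewrite powRM ?invr_ge0 ?(ltW s0)// powRD ?(gt_eqF s0) ?implybT//.
    rewrite powR_mulrn ?(ltW s0)//; congr (_ * _).
    by rewrite -[2^-1](powR_inv1 (ler0n R 2)) -powRrM mulN1r opprB.
  by rewrite /m /B; field.
have E1 : r `^ (n%:R + alpha) = m * m `^ beta * 2 `^ (- (n%:R + alpha)).
  rewrite /r powRM ?powR_ge0 ?invr_ge0//; congr (_ * _); last first.
    by rewrite -[2^-1](powR_inv1 (ler0n R 2)) -powRrM mulN1r.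
  rewrite -powRrM mulrDr mulVf ?gt_eqF// [n%:R^-1 * _]mulrC powRD ?powRr1 ?(ltW m0)//.
  by rewrite (gt_eqF m0) implybT.
have E2 : m `^ beta = B `^ beta * s `^ (- (q * beta)) * F `^ beta.
  by rewrite /m !powRM ?powR_ge0 ?mulr_ge0 ?powR_ge0 ?(ltW B0) ?(ltW F0)// -(powRrM s) mulNr.
rewrite E3 E1 => h.
have {h} : s ^+ 2 * m <= 8 * A * (m * m `^ beta * 2 `^ (- (n%:R + alpha))) * d.
  pose Y := m * m `^ beta * 2 `^ (- (n%:R + alpha)).
  have h' : s ^+ 2 * m <= 2 * (A * Y * d) + s ^+ 2 * m / 2 + s ^+ 2 * m / 4.
    by rewrite (_ : _ + _ / 2 = 2 * A * Y * d + 2 * (s / 2) ^+ 2 * m)//; field.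
  by rewrite (_ : 8 * A * _ * d = 8 * (A * Y * d)); [exact: absorb_fractions h'|rewrite /Y !mulrA].
have -> : 8 * A * (m * m `^ beta * 2 `^ (- (n%:R + alpha))) * d =
  (8 * A * (m `^ beta * 2 `^ (- (n%:R + alpha))) * d) * m by ring.
rewrite ler_pM2r// E2 => h.
(* The volume [m] contributes s^(- q beta) on the right; moving it to the left raises s^2 to s^(2 +
   q beta), which is s^q. *)
have -> : s `^ q = s ^+ 2 * s `^ (q * beta).
  by rewrite -powR_mulrn ?(ltW s0)// -powRD ?sobolev_exponentE// (gt_eqF s0) implybT.
have sq0 : 0 < s `^ (q * beta) by exact: powR_gt0.
rewrite -ler_pdivlMr//; apply: le_trans h _; rewrite (powRN s) /C le_eqVlt; apply/orP; left; apply/eqP.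
by ring.
Qed.

(** Integrating the pointwise bound gives F <= C F^beta times [dif_int f], where F is the finite
    integral [Lq f], and F^beta is divided out. As 1 - beta = 2/q, the left-hand side is the squared
    L^q norm. *)
Lemma sobolev : exists2 C, 0 < C & forall f, measurable_fun setT f -> (Lq f < +oo)%E ->
  ((fine (Lq f) `^ (1 - beta))%:E <= C%:E * dif_int f)%E.
Proof.
have b1 : beta < 1 by rewrite ltr_pdivrMr ?mul1r.
have [C C0 CE] := sobolev_pointwise; exists C => // f mf Foo.
have FE : Lq f = (fine (Lq f))%:E by rewrite fineK// ge0_fin_numE// Lq_ge0.
have F0 : 0 <= fine (Lq f) by rewrite fine_ge0// Lq_ge0.
move: (fine (Lq f)) FE F0 => F FE; rewrite le_eqVlt => /predU1P[<-|F0].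
  rewrite powR0 ?subr_eq0 ?gt_eqF// mule_ge0// ?lee_fin ?(ltW C0)//.
  exact: (dif_int_ge0 c_levy).
have h : (F%:E <= (C * F `^ beta)%:E * dif_int f)%E.
  rewrite -FE (dif_int_tonelli c_levy mf) -ge0_integralZl//; last 3 first.
  - exact: (measurable_tonelli leb (measurable_dif alpha c mf) (dif_ge0 c_levy f)).
  - by move=> x _; apply: integral_ge0 => z _; rewrite lee_fin (dif_ge0 c_levy).
  - by rewrite lee_fin mulr_ge0 ?powR_ge0// ltW.
  apply: le_integral_ge0.
  - apply/measurable_EFinP; exact: measurable_powq.
  - apply: measurable_funeM.
    exact: (measurable_tonelli leb (measurable_dif alpha c mf) (dif_ge0 c_levy f)).
  - by move=> x; rewrite lee_fin powR_ge0.
  exact: CE.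
move: h; have := dif_int_ge0 c_levy f; case: (dif_int f) => [d d0|_ _|//]; last first.
  by rewrite gt0_muley ?lte_fin// leey.
rewrite -!EFinM !lee_fin => h; rewrite powRB; last by rewrite (gt_eqF F0) implybT.
by rewrite powRr1 ?(ltW F0)// ler_pdivrMr ?powR_gt0// mulrAC.
Qed.

(** Places functions of finite energy in one weighted L^2 space. It serves three purposes: pairing
    with rapidly decreasing functions, extracting almost everywhere convergent subsequences, and
    definiteness of the form. *)
Lemma weighted_bound : exists2 C, 0 < C & forall f, measurable_fun setT f -> (Lq f < +oo)%E ->
  (\int[leb]_x (f x ^+ 2 * weight x)%:E <= C%:E * dif_int f)%E.
Proof.
have [S S0 SE] := sobolev.
pose I : R := \int[leb]_x weight x.
have I0 : 0 <= I by apply: Rintegral_ge0 => x _; exact: weight_ge0.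
pose P : R := 2 ^+ n; have P0 : 0 < P by rewrite exprn_gt0.
pose C1 : R := 2 * A / P; pose C2 : R := (2 * P + 2) / P.
have C10 : 0 < C1 by apply: divr_gt0 => //; apply: mulr_gt0.
have C20 : 0 < C2 by rewrite divr_gt0// addr_gt0// mulr_gt0.
exists (C1 + C2 * S * I).
  by rewrite ltr_pwDl// mulr_ge0// mulr_ge0 ?ltW.
move=> f mf Foo; have := SE f mf Foo.
have mfw : measurable_fun setT (fun x : V => f x ^+ 2 * weight x).
  by apply: measurable_funM; [exact: measurable_funX|exact: measurable_weight].
have FE : Lq f = (fine (Lq f))%:E by rewrite fineK// ge0_fin_numE// Lq_ge0.
have F0 : 0 <= fine (Lq f) by rewrite fine_ge0// Lq_ge0.
move: (fine (Lq f)) FE F0 => F FE; rewrite le_eqVlt => /predU1P[F0|F0] SF.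
  have f0 : {ae leb, forall x, (`|f x| `^ q)%:E = 0%E}.
    apply: ge0_integral_eq0_ae; [by apply/measurable_EFinP; exact: measurable_powq| |by rewrite -F0 in FE].
    by move=> x; rewrite lee_fin powR_ge0.
  rewrite (ae_eq_integral_nomeas (g := cst 0%E)) ?integral0.
    rewrite mule_ge0 ?(dif_int_ge0 c_levy)// lee_fin addr_ge0 ?(ltW C10)//.
    by rewrite mulr_ge0// mulr_ge0 ?ltW.
  apply: filterS f0 => x /= + _ => -[] /powR_eq0_eq0/eqP; rewrite normr_eq0 => /eqP ->.
  by rewrite expr0n /= mul0r.
pose G : R := F `^ (1 - beta).
have G0 : 0 <= G by exact: powR_ge0.
have pt x : ((f x ^+ 2)%:E <= C1%:E * \int[leb]_z (dif f (x, z))%:E + (C2 * G)%:E)%E.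
  (* The cube has half-side 1 and the level is the L^q norm itself, for which [lam ^ 2] and
     [lam ^ (2 - q) * F] coincide. *)
  have l0 : 0 < F `^ (q^-1) by exact: powR_gt0.
  have := local_bound x mf ltr01 l0; rewrite FE powR1 mulr1 mulr1.
  have qb : 2 / q = 1 - beta.
    have n0 : n%:R != 0 :> R by rewrite gt_eqF.
    have na0 : n%:R - alpha != 0 by rewrite gt_eqF.
    by field; rewrite n0 na0.
  have -> : (F `^ q^-1) ^+ 2 = G.
    by rewrite -powR_mulrn ?powR_ge0// -powRrM mulrC qb.
  have -> : (F `^ q^-1) `^ (2 - q) = G / F.
    rewrite -powRrM mulrBr [_^-1 * 2]mulrC qb mulVf ?gt_eqF// powRB ?powRr1 ?(ltW F0)//.
    by rewrite (gt_eqF F0) implybT.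
  have : (0 <= \int[leb]_z (dif f (x, z))%:E)%E.
    by apply: integral_ge0 => z _; rewrite lee_fin (dif_ge0 c_levy).
  case: (\int[leb]_z (dif f (x, z))%:E)%E => [d d0|_ _|//]; last first.
    by rewrite gt0_muley ?lte_fin// leey.
  rewrite -!EFinM -!EFinD !lee_fin -/P.
  have -> : 2 * (G / F) * F = 2 * G by rewrite mulrA divfK// gt_eqF.
  move=> h; rewrite -(ler_pM2r P0); apply: le_trans h _.
  by rewrite le_eqVlt; apply/orP; left; apply/eqP; rewrite /C1 /C2; field; rewrite gt_eqF.
pose D x := (\int[leb]_z (dif f (x, z))%:E)%E.
have mD : measurable_fun setT D.
  exact: (measurable_tonelli leb (measurable_dif alpha c mf) (dif_ge0 c_levy f)).
have D0 x : (0 <= D x)%E.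
  by apply: integral_ge0 => z _; rewrite lee_fin (dif_ge0 c_levy).
have mG : measurable_fun setT (fun x : V => (C2 * G * weight x)%:E).
  by apply/measurable_EFinP; apply: measurable_funM => //; exact: measurable_weight.
have CG0 : 0 <= C2 * G by rewrite mulr_ge0// ltW.
have wG0 x : (0 <= (C2 * G * weight x)%:E)%E by rewrite lee_fin mulr_ge0 ?weight_ge0.
have CD0 x : (0 <= C1%:E * D x)%E by rewrite mule_ge0// lee_fin ltW.
apply: (@le_trans _ _ (\int[leb]_x (C1%:E * D x + (C2 * G * weight x)%:E))%E).
  apply: le_integral_ge0.
  - exact/measurable_EFinP.
  - by apply: emeasurable_funD => //; exact: measurable_funeM.
  - by move=> x; rewrite lee_fin mulr_ge0 ?sqr_ge0 ?weight_ge0.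
  move=> x; rewrite EFinM; apply: le_trans (lee_wpmul2r _ (pt x)) _.
    by rewrite lee_fin weight_ge0.
  rewrite -/(D x) ge0_muleDl//.
  rewrite -EFinM leeD2r// -[leRHS]mule1 lee_wpmul2l// lee_fin; exact: weight_le1.
rewrite ge0_integralD//; last exact: measurable_funeM.
rewrite ge0_integralZl//; last by rewrite lee_fin ltW.
rewrite -(dif_int_tonelli c_levy mf).
under eq_integral do rewrite EFinM.
rewrite ge0_integralZl//; last 2 first.
- by apply/measurable_EFinP; exact: measurable_weight.
- by move=> x _; rewrite lee_fin weight_ge0.
rewrite (Rintegral_EFin (integrable_weight n)) -/I -EFinM.
have dE := dif_int_ge0 c_levy f.
rewrite EFinD ge0_muleDl// ?lee_fin ?(ltW C10)//; last by rewrite mulr_ge0// mulr_ge0 ?ltW.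
rewrite leeD2l//; have -> : ((C2 * S * I)%:E * dif_int f = (C2 * I)%:E * (S%:E * dif_int f))%E.
  by rewrite muleA -EFinM; congr (_%:E * _)%E; ring.
have -> : C2 * G * I = C2 * I * G by ring.
by rewrite EFinM; apply: lee_wpmul2l => //; rewrite lee_fin mulr_ge0// ltW.
Qed.

End sobolev.

(** * Weighted square-integrable functions *)

Section weighted_L2.
Context {d} {X : measurableType d} {R : realType}.
Variables (mu : {measure set X -> \bar R}) (w : X -> R).
Hypotheses (mw : measurable_fun setT w) (w0 : forall x, 0 <= w x).
Implicit Types u v : X -> R.

(** One abstract theory serves the Riesz weight in frequency and the Levy density on increments,
    with and without time. *)
Definition wL2 u := measurable_fun setT u /\ (\int[mu]_x (u x ^+ 2 * w x)%:E < +oo)%E.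

Definition wip u v : R := \int[mu]_x (u x * v x * w x).

Lemma wL2_integrable_sqr u : wL2 u -> mu.-integrable setT (EFin \o (fun x => u x ^+ 2 * w x)).
Proof.
move=> [mu_ uoo]; apply: integrable_lty_ge0 => //.
  by apply: measurable_funM => //; exact: measurable_funX.
by move=> x; rewrite mulr_ge0 ?sqr_ge0.
Qed.

Lemma wip_integrable u v : wL2 u -> wL2 v ->
  mu.-integrable setT (EFin \o (fun x => u x * v x * w x)).
Proof.
move=> uL vL; apply: integrable_le (integrable_addR (wL2_integrable_sqr uL) (wL2_integrable_sqr vL)) _ _.
  by apply: measurable_funM => //; apply: measurable_funM; [exact: uL.1|exact: vL.1].
move=> x; rewrite normrM (ger0_norm (w0 x)) -mulrDl ler_wpM2r//; exact: norm_mul_le_sqr.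
Qed.

Lemma wL2D u v : wL2 u -> wL2 v -> wL2 (fun x => u x + v x).
Proof.
move=> uL vL; split; first exact: measurable_funD uL.1 vL.1.
apply: integral_lty_ge0; first by move=> x; rewrite mulr_ge0 ?sqr_ge0.
apply: integrable_le (integrable_addR (integrable_scaleR 2 (wL2_integrable_sqr uL))
  (integrable_scaleR 2 (wL2_integrable_sqr vL))) _ _.
  by apply: measurable_funM => //; apply: measurable_funX; exact: measurable_funD uL.1 vL.1.
move=> x; rewrite ger0_norm; last by rewrite mulr_ge0 ?sqr_ge0.
by rewrite 2!mulrA -mulrDl ler_wpM2r// sqrD_le.
Qed.

Lemma wL2Z k u : wL2 u -> wL2 (fun x => k * u x).
Proof.
move=> uL; split; first by apply: measurable_funM => //; exact: uL.1.
apply: integral_lty_ge0; first by move=> x; rewrite mulr_ge0 ?sqr_ge0.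
rewrite (_ : (fun x => _) = (fun x => k ^+ 2 * (u x ^+ 2 * w x))).
  exact: integrable_scaleR (wL2_integrable_sqr uL).
by apply/funext => x; rewrite exprMn mulrA.
Qed.

Lemma wL2B u v : wL2 u -> wL2 v -> wL2 (fun x => u x - v x).
Proof.
move=> uL /(wL2Z (-1)) vL; have := wL2D uL vL.
by rewrite (_ : (fun x => _ + -1 * _) = (fun x => u x - v x))//; apply/funext => x; rewrite mulN1r.
Qed.

Lemma wipC u v : wip u v = wip v u.
Proof. by rewrite /wip; apply: eq_Rintegral => x _; rewrite [u x * _]mulrC. Qed.

Lemma wipDl u v g : wL2 u -> wL2 v -> wL2 g ->
  wip (fun x => u x + v x) g = wip u g + wip v g.
Proof.
move=> uL vL gL; rewrite /wip -RintegralD//; [|exact: wip_integrable..].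
by apply: eq_Rintegral => x _; rewrite !mulrDl.
Qed.

Lemma wipZl k u g : wL2 u -> wL2 g -> wip (fun x => k * u x) g = k * wip u g.
Proof.
move=> uL gL; rewrite /wip -RintegralZl//; last exact: wip_integrable.
by apply: eq_Rintegral => x _; rewrite !mulrA.
Qed.

Lemma wipBl u v g : wL2 u -> wL2 v -> wL2 g ->
  wip (fun x => u x - v x) g = wip u g - wip v g.
Proof.
move=> uL vL gL; rewrite -[- wip v g]mulN1r -wipZl// -wipDl//; last exact: wL2Z.
by rewrite /wip; apply: eq_Rintegral => x _; rewrite mulN1r.
Qed.

Lemma wip_ge0 u : 0 <= wip u u.
Proof. by apply: Rintegral_ge0 => x _; rewrite mulr_ge0// -expr2 sqr_ge0. Qed.

Lemma wipE u : wL2 u -> (\int[mu]_x (u x ^+ 2 * w x)%:E = (wip u u)%:E)%E.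
Proof. by move=> uL; rewrite /wip -(Rintegral_EFin (wip_integrable uL uL)). Qed.

(** A Cauchy-Schwarz inequality with a free parameter: the pointwise bound |xy| <= x^2 + y^2 is
    applied to sqrt(s) u and v / sqrt(s). *)
Lemma wip_amgm u v (s : R) : wL2 u -> wL2 v -> 0 < s ->
  `|wip u v| <= s * wip u u + s^-1 * wip v v.
Proof.
move=> uL vL s0.
have iuv := wip_integrable uL vL.
have iu := integrable_scaleR s (wip_integrable uL uL).
have iv := integrable_scaleR s^-1 (wip_integrable vL vL).
apply: le_trans (le_normr_Rintegral _ iuv) _ => //.
rewrite /wip -!RintegralZl//; [|exact: wip_integrable..].
rewrite -RintegralD//; apply: le_Rintegral => //.
- exact: (integrable_norm iuv).
- exact: (integrable_addR iu iv).
move=> x _; rewrite normrM (ger0_norm (w0 x)) !mulrA -mulrDl ler_wpM2r//.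
have r0 : 0 < Num.sqrt s by rewrite sqrtr_gt0.
have sE : s = Num.sqrt s ^+ 2 by rewrite sqr_sqrtr// ltW.
have := norm_mul_le_sqr (Num.sqrt s * u x) ((Num.sqrt s)^-1 * v x).
rewrite mulrACA divff ?gt_eqF// mul1r => /le_trans; apply.
by rewrite !exprMn exprVn -sE !expr2 !mulrA.
Qed.

Lemma wip_cvg0 (u : nat -> X -> R) v : (forall k, wL2 (u k)) -> wL2 v ->
  wip (u k) (u k) @[k --> \oo] --> 0 -> wip (u k) v @[k --> \oo] --> 0.
Proof.
move=> uL vL u0; apply/cvgrPdist_lt => e e0.
(* This choice makes the second term of [wip_amgm] at most e/2; the added 1 keeps [s] positive when
   [v] has norm zero. *)
pose s := 2 * (wip v v + 1) / e.
have v1 : 0 < wip v v + 1 by rewrite ltr_wpDl// wip_ge0.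
have s0 : 0 < s by rewrite divr_gt0// mulr_gt0.
have e1 : 0 < e / (2 * s) by rewrite divr_gt0// mulr_gt0.
have /cvgrPdist_lt/(_ _ e1) := u0.
apply: filterS => k; rewrite !sub0r !normrN ger0_norm ?wip_ge0// => h.
apply: le_lt_trans (wip_amgm (uL k) vL s0) _.
have -> : e = s * (e / (2 * s)) + e / 2 by field; rewrite gt_eqF.
apply: ltr_leD; first by rewrite ltr_pM2l.
have -> : s^-1 * wip v v = e / 2 * (wip v v / (wip v v + 1)).
  by rewrite /s; field; rewrite !gt_eqF.
by rewrite ler_piMr ?divr_ge0 ?(ltW e0)// ler_pdivrMr// mul1r lerDl.
Qed.

Lemma wip_sqr_cvg (u : nat -> X -> R) v : (forall k, wL2 (u k)) -> wL2 v ->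
  wip (fun x => u k x - v x) (fun x => u k x - v x) @[k --> \oo] --> 0 ->
  wip (u k) (u k) @[k --> \oo] --> wip v v.
Proof.
move=> uL vL d0; pose d_ k x := u k x - v x.
have dL k : wL2 (d_ k) by exact: wL2B.
have dv0 := wip_cvg0 dL vL d0.
have E k : wip (u k) (u k) = wip (d_ k) (d_ k) + 2 * wip (d_ k) v + wip v v.
  rewrite !(wipBl (uL k) vL)//; rewrite ![wip _ (d_ k)]wipC !(wipBl (uL k) vL)//.
  by rewrite [wip v (u k)]wipC; ring.
have C : wip (d_ k) (d_ k) + 2 * wip (d_ k) v + wip v v @[k --> \oo] --> 0 + 2 * 0 + wip v v.
  by apply: cvgD; [apply: cvgD => //; exact: cvgMr|exact: cvg_cst].
rewrite mulr0 !add0r in C; apply: cvg_trans C; apply: near_eq_cvg; apply: nearW => k.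
by rewrite E.
Qed.

Section completeness.
Variable u : nat -> X -> R.
Hypotheses (mu_ : forall k, measurable_fun setT (u k))
  (cauchy : forall e : R, 0 < e -> exists n0 : nat, forall m k, (n0 <= m)%N -> (n0 <= k)%N ->
     (\int[mu]_x ((u m x - u k x) ^+ 2 * w x)%:E <= e%:E)%E).

Let e_gt0 k : 0 < 8 ^- k :> R. Proof. by rewrite invr_gt0 exprn_gt0. Qed.

Let N_ k := sval (cid (cauchy (e_gt0 k))).

(** Summing all the Cauchy indices up to k makes [s_ j] dominate every [N_ k] with k <= j; the extra
    k forces the subsequence to infinity. *)
Let s_ k := ((\sum_(i < k.+1) N_ i) + k)%N.

Let N_le k j : (k <= j)%N -> (N_ k <= s_ j)%N.
Proof.
move=> kj; have kj1 : (k < j.+1)%N by [].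
by rewrite /s_ (bigD1 (Ordinal kj1))//= -addnA leq_addr.
Qed.

Let d_ k x := u (s_ k.+1) x - u (s_ k) x.

Let d_le k : (\int[mu]_x (d_ k x ^+ 2 * w x)%:E <= (8 ^- k)%:E)%E.
Proof. by apply: (svalP (cid (cauchy (e_gt0 k)))); exact: N_le. Qed.

(** The factor 4^k against the bound 8^(-k) leaves the summable 2^(-k). Where the sum of the [g_ k]
    has a finite value M, the k-th increment is at most sqrt(M / w) 2^(-k). *)
Let g_ k x : \bar R := (4 ^+ k * (d_ k x ^+ 2 * w x))%:E.

Let g_ge0 k x : (0 <= g_ k x)%E.
Proof. by rewrite lee_fin mulr_ge0// mulr_ge0 ?sqr_ge0. Qed.

Let md k : measurable_fun setT (fun x => d_ k x ^+ 2 * w x).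
Proof. by apply: measurable_funM => //; apply: measurable_funX; exact: measurable_funB. Qed.

Let mg k : measurable_fun setT (g_ k).
Proof. by apply/measurable_EFinP; exact: measurable_funM. Qed.

Let g_sum_lty : (\int[mu]_x (\sum_(0 <= k <oo) g_ k x) < +oo)%E.
Proof.
rewrite integral_nneseries//; apply: (@le_lt_trans _ _ (2%:E)%E); last exact: ltry.
have C := @cvg_geometric_eseries_half R 2 0; rewrite expr0 divr1 in C.
rewrite -(cvg_lim _ C)//; apply: lee_nneseries => [k _ _|k _].
  by apply: integral_ge0 => x _; exact: g_ge0.
rewrite /g_ integral_scale_ge0//; last by move=> x; rewrite mulr_ge0 ?sqr_ge0.
apply: (@le_trans _ _ ((4 ^+ k)%:E * (8 ^- k)%:E)%E).
  by rewrite lee_wpmul2l// lee_fin.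
rewrite -EFinM lee_fin addn1 natrX exprS invfM mulrA divff// mul1r.
by rewrite -exprVn -exprMn -exprVn lerXn2r// ?nnegrE//; lra.
Qed.

Lemma geometric_increments_cvg (a : nat -> R) M :
  (forall k, `|a k.+1 - a k| <= M / 2 ^+ k) -> cvgn a.
Proof.
move=> aM; have M0 : 0 <= M.
  by have := le_trans (normr_ge0 _) (aM 0%N); rewrite expr0 divr1.
have ct : cvgn (series (telescope a)).
  apply: normed_cvg; apply: (@series_le_cvg _ _ (geometric M (2^-1))).
  - by move=> k; exact: normr_ge0.
  - by move=> k; rewrite /geometric/= mulr_ge0// exprn_ge0.
  - by move=> k; rewrite /geometric/= exprVn; exact: aM.
  - by apply: is_cvg_geometric_series; rewrite ger0_norm; lra.
rewrite (_ : a = fun n => a 0%N + series (telescope a) n); last first.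
  by apply/funext => n; exact: eq_sum_telescope.
by apply: is_cvgD => //; exact: is_cvg_cst.
Qed.

Let ae_cvg : {ae mu, forall x, w x != 0 -> cvgn (fun k => u (s_ k) x)}.
Proof.
have mS : measurable_fun setT (fun x => \sum_(0 <= k <oo) g_ k x)%E.
  by apply: ge0_emeasurable_sum.
have S0 x : (0 <= \sum_(0 <= k <oo) g_ k x)%E by exact: nneseries_ge0.
apply: filterS (ge0_ae_lty mS S0 g_sum_lty) => x Sx wx.
have wx0 : 0 < w x by rewrite lt_neqAle eq_sym wx w0.
move: (S0 x) Sx; have : forall k, (g_ k x <= \sum_(0 <= k <oo) g_ k x)%E.
  move=> k; apply: le_trans (nneseries_lim_ge k.+1 _); last by [].
  by rewrite big_nat_recr//= leeDr// sume_ge0.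
case: (\sum_(0 <= k <oo) g_ k x)%E => [M gM M0 _| |//]; last by rewrite ltxx.
apply: (@geometric_increments_cvg _ (Num.sqrt (M / w x))) => k.
rewrite -(@ler_pXn2r _ 2)// ?nnegrE ?mulr_ge0 ?sqrtr_ge0 ?invr_ge0 ?exprn_ge0//.
rewrite real_normK ?num_real// expr_div_n sqr_sqrtr ?divr_ge0 ?(ltW wx0)//.
rewrite -mulrA -invfM ler_pdivlMr ?mulr_gt0 ?exprn_gt0//.
have -> : 2 ^+ k ^+ 2 = 4 ^+ k :> R.
  by rewrite -exprM mulnC exprM; congr (_ ^+ _); rewrite expr2; ring.
rewrite [leLHS](_ : _ = 4 ^+ k * (d_ k x ^+ 2 * w x)); last by rewrite /d_; ring.
by have := gM k; rewrite lee_fin.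
Qed.

Lemma L2_cauchy_subsequence : exists (s : nat -> nat) (v : X -> R),
  [/\ measurable_fun setT v, forall k, (k <= s k)%N &
      {ae mu, forall x, w x != 0 -> u (s k) x @[k --> \oo] --> v x}].
Proof.
(* The upper limit is measurable on the whole space and agrees with the limit wherever the
   subsequence converges. *)
exists s_, (fun x => fine (limn_esup (fun k => (u (s_ k) x)%:E))); split.
- have mfine : measurable_fun [set: \bar R] (@fine R) by [].
  apply: (measurableT_comp mfine).
  by apply: measurable_fun_limn_esup => k; exact/measurable_EFinP.
- by move=> k; rewrite leq_addl.
apply: filterS ae_cvg => x h /h /cvg_ex[l ul].
have ulE : ((u (s_ k) x)%:E @[k --> \oo] --> l%:E)%E by apply: cvg_EFin => //; exact: nearW.
by rewrite (cvg_limn_einf_sup ulE).2.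
Qed.

Lemma L2_complete : exists (s : nat -> nat) (v : X -> R),
  [/\ measurable_fun setT v, forall k, (k <= s k)%N,
      {ae mu, forall x, w x != 0 -> u (s k) x @[k --> \oo] --> v x} &
      forall e : R, 0 < e -> exists n0 : nat, forall k, (n0 <= k)%N ->
        (\int[mu]_x ((u k x - v x) ^+ 2 * w x)%:E <= e%:E)%E].
Proof.
have [s [v [mv sk sv]]] := L2_cauchy_subsequence; exists s, v; split => // e e0.
have [n0 n0P] := cauchy e0; exists n0 => k n0k.
(* Fatou's lemma along the subsequence, shifted by [n0] so that every index lies in the range where
   the Cauchy bound holds. *)
apply: (@fatou_cvg _ _ _ mu (fun j x => ((u k x - u (s (j + n0)%N) x) ^+ 2 * w x)%:E)).
- move=> j; apply/measurable_EFinP; apply: measurable_funM => //.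
  by apply: measurable_funX; exact: measurable_funB.
- by move=> j x; rewrite lee_fin mulr_ge0 ?sqr_ge0.
- apply: filterS sv => x; have [->|wx /(_ isT) ux] := eqVneq (w x) 0.
    by move=> _; under eq_fun do rewrite mulr0; rewrite mulr0; exact: cvg_cst.
  apply: cvg_EFin; first exact: nearW.
  apply: cvgMl; rewrite !expr2.
  have h : u k x - u (s (j + n0)%N) x @[j --> \oo] --> u k x - v x.
    by apply: cvgB; [exact: cvg_cst|rewrite (cvg_shiftn n0 (fun j => u (s j) x))].
  exact: (cvgM h h).
- by move=> j; apply: n0P => //; apply: leq_trans (sk _); rewrite leq_addl.
Qed.

End completeness.

End weighted_L2.

(** * Truncation of functions of finite energy *)

Section soft_threshold.
Context {R : realType}.
Implicit Types e r s : R.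

(* Soft thresholding at level e: it is 1-Lipschitz, and so is the difference with
   the identity, whence the two one-sided comparisons below. *)
Definition soft e r : R := Num.max (r - e) 0 - Num.max (- r - e) 0.

Lemma soft_cases e r : 0 <= e -> [\/ r <= - e /\ soft e r = r + e,
  (- e <= r <= e) /\ soft e r = 0 | e <= r /\ soft e r = r - e].
Proof.
move=> e0; rewrite /soft; have [h1|h1] := leP (r - e) 0; have [h2|h2] := leP (- r - e) 0.
- by apply: Or32; split; [apply/andP; split; lra|lra].
- by apply: Or31; split; lra.
- by apply: Or33; split; lra.
- by exfalso; lra.
Qed.

(** [soft e] and the identity minus [soft e] are both nondecreasing, so their increments have the
    same sign. *)
Lemma soft_contract e r s : 0 <= e ->
  0 <= (soft e r - soft e s) * ((r - s) - (soft e r - soft e s)).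
Proof.
move=> e0; case: (soft_cases r e0) => -[h1 ->]; case: (soft_cases s e0) => -[h2 ->];
  try (move/andP: h1 => [h1 h1']); try (move/andP: h2 => [h2 h2']); nra.
Qed.

Lemma soft_sqr_le e r s : 0 <= e -> (soft e r - soft e s) ^+ 2 <= (r - s) ^+ 2.
Proof.
move=> /(soft_contract r s); move: (soft e r - soft e s) (r - s) => u v h.
by rewrite -subr_ge0 (_ : _ - _ = (v - u) ^+ 2 + 2 * (u * (v - u))); [rewrite addr_ge0 ?sqr_ge0// mulr_ge0|ring].
Qed.

Lemma soft_res_sqr_le e r s : 0 <= e ->
  ((soft e r - soft e s) - (r - s)) ^+ 2 <= (r - s) ^+ 2.
Proof.
move=> /(soft_contract r s); move: (soft e r - soft e s) (r - s) => u v h.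
by rewrite -subr_ge0 (_ : _ - _ = u ^+ 2 + 2 * (u * (v - u))); [rewrite addr_ge0 ?sqr_ge0// mulr_ge0|ring].
Qed.

Lemma soft_dist e r : 0 <= e -> `|soft e r - r| <= e.
Proof.
move=> e0; rewrite ler_norml; case: (soft_cases r e0) => -[h ->];
  try (move/andP: h => [h h']); apply/andP; split; lra.
Qed.

Lemma soft0 e : 0 <= e -> soft e 0 = 0.
Proof. by move=> e0; case: (soft_cases 0 e0) => -[h ->] //; lra. Qed.

Lemma soft_eq0 e r : 0 <= e -> `|r| <= e -> soft e r = 0.
Proof.
by move=> e0; rewrite ler_norml => /andP[h1 h2]; case: (soft_cases r e0) => -[h ->] //; lra.
Qed.

Lemma soft_norm_le e r : 0 <= e -> `|soft e r| <= `|r|.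
Proof.
move=> e0; rewrite -(@ler_pXn2r _ 2)// ?nnegrE// !real_normK ?num_real//.
by have := soft_sqr_le r 0 e0; rewrite soft0// !subr0.
Qed.

(** A pointwise Chebyshev estimate: the threshold vanishes below level [e], and above it a power of
    |r| with nonpositive exponent p - q is at most the same power of [e]. The alternative is there
    because 0 to the power 0 is 1. *)
Lemma soft_pow_le e r (p q : R) : 0 < e -> p <= q ->
  `|soft e r| `^ p <= e `^ (p - q) * `|r| `^ q \/ p <= 0.
Proof.
move=> e0 pq; have [p0|p0] := leP p 0; [by right|left].
have [re|er] := leP `|r| e.
  rewrite soft_eq0 ?(ltW e0)// normr0 powR0 ?gt_eqF//.
  by rewrite mulr_ge0 ?powR_ge0.
have r0 : 0 < `|r| by exact: lt_trans er.
apply: (@le_trans _ _ (`|r| `^ p)).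
  by apply: ge0_ler_powR; rewrite ?nnegrE ?(ltW p0)// soft_norm_le// ltW.
have -> : `|r| `^ p = `|r| `^ (p - q) * `|r| `^ q.
  by rewrite -powRD ?subrK// (gt_eqF r0) implybT.
rewrite ler_wpM2r ?powR_ge0//.
have -> : p - q = - (q - p) by rewrite opprB.
rewrite !powRN lef_pV2 ?posrE ?powR_gt0//.
by apply: ge0_ler_powR; rewrite ?nnegrE ?subr_ge0 ?(ltW e0) ?(ltW r0) ?(ltW er).
Qed.

Lemma measurable_soft {d} {X : measurableType d} e (f : X -> R) :
  measurable_fun setT f -> measurable_fun setT (fun x => soft e (f x)).
Proof.
move=> mf; apply: measurable_funB; apply: measurable_maxr => //.
  exact: measurable_funB.
by apply: measurable_funB => //; exact: measurableT_comp.
Qed.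

End soft_threshold.

Section finite_energy_functions.
Context {R : realType} {n : nat}.
Variables (alpha c : R).
Hypotheses (alpha_gt0 : 0 < alpha) (alpha_ltN : alpha < n%:R)
  (c_levy : @levy_normalization R n alpha c).
Local Notation leb := (lebesgue_rV R n).
Local Notation V := 'rV[R]_n.
Local Notation rho := (@levy_density R n alpha c).
Local Notation dif := (@dif R n alpha c).
Local Notation dif_int := (@dif_int R n alpha c).
Local Notation q := (2 * n%:R / (n%:R - alpha)).
Local Notation Lq := (@Lq R n alpha).
Local Notation leb2 := (leb \x leb)%E.
Implicit Types (f g : V -> R).

Let rho_ge0 := levy_density_ge0 c_levy.
Let mrho := @measurable_levy_density R n alpha c.
Definition levy_density2 (p : V * V) : R := rho p.2.
Local Notation rho2 := levy_density2.
Let rho2_ge0 p : 0 <= rho2 p. Proof. exact: rho_ge0. Qed.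
Let mrho2 : measurable_fun setT rho2.
Proof. exact: (measurableT_comp mrho measurable_snd). Qed.

Definition increment f (p : V * V) : R := f (p.1 + p.2) - f p.1.

(* The functions of finite energy in the Sobolev space of order alpha / 2;
   [pair] is twice the energy form. *)
Definition good f := [/\ measurable_fun setT f, (Lq f < +oo)%E & (dif_int f < +oo)%E].

Definition pair f g : R := wip leb2 rho2 (increment f) (increment g).

Lemma good_increment f : good f -> wL2 leb2 rho2 (increment f).
Proof.
move=> [mf _ fE]; split; first exact: measurable_increment.
exact: fE.
Qed.

Lemma dif_int_pair f : good f -> dif_int f = (pair f f)%:E.
Proof. by move=> /good_increment/(wipE mrho2 rho2_ge0) <-. Qed.

Let q_gt0 : 0 < q.
Proof. exact: lt_trans (sobolev_exponent_gt2 alpha_gt0 alpha_ltN). Qed.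

Lemma good_intro f : measurable_fun setT f -> (Lq f < +oo)%E ->
  wL2 leb2 rho2 (increment f) -> good f.
Proof. by move=> mf fq [_ fE]; split. Qed.

Lemma goodD f g : good f -> good g -> good (fun x => f x + g x).
Proof.
move=> fG gG; have [mf fq fE] := fG; have [mg gq gE] := gG.
apply: good_intro; first exact: measurable_funD.
  have h (h' : V -> R) : (Lq h' < +oo)%E -> measurable_fun setT h' ->
      leb.-integrable setT (EFin \o (fun x => `|h' x| `^ q)).
    move=> h'oo mh'; apply: integrable_lty_ge0 => //; exact: measurable_powq.
  apply: integral_lty_ge0; first by move=> x; rewrite powR_ge0.
  apply: integrable_le (integrable_scaleR (2 `^ q) (integrable_addR (h f fq mf) (h g gq mg))) _ _.
    by apply: measurable_powq; exact: measurable_funD.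
  move=> x; rewrite ger0_norm ?powR_ge0//.
  wlog fg : f g {fG gG mf fq fE mg gq gE} / `|g x| <= `|f x|.
    move=> wl; have [gf|/ltW fg] := leP `|g x| `|f x|; first exact: wl.
    by rewrite (addrC (f x)) (addrC (`|f x| `^ q)); exact: wl.
  apply: (@le_trans _ _ ((2 * `|f x|) `^ q)).
    have f2 : 0 <= 2 * `|f x| by rewrite mulr_ge0.
    apply: ge0_ler_powR; rewrite ?nnegrE ?(ltW q_gt0)//.
    by apply: le_trans (ler_normD _ _) _; rewrite mulr_natl mulr2n lerD2l.
  by rewrite powRM// ler_wpM2l ?powR_ge0// lerDl powR_ge0.
rewrite (_ : increment _ = fun p => increment f p + increment g p).
  exact: (wL2D mrho2 rho2_ge0 (good_increment fG) (good_increment gG)).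
by apply/funext => p; rewrite /increment opprD addrACA.
Qed.

Lemma goodZ k f : good f -> good (fun x => k * f x).
Proof.
move=> fG; have [mf fq fE] := fG.
apply: good_intro; first exact: measurable_funM.
  rewrite /Lq [X in (X < _)%E](_ : _ = ((`|k| `^ q)%:E * Lq f)%E).
    by rewrite lte_mul_pinfty// lee_fin powR_ge0.
  rewrite -integral_scale_ge0 ?powR_ge0//; last exact: measurable_powq.
  by apply: eq_integral => x _; rewrite normrM powRM.
rewrite (_ : increment _ = fun p => k * increment f p).
  exact: (wL2Z mrho2 rho2_ge0 k (good_increment fG)).
by apply/funext => p; rewrite /increment mulrBr.
Qed.

Lemma goodB f g : good f -> good g -> good (fun x => f x - g x).
Proof.
move=> fG /(goodZ (-1)) gG; have := goodD fG gG.
by rewrite (_ : (fun x => _ + -1 * _) = (fun x => f x - g x))//; apply/funext => x; rewrite mulN1r.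
Qed.

Lemma pairC f g : pair f g = pair g f. Proof. exact: wipC. Qed.

Lemma pair_ge0 f : 0 <= pair f f. Proof. exact: wip_ge0. Qed.

Lemma pairDl f g h : good f -> good g -> good h ->
  pair (fun x => f x + g x) h = pair f h + pair g h.
Proof.
move=> /good_increment fG /good_increment gG /good_increment hG.
rewrite /pair -(wipDl mrho2 rho2_ge0 fG gG hG); congr wip.
by apply/funext => p; rewrite /increment opprD addrACA.
Qed.

Lemma pairBl f g h : good f -> good g -> good h ->
  pair (fun x => f x - g x) h = pair f h - pair g h.
Proof.
move=> /good_increment fG /good_increment gG /good_increment hG.
rewrite /pair -(wipBl mrho2 rho2_ge0 fG gG hG); congr wip.
by apply/funext => p; rewrite /increment opprB addrACA opprB [- g _ - _]addrC addrACA.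
Qed.

Lemma pair_polar f g : good f -> good g ->
  4 * pair f g = pair (fun x => f x + g x) (fun x => f x + g x) -
                 pair (fun x => f x - g x) (fun x => f x - g x).
Proof.
move=> fG gG; have dG := goodD fG gG; have bG := goodB fG gG.
rewrite (pairDl fG gG dG) (pairBl fG gG bG) ![pair _ (fun x => _ + _)]pairC.
rewrite !(pairDl fG gG)// !(pairBl fG gG)//.
by rewrite (pairC g f); ring.
Qed.

Lemma energy_pair f g : good f -> good g ->
  energy alpha c f g = (2^-1 * pair f g)%:E.
Proof.
move=> fG gG; rewrite EFinM /energy; congr (_ * _)%E.
have i := wip_integrable mrho2 rho2_ge0 (good_increment fG) (good_increment gG).
rewrite /pair /wip -(Rintegral_EFin i) -(integral12_prod_meas1 i).
apply: eq_integral => x _.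
have e0 : ((f (x + 0) - f x) * (g (x + 0) - g x) * rho 0)%:E = 0%E.
  by rewrite (levy_density0 c alpha_gt0) mulr0.
exact: (integral_ne0 (f := fun z => ((f (x + z) - f x) * (g (x + z) - g x) * rho z)%:E) e0).
Qed.

Definition trunc (k : nat) f x : R := soft k.+1%:R^-1 (f x).

Let k_ge0 (k : nat) : 0 <= k.+1%:R^-1 :> R. Proof. by rewrite invr_ge0. Qed.
Let k_gt0 (k : nat) : 0 < k.+1%:R^-1 :> R. Proof. by rewrite invr_gt0. Qed.

Lemma measurable_trunc k f : measurable_fun setT f -> measurable_fun setT (trunc k f).
Proof. exact: measurable_soft. Qed.

Lemma good_trunc k f : good f -> good (trunc k f).
Proof.
move=> [mf fq fE]; split; first exact: measurable_trunc.
- apply: le_lt_trans fq; apply: le_integral_ge0.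
  + by apply/measurable_EFinP; apply: measurable_powq; exact: measurable_trunc.
  + by apply/measurable_EFinP; exact: measurable_powq.
  + by move=> x; rewrite lee_fin powR_ge0.
  move=> x; rewrite lee_fin; apply: ge0_ler_powR; rewrite ?nnegrE ?(ltW q_gt0)//.
  exact: soft_norm_le.
apply: le_lt_trans fE; apply: le_integral_ge0.
- by apply/measurable_EFinP; apply: measurable_dif; exact: measurable_trunc.
- by apply/measurable_EFinP; exact: measurable_dif.
- by move=> p; rewrite lee_fin (dif_ge0 c_levy).
by move=> p; rewrite lee_fin ler_wpM2r//; exact: soft_sqr_le.
Qed.

Let integrable_pow f : good f -> leb.-integrable setT (EFin \o (fun x => `|f x| `^ q)).
Proof.
move=> [mf fq _]; apply: integrable_lty_ge0 => //; exact: measurable_powq.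
Qed.

Lemma integrable_trunc k f : good f -> leb.-integrable setT (EFin \o trunc k f).
Proof.
move=> fG; have [mf _ _] := fG.
apply: integrable_le (integrable_scaleR (k.+1%:R^-1 `^ (1 - q)) (integrable_pow fG)) _ _.
  exact: measurable_trunc.
move=> x; have q1 : 1 <= q by have := sobolev_exponent_gt2 alpha_gt0 alpha_ltN; lra.
have [|] := soft_pow_le (f x) (k_gt0 k) q1; last by rewrite ler10.
by rewrite powRr1.
Qed.

Lemma integrable_trunc_sqr k f : good f ->
  leb.-integrable setT (EFin \o (fun x => trunc k f x ^+ 2)).
Proof.
move=> fG; have [mf _ _] := fG.
apply: integrable_le (integrable_scaleR (k.+1%:R^-1 `^ (2 - q)) (integrable_pow fG)) _ _.
  by apply: measurable_funX; exact: measurable_trunc.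
move=> x; have q1 : 2%:R <= q by have := sobolev_exponent_gt2 alpha_gt0 alpha_ltN; lra.
have [|] := soft_pow_le (f x) (k_gt0 k) q1; last by rewrite lern0.
by rewrite powR_mulrn// normrX.
Qed.

Lemma trunc_norm_le k f x : `|trunc k f x| <= `|f x|.
Proof. exact: soft_norm_le. Qed.

Lemma trunc_cvg f x : trunc k f x @[k --> \oo] --> f x.
Proof.
apply/cvgrPdist_le => e e0; near=> k.
rewrite distrC; apply: le_trans (soft_dist _ (k_ge0 k)) _.
by apply: ltW; near: k; exact: near_infty_natSinv_lt (PosNum e0).
Unshelve. all: by end_near. Qed.

Definition trunc_defect f k p := increment (trunc k f) p - increment f p.
Local Notation inc_trunc := trunc_defect.

(** Dominated convergence: by [soft_res_sqr_le] the increments of the remainder are bounded by those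
    of [f], which are square-integrable against the Levy density. *)
Lemma pair_trunc_diff_cvg f : good f ->
  wip leb2 rho2 (inc_trunc f k) (inc_trunc f k) @[k --> \oo] --> 0.
Proof.
move=> fG; have fL := good_increment fG.
have kL k := good_increment (good_trunc k fG).
have [] // := @Rdominated_cvg _ _ _ leb2 (fun k p => inc_trunc f k p * inc_trunc f k p * rho2 p)
  (cst 0) (fun p => increment f p ^+ 2 * rho2 p).
- move=> k; apply: measurable_funM => //.
  by apply: measurable_funM; apply: measurable_funB; [exact: (kL k).1|exact: fL.1|exact: (kL k).1|exact: fL.1].
- apply: nearW => p.
  have h : inc_trunc f k p @[k --> \oo] --> 0.
    rewrite -(subrr (increment f p)); apply: cvgB; last exact: cvg_cst.
    by apply: cvgB; exact: trunc_cvg.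
  rewrite -(mul0r (rho2 p)) -[X in X * rho2 p](mul0r 0); apply: cvgMl.
  exact: (cvgM h h).
- exact: wL2_integrable_sqr.
- move=> k p; rewrite -expr2 ger0_norm; last by rewrite mulr_ge0 ?sqr_ge0.
  rewrite ler_wpM2r//; exact: soft_res_sqr_le.
by move=> _; rewrite [X in _ --> X]/Rintegral /= integral0.
Qed.

Lemma pair_trunc_cvg f : good f -> pair (trunc k f) (trunc k f) @[k --> \oo] --> pair f f.
Proof.
move=> fG; apply: (wip_sqr_cvg mrho2 rho2_ge0).
- by move=> k; exact: good_increment (good_trunc k fG).
- exact: good_increment.
exact: pair_trunc_diff_cvg.
Qed.

(** The inequality of [soft_contract], integrated. It makes orthogonality of [f] to its own
    thresholds strong enough to annihilate them. *)
Lemma pair_trunc_le k f : good f -> pair (trunc k f) (trunc k f) <= pair f (trunc k f).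
Proof.
move=> fG; have fL := good_increment fG; have kL := good_increment (good_trunc k fG).
apply: le_Rintegral => //; [exact: (wip_integrable mrho2)..|].
move=> p _; rewrite ler_wpM2r// -subr_ge0 -mulrBl mulrC.
exact: soft_contract.
Qed.

Lemma pair_trunc_diff_le k l f : good f ->
  pair (fun x => trunc k f x - trunc l f x) (fun x => trunc k f x - trunc l f x) <=
  2 * wip leb2 rho2 (inc_trunc f k) (inc_trunc f k) +
  2 * wip leb2 rho2 (inc_trunc f l) (inc_trunc f l).
Proof.
move=> fG; have fL := good_increment fG; have kL j := good_increment (good_trunc j fG).
have dL j : wL2 leb2 rho2 (inc_trunc f j) by exact: (wL2B mrho2 rho2_ge0 (kL j) fL).
have i j := integrable_scaleR 2 (wip_integrable mrho2 rho2_ge0 (dL j) (dL j)).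
rewrite /wip -!RintegralZl//; [|exact: (wip_integrable mrho2)..].
rewrite -RintegralD//; apply: le_Rintegral => //.
- have G := good_increment (goodB (good_trunc k fG) (good_trunc l fG)).
  exact: (wip_integrable mrho2 rho2_ge0 G G).
- exact: (integrable_addR (i k) (i l)).
move=> p _; rewrite [leRHS](_ : _ = (2 * inc_trunc f k p ^+ 2 + 2 * inc_trunc f l p ^+ 2) * rho2 p); last by ring.
rewrite -expr2 ler_wpM2r//.
have := sqrD_le (inc_trunc f k p) (- inc_trunc f l p); rewrite sqrrN; apply: le_trans.
by rewrite le_eqVlt; apply/orP; left; apply/eqP; rewrite /inc_trunc /increment; ring.
Qed.

Lemma dif_int_ae0 f : measurable_fun setT f -> {ae leb, forall x, f x = 0} -> dif_int f = 0%E.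
Proof.
move=> mf f0; rewrite (dif_int_tonelliC c_levy mf).
apply: integral0_eq => z _; apply/eqP; rewrite eq_le; apply/andP; split; last first.
  by apply: integral_ge0 => x _; rewrite lee_fin (dif_ge0 c_levy).
have mf2 : measurable_fun setT (fun x => f x ^+ 2) by exact: measurable_funX.
have E0 : (\int[leb]_x (f x ^+ 2)%:E = 0)%E.
  rewrite (ae_eq_integral_nomeas (g := cst 0%E)) ?integral0//.
  by apply: filterS f0 => x /= -> _; rewrite expr0n.
have E1 : (\int[leb]_x (f (x + z) ^+ 2)%:E = 0)%E.
  rewrite (@integral_rV_shift _ _ z (fun x => (f x ^+ 2)%:E))//; first exact/measurable_EFinP.
  by move=> x; rewrite lee_fin sqr_ge0.
have mfz2 : measurable_fun setT (fun x : V => f (x + z) ^+ 2).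
  exact: (measurableT_comp mf2 (measurable_rV_shift z)).
have r2 : 0 <= 2 * rho z by rewrite mulr_ge0.
apply: (@le_trans _ _ (\int[leb]_x ((2 * rho z * f (x + z) ^+ 2)%:E + (2 * rho z * f x ^+ 2)%:E))%E).
  apply: le_integral_ge0.
  - apply/measurable_EFinP.
    exact: (measurableT_comp (measurable_dif alpha c mf) (pair2_measurable z)).
  - by apply: emeasurable_funD; apply/measurable_EFinP; exact: measurable_funM.
  - by move=> x; rewrite lee_fin (dif_ge0 c_levy).
  move=> x; rewrite -EFinD lee_fin [leRHS](_ : _ = (2 * f (x + z) ^+ 2 + 2 * f x ^+ 2) * rho z); last by ring.
  by rewrite ler_wpM2r//; have := sqrD_le (f (x + z)) (- f x); rewrite sqrrN.
rewrite ge0_integralD//; last 4 first.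
- by move=> x _; rewrite lee_fin mulr_ge0 ?sqr_ge0.
- by apply/measurable_EFinP; exact: measurable_funM.
- by move=> x _; rewrite lee_fin mulr_ge0 ?sqr_ge0.
- by apply/measurable_EFinP; exact: measurable_funM.
rewrite !integral_scale_ge0//; try by move=> x; exact: sqr_ge0.
by rewrite E0 E1 !mule0 addr0.
Qed.

End finite_energy_functions.

(** * Smooth bump functions *)

Section flat_function.
Context {R : realType}.

(** The classical exp(-1/s) extended by zero, with powers of 1/s attached so that derivatives of
    members of the family are linear combinations of members. *)
Definition flat (k : nat) (s : R) : R := if 0 < s then s^-1 ^+ k * expR (- s^-1) else 0.

Lemma flat_ge0 k s : 0 <= flat k s.
Proof.
by rewrite /flat; case: ifP => // s0; rewrite mulr_ge0 ?expR_ge0// exprn_ge0// invr_ge0 ltW.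
Qed.

Lemma flat_gt0 k s : 0 < s -> 0 < flat k s.
Proof. by move=> s0; rewrite /flat s0 mulr_gt0 ?expR_gt0// exprn_gt0// invr_gt0. Qed.

Lemma flat_eq0 k s : s <= 0 -> flat k s = 0.
Proof. by rewrite /flat leNgt => /negbTE ->. Qed.

Lemma flat0_le1 s : flat 0 s <= 1.
Proof.
rewrite /flat; case: ifP => // s0; rewrite expr0 mul1r -expR0 ler_expR oppr_le0.
by rewrite invr_ge0 ltW.
Qed.

(** With u = 1/s the claim is u^k exp(-u) <= k^k, the k-th power of u/k <= exp(u/k). *)
Lemma flat_bound k s : flat k s <= k%:R ^+ k.
Proof.
case: k => [|k]; first by rewrite expr0 flat0_le1.
rewrite /flat; case: ifP => s0; last by rewrite exprn_ge0.
have u0 : 0 < s^-1 by rewrite invr_gt0.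
move: (s^-1) u0 => u u0; rewrite expRN ler_pdivrMr ?expR_gt0//.
have -> : expR u = expR (u / k.+1%:R) ^+ k.+1.
  by rewrite -expRM_natl mulrC divfK.
rewrite -exprMn lerXn2r ?nnegrE ?mulr_ge0 ?expR_ge0 ?(ltW u0)//.
rewrite -ler_pdivrMl// mulrC; apply: le_trans (expR_ge1Dx _).
by rewrite ler_wpDl.
Qed.

Lemma flat_mul k s : s * flat k.+1 s = flat k s.
Proof.
rewrite /flat; case: ifP => s0; last by rewrite mulr0.
by rewrite exprS !mulrA divff ?gt_eqF// mul1r.
Qed.

Definition dflat k s : R := flat k.+2 s - k%:R * flat k.+1 s.

Lemma is_derive_flat k (s : R) : is_derive s 1 (flat k) (dflat k s).
Proof.
have [s0|s0|->] := ltgtP s 0.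
- rewrite /dflat !flat_eq0 ?(ltW s0)// mulr0 subr0.
  apply: (@near_eq_is_derive _ _ _ (cst 0)) => //.
  near=> t; rewrite flat_eq0//; apply: ltW; near: t.
  exact: (lt_nbhsl s0).
- have D : is_derive s 1 (fun t : R => t^-1 ^+ k * expR (- t^-1)) (dflat k s).
    have sN : s != 0 by rewrite gt_eqF.
    have Dv : is_derive (s : R) 1 (fun t : R => t^-1) (- s ^- 2).
      by apply: is_derive_eq (is_deriveV sN (is_derive_id s 1)) _; rewrite scaler1.
    have De := @is_derive1_comp _ expR (fun t : R => - t^-1) s _ _ (is_derive_expR (- s^-1)) (is_deriveN Dv).
    have -> : (fun t : R => t^-1 ^+ k * expR (- t^-1)) =
        ((fun t : R => t^-1) ^+ k) * (expR \o (fun t : R => - t^-1)).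
      by apply/funext => t; rewrite !mulrfctE exprfctE.
    apply: is_derive_eq (is_deriveM (is_deriveX k Dv) De) _.
    rewrite /dflat /flat s0 /= /GRing.scale /=.
    rewrite exprfctE /= -!exprVn; move: (expR (- s^-1)) => a; move: (s^-1) => u.
    by case: k => [|k] /=; rewrite !exprS; ring.
  apply: (@near_eq_is_derive _ _ _ (fun t : R => t^-1 ^+ k * expR (- t^-1))) => //.
  near=> t; rewrite /flat ifT//; near: t.
  exact: (lt_nbhsr s0).
rewrite /dflat !flat_eq0// mulr0 subr0.
(* At the origin the difference quotient is [flat k.+1 h], which equals h times the bounded quantity
   [flat k.+2 h]. *)
have L : h^-1 *: (flat k (h *: 1 + 0) - flat k 0) @[h --> 0^'] --> (0 : R).
  apply/cvgrPdist_lt => e e0; near=> h.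
  rewrite sub0r normrN [flat k 0]flat_eq0// subr0 addr0.
  have h0 : h != 0 by near: h; exact: nbhs_dnbhs_neq.
  have -> : h *: (1 : R) = h by rewrite /GRing.scale /= mulr1.
  rewrite /GRing.scale /= -(flat_mul k) -(flat_mul k.+1) !mulrA mulVf// mul1r.
  rewrite normrM (ger0_norm (flat_ge0 _ _)).
  apply: le_lt_trans (ler_wpM2l (normr_ge0 _) (flat_bound k.+2 h)) _.
  rewrite -ltr_pdivlMr ?exprn_gt0//.
  near: h; apply: dnbhs0_lt; by rewrite divr_gt0// exprn_gt0.
by apply: DeriveDef; [apply/cvg_ex; exists 0|exact/cvg_lim].
Unshelve. all: by end_near. Qed.

Lemma continuous_flat k : continuous (flat k).
Proof.
by move=> s; apply/differentiable_continuous/derivable1_diffP; case: (is_derive_flat k s).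
Qed.

(** Rescaled, the smooth step tends to the indicator of the open half-line; products of such steps
    will approximate indicators of boxes and intervals. *)
Lemma flat0_cvg s : flat 0 (m%:R * s) @[m --> \oo] --> (if 0 < s then 1 else 0 : R).
Proof.
case: ifPn => [s0|]; last first.
  rewrite -leNgt => s0; rewrite (_ : (fun m : nat => _) = cst 0); first exact: cvg_cst.
  by apply/funext => m; rewrite flat_eq0// mulr_ge0_le0.
apply/cvgrPdist_le => e e0; near=> m.
have m0 : (0 < m)%N by near: m; exact: nbhs_infty_gt.
have ms : 0 < m%:R * s by rewrite mulr_gt0// ltr0n.
rewrite /flat ms expr0 mul1r ger0_norm; last first.
  rewrite subr_ge0 -[leRHS]expR0 ler_expR oppr_le0 invr_ge0; exact: ltW.
have := expR_ge1Dx (- (m%:R * s)^-1) => h.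
apply: (@le_trans _ _ (m%:R * s)^-1); first lra.
rewrite invf_ple ?posrE//; rewrite -ler_pdivrMr//.
near: m; exact: nbhs_infty_ger.
Unshelve. all: by end_near. Qed.

End flat_function.

Section affine_composition.
Context {R : realType} {W : normedModType R}.

Lemma derive_comp_affine (phi dphi : R -> R) (l : W -> R) v mv :
  (forall s : R, is_derive s 1 phi (dphi s)) ->
  (forall h x, l (h *: v + x) = h * mv + l x) ->
  forall x, derivable (fun x => phi (l x)) x v /\
            'D_v (fun x => phi (l x)) x = mv * dphi (l x).
Proof.
move=> D lv x; have [d1 dE] := D (l x).
have df : differentiable phi (l x) by exact/derivable1_diffP.
have E : (fun h => h^-1 *: (phi (l (h *: v + x)) - phi (l x))) =
    (fun h => h^-1 *: (phi (h *: mv + l x) - phi (l x))).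
  by apply/funext => h; rewrite lv.
split; first by rewrite /derivable E; exact: diff_derivable.
have -> : 'D_v (fun x => phi (l x)) x = 'D_mv phi (l x) by rewrite /derive E.
by rewrite -dE !deriveE// -[in LHS](mulr1 mv) linearZ.
Qed.

End affine_composition.

Section flat_algebra.
Context {R : realType}.

(* The affine maps l of the first constructor are given with their linear parts m. *)
Inductive flat_algebra {W : normedModType R} : (W -> R) -> Prop :=
| flat_algebra_flat k (l m : W -> R) : continuous l ->
    (forall h v x, l (h *: v + x) = h * m v + l x) -> flat_algebra (fun x => flat k (l x))
| flat_algebra_cst a : flat_algebra (fun=> a)
| flat_algebraD f g : flat_algebra f -> flat_algebra g -> flat_algebra (fun x => f x + g x)
| flat_algebraM f g : flat_algebra f -> flat_algebra g -> flat_algebra (fun x => f x * g x).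

Lemma flat_algebra_comp (W W' : normedModType R) (A B : W -> W') f : continuous A ->
  (forall h v x, A (h *: v + x) = h *: B v + A x) ->
  flat_algebra f -> flat_algebra (fun x => f (A x)).
Proof.
move=> cA AB; elim => [k l m cl lm|a|g h _ ag _ ah|g h _ ag _ ah].
- apply: (@flat_algebra_flat _ k (l \o A) (m \o B)).
  + by move=> x; apply: continuous_comp; [exact: cA|exact: cl].
  + by move=> h v x /=; rewrite AB lm.
- exact: flat_algebra_cst.
- exact: flat_algebraD.
- exact: flat_algebraM.
Qed.

Lemma flat_algebra_prod (W : normedModType R) I (r : seq I) (F : I -> W -> R) :
  (forall i, flat_algebra (F i)) -> flat_algebra (fun x => \prod_(i <- r) F i x).
Proof.
move=> FA; elim: r => [|i r IH].
  by under eq_fun do rewrite big_nil; exact: flat_algebra_cst.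
by under eq_fun do rewrite big_cons; exact: flat_algebraM.
Qed.

Lemma flat_algebra_continuous (W : normedModType R) (f : W -> R) : flat_algebra f -> continuous f.
Proof.
elim => [k l m cl lm|a|g h _ ag _ ah|g h _ ag _ ah] x.
- by apply: continuous_comp; [exact: cl|exact: continuous_flat].
- exact: cst_continuous.
- by apply: continuousD; [exact: ag|exact: ah].
- by apply: continuousM; [exact: ag|exact: ah].
Qed.

Lemma flat_algebra_derive (W : normedModType R) (f : W -> R) : flat_algebra f ->
  forall v, (forall x, derivable f x v) /\ flat_algebra ('D_v f).
Proof.
elim => [k l m cl lm|a|g h ag IHg ah IHh|g h ag IHg ah IHh] v.
- have D x := derive_comp_affine (is_derive_flat k) (fun h x => lm h v x) x.
  split; first by move=> x; exact: (D x).1.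
  have -> : 'D_v (fun x => flat k (l x)) =
      (fun x => m v * (flat k.+2 (l x) + - k%:R * flat k.+1 (l x))).
    by apply/funext => x; rewrite mulNr (D x).2.
  apply: flat_algebraM; first exact: flat_algebra_cst.
  apply: flat_algebraD; first exact: (flat_algebra_flat _ cl lm).
  by apply: flat_algebraM; [exact: flat_algebra_cst|exact: (flat_algebra_flat _ cl lm)].
- split; first by move=> x; exact: derivable_cst.
  rewrite (_ : 'D_v _ = fun=> 0); first exact: flat_algebra_cst.
  by apply/funext => x; exact: derive_cst.
- have [dg aDg] := IHg v; have [dh aDh] := IHh v; split.
    by move=> x; exact: derivableD.
  rewrite (_ : 'D_v _ = fun x => 'D_v g x + 'D_v h x); first exact: flat_algebraD.
  by apply/funext => x; exact: deriveD.
- have [dg aDg] := IHg v; have [dh aDh] := IHh v; split.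
    by move=> x; exact: derivableM.
  rewrite (_ : 'D_v _ = fun x => g x * 'D_v h x + h x * 'D_v g x).
    by apply: flat_algebraD; exact: flat_algebraM.
  by apply/funext => x; exact: deriveM.
Qed.

(** The class is stable under directional derivatives, so every iterated derivative stays in it and
    is in particular continuous and differentiable. *)
Lemma flat_algebra_smooth (W : normedModType R) (f : W -> R) : flat_algebra f -> smooth f.
Proof.
move=> fA vs; have A : flat_algebra (iter_derive f vs).
  by elim: vs => [//|v vs IH] /=; exact: (flat_algebra_derive IH v).2.
split; first exact: flat_algebra_continuous.
by move=> v x; exact: (flat_algebra_derive A v).1.
Qed.

End flat_algebra.

Section compact_support.
Context {R : realType} {W : normedModType R}.
Implicit Types (f : W -> R) (K : set W).

Lemma iter_derive_support K f vs : closed K -> (forall x, ~ K x -> f x = 0) ->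
  forall x, ~ K x -> iter_derive f vs x = 0.
Proof.
move=> cK f0; elim: vs => [//|v vs IH] x Kx /=.
have oK : open (~` K) by exact: closed_openC.
have N : \forall y \near x, iter_derive f vs y = cst 0 y.
  have : nbhs x (~` K) by apply: open_nbhs_nbhs; split.
  by apply: filterS => y; exact: IH.
by rewrite (near_eq_derive _ N)// ?derive_cst.
Qed.

Lemma iter_derive_bounded K f vs : compact K -> (forall x, ~ K x -> f x = 0) -> smooth f ->
  exists2 C, 0 <= C & forall x, `|iter_derive f vs x| <= C.
Proof.
move=> kK f0 sf; have cK : closed K by apply: compact_closed => //; exact: norm_hausdorff.
have [cf _] := sf vs.
have : compact (iter_derive f vs @` K).
  by apply: continuous_compact => //; apply: continuous_subspaceT.
move=> /compact_bounded [M [_ MP]].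
exists (`|M| + 1); first by rewrite addr_ge0.
move=> x; have [Kx|Kx] := pselect (K x).
  apply: (MP (`|M| + 1)); first by rewrite (le_lt_trans (ler_norm M))// ltrDl.
  by exists x.
by rewrite (iter_derive_support vs cK f0 Kx) normr0 addr_ge0.
Qed.

End compact_support.

(** * Schwartz functions *)

Section lines.
Context {R : realType} {W : normedModType R}.
Implicit Types (f : W -> R) (v x : W).

Lemma is_derive_line f v x (s : R) : derivable f (s *: v + x) v ->
  is_derive s 1 (fun s => f (s *: v + x)) ('D_v f (s *: v + x)).
Proof.
move=> df.
have E : (fun r => r^-1 *: (f ((r *: 1 + s) *: v + x) - f (s *: v + x))) =
         (fun r => r^-1 *: (f (r *: v + (s *: v + x)) - f (s *: v + x))).
  by apply/funext => r; rewrite scalerDl -addrA /GRing.scale /= mulr1.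
by apply: DeriveDef; [rewrite /derivable E; exact: df|rewrite /derive E].
Qed.

Lemma lipschitz_line f v C : (forall x, derivable f x v) -> (forall x, `|'D_v f x| <= C) ->
  forall x (s : R), `|f (s *: v + x) - f x| <= C * `|s|.
Proof.
move=> df Df.
have P x (s : R) : 0 < s -> `|f (s *: v + x) - f x| <= C * s.
  move=> s0; have D (r : R) := is_derive_line (df (r *: v + x)).
  have cD : {within `[0, s], continuous (fun r : R => f (r *: v + x))}.
    apply: continuous_subspaceT => r; apply/differentiable_continuous/derivable1_diffP.
    by have [] := D r.
  have [r _] := MVT s0 (fun r _ => D r) cD.
  by rewrite scale0r add0r subr0 => ->; rewrite normrM (gtr0_norm s0) ler_wpM2r// ltW.
move=> x s; have [s0|s0|->] := ltgtP s 0.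
- have := P (s *: v + x) (- s); rewrite oppr_gt0 => /(_ s0).
  by rewrite addrA -scalerDl addNr scale0r add0r distrC (ltr0_norm s0).
- by rewrite (gtr0_norm s0); exact: P.
- by rewrite scale0r add0r subrr !normr0 mulr0.
Qed.

End lines.

Section real_continuity.
Context {R : realType} {W : normedModType R}.
Implicit Types l : W -> R.

Lemma continuous_scaleR l k : continuous l -> continuous (fun x => k * l x).
Proof. by move=> cl x; apply: continuousM; [exact: cst_continuous|exact: cl]. Qed.

Lemma continuous_subR l k : continuous l -> continuous (fun x => l x - k).
Proof. by move=> cl x; apply: continuousB; [exact: cl|exact: cst_continuous]. Qed.

Lemma continuous_rsubR l k : continuous l -> continuous (fun x => k - l x).
Proof. by move=> cl x; apply: continuousB; [exact: cst_continuous|exact: cl]. Qed.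

Lemma continuous_addR l l' : continuous l -> continuous l' -> continuous (fun x => l x + l' x).
Proof. by move=> cl cl' x; apply: continuousD; [exact: cl|exact: cl']. Qed.

Lemma continuous_mulR l l' : continuous l -> continuous l' -> continuous (fun x => l x * l' x).
Proof. by move=> cl cl' x; apply: continuousM; [exact: cl|exact: cl']. Qed.

Lemma continuous_sumR I (r : seq I) (F : I -> W -> R) : (forall i, continuous (F i)) ->
  continuous (fun x => \sum_(i <- r) F i x).
Proof.
move=> cF; elim: r => [|i r IH].
  by under eq_fun do rewrite big_nil; exact: cst_continuous.
under eq_fun do rewrite big_cons.
by move=> x; apply: continuousD; [exact: cF|exact: IH].
Qed.

End real_continuity.

Section schwartz_functions.
Context {R : realType} {n : nat}.
Local Notation leb := (lebesgue_rV R n).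
Local Notation V := 'rV[R]_n.
Implicit Types (eta theta : V -> R) (p q : 'I_n -> R).

Lemma iter_derive_rcons (W : normedModType R) (f : W -> R) vs v :
  iter_derive f (rcons vs v) = iter_derive ('D_v f) vs.
Proof. by rewrite /iter_derive foldr_rcons. Qed.

Lemma iter_derive_comb (W : normedModType R) (f g : W -> R) k vs : smooth f -> smooth g ->
  iter_derive (fun x => f x + k * g x) vs = fun x => iter_derive f vs x + k * iter_derive g vs x.
Proof.
move=> sf sg; elim: vs => [//|v vs IH] /=.
rewrite IH; apply/funext => x; have [_ df] := sf vs; have [_ dg] := sg vs.
have dkg : derivable (k \*o iter_derive g vs) x v by exact: (derivableM (derivable_cst _ _ _) (dg v x)).
by rewrite (deriveD (df v x) dkg); congr (_ + _); exact: deriveMl.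
Qed.

Lemma smooth_comb (W : normedModType R) (f g : W -> R) k : smooth f -> smooth g ->
  smooth (fun x => f x + k * g x).
Proof.
move=> sf sg vs; rewrite iter_derive_comb//; have [cf df] := sf vs; have [cg dg] := sg vs.
split=> [x|v x].
  by apply: continuousD; [exact: cf|apply: continuousM; [exact: cst_continuous|exact: cg]].
by apply: derivableD => //; apply: derivableM => //; exact: derivable_cst.
Qed.

Lemma smooth_derive (W : normedModType R) (f : W -> R) v : smooth f -> smooth ('D_v f).
Proof. by move=> sf vs; rewrite -iter_derive_rcons; exact: sf. Qed.

Lemma schwartz_derive eta v : schwartz_real eta -> schwartz_real ('D_v eta).
Proof.
move=> [se de]; split; first exact: smooth_derive.
by move=> k vs; rewrite -iter_derive_rcons; exact: de.
Qed.

Lemma schwartz_comb eta theta k : schwartz_real eta -> schwartz_real theta ->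
  schwartz_real (fun x => eta x + k * theta x).
Proof.
move=> [se de] [st dt]; split; first exact: smooth_comb.
move=> j vs; have [C Ce] := de j vs; have [D Dt] := dt j vs; exists (C + `|k| * D) => x.
rewrite iter_derive_comb//.
have P0 : 0 <= (1 + enorm x) ^+ j by rewrite exprn_ge0// addr_ge0// enorm_ge0.
apply: (@le_trans _ _ ((1 + enorm x) ^+ j * (`|iter_derive eta vs x| + `|k| * `|iter_derive theta vs x|))).
  by rewrite ler_wpM2l// -normrM; exact: ler_normD.
by rewrite mulrDr mulrCA lerD// ler_wpM2l.
Qed.

Lemma schwartz_cst0 : schwartz_real (fun _ : V => 0).
Proof.
have Z vs : iter_derive (fun _ : V => 0 : R) vs = cst 0.
  by elim: vs => [//|v vs /= ->]; apply/funext => x; exact: derive_cst.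
split=> [vs|k vs].
  by rewrite Z; split=> [|v x]; [exact: cst_continuous|exact: derivable_cst].
by exists 0 => x; rewrite Z normr0 mulr0.
Qed.

Lemma schwartz_continuous eta : schwartz_real eta -> continuous eta.
Proof. by move=> [/(_ [::]) []]. Qed.

Lemma measurable_schwartz eta : schwartz_real eta -> measurable_fun setT eta.
Proof. by move=> /schwartz_continuous/continuous_measurable_rV. Qed.

Lemma coord_enorm (x : V) i : `|x ord0 i| <= enorm x.
Proof.
rewrite -(@ler_pXn2r _ 2)// ?nnegrE ?enorm_ge0// sqr_enorm real_normK ?num_real//.
rewrite /dotp (bigD1 i)//= -expr2 lerDl sumr_ge0// => j _.
by rewrite -expr2 sqr_ge0.
Qed.

Lemma weight_enorm (x : V) : 1 <= (1 + enorm x) ^+ (2 * n) * weight x.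
Proof.
rewrite /weight prodfV -ler_pdivrMr ?invr_gt0 ?prodr_gt0//; last first.
  by move=> i _; rewrite ltr_pwDl// sqr_ge0.
have -> : (1 + enorm x) ^+ (2 * n) = \prod_(i < n) (1 + enorm x) ^+ 2.
  by rewrite prodr_const card_ord exprM.
rewrite invrK mul1r; apply: ler_prod => i _.
rewrite addr_ge0 ?sqr_ge0//=; have := coord_enorm x i; have := enorm_ge0 x.
rewrite -(real_normK (num_real (x ord0 i))); move: (enorm x) `|x ord0 i| (normr_ge0 (x ord0 i)) => a b.
by move=> b0 a0 ab; nra.
Qed.

Lemma schwartz_weight eta : schwartz_real eta ->
  exists2 C, 0 <= C & forall x, `|eta x| <= C * weight x.
Proof.
move=> [_ /(_ (2 * n)%N [::]) [C Ce]]; exists `|C| => // x.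
have h := weight_enorm x.
apply: (@le_trans _ _ (((1 + enorm x) ^+ (2 * n) * weight x) * `|eta x|)).
  by rewrite ler_peMl.
by rewrite mulrAC ler_wpM2r ?weight_ge0// (le_trans (Ce x))// ler_norm.
Qed.

(** Peetre's inequality in each coordinate. It keeps the decay of a Schwartz function uniform along
    short segments, which supplies the majorants for difference quotients. *)
Lemma weight_shift (x y : V) : weight (y + x) <= weight x * \prod_i (2 * (1 + y ord0 i ^+ 2)).
Proof.
rewrite /weight -big_split /=; apply: ler_prod => i _.
rewrite invr_ge0 addr_ge0 ?sqr_ge0//= mxE.
have p1 : 0 < 1 + (y ord0 i + x ord0 i) ^+ 2 by rewrite ltr_pwDl// sqr_ge0.
have p2 : 0 < 1 + x ord0 i ^+ 2 by rewrite ltr_pwDl// sqr_ge0.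
rewrite -(ler_pM2l p1) -(ler_pM2r p2) divff ?gt_eqF// mul1r.
rewrite [leRHS](_ : _ = (1 + (y ord0 i + x ord0 i) ^+ 2) * (2 * (1 + y ord0 i ^+ 2))); last by field; rewrite gt_eqF.
have := sqrD_le (y ord0 i + x ord0 i) (- y ord0 i); rewrite sqrrN addrAC subrr add0r.
move: ((_ + _) ^+ 2) (sqr_ge0 (y ord0 i + x ord0 i)) (x ord0 i ^+ 2) (y ord0 i ^+ 2) (sqr_ge0 (y ord0 i)) => a a0 b c c0 h.
by nra.
Qed.

Lemma schwartz_weight_shift eta (v : V) : schwartz_real eta ->
  exists2 C, 0 <= C & forall x (s : R), `|s| <= 1 -> `|eta (s *: v + x)| <= C * weight x.
Proof.
move=> /schwartz_weight[C C0 Ce].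
pose P := \prod_i (2 * (1 + v ord0 i ^+ 2)).
have P0 : 0 <= P by apply: prodr_ge0 => i _; rewrite mulr_ge0// addr_ge0// sqr_ge0.
exists (C * P); first by rewrite mulr_ge0.
move=> x s s1; apply: le_trans (Ce _) _; rewrite -mulrA ler_wpM2l//.
apply: le_trans (weight_shift _ _) _; rewrite mulrC ler_wpM2r ?weight_ge0//.
apply: ler_prod => i _; rewrite mulr_ge0 ?addr_ge0 ?sqr_ge0//= ler_wpM2l// lerD2l mxE exprMn.
by rewrite ler_piMl ?sqr_ge0// -(real_normK (num_real s)) expr_le1.
Qed.

Lemma integrable_schwartz eta : schwartz_real eta -> leb.-integrable setT (EFin \o eta).
Proof.
move=> se; have [C C0 Ce] := schwartz_weight se.
apply: integrable_le (integrable_scaleR C (integrable_weight (R:=R) n)) _ _ => //.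
exact: measurable_schwartz.
Qed.

(* By translation invariance the integral of the difference quotients
   vanishes. *)
Lemma Rintegral_derive_dir_eq0 (h : V -> R) (v : V) (C : R) :
  (forall x, derivable h x v) -> continuous h -> continuous ('D_v h) ->
  (forall x, `|h x| <= C * weight x) ->
  (forall x (s : R), `|s| <= 1 -> `|'D_v h (s *: v + x)| <= C * weight x) ->
  \int[leb]_x 'D_v h x = 0.
Proof.
move=> dh ch cDh hC DhC.
have mh : measurable_fun setT h by exact: continuous_measurable_rV.
have iC := integrable_scaleR C (integrable_weight (R:=R) n).
have ih : leb.-integrable setT (EFin \o h) by exact: integrable_le iC _ hC.
pose t_ (k : nat) : R := k.+1%:R^-1.
have t_gt0 k : 0 < t_ k by rewrite /t_ invr_gt0.
have t_le1 k : t_ k <= 1 by rewrite /t_ invf_le1// ler1n.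
pose f_ k x := (t_ k)^-1 * (h (x + t_ k *: v) - h x).
have D x (s : R) := is_derive_line (dh (s *: v + x)).
have fint k : \int[leb]_x f_ k x = 0.
  rewrite /f_ RintegralZl//; last exact: integrable_subR (integrable_shift _ ih) ih.
  by rewrite RintegralB ?Rintegral_shift ?subrr ?mulr0//; exact: integrable_shift.
have mf k : measurable_fun setT (f_ k).
  apply: measurable_funM => //; apply: measurable_funB => //.
  exact: (measurableT_comp mh (measurable_rV_shift _)).
have t0 : t_ k @[k --> \oo] --> (0 : R)^'.
  have T : t_ k @[k --> \oo] --> (0 : R) by exact: (@cvg_harmonic R).
  move=> A nA; have H : \forall k \near \oo, t_ k != 0 -> A (t_ k) := T _ nA.
  have G : \forall k \near \oo, A (t_ k) by apply: filterS H => k; apply; rewrite gt_eqF.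
  exact: G.
have ae : {ae leb, forall x, f_ k x @[k --> \oo] --> 'D_v h x}.
  apply: nearW => x.
  have d0 : (fun r : R => r^-1 *: (h (r *: v + x) - h x)) @ (0 : R)^' --> 'D_v h x := dh x.
  rewrite (_ : (fun k => f_ k x) = (fun r : R => r^-1 *: (h (r *: v + x) - h x)) \o t_).
    exact: cvg_comp t0 d0.
  by apply/funext => k; rewrite /f_ /= (addrC x).
have bd k x : `|f_ k x| <= C * weight x.
  have cD : {within `[0, t_ k], continuous (fun s : R => h (s *: v + x))}.
    apply: continuous_subspaceT => s; apply/differentiable_continuous/derivable1_diffP.
    by have [] := D x s.
  have [r rI E] := MVT (t_gt0 k) (fun s _ => D x s) cD.
  rewrite /f_ (_ : h (x + t_ k *: v) - h x = 'D_v h (r *: v + x) * t_ k); last first.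
    by rewrite (addrC x); move: E; rewrite subr0 scale0r add0r.
  rewrite mulrCA mulVf ?gt_eqF// mulr1; apply: DhC.
  move: rI; rewrite in_itv /= => /andP[r0 r1]; rewrite ger0_norm ?(ltW r0)//.
  by rewrite (le_trans (ltW r1)).
have [_ L] := Rdominated_cvg mf (continuous_measurable_rV cDh) ae iC bd.
have {}L : (0 : R) @[k --> \oo] --> \int[leb]_x 'D_v h x.
  by apply: cvg_trans L; apply: near_eq_cvg; apply: nearW => k; rewrite fint.
by rewrite -(cvg_lim (@Rhausdorff R) L) lim_cst.
Qed.

Section fourier_decay.
Variable b : R.
Hypothesis b0 : b != 0.
Local Notation ft := (@ft R n b).

(** Integration by parts: the directional derivative of [eta] times the oscillating factor
    integrates to zero. The pair [tr], [dtr] covers cosine and sine together. *)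
Lemma ft_derive (tr dtr : R -> R) eta v xi :
  (forall s : R, is_derive s 1 tr (dtr s)) -> continuous dtr ->
  (forall s, `|tr s| <= 1) -> (forall s, `|dtr s| <= 1) -> schwartz_real eta ->
  ft tr ('D_v eta) xi = - (b * dotp v xi) * ft dtr eta xi.
Proof.
move=> Dtr cdtr tr1 dtr1 se; have sDe := schwartz_derive v se.
have ctr : continuous tr.
  by move=> s; apply/differentiable_continuous/derivable1_diffP; case: (Dtr s).
pose l x := b * dotp x xi.
have cl : continuous (fun x : V => b * dotp x xi).
  apply: continuous_scaleR; apply: (continuous_sumR (F := fun (i : 'I_n) (x : V) => x ord0 i * xi ord0 i)) => i.
  rewrite (_ : (fun x : V => _) = (fun x : V => xi ord0 i * x ord0 i)).
    by apply: continuous_scaleR; exact: coord_continuous.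
  by apply/funext => x; rewrite mulrC.
have lv h x : l (h *: v + x) = h * (b * dotp v xi) + l x.
  by rewrite /l dotpDl dotpZl mulrDr mulrCA.
pose h x := eta x * tr (l x).
have dl x := derive_comp_affine Dtr lv x.
have [[ce de] [cDe _]] := (se.1 [::], se.1 [:: v]).
have Dh x : derivable h x v /\ 'D_v h x = 'D_v eta x * tr (l x) + b * dotp v xi * (eta x * dtr (l x)).
  have [d1 d2] := dl x; split; first exact: derivableM.
  rewrite deriveM// d2 /GRing.scale /=; ring.
have DhE : 'D_v h = fun x => 'D_v eta x * tr (l x) + b * dotp v xi * (eta x * dtr (l x)).
  by apply/funext => x; exact: (Dh x).2.
have ctl : continuous (fun x => tr (l x)).
  by move=> x; apply: continuous_comp; [exact: cl|exact: ctr].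
have cdtl : continuous (fun x => dtr (l x)).
  by move=> x; apply: continuous_comp; [exact: cl|exact: cdtr].
have [C0 C00 eC] := schwartz_weight se.
have [C1 C10 eC1] := schwartz_weight_shift v se.
have [C2 C20 eC2] := schwartz_weight_shift v sDe.
pose K := C0 + (C2 + `|b * dotp v xi| * C1).
have K0 : 0 <= `|b * dotp v xi| * C1 by rewrite mulr_ge0.
have : \int[leb]_x 'D_v h x = 0.
  apply: (@Rintegral_derive_dir_eq0 _ _ K).
  - by move=> x; exact: (Dh x).1.
  - exact: continuous_mulR.
  - rewrite DhE; apply: continuous_addR; first exact: continuous_mulR.
    by apply: continuous_scaleR; exact: continuous_mulR.
  - move=> x; rewrite normrM; apply: (@le_trans _ _ `|eta x|); first by rewrite ler_piMr.
    by apply: le_trans (eC x) _; rewrite ler_wpM2r ?weight_ge0// lerDl addr_ge0.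
  - move=> x s s1; rewrite (Dh _).2; apply: le_trans (ler_normD _ _) _.
    rewrite /K mulrDl mulrDl -[leLHS]add0r; apply: lerD.
      by rewrite mulr_ge0 ?weight_ge0.
    apply: lerD.
      by apply: le_trans (eC2 x s s1); rewrite normrM ler_piMr.
    rewrite [leLHS]normrM -mulrA ler_wpM2l//; apply: le_trans (eC1 x s s1).
    by rewrite normrM ler_piMr.
have i1 := integrable_ft b xi ctr tr1 (integrable_schwartz sDe).
have i2 := integrable_ft b xi cdtr dtr1 (integrable_schwartz se).
rewrite DhE RintegralD//; last exact: integrable_scaleR.
by rewrite RintegralZl// /ft => h0; rewrite mulNr; lra.
Qed.

Lemma ft_cos_derive eta v xi : schwartz_real eta ->
  ft cos ('D_v eta) xi = b * dotp v xi * ft sin eta xi.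
Proof.
move=> se; rewrite (ft_derive (dtr := fun s => - sin s))//.
- rewrite /ft; under eq_Rintegral do rewrite mulrN.
  rewrite RintegralN ?mulrNN//.
  exact: (integrable_ft b xi (@continuous_sin R) sin_norm_le1 (integrable_schwartz se)).
- by move=> s; apply: continuousN; exact: continuous_sin.
- exact: cos_norm_le1.
- by move=> s; rewrite normrN; exact: sin_norm_le1.
Qed.

Lemma ft_sin_derive eta v xi : schwartz_real eta ->
  ft sin ('D_v eta) xi = - (b * dotp v xi * ft cos eta xi).
Proof.
move=> se; rewrite (ft_derive (dtr := cos))//; first by rewrite mulNr.
- exact: continuous_cos.
- exact: sin_norm_le1.
- exact: cos_norm_le1.
Qed.

Let e_ i : V := delta_mx ord0 i.

Let dotp_e i xi : dotp (e_ i) xi = xi ord0 i.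
Proof.
rewrite /dotp (bigD1 i)//= mxE !eqxx mul1r big1 ?addr0// => j ji.
by rewrite mxE (negbTE ji) andbF mul0r.
Qed.

(** The operator 1 - b^(-2) times the second derivative in direction i; on the transform side it
    multiplies by 1 + xi_i^2. *)
Let lap i eta x := eta x + - b ^- 2 * 'D_(e_ i) ('D_(e_ i) eta) x.

Let schwartz_lap i eta : schwartz_real eta -> schwartz_real (lap i eta).
Proof. by move=> se; apply: schwartz_comb => //; do 2 apply: schwartz_derive. Qed.

Let ft_comb tr eta theta k xi : continuous tr -> (forall s, `|tr s| <= 1) ->
  schwartz_real eta -> schwartz_real theta ->
  ft tr (fun x => eta x + k * theta x) xi = ft tr eta xi + k * ft tr theta xi.
Proof.
move=> ct tr1 se st.
have i1 := integrable_ft b xi ct tr1 (integrable_schwartz se).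
have i2 := integrable_ft b xi ct tr1 (integrable_schwartz st).
rewrite /ft -RintegralZl// -RintegralD//; last exact: integrable_scaleR.
by apply: eq_Rintegral => x _; rewrite mulrDl mulrA.
Qed.

Let ft_lap i eta xi : schwartz_real eta ->
  ft cos (lap i eta) xi = (1 + xi ord0 i ^+ 2) * ft cos eta xi /\
  ft sin (lap i eta) xi = (1 + xi ord0 i ^+ 2) * ft sin eta xi.
Proof.
move=> se; have sd := schwartz_derive (e_ i) se; have sdd := schwartz_derive (e_ i) sd.
split; rewrite ft_comb//; [|exact: continuous_cos|exact: cos_norm_le1| |exact: continuous_sin|exact: sin_norm_le1].
- by rewrite ft_cos_derive// ft_sin_derive// dotp_e; field.
- by rewrite ft_sin_derive// ft_cos_derive// dotp_e; field.
Qed.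

(** Applying [lap] in every direction multiplies the transforms by the reciprocal of [weight], while
    the resulting function is again Schwartz and so has transforms bounded by its L^1 norm. *)
Lemma ft_schwartz_bound eta : schwartz_real eta ->
  exists2 C, 0 <= C & forall xi, `|ft cos eta xi| <= C * weight xi /\ `|ft sin eta xi| <= C * weight xi.
Proof.
move=> se; pose H := foldr lap eta (index_enum 'I_n).
have HP : schwartz_real H /\ forall xi,
    ft cos H xi = (\prod_i (1 + xi ord0 i ^+ 2)) * ft cos eta xi /\
    ft sin H xi = (\prod_i (1 + xi ord0 i ^+ 2)) * ft sin eta xi.
  rewrite /H; elim: (index_enum _) => [|i r [sH IH]] /=.
    by split=> // xi; rewrite !big_nil !mul1r.
  split; first exact: schwartz_lap.
  move=> xi; have [-> ->] := ft_lap i xi sH; have [-> ->] := IH xi.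
  by rewrite !big_cons !mulrA.
have [sH HE] := HP.
exists (\int[leb]_x `|H x|) => [|xi]; first by apply: Rintegral_ge0.
have p0 : 0 < \prod_i (1 + xi ord0 i ^+ 2) by apply: prodr_gt0 => i _; rewrite ltr_pwDl// sqr_ge0.
have iH := integrable_schwartz sH.
have [E1 E2] := HE xi; rewrite /weight prodfV; split; rewrite ler_pdivlMr// mulrC -[X in X * _](gtr0_norm p0) -normrM.
- by rewrite -E1; exact: (ft_bound _ _ (@continuous_cos R) cos_norm_le1).
- by rewrite -E2; exact: (ft_bound _ _ (@continuous_sin R) sin_norm_le1).
Qed.

End fourier_decay.

Section bumps.
Implicit Types m : R.

(** The parameter [m] sharpens the edges: for m = 1 this is an ordinary bump, and as m grows it
    tends to the indicator of the open box. *)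
Definition bump m p q (x : V) : R :=
  \prod_i (flat 0 (m * (x ord0 i - p i)) * flat 0 (m * (q i - x ord0 i))).

Lemma bump_algebra m p q : flat_algebra (bump m p q).
Proof.
apply: flat_algebra_prod => i; apply: flat_algebraM.
  apply: (@flat_algebra_flat R V 0 (fun x : V => m * (x ord0 i - p i)) (fun x => m * x ord0 i)).
    by apply: continuous_scaleR; apply: continuous_subR; exact: coord_continuous.
  by move=> h v x; rewrite !mxE; ring.
apply: (@flat_algebra_flat R V 0 (fun x : V => m * (q i - x ord0 i)) (fun x => - m * x ord0 i)).
  by apply: continuous_scaleR; apply: continuous_rsubR; exact: coord_continuous.
by move=> h v x; rewrite !mxE; ring.
Qed.

Lemma bump_ge0 m p q x : 0 <= bump m p q x.
Proof. by apply: prodr_ge0 => i _; rewrite mulr_ge0 ?flat_ge0. Qed.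

Lemma bump_le1 m p q x : bump m p q x <= 1.
Proof.
rewrite [leRHS](_ : 1 = \prod_(i < n) 1); last by rewrite big1.
by apply: ler_prod => i _; rewrite mulr_ge0 ?flat_ge0//= mulr_ile1 ?flat_ge0 ?flat0_le1.
Qed.

Lemma bump_eq0 m p q x : 0 <= m -> ~ box p q x -> bump m p q x = 0.
Proof.
move=> m0 xb; have [i /negP] : exists i, ~ (p i < x ord0 i < q i).
  by apply: contrapT => h; apply: xb => i; apply: contrapT => h'; apply: h; exists i.
rewrite negb_and -!leNgt => h; rewrite /bump (bigD1 i)//=.
case/orP: h => h.
  have -> : flat 0 (m * (x ord0 i - p i)) = 0 by rewrite flat_eq0// mulr_ge0_le0// subr_le0.
  by rewrite !mul0r.
have -> : flat 0 (m * (q i - x ord0 i)) = 0 by rewrite flat_eq0// mulr_ge0_le0// subr_le0.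
by rewrite mulr0 mul0r.
Qed.

Lemma bump_gt0 m p q x : 0 < m -> box p q x -> 0 < bump m p q x.
Proof.
move=> m0 xb; apply: prodr_gt0 => i _; have /andP[h1 h2] := xb i.
by rewrite mulr_gt0// flat_gt0// mulr_gt0// subr_gt0.
Qed.

Lemma bump_cvg p q x : bump m%:R p q x @[m --> \oo] --> (\1_(box p q) x : R).
Proof.
have -> : \1_(box p q) x = \prod_i ((if 0 < x ord0 i - p i then 1 else 0) *
    (if 0 < q i - x ord0 i then 1 else 0)) :> R.
  rewrite indicE; case: (boolP (x \in box p q)) => [/[1!inE] xb|/negP xb].
    rewrite big1// => i _; have /andP[h1 h2] := xb i.
    by rewrite !subr_gt0 h1 h2 mulr1.
  have [i /negP] : exists i, ~ (p i < x ord0 i < q i).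
    apply: contrapT => h; apply: xb; rewrite inE => i; apply: contrapT => h'; apply: h; by exists i.
  rewrite negb_and => h; rewrite (bigD1 i)//= !subr_gt0.
  by case/orP: h => /negbTE ->; rewrite ?mulr0 ?mul0r// !mul0r.
rewrite /bump; apply: cvg_big => [|i _]; first exact: mul_continuous.
by apply: cvgM; exact: flat0_cvg.
Qed.

Definition closed_box p q : set V := [set x | forall i, p i <= x ord0 i <= q i].

Lemma compact_closed_box p q : compact (closed_box p q).
Proof.
have -> : closed_box p q = [set v : V | forall i, `[p i, q i]%classic (v ord0 i)].
  by apply/seteqP; split => x h i; have := h i; rewrite /= in_itv.
by apply: (rV_compact (A := fun i => `[p i, q i]%classic)) => i; exact: segment_compact.
Qed.

Lemma flat_algebra_schwartz eta p q : flat_algebra eta ->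
  (forall x, ~ closed_box p q x -> eta x = 0) -> schwartz_real eta.
Proof.
move=> ae e0; have se := flat_algebra_smooth ae; split=> // k vs.
have kb := @compact_closed_box p q.
have cb : closed (closed_box p q) by apply: compact_closed => //; exact: norm_hausdorff.
have [C C0 Ce] := iter_derive_bounded vs kb e0 se.
pose r := \sum_i (`|p i| + `|q i|).
have r0 : 0 <= r by apply: sumr_ge0 => i _; rewrite addr_ge0.
exists ((1 + Num.sqrt n%:R * r) ^+ k * C) => x.
have [xb|xb] := pselect (closed_box p q x); last first.
  rewrite (iter_derive_support vs cb e0 xb) normr0 mulr0 mulr_ge0// exprn_ge0//.
  by rewrite addr_ge0// mulr_ge0.
apply: ler_pM => //; first by rewrite exprn_ge0// addr_ge0// enorm_ge0.
rewrite lerXn2r ?nnegrE ?addr_ge0 ?enorm_ge0 ?mulr_ge0// lerD2l.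
apply: enorm_cube => // i; rewrite /r (bigD1 i)//=.
apply: (@le_trans _ _ (`|p i| + `|q i|)); last by rewrite lerDl sumr_ge0// => j _; rewrite addr_ge0.
have /andP[h1 h2] := xb i; rewrite ler_norml.
have := ler_norm (q i); have := ler_norm (- p i); rewrite normrN.
have := normr_ge0 (q i); have := normr_ge0 (p i).
move: (x ord0 i) (p i) (q i) `|p i| `|q i| h1 h2 => y pi qi a c h1 h2 h3 h4 h5 h6.
by apply/andP; split; lra.
Qed.

Lemma box_closed_box p q : box p q `<=` closed_box p q.
Proof. by move=> x xb i; have /andP[h1 h2] := xb i; rewrite !ltW. Qed.

Lemma schwartz_bumpM m m' p q p' q' : 0 <= m' ->
  schwartz_real (fun x => bump m p q x * bump m' p' q' x).
Proof.
move=> m0; apply: (@flat_algebra_schwartz _ p' q').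
  by apply: flat_algebraM; exact: bump_algebra.
by move=> x xb; rewrite (@bump_eq0 m') ?mulr0// => /box_closed_box.
Qed.

Lemma schwartz_bump m p q : 0 <= m -> schwartz_real (bump m p q).
Proof.
move=> m0; apply: (@flat_algebra_schwartz _ p q); first exact: bump_algebra.
by move=> x xb; rewrite bump_eq0// => /box_closed_box.
Qed.

End bumps.

End schwartz_functions.

(** * Fourier transform of functions of finite energy *)

Section riesz_kernel.
Context {R : realType} {n : nat}.
Variable alpha : R.
Hypotheses (alpha_gt0 : 0 < alpha) (alpha_ltN : alpha < n%:R).
Local Notation leb := (lebesgue_rV R n).
Local Notation V := 'rV[R]_n.

Let n_gt0 : (0 < n)%N.
Proof. by rewrite -(ltr0n R); exact: lt_trans alpha_gt0 alpha_ltN. Qed.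

(** Since 0 < alpha < n the dimension is positive; in dimension 0 the origin carries mass one. *)
Lemma ae_ne0 : {ae leb, forall x : V, x != 0}.
Proof.
exists (cube (0 : R) : set V); split; first exact: measurable_cube.
  by rewrite lebesgue_cube// mulr0 expr0n (gtn_eqF n_gt0).
move=> x /= /negP; rewrite negbK => /eqP -> i; by rewrite mxE normr0.
Qed.

Lemma geometric_nneseries_lty (C z : R) : 0 <= C -> 0 <= z -> z < 1 ->
  (\sum_(0 <= k <oo) (C * z ^+ k)%:E < +oo)%E.
Proof.
move=> C0 z0 z1; apply: (@le_lt_trans _ _ (C / (1 - z))%:E); last exact: ltry.
apply: lime_le; first by apply: is_cvg_nneseries => k _ _; rewrite lee_fin mulr_ge0 ?exprn_ge0.
apply: nearW => m; rewrite sumEFin lee_fin.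
have z1' : 0 < 1 - z by rewrite subr_gt0.
have := congr1 (fun u : nat -> R => u m) (geometric_seriesE C (negbT (lt_eqF z1))).
rewrite /series /geometric /= => ->.
by rewrite ler_pM2r ?invr_gt0// ler_piMr// lerBlDr lerDl exprn_ge0.
Qed.

(** A majorant of |xi|^(-alpha) on the dyadic shell between 2^(-k-1) and 2^(-k). The integrals form
    a geometric series of ratio 2^alpha / 2^n, and alpha < n makes it converge. *)
Let shell (k : nat) (xi : V) : R := (2 ^+ k.+1) `^ alpha * \1_(cube (2 ^- k) : set V) xi.

Let shell_ge0 k xi : 0 <= shell k xi.
Proof. by rewrite mulr_ge0 ?powR_ge0. Qed.

Let measurable_shell k : measurable_fun setT (shell k).
Proof.
by apply: measurable_funM => //; apply: (measurable_indic (R:=R)); exact: measurable_cube.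
Qed.

Let integral_shell k :
  (\int[leb]_xi (shell k xi)%:E = (2 `^ alpha * 2 ^+ n * (2 `^ alpha / 2 ^+ n) ^+ k)%:E)%E.
Proof.
rewrite /shell integral_scale_ge0 ?powR_ge0//; last first.
  by apply: (measurable_indic (R:=R)); exact: measurable_cube.
rewrite integral_indic//; last exact: measurable_cube.
have k0 : 0 <= 2 ^- k :> R by rewrite invr_ge0 exprn_ge0.
transitivity (((2 ^+ k.+1) `^ alpha)%:E * ((2 * 2 ^- k) ^+ n)%:E)%E.
  by congr (_ * _)%E; rewrite setIT; exact: lebesgue_cube.
rewrite -EFinM; congr _%:E.
rewrite exprS powRM ?exprn_ge0//.
have -> : (2 ^+ k) `^ alpha = (2 `^ alpha) ^+ k :> R.
  elim: (k) => [|j IH]; first by rewrite !expr0 powR1.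
  by rewrite !exprS powRM ?exprn_ge0// IH.
rewrite !exprMn !exprVn -!exprM [(n * k)%N]mulnC; ring.
Qed.

(** Says in effect that a Schwartz function divided by |xi|^alpha lies in L^2 with weight
    |xi|^alpha, so transforms from that space pair with Schwartz functions. *)
Lemma integrable_riesz :
  leb.-integrable setT (EFin \o (fun xi : V => enorm xi `^ (- alpha) * weight xi)).
Proof.
have mr : measurable_fun setT (fun xi : V => enorm xi `^ (- alpha)).
  exact: (measurableT_comp (@measurable_powR R (- alpha)) (measurable_enorm (R:=R) (n:=n))).
apply: integrable_lty_ge0.
- by apply: measurable_funM => //; exact: measurable_weight.
- by move=> xi; rewrite mulr_ge0 ?powR_ge0 ?weight_ge0.
pose S (xi : V) : \bar R := (\sum_(0 <= k <oo) (shell k xi)%:E)%E.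
have S0 xi : (0 <= S xi)%E by apply: nneseries_ge0 => k _ _; rewrite lee_fin.
have mS : measurable_fun setT S.
  apply: ge0_emeasurable_sum => [k x _ _|k _]; first by rewrite lee_fin.
  by apply/measurable_EFinP; exact: measurable_shell.
have Soo : (\int[leb]_xi S xi < +oo)%E.
  rewrite integral_nneseries//; last 2 first.
  - by move=> k; apply/measurable_EFinP; exact: measurable_shell.
  - by move=> k xi _; rewrite lee_fin.
  rewrite (eq_eseriesr (fun k _ => integral_shell k)).
  apply: geometric_nneseries_lty.
  - by rewrite mulr_ge0 ?powR_ge0.
  - by rewrite divr_ge0 ?powR_ge0.
  rewrite ltr_pdivrMr ?exprn_gt0// mul1r -powR_mulrn// /powR pnatr_eq0 /=.
  by rewrite ltr_expR ltr_pM2r// ln_gt0// ltr1n.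
apply: (@le_lt_trans _ _ (\int[leb]_xi ((weight xi)%:E + S xi))%E).
  apply: le_integral_ge0.
  - by apply/measurable_EFinP; apply: measurable_funM => //; exact: measurable_weight.
  - by apply: emeasurable_funD => //; apply/measurable_EFinP; exact: measurable_weight.
  - by move=> xi; rewrite lee_fin mulr_ge0 ?powR_ge0 ?weight_ge0.
  move=> xi; have [->|x0] := eqVneq xi 0.
    by rewrite enorm0 powR0 ?oppr_eq0 ?gt_eqF// mul0r adde_ge0// lee_fin weight_ge0.
  have e0 := enorm_gt0 x0.
  have [x1|x1] := leP 1 (enorm xi).
    apply: (@le_trans _ _ (weight xi)%:E); last by rewrite leeDl.
    rewrite lee_fin ler_piMl ?weight_ge0// powRN invf_le1 ?powR_gt0//.
    by rewrite -[leLHS](powRr0 (enorm xi)) ler_powR// ltW.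
  have ex : exists k, 2 ^- k <= enorm xi.
    exists (Num.bound (enorm xi)^-1).
    rewrite invf_ple ?posrE ?exprn_gt0//.
    apply: le_trans (ltW (archi_boundP (_ : 0 <= (enorm xi)^-1))) _; first by rewrite invr_ge0 ltW.
    by rewrite -natrX ler_nat ltnW// ltn_expl.
  (* The least exponent identifies the shell of [xi]; it is not 0 because |xi| < 1, and by
     minimality [xi] lies in the next larger cube. *)
  case: (ex_minnP ex) => -[|k]; first by rewrite expr0 invr1 leNgt x1.
  move=> kx kmin.
  have xk : cube (2 ^- k) xi.
    move=> i; apply: le_trans (coord_enorm xi i) _; rewrite leNgt; apply/negP => /ltW/kmin.
    by rewrite ltnn.
  apply: (@le_trans _ _ (shell k xi)%:E); last first.
    apply: (@le_trans _ _ (S xi)); last by rewrite leeDr// lee_fin weight_ge0.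
    apply: le_trans (nneseries_lim_ge k.+1 _); last by move=> *; rewrite lee_fin.
    rewrite big_nat_recr//= leeDr//; apply: sume_ge0 => j _; by rewrite lee_fin.
  rewrite lee_fin /shell indicE mem_set// mulr1.
  apply: (@le_trans _ _ (enorm xi `^ (- alpha))).
    by rewrite ler_piMr ?powR_ge0// weight_le1.
  rewrite powRN -powR_inv1 ?powR_ge0// powRAC powR_inv1 ?(ltW e0)//.
  apply: ge0_ler_powR; rewrite ?nnegrE ?(ltW alpha_gt0) ?invr_ge0 ?(ltW e0) ?exprn_ge0//.
  by rewrite invf_ple ?posrE ?exprn_gt0.
rewrite ge0_integralD//; last 2 first.
- by move=> xi _; rewrite lee_fin weight_ge0.
- by apply/measurable_EFinP; exact: measurable_weight.
apply: lte_add_pinfty => //; apply: integral_lty_ge0 => //; first exact: weight_ge0.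
exact: integrable_weight.
Qed.

End riesz_kernel.

(** * Uniqueness of distributional transforms *)

Section transform_uniqueness.
Context {R : realType} {n : nat}.
Local Notation leb := (lebesgue_rV R n).
Local Notation V := 'rV[R]_n.
Implicit Types h : V -> R.

Let big_bump (m : nat) : V -> R := bump 1 (fun=> - m.+1%:R) (fun=> m.+1%:R).

Let schwartz_big_bump m : schwartz_real (big_bump m).
Proof. exact: schwartz_bump. Qed.

Let big_bump_gt0 (x : V) : exists m0, forall m, (m0 <= m)%N -> 0 < big_bump m x.
Proof.
exists (Num.bound (enorm x)) => m mx; apply: bump_gt0 => // i.
rewrite -ltr_norml; apply: le_lt_trans (coord_enorm x i) _.
apply: lt_le_trans (archi_boundP (enorm_ge0 x)) _.
by rewrite ler_nat; exact: leqW.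
Qed.

(** A distributional transform is known only through its products with Schwartz functions.
    Multiplying and dividing by bumps on growing boxes recovers it, the sequence being eventually
    constant at each point. *)
Lemma schwartz_measurable h :
  (forall eta, schwartz_real eta -> measurable_fun setT (fun x => h x * eta x)) ->
  measurable_fun setT h.
Proof.
move=> mh; apply: (measurable_fun_cvg (h := fun m x => h x * big_bump m x / big_bump m x)).
  move=> m; apply: measurable_funM; first exact: mh.
  rewrite (_ : (fun x => _) = fun x => big_bump m x `^ (-1)).
    apply: (measurableT_comp (@measurable_powR R (-1))); exact: measurable_schwartz.
  by apply/funext => x; rewrite powR_inv1// bump_ge0.
move=> x _; have [m0 m0P] := big_bump_gt0 x.
apply: cvg_near_cst; exists m0 => // m /= mm.
by rewrite mulfK// gt_eqF// m0P.
Qed.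

(** The fundamental lemma of the calculus of variations. A fixed bump provides integrability,
    sharpening bumps turn the hypothesis into vanishing integrals over boxes, and letting the fixed
    bump grow covers the space. *)
Lemma schwartz_ae0 h :
  (forall eta, schwartz_real eta -> leb.-integrable setT (EFin \o (fun x => h x * eta x)) /\
     \int[leb]_x (h x * eta x) = 0) ->
  {ae leb, forall x, h x = 0}.
Proof.
move=> hE; have H m : {ae leb, forall x, h x * big_bump m x = 0}.
  have [hi _] := hE _ (schwartz_big_bump m).
  apply: rV_box_ae_eq0 => // p q.
  have iP (k : nat) := hE _ (@schwartz_bumpM R n k%:R 1 p q (fun=> - m.+1%:R) (fun=> m.+1%:R) ler01).
  have mhb : measurable_fun setT (fun x => h x * big_bump m x).
    by apply/measurable_EFinP; exact: measurable_int hi.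
  have mI : measurable_fun setT (fun x : V => h x * big_bump m x * \1_(box p q) x).
    by apply: measurable_funM => //; apply: (measurable_indic (R:=R)); exact: measurable_box.
  have mk k : measurable_fun setT (fun x : V => h x * big_bump m x * bump k%:R p q x).
    by apply: measurable_funM => //; apply: measurable_schwartz; exact: schwartz_bump.
  have cv : {ae leb, forall x, h x * big_bump m x * bump k%:R p q x @[k --> \oo] -->
      h x * big_bump m x * \1_(box p q) x}.
    by apply: nearW => x; apply: cvgMr; exact: bump_cvg.
  have bd (k : nat) x : `|h x * big_bump m x * bump k%:R p q x| <= `|h x * big_bump m x|.
    by rewrite normrM ler_piMr// ger0_norm ?bump_ge0 ?bump_le1.
  have hin : leb.-integrable setT (EFin \o (fun x => `|h x * big_bump m x|)) by exact: integrable_norm hi.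
  have [iI L] := Rdominated_cvg mk mI cv hin bd.
  have I0 : \int[leb]_x (h x * big_bump m x * \1_(box p q) x) = 0.
    rewrite -(cvg_lim (@Rhausdorff R) L); apply/cvg_lim => //.
    apply: cvg_near_cst; apply: nearW => k.
    rewrite -(iP k).2; apply: eq_Rintegral => x _.
    by rewrite /big_bump [bump k%:R _ _ _ * _]mulrC mulrA.
  rewrite integral_mkcond.
  transitivity (\int[leb]_x (h x * big_bump m x * \1_(box p q) x)%:E)%E.
    apply: eq_integral => x _; rewrite /patch indicE.
    by case: ifPn => _; rewrite ?mulr1 ?mulr0.
  by rewrite (Rintegral_EFin iI) I0.
have : {ae leb, forall x, forall m, h x * big_bump m x = 0} by exact: ae_foralln.
apply: filterS => x hx; have [m0 m0P] := big_bump_gt0 x.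
move/eqP: (hx m0); rewrite mulf_eq0 => /orP[/eqP //|].
by rewrite gt_eqF// m0P.
Qed.

End transform_uniqueness.

Section integrable_ae.
Context {d} {X : measurableType d} {R : realType}.
Variable mu : {measure set X -> \bar R}.

Lemma integrable_ae (f g : X -> R) : measurable_fun setT f ->
  {ae mu, forall x, f x = g x} -> mu.-integrable setT (EFin \o g) ->
  mu.-integrable setT (EFin \o f).
Proof.
move=> mf fg /integrableP[_ goo]; apply/integrableP; split; first exact/measurable_EFinP.
rewrite (ae_eq_integral_nomeas (g := fun x => `|(g x)%:E|%E))//.
by apply: filterS fg => x /= ->.
Qed.

Lemma integral_add_ge0 (f g : X -> R) : measurable_fun setT f -> measurable_fun setT g ->
  (forall x, 0 <= f x) -> (forall x, 0 <= g x) ->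
  (\int[mu]_x (f x + g x)%:E = \int[mu]_x (f x)%:E + \int[mu]_x (g x)%:E)%E.
Proof.
move=> mf mg f0 g0; rewrite -ge0_integralD//.
- by move=> x _; rewrite lee_fin.
- exact/measurable_EFinP.
- by move=> x _; rewrite lee_fin.
- exact/measurable_EFinP.
Qed.

Lemma integral_average (f g : X -> R) : measurable_fun setT f -> measurable_fun setT g ->
  (forall x, 0 <= f x) -> (forall x, 0 <= g x) ->
  (\int[mu]_x (g x)%:E = \int[mu]_x (f x)%:E)%E ->
  (\int[mu]_x (2^-1 * f x + 2^-1 * g x)%:E = \int[mu]_x (f x)%:E)%E.
Proof.
move=> mf mg f0 g0 fg; rewrite integral_add_ge0.
- rewrite !integral_scale_ge0// fg -ge0_muleDl ?lee_fin//.
  by rewrite -EFinD (_ : 2^-1 + 2^-1 = 1) ?mul1e//; lra.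
- exact: measurable_funM.
- exact: measurable_funM.
- by move=> x; rewrite mulr_ge0.
- by move=> x; rewrite mulr_ge0.
Qed.

End integrable_ae.

Section slice_transform.
Context {R : realType} {n : nat}.
Variables (alpha c b : R).
Hypotheses (alpha_gt0 : 0 < alpha) (alpha_lt2 : alpha < 2) (alpha_ltN : alpha < n%:R)
  (c_levy : @levy_normalization R n alpha c) (b0 : b != 0).
Local Notation leb := (lebesgue_rV R n).
Local Notation V := 'rV[R]_n.
Local Notation good := (@good R n alpha c).
Local Notation pair := (@pair R n alpha c).
Local Notation dif_int := (@dif_int R n alpha c).
Local Notation ft := (@ft R n b).
Local Notation ftsq := (@ftsq R n b).
Local Notation ecst := (energy_cst (n := n) alpha b).
Implicit Types (f g A B eta : V -> R).

Definition riesz (xi : V) : R := enorm xi `^ alpha.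

Let riesz_ge0 xi : 0 <= riesz xi. Proof. exact: powR_ge0. Qed.

Let mriesz : measurable_fun setT riesz.
Proof.
exact: (measurableT_comp (@measurable_powR R alpha) (measurable_enorm (R:=R) (n:=n))).
Qed.

Let riesz_gt0 xi : xi != 0 -> 0 < riesz xi.
Proof. by move=> x0; rewrite powR_gt0// enorm_gt0. Qed.

(* For tr = cos or sin, A is the cosine or sine transform of f in the sense of
   distributions. *)
Definition transform tr f A := forall eta, schwartz_real eta ->
  [/\ leb.-integrable setT (EFin \o (fun x => f x * ft tr eta x)),
      leb.-integrable setT (EFin \o (fun xi => A xi * eta xi)) &
      \int[leb]_xi (A xi * eta xi) = \int[leb]_x (f x * ft tr eta x)].

(** The multiplication formula: for integrable functions the kernel is symmetric and Fubini's
    theorem moves the transform from one factor to the other. *)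
Lemma ft_duality tr g eta : continuous tr -> (forall s, `|tr s| <= 1) ->
  leb.-integrable setT (EFin \o g) -> leb.-integrable setT (EFin \o eta) ->
  \int[leb]_xi (ft tr g xi * eta xi) = \int[leb]_x (g x * ft tr eta x).
Proof.
move=> ct tr1 gi ei.
pose F (p : V * V) := g p.1 * eta p.2 * tr (b * dotp p.1 p.2).
have Fi : (leb \x leb)%E.-integrable setT (EFin \o F).
  apply: integrable_le (integrable_norm (integrable_prodR gi ei)) _ _.
    apply: measurable_funM; last exact: measurable_tr_bdotp.
    by apply/measurable_EFinP; exact: measurable_int (integrable_prodR gi ei).
  by move=> p; rewrite /F normrM ler_piMr.
transitivity (\int[leb]_x \int[leb]_xi F (x, xi)); last first.
  apply: eq_Rintegral => x _; rewrite /ft -RintegralZl//; last exact: integrable_ft.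
  by apply: eq_Rintegral => xi _; rewrite /F /= dotpC; ring.
rewrite (RfubiniC Fi); apply: eq_Rintegral => xi _.
rewrite /ft -RintegralZr//; last exact: integrable_ft.
by apply: eq_Rintegral => x _; rewrite /F /=; ring.
Qed.

Lemma good_weight_integrable f : good f -> leb.-integrable setT (EFin \o (fun x => f x * weight x)).
Proof.
move=> fG; have [mf fq fE] := fG.
have [C C0 CE] := weighted_bound alpha_gt0 alpha_ltN c_levy.
have i2 : leb.-integrable setT (EFin \o (fun x => f x ^+ 2 * weight x)).
  apply: integrable_lty_ge0.
  - by apply: measurable_funM; [exact: measurable_funX|exact: measurable_weight].
  - by move=> x; rewrite mulr_ge0 ?sqr_ge0 ?weight_ge0.
  apply: le_lt_trans (CE f mf fq) _; by rewrite (dif_int_pair c_levy fG) -EFinM ltry.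
apply: integrable_le (integrable_addR i2 (integrable_weight n)) _ _.
  by apply: measurable_funM => //; exact: measurable_weight.
move=> x; rewrite normrM (ger0_norm (weight_ge0 x)) -[X in _ + X]mul1r -mulrDl.
rewrite ler_wpM2r ?weight_ge0//.
by have := norm_mul_le_sqr (f x) 1; rewrite mulr1 expr1n.
Qed.

Section existence.
Variables (tr : R -> R) (sg : R).
Hypotheses (ctr : continuous tr) (tr1 : forall s, `|tr s| <= 1)
  (trN : forall s, tr (- s) = sg * tr s) (sg2 : sg ^+ 2 = 1)
  (tr_le : forall g xi, ft tr g xi ^+ 2 <= ftsq g xi)
  (tr_schwartz : forall eta, schwartz_real eta ->
     exists2 C, 0 <= C & forall xi, `|ft tr eta xi| <= C * weight xi).

Let ftN g xi : leb.-integrable setT (EFin \o g) -> ft tr g (- xi) = sg * ft tr g xi.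
Proof.
move=> gi; have E x : tr (b * dotp x (- xi)) = sg * tr (b * dotp x xi).
  by rewrite dotpC dotpNl dotpC mulrN trN.
rewrite /ft -RintegralZl//; last exact: integrable_ft.
by apply: eq_Rintegral => x _; rewrite E mulrCA.
Qed.

Variable f : V -> R.
Hypothesis fG : good f.
Let f_ k := trunc k f.
Let fkG k : good (f_ k) := good_trunc alpha_gt0 alpha_ltN c_levy k fG.
Let fi k : leb.-integrable setT (EFin \o f_ k) := integrable_trunc alpha_gt0 alpha_ltN k fG.
Let f2i k : leb.-integrable setT (EFin \o (fun x => f_ k x ^+ 2)) :=
  integrable_trunc_sqr alpha_gt0 alpha_ltN k fG.
Let A_ k := ft tr (f_ k).
Let mA k : measurable_fun setT (A_ k).
Proof. by apply: measurable_ft => //; have [] := fkG k. Qed.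

Let ft_energy_le g : good g -> leb.-integrable setT (EFin \o g) ->
  leb.-integrable setT (EFin \o (fun x => g x ^+ 2)) ->
  (\int[leb]_xi (ft tr g xi ^+ 2 * riesz xi)%:E <= (ecst * pair g g)%:E)%E.
Proof.
move=> gG gi g2i; have [mg _ gE] := gG.
have := energy_fourier alpha_gt0 alpha_lt2 c_levy b0 gi g2i gE.
rewrite (dif_int_pair c_levy gG) -EFinM => <-.
apply: le_integral_ge0.
- apply/measurable_EFinP; apply: measurable_funM => //; apply: measurable_funX; exact: measurable_ft.
- by apply/measurable_EFinP; apply: measurable_funM => //; exact: measurable_ftsq.
- by move=> xi; rewrite lee_fin mulr_ge0 ?sqr_ge0.
by move=> xi; rewrite lee_fin mulrC ler_wpM2l.
Qed.

Lemma ft_trunc_wL2 k : wL2 leb riesz (ft tr (trunc k f)).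
Proof. by split; [exact: mA|apply: le_lt_trans (ft_energy_le (fkG k) (fi k) (f2i k)) _; rewrite ltry]. Qed.

Let AL k : wL2 leb riesz (A_ k) := ft_trunc_wL2 k.

Let A_diff_le m k : (\int[leb]_xi ((A_ m xi - A_ k xi) ^+ 2 * riesz xi)%:E <=
  (ecst * pair (fun x => f_ m x - f_ k x) (fun x => f_ m x - f_ k x))%:E)%E.
Proof.
have i1 := integrable_subR (fi m) (fi k).
have i2 : leb.-integrable setT (EFin \o (fun x => (f_ m x - f_ k x) ^+ 2)).
  apply: integrable_le (integrable_addR (integrable_scaleR 2 (f2i m)) (integrable_scaleR 2 (f2i k))) _ _.
    apply: measurable_funX; apply: measurable_funB; [by have [] := fkG m|by have [] := fkG k].
  by move=> x; rewrite ger0_norm ?sqr_ge0//; have := sqrD_le (f_ m x) (- f_ k x); rewrite sqrrN.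
apply: le_trans (ft_energy_le (goodB alpha_gt0 alpha_ltN c_levy (fkG m) (fkG k)) i1 i2).
rewrite le_eqVlt; apply/orP; left; apply/eqP; apply: eq_integral => xi _.
by rewrite ftB.
Qed.

Let energy_cst_gt0' : 0 < ecst. Proof. exact: energy_cst_gt0. Qed.

Let cauchy e : 0 < e -> exists n0 : nat, forall m k, (n0 <= m)%N -> (n0 <= k)%N ->
  (\int[leb]_xi ((A_ m xi - A_ k xi) ^+ 2 * riesz xi)%:E <= e%:E)%E.
Proof.
move=> e0; have e1 : 0 < e / (4 * ecst) by rewrite divr_gt0// mulr_gt0.
have /cvgrPdist_lt/(_ _ e1)[n0 _ n0P] := pair_trunc_diff_cvg alpha_gt0 alpha_ltN c_levy fG.
exists n0 => m k n0m n0k; apply: le_trans (A_diff_le m k) _; rewrite lee_fin mulrC.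
have := pair_trunc_diff_le alpha_gt0 alpha_ltN c_levy m k fG.
have := n0P _ n0m; have := n0P _ n0k; rewrite /= !sub0r !normrN.
move=> /(le_lt_trans (ler_norm _)) h1 /(le_lt_trans (ler_norm _)) h2 h3.
rewrite -ler_pdivlMr//; apply: le_trans h3 _.
have -> : e / ecst = 4 * (e / (4 * ecst)).
  by field; rewrite gt_eqF.
by move: h1 h2; set u := wip _ _ _ _; set v := wip _ _ _ _; set w := e / _; lra.
Qed.

(** The transforms of the thresholds are Cauchy in L^2 with weight |xi|^alpha, and their limit is
    identified as the distributional transform. The sign [sg] is the parity of [tr], and parity is
    obtained at every point. *)
Lemma transform_exists : exists A, [/\ measurable_fun setT A,
  forall xi, A (- xi) = sg * A xi, wL2 leb riesz A,
  wip leb riesz (fun xi => A_ k xi - A xi) (fun xi => A_ k xi - A xi) @[k --> \oo] --> 0 &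
  transform tr f A].
Proof.
have [s [v [mv _ _ vP]]] := L2_complete mriesz riesz_ge0 mA cauchy.
(* The limit [v] has the right parity only almost everywhere; symmetrising it restores parity at
   every point and does not increase the distance to the already symmetric [A_ k]. *)
pose A (xi : V) := 2^-1 * (v xi + sg * v (- xi)).
have mvN : measurable_fun setT (fun xi : V => v (- xi)).
  exact: (measurableT_comp mv (measurable_rV_opp (R:=R) (n:=n))).
have sg1 : sg * sg = 1 by rewrite -expr2.
have mA' : measurable_fun setT A.
  by apply: measurable_funM => //; apply: measurable_funD => //; exact: measurable_funM.
have AN xi : A (- xi) = sg * A xi.
  by rewrite /A opprK mulrCA; congr (_ * _); rewrite mulrDr mulrA sg1 mul1r addrC.
have rieszN xi : riesz (- xi) = riesz xi.
  by rewrite /riesz /enorm dotpNl dotpC dotpNl opprK.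
have AP e : 0 < e -> exists n0 : nat, forall k, (n0 <= k)%N ->
    (\int[leb]_xi ((A_ k xi - A xi) ^+ 2 * riesz xi)%:E <= e%:E)%E.
  move=> e0; have [n0 n0P] := vP e e0; exists n0 => k n0k.
  pose D (xi : V) := (A_ k xi - v xi) ^+ 2 * riesz xi.
  have mD : measurable_fun setT D.
    by apply: measurable_funM => //; apply: measurable_funX; exact: measurable_funB.
  have D0 xi : 0 <= D xi by rewrite mulr_ge0 ?sqr_ge0.
  have DN : (\int[leb]_xi (D (- xi))%:E = \int[leb]_xi (D xi)%:E)%E.
    by rewrite (@integral_rV_opp _ _ (fun xi => (D xi)%:E))//; exact/measurable_EFinP.
  have mDN : measurable_fun setT (fun xi : V => D (- xi)).
    exact: (measurableT_comp mD (measurable_rV_opp (R:=R) (n:=n))).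
  have m1 : measurable_fun setT (fun xi : V => 2^-1 * D xi).
    exact: (measurable_funM (measurable_cst (2^-1 : R)) mD).
  have m2 : measurable_fun setT (fun xi : V => 2^-1 * D (- xi)).
    exact: (measurable_funM (measurable_cst (2^-1 : R)) mDN).
  have E := integral_average mD mDN D0 (fun xi => D0 (- xi)) DN.
  apply: (@le_trans _ _ (\int[leb]_xi (2^-1 * D xi + 2^-1 * D (- xi))%:E)%E).
    apply: le_integral_ge0.
    - apply/measurable_EFinP.
      exact: (measurable_funM (measurable_funX 2 (measurable_funB (mA k) mA')) mriesz).
    - by apply/measurable_EFinP; exact: (measurable_funD m1 m2).
    - by move=> xi; rewrite lee_fin; apply: mulr_ge0; [exact: sqr_ge0|exact: riesz_ge0].
    move=> xi; have AkN : A_ k (- xi) = sg * A_ k xi by exact: ftN.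
    rewrite lee_fin /D rieszN AkN.
    rewrite [leRHS](_ : _ = 2^-1 * ((A_ k xi - v xi) ^+ 2 + (sg * A_ k xi - v (- xi)) ^+ 2) * riesz xi); last by ring.
    apply: ler_wpM2r; first exact: riesz_ge0.
    rewrite /A; move: (A_ k xi) (v xi) (v (- xi)) => a x y.
    have -> : (sg * a - y) ^+ 2 = (a - sg * y) ^+ 2.
      by rewrite -[LHS]mul1r -sg2 -exprMn mulrBr mulrA sg1 mul1r.
    have := sqrD_le (a - x) (a - sg * y).
    rewrite (_ : a - 2^-1 * (x + sg * y) = 2^-1 * ((a - x) + (a - sg * y))); last by field.
    by rewrite exprMn; lra.
  by rewrite E; exact: n0P.
have AL' : wL2 leb riesz A.
  have [n0 n0P] := AP 1 ltr01.
  have dL : wL2 leb riesz (fun xi => A_ n0 xi - A xi).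
    split; first exact: measurable_funB.
    by apply: le_lt_trans (n0P n0 (leqnn _)) _; rewrite ltry.
  have := wL2B mriesz riesz_ge0 (AL n0) dL.
  by rewrite (_ : (fun xi => _) = A)//; apply/funext => xi; rewrite opprB addrC subrK.
have dL k : wL2 leb riesz (fun xi => A_ k xi - A xi) by exact: wL2B.
have d0 : wip leb riesz (fun xi => A_ k xi - A xi) (fun xi => A_ k xi - A xi) @[k --> \oo] --> 0.
  apply/cvgrPdist_le => e e0; have [n0 n0P] := AP e e0; exists n0 => // k /= n0k.
  rewrite sub0r normrN ger0_norm ?wip_ge0// -lee_fin -wipE//.
  exact: n0P.
exists A; split => // eta se.
have [C C0 CE] := tr_schwartz se.
have [mf _ _] := fG.
have meta := measurable_schwartz se.
have ieta := integrable_schwartz se.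
have iD : leb.-integrable setT (EFin \o (fun x => C * `|f x * weight x|)).
  have iN : leb.-integrable setT (EFin \o (fun x => `|f x * weight x|)).
    exact: (integrable_norm (good_weight_integrable fG)).
  exact: (integrable_scaleR C iN).
have bd k x : `|f_ k x * ft tr eta x| <= C * `|f x * weight x|.
  rewrite !normrM (ger0_norm (weight_ge0 x)) mulrCA; apply: ler_pM => //; exact: trunc_norm_le.
have mft : measurable_fun setT (ft tr eta) by exact: measurable_ft.
have cvf : {ae leb, forall x, f_ k x * ft tr eta x @[k --> \oo] --> f x * ft tr eta x}.
  by apply: nearW => x; apply: cvgMl; exact: trunc_cvg.
have [i1 L1] := Rdominated_cvg (fun k => measurable_funM (measurable_trunc k mf) mft)
  (measurable_funM mf mft) cvf iD bd.
(* Dividing the test function by |xi|^alpha turns the unweighted pairing with [eta] into a weighted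
   inner product, in which convergence is known. *)
pose th xi := eta xi * enorm xi `^ (- alpha).
have men : measurable_fun setT (fun xi : V => enorm xi `^ (- alpha)).
  exact: (measurableT_comp (@measurable_powR R (- alpha)) (measurable_enorm (R:=R) (n:=n))).
have mth : measurable_fun setT th by exact: measurable_funM.
have riesz_inv xi : xi != 0 -> enorm xi `^ (- alpha) * riesz xi = 1.
  by move=> x0; rewrite powRN mulVf// gt_eqF// riesz_gt0.
have thL : wL2 leb riesz th.
  split => //; have [D D0 DE] := schwartz_weight se.
  apply: integral_lty_ge0; first by move=> xi; rewrite mulr_ge0 ?sqr_ge0.
  apply: integrable_le (integrable_scaleR (D ^+ 2) (integrable_riesz alpha_gt0 alpha_ltN)) _ _.
    by apply: measurable_funM => //; exact: measurable_funX.
  move=> xi; rewrite ger0_norm; last by apply: mulr_ge0; [exact: sqr_ge0|exact: riesz_ge0].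
  have [->|x0] := eqVneq xi 0.
    by rewrite /riesz enorm0 powR0 ?gt_eqF// mulr0 mulr_ge0 ?sqr_ge0// mulr_ge0 ?powR_ge0 ?weight_ge0.
  have -> : th xi ^+ 2 * riesz xi = eta xi ^+ 2 * enorm xi `^ (- alpha) * (enorm xi `^ (- alpha) * riesz xi).
    by rewrite /th; ring.
  rewrite (riesz_inv xi x0) mulr1 [leRHS](_ : _ = D ^+ 2 * weight xi * enorm xi `^ (- alpha)); last by ring.
  apply: ler_wpM2r; first exact: powR_ge0.
  rewrite -(real_normK (num_real (eta xi))); apply: (@le_trans _ _ ((D * weight xi) ^+ 2)).
    by rewrite lerXn2r ?nnegrE ?mulr_ge0 ?weight_ge0.
  by rewrite exprMn ler_wpM2l ?sqr_ge0// expr2 ler_piMr ?weight_ge0 ?weight_le1.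
have aeE h : {ae leb, forall xi, h xi * eta xi = h xi * th xi * riesz xi}.
  apply: filterS (ae_ne0 alpha_gt0 alpha_ltN) => xi x0.
  by rewrite /th -!mulrA riesz_inv// mulr1.
have i2 : leb.-integrable setT (EFin \o (fun xi => A xi * eta xi)).
  exact: integrable_ae (measurable_funM mA' meta) (aeE A) (wip_integrable mriesz riesz_ge0 AL' thL).
split => //.
have L2 : \int[leb]_xi (A_ k xi * eta xi) @[k --> \oo] --> \int[leb]_xi (A xi * eta xi).
  rewrite (Rintegral_ae_eq (aeE A)) -/(wip leb riesz A th).
  have W : wip leb riesz (A_ k) th @[k --> \oo] --> wip leb riesz A th.
    have W0 := wip_cvg0 mriesz riesz_ge0 dL thL d0.
    have W1 : wip leb riesz (fun xi => A_ k xi - A xi) th + wip leb riesz A th @[k --> \oo] --> 0 + wip leb riesz A th.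
      by apply: cvgD => //; exact: cvg_cst.
    rewrite add0r in W1; apply: cvg_trans W1; apply: near_eq_cvg; apply: nearW => k.
    by rewrite (wipBl mriesz riesz_ge0 (AL k) AL' thL) subrK.
  apply: cvg_trans W; apply: near_eq_cvg; apply: nearW => k.
  by rewrite (Rintegral_ae_eq (aeE (A_ k))).
apply: (cvg_unique (@Rhausdorff R) L2).
apply: cvg_trans L1; apply: near_eq_cvg; apply: nearW => k.
by rewrite (ft_duality ctr tr1 (fi k) ieta).
Qed.

End existence.

End slice_transform.

Section weighted_L2_polarization.
Context {d} {X : measurableType d} {R : realType}.
Variables (mu : {measure set X -> \bar R}) (w : X -> R).
Hypotheses (mw : measurable_fun setT w) (w0 : forall x, 0 <= w x).
Implicit Types u v : X -> R.

Lemma wip_polar u v : wL2 mu w u -> wL2 mu w v ->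
  4 * wip mu w u v = wip mu w (fun x => u x + v x) (fun x => u x + v x) -
                     wip mu w (fun x => u x - v x) (fun x => u x - v x).
Proof.
move=> uL vL; have aL := wL2D mw w0 uL vL; have sL := wL2B mw w0 uL vL.
rewrite (wipDl mw w0 uL vL aL) (wipBl mw w0 uL vL sL).
rewrite ![wip mu w _ (fun x => _ + _)]wipC !(wipDl mw w0 uL vL)// !(wipBl mw w0 uL vL)//.
by rewrite (wipC _ _ v u); ring.
Qed.

Lemma Rintegral_scaleD k u v : mu.-integrable setT (EFin \o u) ->
  mu.-integrable setT (EFin \o v) ->
  \int[mu]_x (k * (u x + v x)) = k * (\int[mu]_x u x + \int[mu]_x v x).
Proof.
move=> ui vi; rewrite RintegralZl//; last exact: integrable_addR.
by rewrite RintegralD.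
Qed.

Lemma Rintegral_scaleB k u v : mu.-integrable setT (EFin \o u) ->
  mu.-integrable setT (EFin \o v) ->
  \int[mu]_x (k * (u x - v x)) = k * (\int[mu]_x u x - \int[mu]_x v x).
Proof.
move=> ui vi; rewrite RintegralZl//; last exact: integrable_subR.
by rewrite RintegralB.
Qed.

Lemma wL2_ae u v : measurable_fun setT u -> {ae mu, forall x, u x = v x} -> wL2 mu w v ->
  wL2 mu w u /\ wip mu w u u = wip mu w v v.
Proof.
move=> mu_ uv [mv voo]; split.
  split=> //; rewrite (ae_eq_integral_nomeas (g := fun x => (v x ^+ 2 * w x)%:E))//.
  by apply: filterS uv => x /= ->.
by apply: Rintegral_ae_eq; apply: filterS uv => x /= ->.
Qed.

End weighted_L2_polarization.

Section slice_theorem.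
Context {R : realType} {n : nat}.
Variables (alpha c a b : R).
Hypotheses (alpha_gt0 : 0 < alpha) (alpha_lt2 : alpha < 2) (alpha_ltN : alpha < n%:R)
  (c_levy : @levy_normalization R n alpha c) (a_gt0 : 0 < a) (b0 : b != 0).
Local Notation leb := (lebesgue_rV R n).
Local Notation V := 'rV[R]_n.
Local Notation good := (@good R n alpha c).
Local Notation pair := (@pair R n alpha c).
Local Notation ft := (@ft R n b).
Local Notation ecst := (energy_cst (n := n) alpha b).
Local Notation riesz := (@riesz R n alpha).
Local Notation transform := (@transform R n b).
Implicit Types (f g A B : V -> R).

Let riesz_ge0 xi : 0 <= riesz xi. Proof. exact: powR_ge0. Qed.

Let mriesz : measurable_fun setT riesz.
Proof.
exact: (measurableT_comp (@measurable_powR R alpha) (measurable_enorm (R:=R) (n:=n))).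
Qed.

Let csin := @continuous_sin R.
Let ccos := @continuous_cos R.

Let good_energy_fourier g : good g -> leb.-integrable setT (EFin \o g) ->
  leb.-integrable setT (EFin \o (fun x => g x ^+ 2)) ->
  wL2 leb riesz (ft cos g) -> wL2 leb riesz (ft sin g) ->
  wip leb riesz (ft cos g) (ft cos g) + wip leb riesz (ft sin g) (ft sin g) = ecst * pair g g.
Proof.
move=> gG gi g2i cL sL; have [mg _ gE] := gG.
have := energy_fourier alpha_gt0 alpha_lt2 c_levy b0 gi g2i gE.
rewrite (dif_int_pair c_levy gG) -EFinM => /(congr1 fine) /= <-.
rewrite -/(Rintegral leb setT (fun xi => enorm xi `^ alpha * ftsq b g xi)).
rewrite /wip -RintegralD//; [|exact: (wip_integrable mriesz)..].
by apply: eq_Rintegral => xi _; rewrite /ftsq /riesz; ring.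
Qed.

Lemma transform_good f : good f -> exists A B,
  [/\ forall xi, A (- xi) = A xi, forall xi, B (- xi) = - B xi,
      wL2 leb riesz A /\ wL2 leb riesz B,
      transform cos f A /\ transform sin f B &
      wip leb riesz A A + wip leb riesz B B = ecst * pair f f].
Proof.
move=> fG.
have cN (s : R) : cos (- s) = 1 * cos s by rewrite cosN mul1r.
have sN (s : R) : sin (- s) = -1 * sin s by rewrite sinN mulN1r.
have one2 : (1 : R) ^+ 2 = 1 by rewrite expr1n.
have m12 : (-1 : R) ^+ 2 = 1 by rewrite sqrrN expr1n.
have cle (g : V -> R) xi : ft cos g xi ^+ 2 <= ftsq b g xi by rewrite lerDl sqr_ge0.
have sle (g : V -> R) xi : ft sin g xi ^+ 2 <= ftsq b g xi by rewrite lerDr sqr_ge0.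
have cS eta : schwartz_real eta -> exists2 C, 0 <= C & forall xi, `|ft cos eta xi| <= C * weight xi.
  by move=> /(ft_schwartz_bound b0)[C C0 CE]; exists C => // xi; have [] := CE xi.
have sS eta : schwartz_real eta -> exists2 C, 0 <= C & forall xi, `|ft sin eta xi| <= C * weight xi.
  by move=> /(ft_schwartz_bound b0)[C C0 CE]; exists C => // xi; have [] := CE xi.
have [A [mA AN AL Ad AT]] := transform_exists alpha_gt0 alpha_lt2 alpha_ltN c_levy b0
  ccos cos_norm_le1 cN one2 cle cS fG.
have [B [mB BN BL Bd BT]] := transform_exists alpha_gt0 alpha_lt2 alpha_ltN c_levy b0
  csin sin_norm_le1 sN m12 sle sS fG.
have AkL := ft_trunc_wL2 alpha_gt0 alpha_lt2 alpha_ltN c_levy b0 ccos cle fG.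
have BkL := ft_trunc_wL2 alpha_gt0 alpha_lt2 alpha_ltN c_levy b0 csin sle fG.
exists A, B; split => //.
- by move=> xi; rewrite AN mul1r.
- by move=> xi; rewrite BN mulN1r.
have cA := wip_sqr_cvg mriesz riesz_ge0 AkL AL Ad.
have cB := wip_sqr_cvg mriesz riesz_ge0 BkL BL Bd.
have cP : ecst * pair (trunc k f) (trunc k f) @[k --> \oo] --> ecst * pair f f.
  by apply: cvgMr; exact: pair_trunc_cvg.
have cAB : wip leb riesz (ft cos (trunc k f)) (ft cos (trunc k f)) +
    wip leb riesz (ft sin (trunc k f)) (ft sin (trunc k f)) @[k --> \oo] -->
    wip leb riesz A A + wip leb riesz B B by exact: (cvgD cA cB).
apply: (cvg_unique (@Rhausdorff R) cAB).
apply: cvg_trans cP; apply: near_eq_cvg; apply: nearW => k /=.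
rewrite good_energy_fourier//.
- exact: good_trunc.
- exact: (integrable_trunc alpha_gt0 alpha_ltN k fG).
- exact: (integrable_trunc_sqr alpha_gt0 alpha_ltN k fG).
Qed.

Lemma transform_measurable tr f A : transform tr f A -> measurable_fun setT A.
Proof.
move=> fA; apply: schwartz_measurable => eta /fA[_ i _].
by apply/measurable_EFinP; exact: measurable_int i.
Qed.

Lemma transform_unique tr f A B : transform tr f A -> transform tr f B ->
  {ae leb, forall xi, A xi = B xi}.
Proof.
move=> fA fB.
suff : {ae leb, forall xi, A xi - B xi = 0} by apply: filterS => xi /eqP; rewrite subr_eq0 => /eqP.
apply: schwartz_ae0 => eta se; have [_ iA EA] := fA _ se; have [_ iB EB] := fB _ se.
rewrite (_ : (fun x => _) = (fun x => A x * eta x - B x * eta x)).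
  by split; [exact: integrable_subR|rewrite RintegralB// EA EB subrr].
by apply/funext => x; rewrite mulrBl.
Qed.

Lemma transformD tr f g A B : transform tr f A -> transform tr g B ->
  transform tr (fun x => f x + g x) (fun x => A x + B x).
Proof.
move=> fA gB eta se; have [if_ iA EA] := fA _ se; have [ig iB EB] := gB _ se.
have E (u v w : V -> R) : (fun x => (u x + v x) * w x) = (fun x => u x * w x + v x * w x).
  by apply/funext => x; rewrite mulrDl.
rewrite !E; split; [exact: integrable_addR|exact: integrable_addR|].
by rewrite !RintegralD// EA EB.
Qed.

Lemma transformB tr f g A B : transform tr f A -> transform tr g B ->
  transform tr (fun x => f x - g x) (fun x => A x - B x).
Proof.
move=> fA gB eta se; have [if_ iA EA] := fA _ se; have [ig iB EB] := gB _ se.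
have E (u v w : V -> R) : (fun x => (u x - v x) * w x) = (fun x => u x * w x - v x * w x).
  by apply/funext => x; rewrite mulrBl.
rewrite !E; split; [exact: integrable_subR|exact: integrable_subR|].
by rewrite !RintegralB// EA EB.
Qed.

Lemma transform_norm f A B : good f -> transform cos f A -> transform sin f B ->
  [/\ wL2 leb riesz A, wL2 leb riesz B &
      wip leb riesz A A + wip leb riesz B B = ecst * pair f f].
Proof.
move=> fG fA fB; have [A' [B' [_ _ [AL BL] [fA' fB'] <-]]] := transform_good fG.
have [AL' ->] := wL2_ae (transform_measurable fA) (transform_unique fA fA') AL.
by have [BL' ->] := wL2_ae (transform_measurable fB) (transform_unique fB fB') BL.
Qed.

(** Polarisation of the norm identity. It applies to any transforms of [f] and [g], since sums and
    differences of transforms are transforms of the sums and differences. *)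
Lemma transform_pair f g A B A' B' : good f -> good g ->
  transform cos f A -> transform sin f B -> transform cos g A' -> transform sin g B' ->
  wip leb riesz A A' + wip leb riesz B B' = ecst * pair f g.
Proof.
move=> fG gG fA fB gA gB.
have [AL BL _] := transform_norm fG fA fB; have [AL' BL' _] := transform_norm gG gA gB.
have four : (4 : R) != 0 by [].
apply: (mulfI four); rewrite mulrDr !wip_polar// mulrCA.
rewrite (pair_polar alpha_gt0 alpha_ltN c_levy fG gG).
have [_ _ E1] := transform_norm (goodD alpha_gt0 alpha_ltN c_levy fG gG) (transformD fA gA) (transformD fB gB).
have [_ _ E2] := transform_norm (goodB alpha_gt0 alpha_ltN c_levy fG gG) (transformB fA gA) (transformB fB gB).
by rewrite mulrBr -E1 -E2; ring.
Qed.

Let ReM (x y : R[i]) : complex.Re (x * y) = complex.Re x * complex.Re y - complex.Im x * complex.Im y.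
Proof. by case: x y => x1 x2 [y1 y2]. Qed.

Let ImM (x y : R[i]) : complex.Im (x * y) = complex.Re x * complex.Im y + complex.Im x * complex.Re y.
Proof. by case: x y => x1 x2 [y1 y2]. Qed.

Let schwartz_ft tr (eta : V -> R) xi : continuous tr -> (forall s, `|tr s| <= 1) -> schwartz_real eta ->
  leb.-integrable setT (EFin \o (fun x => eta x * tr (b * dotp x xi))).
Proof. by move=> ct tr1 se; apply: integrable_ft => //; exact: integrable_schwartz. Qed.

Lemma fourier_schwartzE eta xi : schwartz eta ->
  fourier_schwartz a b eta xi = Complex
    (a * (ft cos (fun x => complex.Re (eta x)) xi + ft sin (fun x => complex.Im (eta x)) xi))
    (a * (ft cos (fun x => complex.Im (eta x)) xi - ft sin (fun x => complex.Re (eta x)) xi)).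
Proof.
move=> [se1 se2]; rewrite /fourier_schwartz /cintegral.
have -> : \int[leb]_x complex.Re (eta x * cexpi (- (b * dotp x xi))) =
    ft cos (fun x => complex.Re (eta x)) xi + ft sin (fun x => complex.Im (eta x)) xi.
  rewrite /ft -RintegralD//; [|exact: schwartz_ft ccos cos_norm_le1 _|exact: schwartz_ft csin sin_norm_le1 _].
  by apply: eq_Rintegral => x _; rewrite ReM /= cosN sinN; ring.
have -> : \int[leb]_x complex.Im (eta x * cexpi (- (b * dotp x xi))) =
    ft cos (fun x => complex.Im (eta x)) xi - ft sin (fun x => complex.Re (eta x)) xi.
  rewrite /ft -RintegralB//; [|exact: schwartz_ft ccos cos_norm_le1 _|exact: schwartz_ft csin sin_norm_le1 _].
  by apply: eq_Rintegral => x _; rewrite ImM /= cosN sinN; ring.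
by apply/eqP; rewrite eq_complex ReM ImM /= !mul0r subr0 addr0 !eqxx.
Qed.

Lemma transform_is_fourier f A B : transform cos f A -> transform sin f B ->
  is_fourier a b f (fun xi => Complex (a * A xi) (- (a * B xi))).
Proof.
move=> fA fB eta [se1 se2].
have [i1 j1 E1] := fA _ se1; have [i2 j2 E2] := fA _ se2.
have [i3 j3 E3] := fB _ se1; have [i4 j4 E4] := fB _ se2.
pose e1 x := complex.Re (eta x); pose e2 x := complex.Im (eta x).
have L1 : (fun x => complex.Re ((f x)%:C%C * fourier_schwartz a b eta x)) =
    (fun x => a * (f x * ft cos e1 x + f x * ft sin e2 x)).
  by apply/funext => x; rewrite fourier_schwartzE// ReM /=; ring.
have L2 : (fun x => complex.Im ((f x)%:C%C * fourier_schwartz a b eta x)) =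
    (fun x => a * (f x * ft cos e2 x - f x * ft sin e1 x)).
  by apply/funext => x; rewrite fourier_schwartzE// ImM /=; ring.
have M1 : (fun x => complex.Re (Complex (a * A x) (- (a * B x)) * eta x)) =
    (fun x => a * (A x * e1 x + B x * e2 x)).
  by apply/funext => x; rewrite ReM /= /e1 /e2; ring.
have M2 : (fun x => complex.Im (Complex (a * A x) (- (a * B x)) * eta x)) =
    (fun x => a * (A x * e2 x - B x * e1 x)).
  by apply/funext => x; rewrite ImM /= /e1 /e2; ring.
have I1 := integrable_addR i1 i4; have I2 := integrable_subR i2 i3.
have J1 := integrable_addR j1 j4; have J2 := integrable_subR j2 j3.
split.
- by split; [rewrite L1; exact: (integrable_scaleR a I1)|rewrite L2; exact: (integrable_scaleR a I2)].
- by split; [rewrite M1; exact: (integrable_scaleR a J1)|rewrite M2; exact: (integrable_scaleR a J2)].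
rewrite /cintegral L1 L2 M1 M2; congr Complex.
- by rewrite (Rintegral_scaleD a j1 j4) (Rintegral_scaleD a i1 i4) E1 E4.
- by rewrite (Rintegral_scaleB a j2 j3) (Rintegral_scaleB a i2 i3) E2 E3.
Qed.

Let schwartzC (eta : V -> R) : schwartz_real eta -> schwartz (fun x => (eta x)%:C%C).
Proof. by move=> se; split => //; exact: schwartz_cst0. Qed.

Let is_fourier_real f F (eta : V -> R) : is_fourier a b f F -> schwartz_real eta ->
  [/\ leb.-integrable setT (EFin \o (fun xi => complex.Re (F xi) * eta xi)),
      leb.-integrable setT (EFin \o (fun xi => complex.Im (F xi) * eta xi)),
      \int[leb]_xi (complex.Re (F xi) * eta xi) =
        complex.Re (cintegral leb setT (fun x => (f x)%:C%C * fourier_schwartz a b (fun x => (eta x)%:C%C) x)) &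
      \int[leb]_xi (complex.Im (F xi) * eta xi) =
        complex.Im (cintegral leb setT (fun x => (f x)%:C%C * fourier_schwartz a b (fun x => (eta x)%:C%C) x))].
Proof.
move=> fF se; have [_ [i1 i2] <-] := fF _ (schwartzC se).
have E1 : (fun xi => complex.Re (F xi * (eta xi)%:C%C)) = (fun xi => complex.Re (F xi) * eta xi).
  by apply/funext => xi; rewrite ReM /= mulr0 subr0.
have E2 : (fun xi => complex.Im (F xi * (eta xi)%:C%C)) = (fun xi => complex.Im (F xi) * eta xi).
  by apply/funext => xi; rewrite ImM /= mulr0 add0r.
by rewrite -E1 -E2; split.
Qed.

Lemma is_fourier_measurable f F : is_fourier a b f F ->
  measurable_fun setT (fun xi => complex.Re (F xi)) /\ measurable_fun setT (fun xi => complex.Im (F xi)).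
Proof.
by move=> fF; split; apply: schwartz_measurable => eta /(is_fourier_real fF)[i1 i2 _ _];
  apply/measurable_EFinP; [exact: measurable_int i1|exact: measurable_int i2].
Qed.

Lemma is_fourier_unique f F G : is_fourier a b f F -> is_fourier a b f G ->
  {ae leb, forall xi, complex.Re (F xi) = complex.Re (G xi) /\ complex.Im (F xi) = complex.Im (G xi)}.
Proof.
move=> fF fG.
have h1 : {ae leb, forall xi, complex.Re (F xi) - complex.Re (G xi) = 0}.
  apply: schwartz_ae0 => eta se.
  have [i1 _ E1 _] := is_fourier_real fF se; have [i2 _ E2 _] := is_fourier_real fG se.
  rewrite (_ : (fun x => _) = (fun x => complex.Re (F x) * eta x - complex.Re (G x) * eta x)).
    by split; [exact: integrable_subR|rewrite RintegralB// E1 E2 subrr].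
  by apply/funext => x; rewrite mulrBl.
have h2 : {ae leb, forall xi, complex.Im (F xi) - complex.Im (G xi) = 0}.
  apply: schwartz_ae0 => eta se.
  have [_ i1 _ E1] := is_fourier_real fF se; have [_ i2 _ E2] := is_fourier_real fG se.
  rewrite (_ : (fun x => _) = (fun x => complex.Im (F x) * eta x - complex.Im (G x) * eta x)).
    by split; [exact: integrable_subR|rewrite RintegralB// E1 E2 subrr].
  by apply/funext => x; rewrite mulrBl.
apply: filterS2 h1 h2 => xi /eqP + /eqP.
by rewrite !subr_eq0 => /eqP -> /eqP ->.
Qed.

Let eq_opp_eq0 (x y : R) : y = x -> y = - x -> x = 0.
Proof. by move=> ->; lra. Qed.

(** The chosen transform agrees almost everywhere with one built from an even cosine part and an odd
    sine part. The real part of the form is then the polarised energy identity and the imaginary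
    part has an odd integrand. *)
Lemma fourier_form_xE f g : good f -> good g ->
  [/\ exists F, is_fourier a b f F, exists G, is_fourier a b g G,
      cintegrable leb setT (fourier_integrand alpha a b f g) &
      fourier_form_x alpha a b f g = (a ^+ 2 * ecst * pair f g)%:C%C].
Proof.
move=> fG gG.
have [A [B [AN BN [AL BL] [fA fB] _]]] := transform_good fG.
have [A' [B' [AN' BN' [AL' BL'] [gA gB] _]]] := transform_good gG.
have fF0 := transform_is_fourier fA fB; have gF0 := transform_is_fourier gA gB.
(* [fourier] selects some transform if one exists; existence has just been shown, so the default
   value does not occur. *)
have fF : is_fourier a b f (fourier a b f).
  by rewrite /fourier; case: xgetP => [F _ //|/(_ _ fF0)].
have gF : is_fourier a b g (fourier a b g).
  by rewrite /fourier; case: xgetP => [F _ //|/(_ _ gF0)].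
have [mF1 mF2] := is_fourier_measurable fF; have [mG1 mG2] := is_fourier_measurable gF.
have aeF := is_fourier_unique fF fF0; have aeG := is_fourier_unique gF gF0.
have RE xi : complex.Re (fourier_integrand alpha a b f g xi) = riesz xi *
   (complex.Re (fourier a b f xi) * complex.Re (fourier a b g xi) +
    complex.Im (fourier a b f xi) * complex.Im (fourier a b g xi)).
  rewrite /fourier_integrand !ReM !ImM; case: (fourier a b g xi) => u v /=.
  by rewrite /riesz; ring.
have IE xi : complex.Im (fourier_integrand alpha a b f g xi) = riesz xi *
   (complex.Im (fourier a b f xi) * complex.Re (fourier a b g xi) -
    complex.Re (fourier a b f xi) * complex.Im (fourier a b g xi)).
  rewrite /fourier_integrand ImM !ReM !ImM; case: (fourier a b g xi) => u v /=.
  by rewrite /riesz; ring.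
pose Re0 xi := a ^+ 2 * (A xi * A' xi * riesz xi + B xi * B' xi * riesz xi).
pose Im0 xi := a ^+ 2 * (A xi * B' xi * riesz xi - B xi * A' xi * riesz xi).
have aeR : {ae leb, forall xi, complex.Re (fourier_integrand alpha a b f g xi) = Re0 xi}.
  apply: filterS2 aeF aeG => xi [F1 F2] [G1 G2].
  by rewrite RE F1 F2 G1 G2 /= /Re0; ring.
have aeI : {ae leb, forall xi, complex.Im (fourier_integrand alpha a b f g xi) = Im0 xi}.
  apply: filterS2 aeF aeG => xi [F1 F2] [G1 G2].
  by rewrite IE F1 F2 G1 G2 /= /Im0; ring.
have iAA := wip_integrable mriesz riesz_ge0 AL AL'; have iBB := wip_integrable mriesz riesz_ge0 BL BL'.
have iAB := wip_integrable mriesz riesz_ge0 AL BL'; have iBA := wip_integrable mriesz riesz_ge0 BL AL'.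
have iR0 : leb.-integrable setT (EFin \o Re0) := integrable_scaleR (a ^+ 2) (integrable_addR iAA iBB).
have iI0 : leb.-integrable setT (EFin \o Im0) := integrable_scaleR (a ^+ 2) (integrable_subR iAB iBA).
have rieszN xi : riesz (- xi) = riesz xi.
  by rewrite /riesz /enorm dotpNl dotpC dotpNl opprK.
split; [by exists (fourier a b f)|by exists (fourier a b g)| |].
- split.
    apply: integrable_ae aeR iR0; rewrite (funext RE).
    apply: (measurable_funM mriesz).
    exact: (measurable_funD (measurable_funM mF1 mG1) (measurable_funM mF2 mG2)).
  apply: integrable_ae aeI iI0; rewrite (funext IE).
  apply: (measurable_funM mriesz).
  exact: (measurable_funB (measurable_funM mF2 mG1) (measurable_funM mF1 mG2)).
rewrite /fourier_form_x /cintegral (Rintegral_ae_eq aeR) (Rintegral_ae_eq aeI); congr Complex.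
  rewrite /Re0 (Rintegral_scaleD _ iAA iBB) -mulrA; congr (_ * _).
  exact: (transform_pair fG gG fA fB gA gB).
(* Reflection preserves the integral of [Im0] and, by the parities of the four factors, also changes
   its sign. *)
have I0N : \int[leb]_xi Im0 (- xi) = \int[leb]_xi Im0 xi.
  by apply: Rintegral_opp; apply/measurable_EFinP; exact: measurable_int iI0.
have I0N' : \int[leb]_xi Im0 (- xi) = - \int[leb]_xi Im0 xi.
  rewrite -(RintegralN iI0); apply: eq_Rintegral => xi _.
  by rewrite /Im0 AN BN AN' BN' rieszN; ring.
exact: (eq_opp_eq0 I0N I0N').
Qed.

End slice_theorem.

(** * Time-dependent functions *)

Section time_dependent.
Context {R : realType} {n : nat}.
Variables (alpha c : R).
Hypotheses (alpha_gt0 : 0 < alpha) (alpha_ltN : alpha < n%:R)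
  (c_levy : @levy_normalization R n alpha c).
Local Notation leb := (lebesgue_rV R n).
Local Notation lebt := (@lebesgue_measure R).
Local Notation V := 'rV[R]_n.
Local Notation TR := (measurableTypeR R).
Local Notation E := (V * TR)%type.
Local Notation good := (@good R n alpha c).
Local Notation pair := (@pair R n alpha c).
Local Notation dif_int := (@dif_int R n alpha c).
Local Notation Lq := (@Lq R n alpha).
Local Notation q := (2 * n%:R / (n%:R - alpha)).
Local Notation beta := (alpha / n%:R).
Local Notation rho2 := (@levy_density2 R n alpha c).
Local Notation leb2 := (product_sigma_finite leb leb).
Local Notation leb3 := (lebt \x leb2)%E.
Implicit Types (f g : E -> R) (t : TR).

Definition levy_density3 (p : TR * (V * V)) : R := rho2 p.2.
Local Notation rho3 := levy_density3.

Lemma levy_density3_ge0 p : 0 <= rho3 p. Proof. exact: (levy_density_ge0 c_levy). Qed.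

Lemma measurable_levy_density3 : measurable_fun setT rho3.
Proof.
apply: (measurableT_comp (measurable_levy_density (n:=n) alpha c)).
exact: (measurableT_comp measurable_snd measurable_snd).
Qed.

Let rho3_ge0 := levy_density3_ge0.
Let mrho3 := measurable_levy_density3.

(** Time is the first coordinate, so that integrating out the pair (point, increment) leaves at each
    time the form of the slice. *)
Definition increment3 f (p : TR * (V * V)) : R :=
  f (p.2.1 + p.2.2, p.1) - f (p.2.1, p.1).

Lemma measurable_increment3 f : measurable_fun setT f -> measurable_fun setT (increment3 f).
Proof.
move=> mf.
have m21 : measurable_fun setT (fun p : TR * (V * V) => p.2.1).
  exact: (measurableT_comp measurable_fst measurable_snd).
have m22 : measurable_fun setT (fun p : TR * (V * V) => p.2.2).
  exact: (measurableT_comp measurable_snd measurable_snd).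
apply: measurable_funB; apply: (measurableT_comp mf); apply/measurable_fun_prod => //=.
exact: (measurable_fun_addrV m21 m22).
Qed.

Lemma measurable_slice f t : measurable_fun setT f -> measurable_fun setT (slice f t).
Proof. by move=> mf; exact: (measurableT_comp mf (pair2_measurable t)). Qed.

Lemma measurable_swapped f : measurable_fun setT f ->
  measurable_fun setT (fun p : TR * V => f (p.2, p.1)).
Proof. by move=> mf; apply: (measurableT_comp mf); exact: measurable_fun_pair. Qed.

Let measurable_pow3 f : measurable_fun setT f ->
  measurable_fun setT (fun p : TR * V => `|f (p.2, p.1)| `^ q).
Proof.
move=> mf; apply: (measurableT_comp (@measurable_powR R q)).
by apply: measurableT_comp => //; exact: measurable_swapped.
Qed.

Lemma measurable_Lq_slice f : measurable_fun setT f ->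
  measurable_fun setT (fun t => Lq (slice f t)).
Proof.
by move=> mf; exact: (measurable_tonelli leb (measurable_pow3 mf) (fun p => powR_ge0 _ _)).
Qed.

Let measurable_dif3 f : measurable_fun setT f ->
  measurable_fun setT (fun p => increment3 f p ^+ 2 * rho3 p).
Proof.
by move=> mf; apply: measurable_funM => //; apply: measurable_funX; exact: measurable_increment3.
Qed.

Let dif3_ge0 f p : 0 <= increment3 f p ^+ 2 * rho3 p.
Proof. by rewrite mulr_ge0 ?sqr_ge0. Qed.

Lemma measurable_dif_int_slice f : measurable_fun setT f ->
  measurable_fun setT (fun t => dif_int (slice f t)).
Proof.
by move=> mf; exact: (measurable_tonelli leb2 (measurable_dif3 mf) (dif3_ge0 f)).
Qed.

Lemma integral_dif3 f : measurable_fun setT f ->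
  (\int[leb3]_p (increment3 f p ^+ 2 * rho3 p)%:E = \int[lebt]_t dif_int (slice f t))%E.
Proof.
by move=> mf; exact: (tonelliE lebt leb2 (measurable_dif3 mf) (dif3_ge0 f)).
Qed.

(* Square integrability in time of the L^q norm is not part of the definition:
   it follows from the Sobolev inequality, see [sobolevT]. *)
Definition goodT f := [/\ measurable_fun setT f,
  {ae lebt, forall t, (Lq (slice f t) < +oo)%E} & wL2 leb3 rho3 (increment3 f)].

Definition pairT f g : R := wip leb3 rho3 (increment3 f) (increment3 g).

Lemma goodT_slice f : goodT f -> {ae lebt, forall t, good (slice f t)}.
Proof.
move=> [mf fq [_ fE]].
rewrite integral_dif3// in fE.
have dE := ge0_ae_lty (measurable_dif_int_slice mf) (fun t => dif_int_ge0 c_levy _) fE.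
by apply: filterS2 fq dE => t h1 h2; split => //; exact: measurable_slice.
Qed.

Lemma goodTD f g : goodT f -> goodT g -> goodT (fun p => f p + g p).
Proof.
move=> fG gG; have [mf _ fE] := fG; have [mg _ gE] := gG; split.
- exact: measurable_funD.
- apply: filterS2 (goodT_slice fG) (goodT_slice gG) => t ft gt.
  by have [] := goodD alpha_gt0 alpha_ltN c_levy ft gt.
have := wL2D mrho3 rho3_ge0 fE gE; congr (wL2 _ _ _); apply/funext => p.
by rewrite /increment3 opprD addrACA.
Qed.

Lemma goodTZ k f : goodT f -> goodT (fun p => k * f p).
Proof.
move=> fG; have [mf _ fE] := fG; split.
- exact: measurable_funM.
- apply: filterS (goodT_slice fG) => t ft.
  by have [] := goodZ c_levy k ft.
have := wL2Z mrho3 rho3_ge0 k fE; congr (wL2 _ _ _); apply/funext => p.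
by rewrite /increment3 mulrBr.
Qed.

Lemma goodTB f g : goodT f -> goodT g -> goodT (fun p => f p - g p).
Proof.
move=> fG /(goodTZ (-1)) gG; have := goodTD fG gG.
by rewrite (_ : (fun x => _ + -1 * _) = (fun x => f x - g x))//; apply/funext => x; rewrite mulN1r.
Qed.

Lemma pairTC f g : pairT f g = pairT g f. Proof. exact: wipC. Qed.

Lemma pairT_ge0 f : 0 <= pairT f f. Proof. exact: wip_ge0. Qed.

Lemma pairTDl f g h : goodT f -> goodT g -> goodT h ->
  pairT (fun p => f p + g p) h = pairT f h + pairT g h.
Proof.
move=> [_ _ fE] [_ _ gE] [_ _ hE]; rewrite /pairT -(wipDl mrho3 rho3_ge0 fE gE hE).
by congr wip; apply/funext => p; rewrite /increment3 opprD addrACA.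
Qed.

Lemma pairTZl k f h : goodT f -> goodT h -> pairT (fun p => k * f p) h = k * pairT f h.
Proof.
move=> [_ _ fE] [_ _ hE]; rewrite /pairT -(wipZl mrho3 rho3_ge0 k fE hE).
by congr wip; apply/funext => p; rewrite /increment3 mulrBr.
Qed.

Lemma pairT_integrable f g : goodT f -> goodT g ->
  leb3.-integrable setT (EFin \o (fun p => increment3 f p * increment3 g p * rho3 p)).
Proof. by move=> [_ _ fE] [_ _ gE]; exact: (wip_integrable mrho3). Qed.

Lemma pairT_fubini f g : goodT f -> goodT g ->
  lebt.-integrable setT (EFin \o (fun t => pair (slice f t) (slice g t))) /\
  \int[lebt]_t pair (slice f t) (slice g t) = pairT f g.
Proof.
move=> fG gG; have i := pairT_integrable fG gG; split; last exact: (Rfubini i).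
pose F p := increment3 f p * increment3 g p * rho3 p.
have mF : measurable_fun setT F by apply/measurable_EFinP; exact: measurable_int i.
have m : measurable_fun setT (fun t => pair (slice f t) (slice g t)).
  exact: (measurable_Rintegral leb2 mF).
have /integrableP[_ goo] := integrable_fubini_F i.
apply/integrableP; split; first exact/measurable_EFinP.
rewrite (ae_eq_integral_nomeas (g := fun t => `|fubini_F leb2 (EFin \o F) t|%E))//.
by apply: filterS (ae_integrable1 i) => t it _ /=; rewrite /fubini_F (Rintegral_EFin it).
Qed.

Lemma pairT_dif_int f : goodT f ->
  (\int[lebt]_t dif_int (slice f t) = (pairT f f)%:E)%E.
Proof.
by move=> [mf _ fE]; rewrite -(integral_dif3 mf) (wipE mrho3 rho3_ge0 fE).
Qed.

Lemma sobolevT : exists2 C, 0 < C & forall f, goodT f ->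
  (\int[lebt]_t ((fine (Lq (slice f t)) `^ (1 - beta))%:E) <= (C * pairT f f)%:E)%E.
Proof.
have [C C0 CE] := sobolev alpha_gt0 alpha_ltN c_levy; exists C => // f fG.
have [mf _ fE] := fG.
rewrite EFinM -(pairT_dif_int fG) -ge0_integralZl//; last 3 first.
- exact: measurable_dif_int_slice.
- by move=> t _; exact: (dif_int_ge0 c_levy).
- by rewrite lee_fin ltW.
have mL : measurable_fun setT (fun t => (fine (Lq (slice f t)) `^ (1 - beta))%:E).
  apply/measurable_EFinP; apply: (measurableT_comp (@measurable_powR R (1 - beta))).
  have mfine : measurable_fun [set: \bar R] (@fine R) by [].
  exact: (measurableT_comp mfine (measurable_Lq_slice mf)).
apply: ae_ge0_le_integral => //.
- by move=> t _; rewrite lee_fin powR_ge0.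
- by move=> t _; apply: mule_ge0; [rewrite lee_fin ltW|exact: (dif_int_ge0 c_levy)].
- by apply: measurable_funeM; exact: measurable_dif_int_slice.
by apply: filterS (goodT_slice fG) => t [m fq _] _; exact: CE.
Qed.

Lemma integral_swap (h : E -> R) : measurable_fun setT h -> (forall p, 0 <= h p) ->
  (\int[(leb \x lebt)%E]_p (h p)%:E = \int[lebt]_t \int[leb]_x (h (x, t))%:E)%E.
Proof. by move=> mh h0; rewrite (tonelliE leb lebt mh h0) (tonelliC leb lebt mh h0). Qed.

Definition weightT (p : E) : R := weight p.1.

Lemma measurable_weightT : measurable_fun setT weightT.
Proof. exact: (measurableT_comp (@measurable_weight R n) measurable_fst). Qed.

Lemma weighted_boundT : exists2 C, 0 < C & forall f, goodT f ->
  (\int[(leb \x lebt)%E]_p (f p ^+ 2 * weightT p)%:E <= (C * pairT f f)%:E)%E.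
Proof.
have [C C0 CE] := weighted_bound alpha_gt0 alpha_ltN c_levy; exists C => // f fG.
have [mf _ fE] := fG.
have mfw : measurable_fun setT (fun p : E => f p ^+ 2 * weightT p).
  by apply: measurable_funM; [exact: measurable_funX|exact: measurable_weightT].
have fw0 (p : E) : 0 <= f p ^+ 2 * weightT p by rewrite mulr_ge0 ?sqr_ge0 ?weight_ge0.
rewrite integral_swap// EFinM -(pairT_dif_int fG) -ge0_integralZl//; last 3 first.
- exact: measurable_dif_int_slice.
- by move=> t _; exact: (dif_int_ge0 c_levy).
- by rewrite lee_fin ltW.
apply: ae_ge0_le_integral => //.
- by move=> t _; apply: integral_ge0 => x _; rewrite lee_fin.
- exact: (measurable_tonelli leb (measurable_swapped mfw) (fun p => fw0 (p.2, p.1))).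
- by move=> t _; apply: mule_ge0; [rewrite lee_fin ltW|exact: (dif_int_ge0 c_levy)].
- by apply: measurable_funeM; exact: measurable_dif_int_slice.
by apply: filterS (goodT_slice fG) => t [m fq _] _; exact: (CE (slice f t)).
Qed.

(** Vanishing energy alone would allow slices that are constant in space; the finite L^q norm in
    [goodT], through the weighted bound, forces the constant to be zero. *)
Lemma pairT_eq0 f : goodT f -> pairT f f = 0 ->
  {ae (leb \x lebt)%E, forall p, f p = 0}.
Proof.
move=> fG f0; have [mf _ _] := fG.
have [C C0 /(_ f fG)] := weighted_boundT; rewrite f0 mulr0 => h.
have : {ae (leb \x lebt)%E, forall p, (f p ^+ 2 * weightT p)%:E = 0%E}.
  apply: ge0_integral_eq0_ae.
  - apply/measurable_EFinP; apply: measurable_funM; [exact: measurable_funX|exact: measurable_weightT].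
  - by move=> p; rewrite lee_fin mulr_ge0 ?sqr_ge0 ?weight_ge0.
  apply/eqP; rewrite eq_le h; apply: integral_ge0 => p _.
  by rewrite lee_fin mulr_ge0 ?sqr_ge0 ?weight_ge0.
apply: filterS => p [] /eqP; rewrite mulf_eq0 sqrf_eq0 => /orP[/eqP //|].
by rewrite gt_eqF ?weight_gt0.
Qed.

Lemma ae_slices (P : set E) : {ae (leb \x lebt)%E, forall p, P p} ->
  {ae lebt, forall t, {ae leb, forall x, P (x, t)}}.
Proof.
move=> [N [mN N0 PN]].
have m1 : measurable_fun setT (fun p : E => \1_N p : R) by exact: (measurable_indic (R:=R)).
have I0 : (\int[lebt]_t \int[leb]_x (\1_N (x, t))%:E = 0)%E.
  by rewrite -integral_swap// integral_indic ?setIT.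
have : {ae lebt, forall t, (\int[leb]_x (\1_N (x, t))%:E = 0)%E}.
  apply: ge0_integral_eq0_ae => //.
  - exact: (measurable_tonelli leb (measurable_swapped m1)).
  - by move=> t; apply: integral_ge0 => x _; rewrite lee_fin.
apply: filterS => t t0.
have : {ae leb, forall x, (\1_N (x, t) : R)%:E = 0%E}.
  apply: ge0_integral_eq0_ae => //.
  by apply/measurable_EFinP; exact: (measurable_slice t m1).
apply: filterS => x [] /eqP; rewrite indicE pnatr_eq0 eqb0 => /negP Nx.
by apply: contrapT => nP; apply: Nx; rewrite inE; exact: PN.
Qed.

(* Null sets of (x, t) pull back to null sets of (t, (x, z)) under the two maps
   (x, t) and (x + z, t). *)
Lemma ae_increment3 (P : set E) : {ae (leb \x lebt)%E, forall p, P p} ->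
  {ae leb3, forall p, P (p.2.1, p.1) /\ P (p.2.1 + p.2.2, p.1)}.
Proof.
move=> [N [mN N0 PN]].
have m1 : measurable_fun setT (fun p : E => \1_N p : R) by exact: (measurable_indic (R:=R)).
have ae0 : {ae lebt, forall t, (\int[leb]_x (\1_N (x, t))%:E = 0)%E}.
  apply: ge0_integral_eq0_ae => //.
  - exact: (measurable_tonelli leb (measurable_swapped m1)).
  - by move=> t; apply: integral_ge0 => x _; rewrite lee_fin.
  by rewrite -integral_swap// integral_indic ?setIT.
pose F (p : TR * (V * V)) : R := \1_N (p.2.1, p.1) + \1_N (p.2.1 + p.2.2, p.1).
have m21 : measurable_fun setT (fun p : TR * (V * V) => p.2.1).
  exact: (measurableT_comp measurable_fst measurable_snd).
have m22 : measurable_fun setT (fun p : TR * (V * V) => p.2.2).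
  exact: (measurableT_comp measurable_snd measurable_snd).
have mF : measurable_fun setT F.
  apply: measurable_funD; apply: (measurableT_comp m1); apply/measurable_fun_prod => //=.
  exact: (measurable_fun_addrV m21 m22).
have F0 p : 0 <= F p by rewrite addr_ge0.
have IF : (\int[leb3]_p (F p)%:E = 0)%E.
  rewrite (tonelliE lebt leb2 mF F0).
  rewrite (ae_eq_integral_nomeas (g := cst 0%E)) ?integral0//.
  apply: filterS ae0 => t t0 _ /=.
  have mt : measurable_fun setT (fun x : V => \1_N (x, t) : R) := measurable_slice t m1.
  have mFt : measurable_fun setT (fun p : V * V => F (t, p)) := measurableT_comp mF (pair1_measurable t).
  apply: (etrans (tonelliE leb leb mFt (fun p => F0 (t, p)))).
  apply: (etrans (tonelliC leb leb mFt (fun p => F0 (t, p)))).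
  apply: integral0_eq => z _.
  have mtz : measurable_fun setT (fun x : V => \1_N (x + z, t) : R).
    exact: (measurableT_comp mt (measurable_rV_shift z)).
  rewrite /F /= (integral_add_ge0 leb mt mtz)// t0 add0e.
  rewrite (@integral_rV_shift _ _ z (fun x => (\1_N (x, t) : R)%:E))//.
  exact/measurable_EFinP.
have : {ae leb3, forall p, (F p)%:E = 0%E}.
  by apply: ge0_integral_eq0_ae => //; exact/measurable_EFinP.
apply: filterS => p [] /eqP; rewrite /F paddr_eq0// !indicE !pnatr_eq0 !eqb0 => /andP[/negP h1 /negP h2].
by split; apply: contrapT => nP; [apply: h1|apply: h2]; rewrite inE; exact: PN.
Qed.

End time_dependent.

Section power_continuity.
Context {R : realType}.

Lemma cvg_powR (u : nat -> R) (l q : R) : 0 < q -> (forall k, 0 <= u k) ->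
  u k @[k --> \oo] --> l -> u k `^ q @[k --> \oo] --> l `^ q.
Proof.
move=> q0 u0 ul.
have l0 : 0 <= l.
  by rewrite -(cvg_lim (@Rhausdorff R) ul); apply: limr_ge; [apply/cvg_ex; exists l|exact: nearW].
move: l0; rewrite le_eqVlt => /predU1P[l0|l0]; last first.
  have lE : l `^ q = expR (q * ln l) by rewrite /powR gt_eqF.
  have C : expR (q * ln (u k)) @[k --> \oo] --> expR (q * ln l).
    apply: continuous_cvg; first exact: continuous_expR.
    by apply: cvgMr; apply: continuous_cvg ul; exact: continuous_ln.
  rewrite lE; apply: cvg_trans C; apply: near_eq_cvg.
  have /cvgrPdist_lt/(_ _ l0) := ul; apply: filterS => k h.
  rewrite /powR ifF//; apply/negP => /eqP uk; move: h; rewrite uk subr0 gtr0_norm//.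
  by rewrite ltxx.
rewrite -l0 powR0 ?gt_eqF//; apply/cvgrPdist_lt => e e0.
have e1 : 0 < e `^ q^-1 by exact: powR_gt0.
have /cvgrPdist_lt/(_ _ e1) := ul; apply: filterS => k.
rewrite -l0 !sub0r !normrN !ger0_norm ?powR_ge0// => h.
have -> : e = (e `^ q^-1) `^ q by rewrite -powRrM mulVf ?gt_eqF// powRr1// ltW.
by apply: gt0_ltr_powR; rewrite ?nnegrE ?powR_ge0.
Qed.

Lemma powR_le_root (x y p : R) : 0 <= x -> 0 < p -> x `^ p <= y -> x <= y `^ p^-1.
Proof.
move=> x0 p0 xy; rewrite -[leLHS](powRr1 x0) -(divff (lt0r_neq0 p0)) powRrM.
apply: ge0_ler_powR => //; rewrite ?nnegrE ?powR_ge0 ?invr_ge0 ?(ltW p0)//.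
by apply: le_trans xy; exact: powR_ge0.
Qed.

End power_continuity.

Section recurrent_bound.
Context {d} {X : measurableType d} {R : realType}.
Variable mu : {measure set X -> \bar R}.

(* Fatou's lemma: the lower limit is finite almost everywhere. *)
Lemma ae_often_bounded (h : nat -> X -> \bar R) (C : R) :
  (forall k, measurable_fun setT (h k)) -> (forall k x, 0 <= h k x)%E ->
  (forall k, (\int[mu]_x h k x <= C%:E)%E) ->
  {ae mu, forall x, exists M : R, forall n, exists2 k, (n <= k)%N & (h k x < M%:E)%E}.
Proof.
move=> mh h0 hC.
have ml : measurable_fun setT (fun x => limn_einf (h^~ x)).
  rewrite (_ : (fun x => _) = (fun x => - limn_esup (fun k => - h k x))%E).
    apply: measurableT_comp => //; apply: measurable_fun_limn_esup => k.
    exact: measurableT_comp.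
  apply/funext => x; rewrite -[in RHS]/(-%E \o h^~ x).
  by rewrite limn_esupN oppeK.
have l0 x : (0 <= limn_einf (h^~ x))%E.
  rewrite limn_einf_lim; apply: lime_ge; first exact: is_cvg_einfs.
  by apply: nearW => k; apply: le_ereal_inf_tmp => _ [j _ <-].
have loo : (\int[mu]_x limn_einf (h^~ x) < +oo)%E.
  apply: (@le_lt_trans _ _ C%:E); last exact: ltry.
  apply: le_trans (fatou mu measurableT mh (fun n x _ => h0 n x)) _.
  rewrite limn_einf_lim; apply: lime_le; first exact: is_cvg_einfs.
  by apply: nearW => n; apply: le_trans (hC n); apply: ereal_inf_lbound; exists n => /=.
apply: filterS (ge0_ae_lty ml l0 loo) => x.
move: (l0 x) => l0x lxoo.
have lE : (limn_einf (h^~ x) = (fine (limn_einf (h^~ x)))%:E)%E.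
  by rewrite fineK// ge0_fin_numE.
exists (fine (limn_einf (h^~ x)) + 1) => n.
have : (einfs (h^~ x) n < (fine (limn_einf (h^~ x)) + 1)%:E)%E.
  apply: (@le_lt_trans _ _ (limn_einf (h^~ x))).
    rewrite limn_einf_lim (cvg_lim _ (@cvg_einfs_sup _ _))//.
    by apply: ereal_sup_ubound; exists n.
  by rewrite lE lte_fin ltrDl.
by move=> /ereal_inf_lt[_ [k nk <-]] hk; exists k.
Qed.

End recurrent_bound.

(** * Completeness *)

Section completeness_in_time.
Context {R : realType} {n : nat}.
Variables (alpha c : R).
Hypotheses (alpha_gt0 : 0 < alpha) (alpha_ltN : alpha < n%:R)
  (c_levy : @levy_normalization R n alpha c).
Local Notation leb := (lebesgue_rV R n).
Local Notation lebt := (@lebesgue_measure R).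
Local Notation V := 'rV[R]_n.
Local Notation TR := (measurableTypeR R).
Local Notation E := (V * TR)%type.
Local Notation Lq := (@Lq R n alpha).
Local Notation q := (2 * n%:R / (n%:R - alpha)).
Local Notation beta := (alpha / n%:R).
Local Notation rho3 := (@levy_density3 R n alpha c).
Local Notation leb2 := (product_sigma_finite leb leb).
Local Notation leb3 := (lebt \x leb2)%E.
Local Notation goodT := (@goodT R n alpha c).
Local Notation pairT := (@pairT R n alpha c).
Implicit Types (f g : E -> R) (t : TR).

Let rho3_ge0 := levy_density3_ge0 c_levy.
Let mrho3 := @measurable_levy_density3 R n alpha c.

Lemma increment3B f g : increment3 (fun p => f p - g p) = (fun p => increment3 f p - increment3 g p).
Proof.
apply/funext => p; rewrite /increment3.
by move: (f _) (f _) (g _) (g _) => x y z w; ring.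
Qed.

Let q_gt0 : 0 < q.
Proof. exact: lt_trans (sobolev_exponent_gt2 alpha_gt0 alpha_ltN). Qed.

Let beta_lt1 : 0 < 1 - beta.
Proof.
by rewrite subr_gt0 ltr_pdivrMr ?mul1r// (lt_trans alpha_gt0).
Qed.

Section cauchy_sequence.
Variables (u : nat -> E -> R) (S : set E).
Hypotheses (uG : forall k, goodT (u k)) (mS : measurable S)
  (uS : forall k p, ~ S p -> u k p = 0)
  (cauchy : forall e : R, 0 < e -> exists n0 : nat, forall m k, (n0 <= m)%N -> (n0 <= k)%N ->
    pairT (fun p => u m p - u k p) (fun p => u m p - u k p) <= e).

Let mu_ k : measurable_fun setT (u k). Proof. by have [] := uG k. Qed.

Let uB m k : goodT (fun p => u m p - u k p).
Proof. exact: goodTB. Qed.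

Let weighted_cauchy e : 0 < e -> exists n0 : nat, forall m k, (n0 <= m)%N -> (n0 <= k)%N ->
  (\int[(leb \x lebt)%E]_p ((u m p - u k p) ^+ 2 * weightT p)%:E <= e%:E)%E.
Proof.
move=> e0; have [C C0 CE] := weighted_boundT alpha_gt0 alpha_ltN c_levy.
have e1 : 0 < e / C by rewrite divr_gt0.
have [n0 n0P] := cauchy e1; exists n0 => m k n0m n0k.
apply: le_trans (CE _ (uB m k)) _; rewrite lee_fin mulrC -ler_pdivlMr//.
exact: n0P.
Qed.

Let increment_cauchy m k e : pairT (fun p => u m p - u k p) (fun p => u m p - u k p) <= e ->
  (\int[leb3]_p ((increment3 (u m) p - increment3 (u k) p) ^+ 2 * rho3 p)%:E <= e%:E)%E.
Proof.
have [_ _ L] := uB m k; rewrite -lee_fin /pairT -(wipE mrho3 rho3_ge0 L).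
by rewrite increment3B.
Qed.

(** The weighted L^2 bound yields an almost everywhere limit; Fatou's lemma on the increments gives
    convergence in energy; a second use of Fatou at fixed time gives finite L^q norms. *)
Lemma goodT_complete : exists v, [/\ goodT v, forall p, ~ S p -> v p = 0 &
  forall e : R, 0 < e -> exists n0 : nat, forall k, (n0 <= k)%N ->
    pairT (fun p => u k p - v p) (fun p => u k p - v p) <= e].
Proof.
have [s [v0 [mv0 sk aev0]]] := L2_cauchy_subsequence (measurable_weightT (R:=R) (n:=n))
  (fun p => weight_ge0 p.1) mu_ weighted_cauchy.
(* The limit is determined only up to a null set; the indicator makes it vanish at every point
   outside [S]. *)
pose v (p : E) := v0 p * \1_S p.
have mv : measurable_fun setT v.
  by apply: measurable_funM => //; apply: (measurable_indic (R:=R)).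
have vS p : ~ S p -> v p = 0.
  by move=> Sp; rewrite /v indicE memNset// mulr0.
have aev : {ae (leb \x lebt)%E, forall p, u (s k) p @[k --> \oo] --> v p}.
  apply: filterS aev0 => p h; have {}h := h (lt0r_neq0 (weight_gt0 p.1)).
  have [Sp|Sp] := pselect (S p); first by rewrite /v indicE mem_set// mulr1.
  rewrite vS//; rewrite (_ : (fun k => _) = cst 0); first exact: cvg_cst.
  by apply/funext => k; rewrite uS.
have aeI : {ae leb3, forall p, increment3 (u (s k)) p @[k --> \oo] --> increment3 v p}.
  by apply: filterS (ae_increment3 aev) => p [h1 h2]; exact: (cvgB h2 h1).
have mI k : measurable_fun setT (increment3 (u k)) by exact: measurable_increment3.
have mIv : measurable_fun setT (increment3 v) by exact: measurable_increment3.
have limE e : 0 < e -> exists n0 : nat, forall k, (n0 <= k)%N ->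
    (\int[leb3]_p ((increment3 (u k) p - increment3 v p) ^+ 2 * rho3 p)%:E <= e%:E)%E.
  move=> e0; have [n0 n0P] := cauchy e0; exists n0 => k n0k.
  apply: (fatou_cvg (f_ := fun j p => ((increment3 (u k) p - increment3 (u (s (j + n0)%N)) p) ^+ 2 * rho3 p)%:E)).
  - move=> j; apply/measurable_EFinP.
    exact: (measurable_funM (measurable_funX 2 (measurable_funB (mI k) (mI _))) mrho3).
  - by move=> j p; rewrite lee_fin; apply: mulr_ge0; [exact: sqr_ge0|exact: rho3_ge0].
  - apply: filterS aeI => p h; apply: cvg_EFin; first exact: nearW.
    apply: cvgMl; rewrite expr2.
    have h' : increment3 (u k) p - increment3 (u (s (j + n0)%N)) p @[j --> \oo] -->
        increment3 (u k) p - increment3 v p.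
      by apply: cvgB; [exact: cvg_cst|rewrite (cvg_shiftn n0 (fun j => increment3 (u (s j)) p))].
    exact: (cvgM h' h').
  - move=> j; apply: increment_cauchy; apply: n0P => //.
    by apply: leq_trans (sk _); exact: leq_addl.
have vL : wL2 leb3 rho3 (increment3 v).
  have [n0 n0P] := limE 1 ltr01.
  have dL : wL2 leb3 rho3 (fun p => increment3 (u n0) p - increment3 v p).
    split; first exact: measurable_funB (mI n0) mIv.
    by apply: le_lt_trans (n0P n0 (leqnn _)) _; rewrite ltry.
  have [_ _ uL] := uG n0.
  have := wL2B mrho3 rho3_ge0 uL dL; congr (wL2 _ _ _); apply/funext => p.
  by rewrite opprB addrC subrK.
have dL k : wL2 leb3 rho3 (fun p => increment3 (u k) p - increment3 v p).
  by have [_ _ uL] := uG k; exact: (wL2B mrho3 rho3_ge0 uL vL).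
have limP e : 0 < e -> exists n0 : nat, forall k, (n0 <= k)%N ->
    pairT (fun p => u k p - v p) (fun p => u k p - v p) <= e.
  move=> e0; have [n0 n0P] := limE e e0; exists n0 => k n0k.
  by rewrite /pairT increment3B -lee_fin -(wipE mrho3 rho3_ge0 (dL k)); exact: n0P.
have bounded : exists n1 : nat, forall k, (n1 <= k)%N -> pairT (u k) (u k) <= pairT v v + 1.
  have d0 : wip leb3 rho3 (fun p => increment3 (u k) p - increment3 v p)
      (fun p => increment3 (u k) p - increment3 v p) @[k --> \oo] --> 0.
    apply/cvgrPdist_le => e e0; have [n0 n0P] := limP e e0; exists n0 => // k /= n0k.
    rewrite sub0r normrN ger0_norm; last exact: (wip_ge0 _ rho3_ge0).
    by have := n0P k n0k; rewrite /pairT increment3B.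
  have uL k : wL2 leb3 rho3 (increment3 (u k)) by have [] := uG k.
  have C := wip_sqr_cvg mrho3 rho3_ge0 uL vL d0.
  have /cvgrPdist_lt/(_ _ ltr01)[n1 _ n1P] := C; exists n1 => k n1k.
  have := n1P k n1k; rewrite /= ltr_norml => /andP[h _].
  by rewrite /pairT; move: h; rewrite ltrNl opprB ltrBlDl => /ltW; rewrite addrC.
(* The Sobolev bounds are uniform only after integration in time. At almost every time the lower
   limit of the norms is finite, so infinitely many of them stay below a level [M] that depends on
   the time. *)
have vq : {ae lebt, forall t, (Lq (slice v t) < +oo)%E}.
  have [n1 n1P] := bounded.
  have [C C0 CE] := sobolevT alpha_gt0 alpha_ltN c_levy.
  pose w k := u (s (k + n1)%N).
  have wG k : goodT (w k) by exact: uG.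
  have mw k : measurable_fun setT (w k) by exact: mu_.
  have mL k : measurable_fun setT (fun t => (fine (Lq (slice (w k) t)) `^ (1 - beta))%:E).
    apply/measurable_EFinP; apply: (measurableT_comp (@measurable_powR R (1 - beta))).
    have mfine : measurable_fun [set: \bar R] (@fine R) by [].
    exact: (measurableT_comp mfine (measurable_Lq_slice alpha (mw k))).
  have often := @ae_often_bounded _ _ _ lebt (fun k t => (fine (Lq (slice (w k) t)) `^ (1 - beta))%:E)
    (C * (pairT v v + 1)) mL.
  have {}often := often (fun k t => powR_ge0 _ _).
  have wbound k : (\int[lebt]_t (fine (Lq (slice (w k) t)) `^ (1 - beta))%:E <= (C * (pairT v v + 1))%:E)%E.
    apply: le_trans (CE _ (wG k)) _; rewrite lee_fin ler_wpM2l ?(ltW C0)//.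
    by apply: n1P; apply: leq_trans (sk _); exact: leq_addl.
  have {}often := often wbound.
  have wgood : {ae lebt, forall t, forall k, (Lq (slice (w k) t) < +oo)%E}.
    by apply/ae_foralln => k; have [] := wG k.
  apply: filterS3 often wgood (ae_slices aev) => t [M MP] wt cvt.
  (* A subsequence depending on [t], with bounded norms; it still converges to [v] for almost every
     x, and Fatou's lemma in x bounds the norm of the slice of [v]. *)
  have /choice[sg sgP] : forall j, exists k, (j <= k)%N /\
      ((fine (Lq (slice (w k) t)) `^ (1 - beta))%:E < M%:E)%E.
    by move=> j; have [k jk kM] := MP j; exists k.
  have sg_oo : (fun j => (sg j + n1)%N) @ \oo --> \oo.
    move=> A [m _ mA]; exists m => // j /= mj; apply: mA => /=.
    by apply: leq_trans mj (leq_trans (sgP j).1 _); exact: leq_addr.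
  apply: (@le_lt_trans _ _ (M `^ (1 - beta)^-1)%:E); last exact: ltry.
  apply: (fatou_cvg (f_ := fun j x => (`|slice (w (sg j)) t x| `^ q)%:E)).
  - move=> j; apply/measurable_EFinP; apply: measurable_powq; exact: measurable_slice.
  - by move=> j x; rewrite lee_fin powR_ge0.
  - apply: filterS cvt => x h; apply: cvg_EFin; first exact: nearW.
    apply: cvg_powR => //; apply: cvg_norm.
    have hh : ((fun k => u (s k) (x, t)) \o (fun j => (sg j + n1)%N)) @ \oo --> v (x, t).
      exact: cvg_comp sg_oo h.
    exact: hh.
  move=> j; have [_ jM] := sgP j; have woo := wt (sg j).
  rewrite -/(Lq (slice (w (sg j)) t)).
  have LE : Lq (slice (w (sg j)) t) = (fine (Lq (slice (w (sg j)) t)))%:E.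
    by rewrite fineK// ge0_fin_numE// Lq_ge0.
  have L0 : 0 <= fine (Lq (slice (w (sg j)) t)) by rewrite fine_ge0// Lq_ge0.
  rewrite LE lee_fin; move: jM; rewrite lte_fin => /ltW jM.
  exact: (powR_le_root L0 beta_lt1 jM).
by exists v; split.
Qed.

End cauchy_sequence.

End completeness_in_time.

(** * The Hilbert space *)

Section time_slices.
Context {R : realType} {n : nat}.
Variables (alpha c a b : R).
Hypotheses (alpha_gt0 : 0 < alpha) (alpha_lt2 : alpha < 2) (alpha_ltN : alpha < n%:R)
  (c_levy : @levy_normalization R n alpha c) (a_gt0 : 0 < a) (b0 : b != 0).
Variable T : R.
Local Notation leb := (lebesgue_rV R n).
Local Notation lebt := (@lebesgue_measure R).
Local Notation V := 'rV[R]_n.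
Local Notation TR := (measurableTypeR R).
Local Notation E := (V * TR)%type.
Local Notation Lq := (@Lq R n alpha).
Local Notation q := (2 * n%:R / (n%:R - alpha)).
Local Notation beta := (alpha / n%:R).
Local Notation good := (@good R n alpha c).
Local Notation goodT := (@goodT R n alpha c).
Local Notation pair := (@pair R n alpha c).
Local Notation pairT := (@pairT R n alpha c).
Local Notation dif_int := (@dif_int R n alpha c).
Local Notation rho3 := (@levy_density3 R n alpha c).
Local Notation D := (`]0, T[%classic : set TR).
Local Notation QT := (@QT R n T).
Local Notation Hdot := (@L2Hdot R n alpha c T).
Local Notation ecst := (energy_cst (n := n) alpha b).
Implicit Types (f g : 'rV[R]_n * R -> R) (t : TR).

(** Extension by zero outside the cylinder: membership constrains a function only there, while
    [goodT] and [pairT] live on the whole time line. *)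
Definition cut f (p : E) : R := f p * \1_QT p.

Lemma measurable_QT : measurable (QT : set E).
Proof. by apply: measurableX => //; exact: measurable_itv. Qed.

Lemma cut_in f p : QT p -> cut f p = f p.
Proof. by move=> Sp; rewrite /cut indicE mem_set// mulr1. Qed.

Lemma cut_out f p : ~ QT p -> cut f p = 0.
Proof. by move=> Sp; rewrite /cut indicE memNset// mulr0. Qed.

Lemma measurable_cut f : measurable_fun (QT : set E) f -> measurable_fun setT (cut f).
Proof.
move=> /(measurable_restrictT _ measurable_QT).
rewrite (_ : f \_ QT = cut f)//; apply/funext => p.
rewrite /patch /cut indicE; by case: ifPn => _; rewrite ?mulr1 ?mulr0.
Qed.

Lemma slice_cut_in f t : D t -> slice (cut f) t = slice f t.
Proof. by move=> Dt; apply/funext => x; rewrite /slice cut_in. Qed.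

Lemma slice_cut_out f t : ~ D t -> slice (cut f) t = cst 0.
Proof. by move=> Dt; apply/funext => x; rewrite /slice cut_out// => -[]. Qed.

Lemma cutD f g : cut (f \+ g) = fun p => cut f p + cut g p.
Proof. by apply/funext => p; rewrite /cut mulrDl. Qed.

Lemma cutB f g : cut (f \- g) = fun p => cut f p - cut g p.
Proof. by apply/funext => p; rewrite /cut mulrBl. Qed.

Lemma cutZ k f : cut (k \*o f) = fun p => k * cut f p.
Proof. by apply/funext => p; rewrite /cut mulrA. Qed.

Lemma integral_time (F G : TR -> \bar R) : (forall t, D t -> F t = G t) ->
  (forall t, ~ D t -> G t = 0%E) -> (\int[lebt]_(t in D) F t = \int[lebt]_t G t)%E.
Proof.
move=> FG G0; rewrite integral_mkcond; apply: eq_integral => t _; rewrite /patch.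
by case: ifPn => [/[1!inE]|/negP]; [exact: FG|rewrite inE => /G0 ->].
Qed.

Let q_gt0 : 0 < q.
Proof. exact: lt_trans (sobolev_exponent_gt2 alpha_gt0 alpha_ltN). Qed.

Let rho3_ge0 := levy_density3_ge0 c_levy.
Let mrho3 := @measurable_levy_density3 R n alpha c.

Lemma LnormE (g : V -> R) : Lnorm leb q%:E (EFin \o g) = poweR (Lq g) q^-1.
Proof.
rewrite unlock /Lnorm /Lq; congr (poweR _ _).
Qed.

Let Lq0 : Lq (cst 0 : V -> R) = 0%E.
Proof.
rewrite /Lq; apply: integral0_eq => x _.
by rewrite normr0 powR0// gt_eqF.
Qed.

Let pair0l (g : V -> R) : pair (cst 0) g = 0.
Proof.
rewrite /pair /wip (_ : (fun x => _) = cst 0) ?/Rintegral ?integral0//.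
by apply/funext => p; rewrite /increment subrr !mul0r.
Qed.

Let dif_int0 : dif_int (cst 0 : V -> R) = 0%E.
Proof.
rewrite /dif_int; apply: integral0_eq => p _.
by rewrite /dif subrr expr0n/= mul0r.
Qed.

Let F2 f t : \bar R := (Lnorm leb q%:E (EFin \o slice (cut f) t) ^+ 2)%E.

Let measurable_F2 f : measurable_fun setT (cut f) -> measurable_fun setT (F2 f).
Proof.
move=> mf; have m : measurable_fun setT (fun t => poweR (Lq (slice (cut f) t)) q^-1).
  exact: (measurableT_comp (measurable_poweR _) (measurable_Lq_slice alpha mf)).
have E t : F2 f t = (poweR (Lq (slice (cut f) t)) q^-1 * poweR (Lq (slice (cut f) t)) q^-1)%E.
  by rewrite /F2 LnormE expe2.
by rewrite (funext E); exact: emeasurable_funM.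
Qed.

Let F2_ge0 f t : (0 <= F2 f t)%E.
Proof. by rewrite /F2 LnormE expe2 mule_ge0// poweR_ge0. Qed.

Let integral_F2 f :
  (\int[lebt]_(t in D) (Lnorm leb q%:E (EFin \o slice f t) ^+ 2) = \int[lebt]_t F2 f t)%E.
Proof.
apply: integral_time => t Dt; rewrite /F2; first by rewrite slice_cut_in.
rewrite slice_cut_out// LnormE Lq0 poweR0r ?expe2 ?mule0//.
by rewrite invr_neq0// gt_eqF.
Qed.

Let energy_T_dif f : measurable_fun setT (cut f) ->
  (energy_T alpha c T f f = (2^-1)%:E * \int[lebt]_t dif_int (slice (cut f) t))%E.
Proof.
move=> mf; have Z := ge0_integralZl lebt measurableT
  (measurable_dif_int_slice c_levy mf) (fun t _ => dif_int_ge0 c_levy (slice (cut f) t)).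
rewrite -Z ?lee_fin ?invr_ge0//; apply: integral_time => t Dt; last by rewrite slice_cut_out// dif_int0 mule0.
have := energyE alpha_gt0 c_levy (measurable_slice t mf).
by rewrite slice_cut_in.
Qed.

Lemma L2Hdot_goodT f : Hdot f -> goodT (cut f).
Proof.
move=> [[mf fq] [_ fE]]; have mc := measurable_cut mf.
split; first exact: mc.
  have : (\int[lebt]_t F2 f t < +oo)%E by rewrite -integral_F2.
  move=> /(ge0_ae_lty (measurable_F2 mc) (F2_ge0 f)); apply: filterS => t.
  rewrite /F2 LnormE; have := Lq_ge0 alpha (slice (cut f) t).
  case: (Lq (slice (cut f) t)) => [r _ _| _|//]; first by rewrite ltry.
  by rewrite poweRyr ?expe2 ?mulyy ?ltxx// invr_neq0// gt_eqF.
split; first exact: measurable_increment3.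
rewrite (integral_dif3 c_levy mc).
rewrite (energy_T_dif mc) in fE.
move: fE; have : (0 <= \int[lebt]_t dif_int (slice (cut f) t))%E.
  by apply: integral_ge0 => t _; exact: (dif_int_ge0 c_levy).
case: (\int[lebt]_t dif_int (slice (cut f) t))%E => [r _ _| |]//; first by rewrite ltry.
by move=> _; rewrite gt0_muley ?lte_fin// ltxx.
Qed.

(** The mixed norm is recovered from the energy: since 2/q = 1 - beta, the squared L^q norm of a
    slice is the quantity whose time integral [sobolevT] bounds. *)
Lemma goodT_L2Hdot f : measurable_fun (QT : set E) f -> goodT (cut f) -> Hdot f.
Proof.
move=> mf fG; have mc := measurable_cut mf; have [_ fq _] := fG.
split; split => //.
  rewrite [X in (X < _)%E]integral_F2.
  have [C C0 CE] := sobolevT alpha_gt0 alpha_ltN c_levy.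
  apply: le_lt_trans (ltry (C * pairT (cut f) (cut f))); apply: le_trans (CE _ fG).
  rewrite le_eqVlt; apply/orP; left; apply/eqP; apply: ae_eq_integral_nomeas.
  apply: filterS fq => t ft _.
  have LE : Lq (slice (cut f) t) = (fine (Lq (slice (cut f) t)))%:E.
    by rewrite fineK// ge0_fin_numE// Lq_ge0.
  rewrite /F2 LnormE LE poweR_EFin expe2 -EFinM /=; congr _%:E.
  rewrite -expr2 -powR_mulrn ?powR_ge0// -powRrM; congr (_ `^ _).
  have n0 : n%:R != 0 :> R by rewrite gt_eqF// (lt_trans alpha_gt0).
  have na0 : n%:R - alpha != 0 by rewrite subr_eq0 gt_eqF.
  by field; rewrite n0 na0.
rewrite energy_T_dif// (pairT_dif_int c_levy fG) -EFinM; exact: ltry.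
Qed.

Lemma L2Hdot_measurable f : Hdot f -> measurable_fun (QT : set E) f.
Proof. by move=> [[]]. Qed.

Let ae_good f : Hdot f -> {ae lebt, forall t, D t -> good (slice f t)}.
Proof.
move=> /L2Hdot_goodT/(goodT_slice c_levy); apply: filterS => t gt Dt.
by rewrite -slice_cut_in.
Qed.

Lemma energy_T_pairT f g : Hdot f -> Hdot g ->
  energy_T alpha c T f g = (2^-1 * pairT (cut f) (cut g))%:E.
Proof.
move=> fH gH; have fG := L2Hdot_goodT fH; have gG := L2Hdot_goodT gH.
have [i <-] := pairT_fubini c_levy fG gG.
transitivity (\int[lebt]_(t in D) (2^-1 * pair (slice (cut f) t) (slice (cut g) t))%:E)%E.
  apply: ae_eq_integral_nomeas; apply: filterS2 (ae_good fH) (ae_good gH) => t ft gt Dt.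
  by rewrite !slice_cut_in// (energy_pair alpha_gt0 c_levy (ft Dt) (gt Dt)).
rewrite (integral_time (G := fun t => (2^-1 * pair (slice (cut f) t) (slice (cut g) t))%:E))//; last first.
  by move=> t Dt; rewrite slice_cut_out// pair0l mulr0.
rewrite (Rintegral_EFin (integrable_scaleR 2^-1 i)); congr _%:E.
by rewrite RintegralZl.
Qed.

(** The factor a^2 comes from the normalisation of two transforms, [energy_cst] from the Fourier
    representation of [pair], which is twice the energy form. *)
Definition form_cst : R := a ^+ 2 * ecst.

Lemma form_cst_gt0 : 0 < form_cst.
Proof. by apply: mulr_gt0; [rewrite exprn_gt0|exact: energy_cst_gt0]. Qed.

Let form_slice f g t := (form_cst * pair (slice (cut f) t) (slice (cut g) t))%:C%C.

Let ae_form f g : Hdot f -> Hdot g ->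
  ae_eq lebt D (fun t => fourier_form_x alpha a b (slice f t) (slice g t)) (form_slice f g).
Proof.
move=> fH gH; apply: filterS2 (ae_good fH) (ae_good gH) => t ft gt Dt.
have [_ _ _ ->] := fourier_form_xE a alpha_gt0 alpha_lt2 alpha_ltN c_levy b0 (ft Dt) (gt Dt).
by rewrite /form_slice !slice_cut_in.
Qed.

Lemma fourier_form_definedP f g : Hdot f -> Hdot g -> fourier_form_defined alpha a b T f g.
Proof.
move=> fH gH; split.
  apply: filterS2 (ae_good fH) (ae_good gH) => t ft gt Dt.
  by have [h1 h2 h3 _] := fourier_form_xE a alpha_gt0 alpha_lt2 alpha_ltN c_levy b0 (ft Dt) (gt Dt).
exists (form_slice f g); last exact: ae_form.
have [i _] := pairT_fubini c_levy (L2Hdot_goodT fH) (L2Hdot_goodT gH).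
split; last exact: integrable0.
have j := integrable_scaleR form_cst i.
exact: (@integrableS _ _ _ lebt setT D _ measurableT (measurable_itv `]0, T[) (@subsetT _ D) j).
Qed.

Lemma fourier_formE f g : Hdot f -> Hdot g ->
  fourier_form alpha a b T f g = (form_cst * pairT (cut f) (cut g))%:C%C.
Proof.
move=> fH gH; rewrite /fourier_form /cintegral /Rintegral; congr Complex.
  rewrite (ae_eq_integral_nomeas (g := fun t => (complex.Re (form_slice f g t))%:E)); last first.
    by apply: filterS (ae_form fH gH) => t h Dt; rewrite h.
  have [i <-] := pairT_fubini c_levy (L2Hdot_goodT fH) (L2Hdot_goodT gH).
  rewrite (integral_time (G := fun t => (form_cst * pair (slice (cut f) t) (slice (cut g) t))%:E))//; last first.
    by move=> t Dt; rewrite slice_cut_out// pair0l mulr0.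
  by rewrite (Rintegral_EFin (integrable_scaleR form_cst i)) /= RintegralZl.
rewrite (ae_eq_integral_nomeas (g := cst 0%E)) ?integral0//.
by apply: filterS (ae_form fH gH) => t h Dt; rewrite h.
Qed.

Let ip f g := complex.Re (fourier_form alpha a b T f g).

Let ipE f g : Hdot f -> Hdot g -> ip f g = form_cst * pairT (cut f) (cut g).
Proof. by move=> fH gH; rewrite /ip fourier_formE. Qed.

Lemma goodT_cst0 : goodT (cst 0).
Proof.
split => //.
  by apply: nearW => t; rewrite (_ : slice _ _ = cst 0)// Lq0 ltry.
split; first by apply: measurable_increment3.
rewrite integral0_eq ?ltry// => p _.
by rewrite /increment3 subrr expr0n/= mul0r.
Qed.

Lemma L2Hdot0 : Hdot (cst 0).
Proof.
apply: goodT_L2Hdot; first exact: measurable_cst.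
rewrite (_ : cut _ = cst 0); first exact: goodT_cst0.
by apply/funext => p; rewrite /cut mul0r.
Qed.

Lemma L2HdotD f g : Hdot f -> Hdot g -> Hdot (f \+ g).
Proof.
move=> fH gH; apply: goodT_L2Hdot.
  exact: measurable_funD (L2Hdot_measurable fH) (L2Hdot_measurable gH).
by rewrite cutD; apply: (goodTD alpha_gt0 alpha_ltN c_levy); exact: L2Hdot_goodT.
Qed.

Lemma L2HdotZ k f : Hdot f -> Hdot (k \*o f).
Proof.
move=> fH; apply: goodT_L2Hdot.
  by apply: measurable_funM; [exact: measurable_cst|exact: L2Hdot_measurable].
by rewrite cutZ; apply: (goodTZ c_levy); exact: L2Hdot_goodT.
Qed.

Lemma L2HdotB f g : Hdot f -> Hdot g -> Hdot (f \- g).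
Proof.
move=> fH /(L2HdotZ (-1)) gH; have := L2HdotD fH gH.
by rewrite (_ : f \+ _ = f \- g)//; apply/funext => p /=; rewrite mulN1r.
Qed.

Lemma L2Hdot_hilbert : hilbert_space Hdot (@ae_eq_QT R n T) ip.
Proof.
have K0 := form_cst_gt0; split.
- exact: L2Hdot0.
- exact: L2HdotD.
- exact: L2HdotZ.
- move=> f f' g fH fH' gH ff'; rewrite !ipE//; congr (_ * _).
  have ae : {ae (leb \x lebt)%E, forall p, cut f p = cut f' p}.
    apply: filterS ff' => p h; have [Sp|Sp] := pselect (QT p); last by rewrite !cut_out.
    by rewrite !cut_in// h.
  apply: Rintegral_ae_eq; apply: filterS (ae_increment3 ae) => p [h1 h2].
  by rewrite /increment3 h1 h2.
- by move=> f g fH gH; rewrite !ipE// pairTC.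
- move=> f g h fH gH hH; rewrite (ipE (L2HdotD fH gH) hH) (ipE fH hH) (ipE gH hH) cutD -mulrDr.
  by congr (_ * _); apply: (pairTDl c_levy); exact: L2Hdot_goodT.
- move=> k f g fH gH; rewrite (ipE (L2HdotZ k fH) gH) (ipE fH gH) cutZ mulrCA.
  by congr (_ * _); apply: (pairTZl c_levy); exact: L2Hdot_goodT.
- by move=> f fH; rewrite ipE// mulr_ge0 ?(ltW K0)//; exact: pairT_ge0.
- move=> f fH; rewrite ipE// => /eqP; rewrite mulf_eq0 (gt_eqF K0)/= => /eqP f0.
  have := pairT_eq0 alpha_gt0 alpha_ltN c_levy (L2Hdot_goodT fH) f0.
  by apply: filterS => p h Sp; rewrite -(cut_in f Sp) h.
move=> u uH ucauchy.
have uB m k : Hdot (u m \- u k) by exact: L2HdotB.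
have [v [vG vS vP]] : exists v, [/\ goodT v, forall p, ~ QT p -> v p = 0 &
  forall e : R, 0 < e -> exists n0 : nat, forall k, (n0 <= k)%N ->
    pairT (fun p => cut (u k) p - v p) (fun p => cut (u k) p - v p) <= e].
  apply: (goodT_complete alpha_gt0 alpha_ltN c_levy).
  - by move=> k; exact: L2Hdot_goodT.
  - exact: measurable_QT.
  - by move=> k p Sp; exact: cut_out.
  (* The Cauchy hypothesis concerns the norm of [ip]; after squaring, the constant [form_cst]
     cancels and [e] bounds [pairT]. *)
  move=> e e0; have e1 : 0 < Num.sqrt (form_cst * e) by rewrite sqrtr_gt0 mulr_gt0.
  have [n0 n0P] := ucauchy _ e1; exists n0 => m k n0m n0k.
  have := n0P m k n0m n0k; rewrite (ipE (uB m k) (uB m k)) cutB ltr_sqrt; last exact: mulr_gt0.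
  by rewrite ltr_pM2l// => /ltW.
have vE : cut v = v.
  by apply/funext => p; have [Sp|Sp] := pselect (QT p); [rewrite cut_in|rewrite cut_out// vS].
have vH : Hdot v.
  apply: goodT_L2Hdot; last by rewrite vE.
  by have [mv _ _] := vG; exact: measurable_funTS.
exists v => //; apply/cvgrPdist_lt => e e0.
have e1 : 0 < e ^+ 2 / (2 * form_cst) by rewrite divr_gt0 ?exprn_gt0// mulr_gt0.
have [n0 n0P] := vP _ e1; exists n0 => // k /= n0k.
have Bk := L2HdotB (uH k) vH.
rewrite sub0r normrN (ger0_norm (sqrtr_ge0 _)) (ipE Bk Bk) cutB vE -[e](gtr0_norm e0) -sqrtr_sqr ltr_sqrt ?exprn_gt0//.
apply: (@le_lt_trans _ _ (form_cst * (e ^+ 2 / (2 * form_cst)))).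
  by rewrite ler_pM2l//; exact: n0P.
have -> : form_cst * (e ^+ 2 / (2 * form_cst)) = e ^+ 2 / 2 by field; rewrite gt_eqF.
by rewrite ltr_pdivrMr// ltr_pMr ?exprn_gt0// ltr1n.
Qed.

End time_slices.

(** * Test functions *)

Section lipschitz_good.
Context {R : realType} {n : nat}.
Variables (alpha c : R).
Hypotheses (alpha_gt0 : 0 < alpha) (alpha_lt2 : alpha < 2) (alpha_ltN : alpha < n%:R)
  (c_levy : @levy_normalization R n alpha c).
Local Notation leb := (lebesgue_rV R n).
Local Notation V := 'rV[R]_n.
Local Notation rho := (@levy_density R n alpha c).
Local Notation Lq := (@Lq R n alpha).
Local Notation q := (2 * n%:R / (n%:R - alpha)).
Local Notation good := (@good R n alpha c).
Local Notation dif_int := (@dif_int R n alpha c).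

Let rho_ge0 := levy_density_ge0 c_levy.
Let mrho := @measurable_levy_density R n alpha c.

(** A smooth stand-in for min(1, |z|^2), whose integral against a Levy measure is finite. *)
Definition cut_sqr (z : V) : R := enorm z ^+ 2 / (1 + enorm z ^+ 2).

Let den_gt0 (z : V) : 0 < 1 + enorm z ^+ 2.
Proof. by rewrite ltr_pwDl// sqr_ge0. Qed.

Lemma cut_sqr_ge0 z : 0 <= cut_sqr z.
Proof. by rewrite /cut_sqr divr_ge0 ?sqr_ge0// ltW. Qed.

Lemma measurable_cut_sqr : measurable_fun setT cut_sqr.
Proof.
have m : measurable_fun setT (fun z : V => enorm z ^+ 2).
  exact: (measurable_funX 2 (measurable_enorm (R := R) (n := n))).
rewrite (_ : cut_sqr = fun z : V => 1 - (1 + enorm z ^+ 2) `^ (-1)).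
  apply: measurable_funB; first exact: measurable_cst.
  apply: (measurableT_comp (@measurable_powR R (-1))).
  by apply: measurable_funD; first exact: measurable_cst.
apply/funext => z; rewrite powRN powRr1 ?(ltW (den_gt0 z))// /cut_sqr.
by have := den_gt0 z; move: (enorm z ^+ 2) => u u0; field; rewrite gt_eqF.
Qed.

Let gauss_defect (z : V) : cut_sqr z <= 1 - gaussN 1 z.
Proof.
rewrite /cut_sqr /gaussN mul1r -sqr_enorm; have := den_gt0 z.
have := sqr_ge0 (enorm z); move: (enorm z ^+ 2) => u u0 u1.
have : expR (- u) <= (1 + u)^-1.
  by rewrite expRN lef_pV2 ?posrE ?expR_gt0//; exact: expR_ge1Dx.
have -> : u / (1 + u) = 1 - (1 + u)^-1 by field; rewrite gt_eqF.
by move=> h; rewrite lerD2l lerN2.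
Qed.

Let riesz_gauss_ge0 (xi : V) : 0 <= enorm xi `^ alpha * gaussN 1 xi.
Proof. by apply: mulr_ge0; [exact: powR_ge0|exact: gaussN_ge0]. Qed.

Let mgd : measurable_fun setT (fun z : V => (1 - gaussN 1 z) * rho z).
Proof.
apply: (measurable_funM (measurable_funB (measurable_cst _) _) mrho).
exact: measurable_gaussN.
Qed.

Let gd_ge0 (z : V) : 0 <= (1 - gaussN 1 z) * rho z.
Proof. by rewrite mulr_ge0 ?subr_ge0 ?gaussN_le1 ?rho_ge0. Qed.

Let gd_le (z : V) : cut_sqr z * rho z <= (1 - gaussN 1 z) * rho z.
Proof. by rewrite ler_wpM2r. Qed.

Let riesz_gauss_le (xi : V) : enorm xi `^ alpha * gaussN 1 xi <= 2 * gaussN 2^-1 xi.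
Proof.
have h : enorm xi `^ alpha <= 1 + enorm xi ^+ 2.
  have [x1|x1] := leP (enorm xi) 1.
    apply: (@le_trans _ _ 1); last by rewrite lerDl sqr_ge0.
    by have := ge0_ler_powR (ltW alpha_gt0) (enorm_ge0 xi) ler01 x1; rewrite powR1.
  apply: (@le_trans _ _ (enorm xi `^ 2)); first by rewrite ler_powR// ltW.
  by rewrite powR_mulrn ?enorm_ge0// lerDr.
apply: (le_trans (ler_wpM2r (gaussN_ge0 _ _) h)).
rewrite /gaussN mul1r -sqr_enorm; have := sqr_ge0 (enorm xi); move: (enorm xi ^+ 2) => u u0.
have -> : expR (- u) = expR (- (2^-1 * u)) * expR (- (2^-1 * u)).
  by rewrite -expRD; congr expR; lra.
rewrite mulrA ler_wpM2r ?expR_ge0// expRN ler_pdivrMr ?expR_gt0//.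
have := expR_ge1Dx (2^-1 * u); lra.
Qed.

(* The symbol of the Levy measure has a finite average against a Gaussian; by
   Tonelli this average is the integral of 1 - exp (- |z|^2), up to a factor. *)
Lemma integrable_levy_cut_sqr :
  leb.-integrable setT (EFin \o (fun z => cut_sqr z * rho z)).
Proof.
have mcr : measurable_fun setT (fun z => cut_sqr z * rho z).
  by apply: measurable_funM; [exact: measurable_cut_sqr|exact: mrho].
have cr0 z : 0 <= cut_sqr z * rho z by rewrite mulr_ge0 ?cut_sqr_ge0.
apply: integrable_lty_ge0 => //.
pose K := Num.sqrt (pi / 1) ^+ n : R.
have K0 : 0 < K by rewrite exprn_gt0// sqrtr_gt0 divr1 pi_gt0.
(* Frequency 2 is chosen because the transform of exp(-|xi|^2) at frequency 2z is the multiple [K]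
   of exp(-|z|^2), the Gaussian that [cut_sqr] is compared with. *)
pose F (p : V * V) := (1 - cos (2 * dotp p.2 p.1)) * rho p.2 * gaussN 1 p.1.
have F0 p : 0 <= F p.
  rewrite /F mulr_ge0 ?gaussN_ge0// mulr_ge0// subr_ge0; exact: cos_le1.
have mF : measurable_fun setT F.
  apply: measurable_funM; last first.
    exact: (measurableT_comp (measurable_gaussN (n := n) 1) measurable_fst).
  apply: measurable_funM; last exact: (measurableT_comp mrho measurable_snd).
  apply: measurable_funB; first exact: measurable_cst.
  have mc : measurable_fun setT (fun p : V * V => cos (2 * dotp p.1 p.2)).
    exact: (measurable_tr_bdotp 2 (@continuous_cos R)).
  exact: (measurableT_comp mc (measurable_fun_pair measurable_snd measurable_fst)).
have i1 (xi : V) : (\int[leb]_z (F (xi, z))%:E = (`|2| `^ alpha * (enorm xi `^ alpha * gaussN 1 xi))%:E)%E.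
  have := levy_symbol 2 alpha_gt0 c_levy xi.
  have mS : measurable_fun setT (fun z : V => (1 - cos (2 * dotp z xi)) * rho z).
    apply: measurable_funM => //; apply: measurable_funB => //.
    exact: (measurable_tr_bdotpl 2 xi (@continuous_cos R)).
  have S0 (z : V) : 0 <= (1 - cos (2 * dotp z xi)) * rho z.
    by rewrite mulr_ge0// subr_ge0; exact: cos_le1.
  have Z := integral_scale_ge0 leb mS (gaussN_ge0 1 xi) S0.
  move=> h; transitivity (\int[leb]_z (gaussN 1 xi * ((1 - cos (2 * dotp z xi)) * rho z))%:E)%E.
    by apply: eq_integral => z _; rewrite /F mulrC.
  by rewrite Z h -EFinM mulrC mulrA.
have i2 (z : V) : (\int[leb]_xi (F (xi, z))%:E = (K * ((1 - gaussN 1 z) * rho z))%:E)%E.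
  have ig := integrable_gaussN n (ltr01 : 0 < (1 : R)).
  have ic : leb.-integrable setT (EFin \o (fun x => cos (2 * dotp z x) * gaussN 1 x)).
    have := integrable_tr_gaussN (2 *: z) (@continuous_cos R) (@cos_norm_le1 R) (ltr01 : 0 < (1 : R)).
    by under eq_fun do rewrite dotpZl.
  have iF : leb.-integrable setT (EFin \o (fun xi => F (xi, z))).
    rewrite (_ : (fun xi => _) = fun xi => rho z * (gaussN 1 xi - cos (2 * dotp z xi) * gaussN 1 xi)).
      by apply: integrable_scaleR; exact: integrable_subR.
    by apply/funext => xi; rewrite /F; ring.
  rewrite (Rintegral_EFin iF); congr _%:E.
  transitivity (\int[leb]_xi (rho z * (gaussN 1 xi - cos (2 * dotp z xi) * gaussN 1 xi))).
    by apply: eq_Rintegral => xi _; rewrite /F; ring.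
  rewrite RintegralZl//; last exact: integrable_subR.
  rewrite RintegralB// (kernE 2 z ltr01) /kern -/K.
  have := integral_gaussN n (ltr01 : 0 < (1 : R)); rewrite (Rintegral_EFin ig) => -[->].
  have -> : 2 ^+ 2 / (4 * 1) = 1 :> R by lra.
  by rewrite -/K; ring.
have T := tonelliC leb leb mF F0.
have : (\int[leb]_xi \int[leb]_z (F (xi, z))%:E < +oo)%E.
  rewrite (_ : (\int[leb]_xi _ = \int[leb]_xi (`|2| `^ alpha * (enorm xi `^ alpha * gaussN 1 xi))%:E)%E); last first.
    by apply: eq_integral => xi _; exact: i1.
  apply: (@le_lt_trans _ _ (\int[leb]_xi (`|2| `^ alpha * (2 * gaussN 2^-1 xi))%:E)%E).
    apply: le_integral_ge0.
    - apply/measurable_EFinP/measurable_funM; first exact: measurable_cst.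
      apply: measurable_funM; last exact: measurable_gaussN.
      exact: (measurableT_comp (@measurable_powR R alpha) (measurable_enorm (R:=R) (n:=n))).
    - apply/measurable_EFinP/measurable_funM; first exact: measurable_cst.
      by apply: measurable_funM; [exact: measurable_cst|exact: measurable_gaussN].
    - by move=> xi; exact: (mulr_ge0 (powR_ge0 _ _) (riesz_gauss_ge0 xi)).
    - by move=> xi; rewrite lee_fin ler_wpM2l ?powR_ge0.
  apply: integral_lty_ge0.
    by move=> xi; exact: (mulr_ge0 (powR_ge0 _ _) (mulr_ge0 (ler0n R 2) (gaussN_ge0 _ _))).
  by do 2 apply: integrable_scaleR; apply: integrable_gaussN; rewrite invr_gt0.
rewrite T (_ : (\int[leb]_z _ = \int[leb]_z (K * ((1 - gaussN 1 z) * rho z))%:E)%E); last first.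
  by apply: eq_integral => z _; exact: i2.
move=> h; apply: (@le_lt_trans _ _ (\int[leb]_z (K^-1 * (K * ((1 - gaussN 1 z) * rho z)))%:E)%E).
  apply: le_integral_ge0.
  - exact/measurable_EFinP.
  - apply/measurable_EFinP/measurable_funM; first exact: measurable_cst.
    exact: (measurable_funM (measurable_cst _) mgd).
  - by move=> z; rewrite lee_fin.
  - by move=> z; rewrite lee_fin (mulKf (lt0r_neq0 K0)); exact: gd_le.
have mg : measurable_fun setT (fun z : V => K * ((1 - gaussN 1 z) * rho z)).
  exact: (measurable_funM (measurable_cst _) mgd).
have g0 (z : V) : 0 <= K * ((1 - gaussN 1 z) * rho z).
  by apply: mulr_ge0; [exact: ltW|exact: gd_ge0].
have Ki : 0 <= K^-1 by rewrite invr_ge0 ltW.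
by rewrite (integral_scale_ge0 leb mg Ki g0) lte_mul_pinfty.
Qed.

(** The energy bound depends only on [C] and [L], so it is uniform over the time slices of one
    function. Small increments use the Lipschitz estimate, large ones the decay, and [cut_sqr]
    measures both. *)
Lemma good_lipschitz (C L : R) : 0 <= C -> 0 <= L -> exists2 K : R, 0 <= K &
  forall g : V -> R, measurable_fun setT g -> (forall x, `|g x| <= C * weight x) ->
  (forall x z, (g (x + z) - g x) ^+ 2 <= L * enorm z ^+ 2 * (weight x + weight (x + z))) ->
  good g /\ (dif_int g <= K%:E)%E.
Proof.
move=> C0 L0; pose v z := cut_sqr z * rho z.
have iv : leb.-integrable setT (EFin \o v) := integrable_levy_cut_sqr.
have mv : measurable_fun setT v by apply/measurable_EFinP; exact: measurable_int iv.
have v0 z : 0 <= v z by rewrite mulr_ge0 ?cut_sqr_ge0.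
have mw := @measurable_weight R n.
pose F (p : V * V) := (L + 2 * C ^+ 2) * (weight p.1 * v p.2 + weight (p.1 + p.2) * v p.2).
have D0 : 0 <= L + 2 * C ^+ 2 by rewrite addr_ge0// mulr_ge0// sqr_ge0.
have m1 : measurable_fun setT (fun p : V * V => weight p.1 * v p.2) by exact: measurable_prodR.
have m2 : measurable_fun setT (fun p : V * V => weight (p.1 + p.2) * v p.2).
  apply: measurable_funM; first exact: measurable_add_fun.
  exact: (measurableT_comp mv measurable_snd).
have p1 (p : V * V) : 0 <= weight p.1 * v p.2 by rewrite mulr_ge0 ?weight_ge0.
have p2 (p : V * V) : 0 <= weight (p.1 + p.2) * v p.2 by rewrite mulr_ge0 ?weight_ge0.
have mF : measurable_fun setT F.
  by apply: measurable_funM; [exact: measurable_cst|exact: measurable_funD].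
have F0 p : 0 <= F p by rewrite mulr_ge0// addr_ge0.
have Foo : (\int[(leb \x leb)%E]_p (F p)%:E < +oo)%E.
  rewrite (integral_scale_ge0 _ (measurable_funD m1 m2) D0); last first.
    by move=> p /=; rewrite addr_ge0.
  rewrite lte_mul_pinfty// (integral_add_ge0 _ m1 m2 p1 p2) lte_add_pinfty//.
    apply: integral_lty_ge0 => //; apply: integrable_prodR => //; exact: integrable_weight.
  rewrite (tonelliE leb leb m2 p2) (integral_rV_sqr_shift mw mv (@weight_ge0 R n) v0).
  rewrite (Rintegral_EFin (integrable_weight n)) (Rintegral_EFin iv) -EFinM; exact: ltry.
have F1 : (0 <= \int[(leb \x leb)%E]_p (F p)%:E)%E.
  by apply: integral_ge0 => p _; rewrite lee_fin.
exists (fine (\int[(leb \x leb)%E]_p (F p)%:E)); first exact: fine_ge0.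
move=> g mg gC gL; rewrite fineK ?ge0_fin_numE//.
have le : (dif_int g <= \int[(leb \x leb)%E]_p (F p)%:E)%E.
  apply: le_integral_ge0.
  - by apply/measurable_EFinP; exact: measurable_dif.
  - exact/measurable_EFinP.
  - by move=> p; rewrite lee_fin (dif_ge0 c_levy).
  move=> [x z]; rewrite lee_fin /dif /F /=.
  have -> : (L + 2 * C ^+ 2) * (weight x * v z + weight (x + z) * v z) =
      (L + 2 * C ^+ 2) * (weight x + weight (x + z)) * cut_sqr z * rho z by rewrite /v; ring.
  apply: ler_wpM2r => //.
  have h1 := gL x z; have e0 := sqr_ge0 (enorm z); have e1 := den_gt0 z.
  have h2 : (g (x + z) - g x) ^+ 2 <= 2 * C ^+ 2 * (weight x + weight (x + z)).
    have S y : g y ^+ 2 <= C ^+ 2 * weight y.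
      rewrite -(real_normK (num_real (g y))); apply: (@le_trans _ _ ((C * weight y) ^+ 2)).
        by rewrite lerXn2r ?nnegrE// mulr_ge0 ?weight_ge0.
      rewrite exprMn ler_wpM2l ?sqr_ge0// expr2 ler_piMr ?weight_ge0//; exact: weight_le1.
    apply: le_trans (sqrD_le _ _) _; rewrite sqrrN.
    by have := S x; have := S (x + z); lra.
  (* With u = |z|^2, w the sum of weights and d the squared increment, d <= L u w and d <= 2 C^2 w
     combine to d (1 + u) <= (L + 2 C^2) u w. *)
  rewrite /cut_sqr mulrA ler_pdivlMr// mulrDr mulr1.
  have w0 : 0 <= weight x + weight (x + z) by rewrite addr_ge0 ?weight_ge0.
  move: h1 h2 w0; move: (weight x + weight (x + z)) ((g (x + z) - g x) ^+ 2) (enorm z ^+ 2) e0 e1 (C ^+ 2).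
  move=> w d u u0 u1 C2 h1 h2 w0; have := ler_wpM2r u0 h2; nra.
split=> //; split => //; last exact: le_lt_trans Foo.
have q1 : 1 <= q by have := sobolev_exponent_gt2 alpha_gt0 alpha_ltN; lra.
apply: (@le_lt_trans _ _ (\int[leb]_x (C `^ q * weight x)%:E)%E).
  apply: le_integral_ge0.
  - by apply/measurable_EFinP; exact: measurable_powq.
  - by apply/measurable_EFinP/measurable_funM; first exact: measurable_cst.
  - by move=> x; rewrite lee_fin powR_ge0.
  move=> x; rewrite lee_fin; apply: (@le_trans _ _ ((C * weight x) `^ q)).
    apply: (ge0_ler_powR (le_trans ler01 q1)) (gC x); rewrite nnegrE//.
    by apply: mulr_ge0 => //; exact: weight_ge0.
  rewrite powRM ?weight_ge0// ler_wpM2l ?powR_ge0// -[leRHS]powRr1 ?weight_ge0//.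
  by rewrite ger_powR// weight_gt0 weight_le1.
apply: integral_lty_ge0; last by apply: integrable_scaleR; exact: integrable_weight.
by move=> x; rewrite mulr_ge0 ?powR_ge0 ?weight_ge0.
Qed.

End lipschitz_good.

Section compact_support_bounds.
Context {R : realType} {n : nat}.
Local Notation V := 'rV[R]_n.
Local Notation W := (V * R)%type.

Lemma coord_norm (x : V) i : `|x ord0 i| <= `|x|.
Proof.
by rewrite [leRHS]mx_normrE (le_trans _ (le_bigmax 0 (fun ij => `|x ij.1 ij.2|) (ord0, i))).
Qed.

(** The increment is telescoped along the coordinate directions, each step being at most |z|. *)
Lemma lipschitz_coords (g : V -> R) C : 0 <= C ->
  (forall i x (s : R), `|g (s *: delta_mx ord0 i + x) - g x| <= C * `|s|) ->
  forall x z, `|g (x + z) - g x| <= C * (n%:R * enorm z).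
Proof.
move=> C0 gC x z.
have P r : `|g (\sum_(i <- r) z ord0 i *: delta_mx ord0 i + x) - g x| <=
    C * \sum_(i <- r) `|z ord0 i|.
  elim: r => [|i r IH]; first by rewrite !big_nil add0r subrr normr0 mulr0.
  rewrite !big_cons -addrA mulrDr.
  set y := (\sum_(j <- r) _ + x) in IH *.
  by rewrite -(subrKA (g y)) (le_trans (ler_normD _ _))// lerD// gC.
have -> : x + z = \sum_(i < n) z ord0 i *: delta_mx ord0 i + x.
  by rewrite addrC -row_sum_delta.
apply: le_trans (P _) _; rewrite ler_wpM2l//.
apply: (@le_trans _ _ (\sum_(i < n) enorm z)).
  by apply: ler_sum => i _; exact: coord_enorm.
by rewrite sumr_const card_ord mulr_natl.
Qed.

Lemma compact_weight_bound (K : set W) : compact K ->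
  exists2 w0 : R, 0 < w0 & forall x t, K (x, t) -> w0 <= weight x.
Proof.
move=> /compact_bounded [M [_ MP]].
have M1 : M < `|M| + 1 by rewrite (le_lt_trans (ler_norm M))// ltrDl.
have B x t i : K (x, t) -> `|x ord0 i| <= `|M| + 1.
  move=> /(MP _ M1) /=; rewrite prod_normE ge_max => /andP[/= h _].
  exact: le_trans (coord_norm x i) h.
exists (\prod_(i < n) (1 + (`|M| + 1) ^+ 2)^-1).
  by apply: prodr_gt0 => i _; rewrite invr_gt0 ltr_pwDl// sqr_ge0.
move=> x t Kx; apply: ler_prod => i _.
have D (s : R) : 0 < 1 + s ^+ 2 by rewrite ltr_pwDl// sqr_ge0.
rewrite invr_ge0 (ltW (D _))/= lef_pV2 ?posrE//.
by rewrite lerD2l -(real_normK (num_real (x ord0 i))) lerXn2r ?nnegrE ?addr_ge0// (B x t).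
Qed.

Lemma smooth_compact_bounds (f : W -> R) (K : set W) : smooth f -> compact K ->
  (forall p, ~ K p -> f p = 0) -> exists C L, [/\ 0 <= C, 0 <= L,
    forall x t, `|f (x, t)| <= C * weight x &
    forall x z t, (f (x + z, t) - f (x, t)) ^+ 2 <=
      L * enorm z ^+ 2 * (weight x + weight (x + z))].
Proof.
move=> sf kK f0; have [w0 w00 wP] := compact_weight_bound kK.
have [C0 C00 CP] := iter_derive_bounded [::] kK f0 sf.
have /choice[L_ LP] : forall i : 'I_n, exists L : R, 0 <= L /\
    forall p, `|'D_((delta_mx ord0 i, 0) : W) f p| <= L.
  move=> i; have [L L0 LP] := iter_derive_bounded [:: (delta_mx ord0 i, 0) : W] kK f0 sf.
  by exists L.
pose L0 := \sum_i L_ i.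
have L00 : 0 <= L0 by apply: sumr_ge0 => i _; exact: (LP i).1.
have lip x z t : `|f (x + z, t) - f (x, t)| <= L0 * (n%:R * enorm z).
  apply: (lipschitz_coords (g := fun x => f (x, t)) L00) => i y s.
  have [_ df] := sf [::].
  have b p : `|'D_((delta_mx ord0 i, 0) : W) f p| <= L0.
    apply: le_trans ((LP i).2 p) _; rewrite /L0 (bigD1 i)//= lerDl.
    by apply: sumr_ge0 => j _; exact: (LP j).1.
  have := lipschitz_line (df _) b (y, t) s.
  rewrite (_ : s *: ((delta_mx ord0 i, 0) : W) + (y, t) = (s *: delta_mx ord0 i + y, t))//.
  transitivity (s *: delta_mx ord0 i + y, s *: (0 : R) + t); first by [].
  by rewrite scaler0 add0r.
exists (C0 / w0), (L0 ^+ 2 * n%:R ^+ 2 / w0); split.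
- by rewrite divr_ge0// ltW.
- by rewrite divr_ge0 ?(ltW w00)// mulr_ge0 ?sqr_ge0.
- move=> x t; have [Kx|Kx] := pselect (K (x, t)); last first.
    by rewrite f0// normr0 mulr_ge0 ?weight_ge0// divr_ge0// ltW.
  apply: le_trans (CP _) _; rewrite mulrAC ler_pdivlMr// ler_wpM2l//; exact: wP Kx.
move=> x z t.
have w2 : 0 <= weight x + weight (x + z) by rewrite addr_ge0 ?weight_ge0.
have [[Kx Kz]|w1] : (~ K (x, t) /\ ~ K (x + z, t)) \/ w0 <= weight x + weight (x + z).
  have [Kx|Kx] := pselect (K (x, t)).
    by right; rewrite (le_trans (wP _ _ Kx))// lerDl weight_ge0.
  have [Kz|Kz] := pselect (K (x + z, t)); last by left.
  by right; rewrite (le_trans (wP _ _ Kz))// lerDr weight_ge0.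
- rewrite !f0// subrr expr0n/= mulr_ge0// mulr_ge0 ?sqr_ge0//.
  by rewrite divr_ge0 ?(ltW w00)// mulr_ge0 ?sqr_ge0.
rewrite -(real_normK (num_real (f _ - _))).
apply: (@le_trans _ _ ((L0 * (n%:R * enorm z)) ^+ 2)).
  by rewrite lerXn2r ?nnegrE ?lip// mulr_ge0// mulr_ge0 ?enorm_ge0.
rewrite !exprMn mulrA; have A0 : 0 <= L0 ^+ 2 * n%:R ^+ 2 * enorm z ^+ 2.
  exact: (mulr_ge0 (mulr_ge0 (sqr_ge0 _) (sqr_ge0 _)) (sqr_ge0 _)).
rewrite (_ : _ / w0 * _ * _ = L0 ^+ 2 * n%:R ^+ 2 * enorm z ^+ 2 * ((weight x + weight (x + z)) / w0)).
  by rewrite ler_peMr// ler_pdivlMr// mul1r.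
by move: (weight x + _) => w; field; rewrite gt_eqF.
Qed.

Lemma test_fun0 T : @test_fun R n T (cst 0).
Proof.
have E : [set p : W | (cst 0 p : R) != 0] = set0.
  by apply/seteqP; split => // p /=; rewrite eqxx.
split; rewrite ?E ?closure0//; last exact: compact0.
have Z vs : iter_derive (fun _ : W => 0 : R) vs = cst 0.
  by elim: vs => [//|v vs /= ->]; apply/funext => x; exact: derive_cst.
by move=> vs; rewrite Z; split=> [|v x]; [exact: cst_continuous|exact: derivable_cst].
Qed.

Lemma test_fun_comb T k f g : @test_fun R n T f -> @test_fun R n T g ->
  @test_fun R n T (fun p => f p + k * g p).
Proof.
move=> [sf kf fT] [sg kg gT].
have S : closure [set p : W | f p + k * g p != 0] `<=`
    closure [set p | f p != 0] `|` closure [set p | g p != 0].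
  rewrite -closureU; apply: closure_subset => p /=.
  have [->|] := eqVneq (f p) 0; last by left.
  have [->|] := eqVneq (g p) 0; last by right.
  by rewrite mulr0 addr0 eqxx.
split; first exact: smooth_comb.
- apply: subclosed_compact S; first exact: closed_closure.
  exact: compactU.
- by move=> p /S[/fT|/gT].
Qed.

End compact_support_bounds.

Section test_functions.
Context {R : realType} {n : nat}.
Variables (alpha c : R).
Hypotheses (alpha_gt0 : 0 < alpha) (alpha_lt2 : alpha < 2) (alpha_ltN : alpha < n%:R)
  (c_levy : @levy_normalization R n alpha c).
Variable T : R.
Hypothesis T_gt0 : 0 < T.
Local Notation leb := (lebesgue_rV R n).
Local Notation lebt := (@lebesgue_measure R).
Local Notation V := 'rV[R]_n.
Local Notation TR := (measurableTypeR R).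
Local Notation E := (V * TR)%type.
Local Notation good := (@good R n alpha c).
Local Notation goodT := (@goodT R n alpha c).
Local Notation dif_int := (@dif_int R n alpha c).
Local Notation D := (`]0, T[%classic : set TR).
Local Notation QT := (@QT R n T).
Local Notation Hdot := (@L2Hdot R n alpha c T).

(** Assumes bounds uniform in time and no decay in time: besides test functions it must cover
    time-independent mollifiers, which the finite interval makes admissible. *)
Lemma L2Hdot_lipschitz (f : V * R -> R) C L : 0 <= C -> 0 <= L ->
  measurable_fun (setT : set E) f -> (forall x t, `|f (x, t)| <= C * weight x) ->
  (forall x z t, (f (x + z, t) - f (x, t)) ^+ 2 <= L * enorm z ^+ 2 * (weight x + weight (x + z))) ->
  Hdot f.
Proof.
move=> C0 L0 mf fC fL.
have [K K0 KP] := good_lipschitz alpha_gt0 alpha_lt2 alpha_ltN c_levy C0 L0.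
have gS t : good (slice f t) /\ (dif_int (slice f t) <= K%:E)%E.
  apply: KP => [|x|x z]; [exact: measurable_slice|exact: fC|exact: fL].
have mfT : measurable_fun (QT : set E) f by exact: measurable_funTS.
have mc := measurable_cut mfT.
have d0 : dif_int (cst 0 : V -> R) = 0%E by apply: (dif_int_ae0 c_levy) => //; exact: nearW.
apply: goodT_L2Hdot => //; split; first exact: mc.
  apply: nearW => t; have [Dt|Dt] := pselect (D t).
    by rewrite slice_cut_in//; have [[]] := gS t.
  rewrite slice_cut_out// (_ : Lq _ _ = 0%E) ?ltry//.
  apply: integral0_eq => x _; rewrite normr0 powR0// gt_eqF//.
  by apply: lt_trans (sobolev_exponent_gt2 alpha_gt0 alpha_ltN).
split; first exact: measurable_increment3.
rewrite (integral_dif3 c_levy mc).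
apply: (@le_lt_trans _ _ (\int[lebt]_t (K * \1_D t)%:E)%E).
  apply: le_integral_ge0.
  - exact: (measurable_dif_int_slice c_levy mc).
  - apply/measurable_EFinP/measurable_funM; first exact: measurable_cst.
    by apply: measurable_indic; exact: measurable_itv.
  - by move=> t; exact: (dif_int_ge0 c_levy).
  - move=> t; have [Dt|Dt] := pselect (D t).
      by rewrite slice_cut_in// indicE mem_set// mulr1; exact: (gS t).2.
    by rewrite slice_cut_out// d0 indicE memNset// mulr0.
rewrite integral_scale_ge0//.
rewrite integral_indic ?setIT//.
have := lebesgue_measure_itv (`]0, T[ : interval R).
rewrite /= lte_fin T_gt0 sube0 => DT.
by rewrite [X in (_ * X)%E]DT -EFinM ltry.
Qed.

Lemma test_fun_L2Hdot : @test_fun R n T `<=` Hdot.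
Proof.
move=> f [sf kf _]; have f0 p : ~ closure [set p | f p != 0] p -> f p = 0.
  by move=> h; apply: contrapT => /eqP fp; apply: h; exact: subset_closure.
have [C [L [C0 L0 fC fL]]] := smooth_compact_bounds sf kf f0.
apply: (L2Hdot_lipschitz C0 L0) => //.
by apply: continuous_measurable_rVR; have [] := sf [::].
Qed.

End test_functions.

(** * Density *)

Section orthogonal_density.
Context {R : realType} {X : Type}.
Variables (V A : set (X -> R)) (eqv : (X -> R) -> (X -> R) -> Prop)
  (ip : (X -> R) -> (X -> R) -> R).
Hypothesis VH : hilbert_space V eqv ip.
Hypotheses (AV : A `<=` V) (A0 : A (cst 0))
  (A_comb : forall k f g, A f -> A g -> A (fun x => f x + k * g x)).
Implicit Types f g h : X -> R.

Let VD f g : V f -> V g -> V (f \+ g). Proof. exact: (hilbertD VH). Qed.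
Let VZ k f : V f -> V (k \*o f). Proof. exact: (hilbertZ VH). Qed.

Let subE f g : f \- g = f \+ (-1) \*o g.
Proof. by apply/funext => x /=; rewrite mulN1r. Qed.

Let VB f g : V f -> V g -> V (f \- g).
Proof. by move=> fV gV; rewrite subE; apply: VD => //; exact: VZ. Qed.

Let ip_comb k f g h : V f -> V g -> V h -> ip (f \+ k \*o g) h = ip f h + k * ip g h.
Proof. by move=> fV gV hV; rewrite (ipDl VH) ?(ipZl VH)//; exact: VZ. Qed.

Let ip_sqr k f g : V f -> V g ->
  ip (f \+ k \*o g) (f \+ k \*o g) = ip f f + 2 * k * ip f g + k ^+ 2 * ip g g.
Proof.
move=> fV gV; have cV : V (f \+ k \*o g) by apply: VD => //; exact: VZ.
rewrite ip_comb// (ipC VH fV cV) (ipC VH gV cV) !ip_comb// (ipC VH gV fV); ring.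
Qed.

Let discriminant (p e m : R) : 0 <= m -> (forall k, 2 * k * p <= e + k ^+ 2 * m) -> p ^+ 2 <= e * m.
Proof.
rewrite le_eqVlt => /orP[/eqP <-|m0] h.
  have [->|p0] := eqVneq p 0; first by rewrite expr0n/= mulr0.
  (* For m = 0 and p nonzero, the hypothesis at this k would read e + 1 <= e. *)
  have := h ((e + 1) / (2 * p)); rewrite mulr0 addr0.
  by rewrite (_ : 2 * _ * p = e + 1); [lra|field].
have := h (p / m); rewrite (_ : 2 * (p / m) * p = 2 * (p ^+ 2 / m)); last by field; rewrite gt_eqF.
rewrite (_ : (p / m) ^+ 2 * m = p ^+ 2 / m); last by field; rewrite gt_eqF.
by move=> h'; rewrite -ler_pdivrMr//; lra.
Qed.

Let cauchy_schwarz f g : V f -> V g -> ip f g ^+ 2 <= ip f f * ip g g.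
Proof.
move=> fV gV; apply: discriminant; first exact: (ip_ge0 VH gV).
move=> k; have cV : V (f \+ (- k) \*o g) by apply: VD => //; exact: VZ.
by have := ip_ge0 VH cV; rewrite ip_sqr//; lra.
Qed.

Let gap_le (m a b x y : R) : 0 < m -> a ^+ 2 <= x * m -> b ^+ 2 <= y * m ->
  m ^+ 2 <= 2 * b ^+ 2 + 2 * a ^+ 2 -> m <= 2 * (x + y).
Proof. by move=> m0 ax by_ h; rewrite -(ler_pM2r m0) -expr2 mulrDr mulrDl; lra. Qed.

(* A minimising sequence for the distance from f to A converges, and f minus its
   limit is orthogonal to A. *)
Lemma orthogonal_dense :
  (forall h, V h -> (forall g, A g -> ip h g = 0) -> ip h h = 0) -> ip_dense V A ip.
Proof.
move=> orth; split=> // f e fV e0.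
pose S := [set ip (f \- g) (f \- g) | g in A].
have Slb : lbound S 0 by move=> _ [g gA <-]; apply: (ip_ge0 VH); apply: VB => //; exact: AV.
have Sinf : has_inf S by split; [exists (ip (f \- cst 0) (f \- cst 0)), (cst 0)|exists 0].
set d := inf S; have dle g : A g -> d <= ip (f \- g) (f \- g).
  by move=> gA; apply: ge_inf; [exists 0|exists g].
(* Perturbing an almost-minimiser [g] in the direction [h] cannot lower the distance below [d], so
   the quadratic in k has a bounded discriminant: f - g is almost orthogonal to A. *)
have key g h (eps : R) : A g -> A h -> ip (f \- g) (f \- g) <= d + eps ->
    ip (f \- g) h ^+ 2 <= eps * ip h h.
  move=> gA hA ge; have gV := AV gA; have hV := AV hA.
  apply: discriminant; first exact: (ip_ge0 VH).
  move=> k; have := dle _ (A_comb k gA hA).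
  have -> : f \- (fun x => g x + k * h x) = (f \- g) \+ (- k) \*o h.
    by apply/funext => x /=; ring.
  by rewrite ip_sqr//; [lra|exact: VB].
have /choice[g_ gP] : forall k : nat, exists g, A g /\ ip (f \- g) (f \- g) <= d + k.+1%:R^-1.
  move=> k; have k0 : 0 < k.+1%:R^-1 :> R by rewrite invr_gt0.
  have [_ [g gA <-] h] := inf_adherent k0 Sinf.
  by exists g; split => //; exact: ltW.
have gV k : V (g_ k) := AV (gP k).1.
have gB m k : ip (g_ m \- g_ k) (g_ m \- g_ k) <= 2 * (m.+1%:R^-1 + k.+1%:R^-1).
  set h := g_ m \- g_ k.
  have hA : A h.
    rewrite /h (_ : _ \- _ = fun x => g_ m x + (-1) * g_ k x); last exact: subE.
    by apply: A_comb; exact: (gP _).1.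
  have hV := AV hA; have h0 := ip_ge0 VH hV.
  have k1 := key _ _ _ (gP m).1 hA (gP m).2; have k2 := key _ _ _ (gP k).1 hA (gP k).2.
  (* The difference h of two almost-minimisers is itself a direction in A, so almost orthogonality
     of both residuals to [h] bounds the norm of [h]. *)
  have E : ip h h = ip (f \- g_ k) h - ip (f \- g_ m) h.
    have -> : ip h h = ip ((f \- g_ k) \+ (-1) \*o (f \- g_ m)) h.
      by congr ip; apply/funext => x; rewrite /h /=; ring.
    by rewrite ip_comb ?mulN1r//; exact: VB.
  have [->|hn0] := eqVneq (ip h h) 0; first by rewrite mulr_ge0// addr_ge0// invr_ge0.
  have hp : 0 < ip h h by rewrite lt_def hn0.
  have := sqrD_le (ip (f \- g_ k) h) (- ip (f \- g_ m) h); rewrite -E sqrrN => s2.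
  exact: gap_le hp k1 k2 s2.
have [v vV vP] : exists2 v, V v & Num.sqrt (ip (g_ k \- v) (g_ k \- v)) @[k --> \oo] --> (0 : R).
  apply: (hilbert_complete VH) => // eps eps0.
  have [n0 _ n0P] := near_infty_natSinv_lt (PosNum (divr_gt0 (exprn_gt0 2 eps0) (ltr0Sn R 3))).
  exists n0 => m k n0m n0k; rewrite -[ltRHS](gtr0_norm eps0) -sqrtr_sqr ltr_sqrt ?exprn_gt0//.
  apply: le_lt_trans (gB m k) _.
  have := n0P _ n0m; have := n0P _ n0k; rewrite /=.
  by move: m.+1%:R^-1 k.+1%:R^-1 (eps ^+ 2) => x y u; lra.
pose N k := ip (g_ k \- v) (g_ k \- v).
have N0 : N k @[k --> \oo] --> (0 : R).
  have L := cvgM vP vP; rewrite mulr0 in L.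
  rewrite (_ : N = fun k => Num.sqrt (ip (g_ k \- v) (g_ k \- v)) *
                            Num.sqrt (ip (g_ k \- v) (g_ k \- v))); first exact: L.
  apply/funext => k; rewrite -expr2 sqr_sqrtr//; apply: (ip_ge0 VH); exact: VB.
have wV : V (f \- v) by exact: VB.
have worth : ip (f \- v) (f \- v) = 0.
  apply: orth => // h hA; have hV := AV hA; have h0 := ip_ge0 VH hV.
  apply/eqP; rewrite -sqrf_eq0; apply/eqP/le_anti/andP; split; last exact: sqr_ge0.
  have L : 2 * (k.+1%:R^-1 * ip h h) + 2 * (N k * ip h h) @[k --> \oo] --> (0 : R).
    rewrite [X in _ --> X](_ : 0 = 2 * (0 * ip h h) + 2 * (0 * ip h h)); last by ring.
    apply: cvgD; apply: cvgM; [exact: cvg_cst| |exact: cvg_cst|].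
      by apply: cvgM; [exact: (@cvg_harmonic R)|exact: cvg_cst].
    by apply: cvgM; [exact: N0|exact: cvg_cst].
  rewrite -(cvg_lim (@Rhausdorff R) L); apply: limr_ge; first exact: cvgP L.
  apply: nearW => k.
  have -> : ip (f \- v) h = ip (f \- g_ k) h + ip (g_ k \- v) h.
    rewrite -(ipDl VH (VB fV (gV k)) (VB (gV k) vV) hV).
    by congr ip; apply/funext => x /=; ring.
  apply: le_trans (sqrD_le _ _) _; rewrite lerD// ler_wpM2l//.
    by apply: key => //; [exact: (gP k).1|exact: (gP k).2].
  by apply: cauchy_schwarz => //; exact: VB.
have e2 : 0 < e ^+ 2 by rewrite exprn_gt0.
have [k _ kP] : \forall k \near \oo, N k < e ^+ 2 by exact: (cvgr_lt _ N0).
exists (g_ k); first exact: (gP k).1.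
rewrite -[ltRHS](gtr0_norm e0) -sqrtr_sqr ltr_sqrt//.
(* The residual f - v has norm zero, so by Cauchy-Schwarz the cross term drops out and the distance
   from f to [g_ k] is the distance from v to [g_ k]. *)
have -> : f \- g_ k = (f \- v) \+ (-1) \*o (g_ k \- v).
  by apply/funext => x /=; ring.
rewrite (ip_sqr (-1) wV (VB (gV k) vV)) worth; have := cauchy_schwarz wV (VB (gV k) vV).
rewrite worth mul0r => h; have : ip (f \- v) (g_ k \- v) ^+ 2 = 0.
  by apply/le_anti/andP; split => //; exact: sqr_ge0.
move=> /eqP; rewrite sqrf_eq0 => /eqP ->; rewrite mulr0 add0r add0r sqrrN expr1n mul1r.
by have := kP k (leqnn k).
Qed.

End orthogonal_density.

Section tensor_bumps.
Context {R : realType} {n : nat}.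
Local Notation V := 'rV[R]_n.
Local Notation W := (V * R)%type.

Definition bump_time (j p q t : R) : R := flat 0 (j * (t - p)) * flat 0 (j * (q - t)).

Lemma bump_time_ge0 j p q t : 0 <= bump_time j p q t.
Proof. by rewrite mulr_ge0 ?flat_ge0. Qed.

Lemma bump_time_le1 j p q t : bump_time j p q t <= 1.
Proof. by rewrite mulr_ile1 ?flat_ge0 ?flat0_le1. Qed.

Lemma bump_time_cvg p q t :
  bump_time m%:R p q t @[m --> \oo] --> ((p < t < q)%R%:R : R).
Proof.
rewrite (_ : _%:R = (if 0 < t - p then 1 else 0) * (if 0 < q - t then 1 else 0)).
  by apply: cvgM; exact: flat0_cvg.
by rewrite !subr_gt0; case: (p < t); case: (t < q); rewrite ?mulr1 ?mulr0.
Qed.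

(** Tensor products in space and time are the only test functions on which orthogonality will be
    evaluated. *)
Definition bumpT j p0 q0 p q (w : W) : R := bump 1 p q w.1 * bump_time j p0 q0 w.2.

Lemma bumpT_algebra j p0 q0 p q : flat_algebra (bumpT j p0 q0 p q).
Proof.
have c2 : continuous (snd : W -> R) by move=> w; exact: cvg_snd.
apply: flat_algebraM.
  apply: (@flat_algebra_comp R W V fst fst) (bump_algebra 1 p q) => //.
  by move=> w; exact: cvg_fst.
apply: flat_algebraM.
  apply: (@flat_algebra_flat R W 0 (fun w : W => j * (w.2 - p0)) (fun w => j * w.2)).
    by apply: continuous_scaleR; apply: continuous_subR.
  by move=> h v x /=; rewrite /GRing.scale /=; ring.
apply: (@flat_algebra_flat R W 0 (fun w : W => j * (q0 - w.2)) (fun w => - j * w.2)).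
  by apply: continuous_scaleR; apply: continuous_rsubR.
by move=> h v x /=; rewrite /GRing.scale /=; ring.
Qed.

Lemma bump_time_eq0 j p q t : 0 <= j -> ~ (p <= t <= q) -> bump_time j p q t = 0.
Proof.
move=> j0 /negP; rewrite negb_and -!ltNge => /orP[h|h]; rewrite /bump_time.
  by rewrite (@flat_eq0 _ _ (j * (t - p))) ?mul0r// mulr_ge0_le0// subr_le0 ltW.
by rewrite (@flat_eq0 _ _ (j * (q - t))) ?mulr0// mulr_ge0_le0// subr_le0 ltW.
Qed.

Definition bumpT_support (p0 q0 : R) p q : set W := closed_box p q `*` `[p0, q0]%classic.

Lemma compact_bumpT_support p0 q0 p q : compact (bumpT_support p0 q0 p q).
Proof. by apply: compact_setX; [exact: compact_closed_box|exact: segment_compact]. Qed.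

Lemma bumpT_eq0 j p0 q0 p q w : 0 <= j -> ~ bumpT_support p0 q0 p q w -> bumpT j p0 q0 p q w = 0.
Proof.
move=> j0 h; rewrite /bumpT; have [xb|xb] := pselect (closed_box p q w.1); last first.
  by rewrite bump_eq0 ?mul0r// => /box_closed_box.
by rewrite bump_time_eq0 ?mulr0// => tb; apply: h; split.
Qed.

Lemma bumpT_test_fun T j p0 q0 p q : 0 <= j -> q0 < T -> @test_fun R n T (bumpT j p0 q0 p q).
Proof.
move=> j0 qT; pose K := bumpT_support p0 q0 p q.
have kK : compact K := @compact_bumpT_support p0 q0 p q.
have cK : closed K by apply: compact_closed => //; exact: norm_hausdorff.
have S : closure [set w | bumpT j p0 q0 p q w != 0] `<=` K.
  rewrite [X in _ `<=` X]((closure_id K).1 cK); apply: closure_subset => w /= /eqP w0.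
  by apply: contrapT => h; apply: w0; exact: bumpT_eq0.
split; first exact/flat_algebra_smooth/bumpT_algebra.
- by apply: subclosed_compact kK S; exact: closed_closure.
- by move=> w /S[_ /=]; rewrite in_itv/= => /andP[_ h]; exact: le_lt_trans h qT.
Qed.

(** The spatial bump is the slice at t = 0 of a space-time bump divided by the positive time factor
    there, so the bounds for compactly supported functions on space-time carry over. *)
Lemma bump_bounds p q : exists C L : R, [/\ 0 <= C, 0 <= L,
  forall x : V, `|bump 1 p q x| <= C * weight x &
  forall x z : V, (bump 1 p q (x + z) - bump 1 p q x) ^+ 2 <=
    L * enorm z ^+ 2 * (weight x + weight (x + z))].
Proof.
have f0 w : ~ bumpT_support (-1) 1 p q w -> bumpT 1 (-1) 1 p q w = 0 by exact: bumpT_eq0.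
have [C [L [C0 L0 Cb Lb]]] := smooth_compact_bounds
  (flat_algebra_smooth (bumpT_algebra 1 (-1) 1 p q)) (@compact_bumpT_support (-1) 1 p q) f0.
pose s : R := bump_time 1 (-1) 1 0.
have s0 : 0 < s by rewrite mulr_gt0// flat_gt0// mul1r ?subr0// opprK add0r.
have E x : bump 1 p q x = bumpT 1 (-1) 1 p q (x, 0) / s by rewrite /bumpT mulfK// gt_eqF.
exists (C / s), (L / s ^+ 2); split.
- by rewrite divr_ge0// ltW.
- by rewrite divr_ge0// sqr_ge0.
- by move=> x; rewrite E normrM (gtr0_norm (_ : 0 < s^-1)) ?invr_gt0// mulrAC ler_pM2r ?invr_gt0.
move=> x z; rewrite !E -mulrBl exprMn exprVn; have := Lb x z 0.
move: (bumpT _ _ _ _ _ _ - _) (weight x + _) (enorm z) => d w e h.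
rewrite (_ : L / s ^+ 2 * e ^+ 2 * w = (L * e ^+ 2 * w) / s ^+ 2); last by ring.
by rewrite ler_pM2r// invr_gt0 exprn_gt0.
Qed.

End tensor_bumps.

Section Rintegral_sums.
Context {d} {X : measurableType d} {R : realType}.
Variable mu : {measure set X -> \bar R}.
Implicit Types f g : X -> R.

Lemma Rintegral_sum4 f1 f2 f3 f4 :
  mu.-integrable setT (EFin \o f1) -> mu.-integrable setT (EFin \o f2) ->
  mu.-integrable setT (EFin \o f3) -> mu.-integrable setT (EFin \o f4) ->
  (\int[mu]_x f1 x - \int[mu]_x f2 x) + (\int[mu]_x f3 x + \int[mu]_x f4 x) =
  \int[mu]_x ((f1 x - f2 x) + (f3 x + f4 x)).
Proof.
move=> i1 i2 i3 i4; rewrite -RintegralB// -RintegralD// -RintegralD//.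
- exact: integrable_subR.
- exact: integrable_addR.
Qed.

Lemma Rintegral_ae0 f : {ae mu, forall x, f x = 0} -> \int[mu]_x f x = 0.
Proof. by move=> /(Rintegral_ae_eq (g := cst 0)) ->; rewrite /Rintegral integral0. Qed.

End Rintegral_sums.

(** * Orthogonality to mollifiers at a fixed time *)

Section mollifiers.
Context {R : realType} {n : nat}.
Variables (alpha c b : R).
Hypotheses (alpha_gt0 : 0 < alpha) (alpha_lt2 : alpha < 2) (alpha_ltN : alpha < n%:R)
  (c_levy : @levy_normalization R n alpha c) (b0 : b != 0).
Local Notation leb := (lebesgue_rV R n).
Local Notation V := 'rV[R]_n.
Local Notation good := (@good R n alpha c).
Local Notation pair := (@pair R n alpha c).
Local Notation ft := (@ft R n b).
Local Notation ecst := (energy_cst (n := n) alpha b).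
Local Notation riesz := (@riesz R n alpha).
Local Notation transform := (@transform R n b).

Let riesz_ge0 (xi : V) : 0 <= riesz xi. Proof. exact: powR_ge0. Qed.

Let mriesz : measurable_fun setT riesz.
Proof. exact: (measurableT_comp (@measurable_powR R alpha) (measurable_enorm (R:=R) (n:=n))). Qed.

(** Not normalised: orthogonality is insensitive to scaling, and the mass is divided out where the
    transforms are compared with 1. *)
Definition mollifier (k : nat) : V -> R := bump 1 (fun=> - k.+1%:R^-1) (fun=> k.+1%:R^-1).

Lemma mollifier_shift k y x :
  mollifier k (x - y) = bump 1 (fun i => y ord0 i - k.+1%:R^-1) (fun i => y ord0 i + k.+1%:R^-1) x.
Proof.
rewrite /mollifier /bump; apply: eq_bigr => i _; rewrite !mul1r !mxE.
by congr (flat 0 _ * flat 0 _); ring.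
Qed.

Lemma continuous_bump p q : continuous (bump 1 p q : V -> R).
Proof. exact/flat_algebra_continuous/bump_algebra. Qed.

Lemma good_bump p q : good (bump 1 p q).
Proof.
have [C [L [C0 L0 Cb Lb]]] := @bump_bounds R n p q.
have [K _ KP] := good_lipschitz alpha_gt0 alpha_lt2 alpha_ltN c_levy C0 L0.
by have [] := KP _ (continuous_measurable_rV (@continuous_bump p q)) Cb Lb.
Qed.

Lemma integrable_bump p q : leb.-integrable setT (EFin \o (bump 1 p q : V -> R)).
Proof. by apply: integrable_schwartz; exact: schwartz_bump. Qed.

Let mollifierE k : mollifier k = bump 1 (fun=> - k.+1%:R^-1) (fun=> k.+1%:R^-1).
Proof. by []. Qed.

Let r_gt0 (k : nat) : 0 < k.+1%:R^-1 :> R. Proof. by rewrite invr_gt0. Qed.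

Let mass k : R := \int[leb]_x mollifier k x.

Lemma mollifier_mass_gt0 k : 0 < \int[leb]_x mollifier k x.
Proof.
rewrite lt_def; apply/andP; split; last first.
  by apply: Rintegral_ge0 => x _; exact: bump_ge0.
apply/eqP => I0; have mi := integrable_bump (fun=> - k.+1%:R^-1) (fun=> k.+1%:R^-1).
have : (\int[leb]_x (mollifier k x)%:E = 0)%E by rewrite (Rintegral_EFin mi) I0.
move=> /(ge0_integral_eq0_ae _ _) [].
- exact: measurable_int mi.
- by move=> x; rewrite lee_fin; exact: bump_ge0.
move=> N [mN N0 PN]; have r2 : 0 < k.+1%:R^-1 / 2 :> R by rewrite divr_gt0.
have : (leb (cube (k.+1%:R^-1 / 2) : set V) <= leb N)%E.
  apply: le_measure; rewrite ?inE//; first exact: measurable_cube.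
  move=> x xc; apply: PN => /= -[x0]; have : 0 < mollifier k x.
    apply: bump_gt0 => // i; have := xc i; rewrite ler_norml => /andP[h1 h2].
    by have := r_gt0 k; move: h1 h2 r2; move: (x ord0 i) k.+1%:R^-1 => u r h1 h2 r2 r0; apply/andP; split; lra.
  by rewrite x0 ltxx.
rewrite N0 lebesgue_cube ?(ltW r2)// lee_fin leNgt exprn_gt0//.
Qed.

Let tr_lip (tr dtr : R -> R) : (forall s : R, is_derive s 1 tr (dtr s)) ->
  (forall s, `|dtr s| <= 1) -> forall s, `|tr s - tr 0| <= `|s|.
Proof.
move=> D d1 s; have := @lipschitz_line R R tr 1 1 _ _ 0 s.
rewrite mul1r addr0 /GRing.scale /= mulr1; apply => x; first by have [] := D x.
by have [_ ->] := D x.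
Qed.

Let ft_mollifier tr xi k : continuous tr -> (forall s, `|tr s| <= 1) ->
  (forall s, `|tr s - tr 0| <= `|s|) ->
  `|ft tr (mollifier k) xi / mass k - tr 0| <= `|b| * (n%:R * enorm xi) * k.+1%:R^-1.
Proof.
move=> ctr tr1 trl; have mk := mollifier_mass_gt0 k.
have mi := integrable_bump (fun=> - k.+1%:R^-1) (fun=> k.+1%:R^-1).
set M := `|b| * _ * _; rewrite -mollifierE in mi.
have i1 := integrable_ft b xi ctr tr1 mi.
have E : ft tr (mollifier k) xi - mass k * tr 0 =
    \int[leb]_x (mollifier k x * (tr (b * dotp x xi) - tr 0)).
  under [RHS]eq_Rintegral do rewrite mulrBr.
  rewrite RintegralB//; last by under eq_fun do rewrite mulrC; exact: integrable_scaleR.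
  by congr (_ - _); rewrite mulrC -RintegralZl//; apply: eq_Rintegral => x _; rewrite mulrC.
have ii : leb.-integrable setT (EFin \o (fun x => mollifier k x * (tr (b * dotp x xi) - tr 0))).
  under eq_fun do rewrite mulrBr.
  apply: integrable_subR => //; under eq_fun do rewrite mulrC; exact: integrable_scaleR.
rewrite (_ : _ / _ - _ = (ft tr (mollifier k) xi - mass k * tr 0) / mass k); last first.
  by rewrite mulrBl mulrAC divff ?mul1r// gt_eqF.
rewrite normrM (gtr0_norm (_ : 0 < (mass k)^-1)) ?invr_gt0// ler_pdivrMr// E.
apply: le_trans (le_normr_Rintegral _ ii) _; first exact: measurableT.
rewrite /mass -RintegralZl//; apply: le_Rintegral => //.
- exact: (integrable_norm ii).
- exact: integrable_scaleR.
move=> x _; rewrite normrM (ger0_norm (bump_ge0 _ _ _ _)).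
have [xb|xb] := pselect (box (fun=> - k.+1%:R^-1) (fun=> k.+1%:R^-1) x); last first.
  by rewrite /mollifier bump_eq0// mul0r mulr0.
rewrite mulrC ler_wpM2r ?bump_ge0//; apply: le_trans (trl _) _.
rewrite normrM /M -mulrA ler_wpM2l// /dotp; apply: le_trans (ler_norm_sum _ _ _) _.
have -> : n%:R * enorm xi / k.+1%:R = \sum_(i < n) (enorm xi / k.+1%:R).
  by rewrite sumr_const card_ord -mulrA mulr_natl.
apply: ler_sum => i _; rewrite normrM mulrC ler_pM ?coord_enorm//.
by have /andP[h1 h2] := xb i; rewrite ler_norml !ltW.
Qed.

Lemma ft_mollifier_cvg tr xi : continuous tr -> (forall s, `|tr s| <= 1) ->
  (forall s, `|tr s - tr 0| <= `|s|) ->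
  ft tr (mollifier k) xi / mass k @[k --> \oo] --> tr 0.
Proof.
move=> ctr tr1 trl; pose M := `|b| * (n%:R * enorm xi).
have M0 : M * k.+1%:R^-1 @[k --> \oo] --> (0 : R).
  rewrite -[X in _ --> X](mulr0 M).
  by apply: cvgM; [exact: cvg_cst|exact: (@cvg_harmonic R)].
apply/cvgrPdist_le => e e0; near=> k.
rewrite distrC; apply: le_trans (ft_mollifier _ _ ctr tr1 trl) _; rewrite -/M.
by near: k; exact: (cvgr_le _ M0).
Unshelve. all: by end_near. Qed.

Let integrable_mul_bounded (u h : V -> R) M : leb.-integrable setT (EFin \o u) ->
  measurable_fun setT h -> (forall x, `|h x| <= M) ->
  leb.-integrable setT (EFin \o (fun x => u x * h x)).
Proof.
move=> ui mh hM; have mu : measurable_fun setT u by apply/measurable_EFinP; exact: measurable_int ui.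
apply: integrable_le (integrable_scaleR M (integrable_norm ui)) _ _.
  exact: measurable_funM.
by move=> x; rewrite normrM mulrC ler_wpM2r.
Qed.

Let ft_integrable tr u v : continuous tr -> (forall s, `|tr s| <= 1) ->
  leb.-integrable setT (EFin \o u) -> leb.-integrable setT (EFin \o v) ->
  leb.-integrable setT (EFin \o (fun x => u x * ft tr v x)).
Proof.
move=> ctr tr1 ui vi; apply: (integrable_mul_bounded ui _ (fun x => ft_bound b x ctr tr1 vi)).
by apply: measurable_ft => //; apply/measurable_EFinP; exact: measurable_int vi.
Qed.

Lemma transform_ft tr g : continuous tr -> (forall s, `|tr s| <= 1) ->
  leb.-integrable setT (EFin \o g) -> transform tr g (ft tr g).
Proof.
move=> ctr tr1 gi eta /integrable_schwartz ei; split; last exact: ft_duality.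
- exact: ft_integrable.
- by under eq_fun do rewrite mulrC; exact: ft_integrable.
Qed.

Let cos1 := @cos_norm_le1 R.
Let sin1 := @sin_norm_le1 R.
Let ccos := @continuous_cos R.
Let csin := @continuous_sin R.

Section slices.
Variables (f A B : V -> R).
Hypotheses (fG : good f) (fA : transform cos f A) (fB : transform sin f B).

Let AL : wL2 leb riesz A.
Proof. by have [] := transform_norm alpha_gt0 alpha_lt2 alpha_ltN c_levy b0 fG fA fB. Qed.

Let BL : wL2 leb riesz B.
Proof. by have [] := transform_norm alpha_gt0 alpha_lt2 alpha_ltN c_levy b0 fG fA fB. Qed.

Let mollifier_integrable k : leb.-integrable setT (EFin \o (mollifier k)).
Proof. exact: integrable_bump. Qed.

Let ft_wL2 g : good g -> leb.-integrable setT (EFin \o g) ->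
  wL2 leb riesz (ft cos g) /\ wL2 leb riesz (ft sin g).
Proof.
move=> gG gi.
by have [] := transform_norm alpha_gt0 alpha_lt2 alpha_ltN c_levy b0 gG
  (transform_ft ccos cos1 gi) (transform_ft csin sin1 gi).
Qed.

Let P u k tr (xi : V) := u xi * ft tr (mollifier k) xi * riesz xi.

Let P_integrable u k : wL2 leb riesz u ->
  leb.-integrable setT (EFin \o (P u k cos)) /\ leb.-integrable setT (EFin \o (P u k sin)).
Proof.
move=> uL; have [CL SL] := ft_wL2 (good_bump _ _) (mollifier_integrable k).
by split; exact: (wip_integrable mriesz riesz_ge0).
Qed.

Let good_shift k y : good (fun x => mollifier k (x - y)).
Proof. by under eq_fun do rewrite mollifier_shift; exact: good_bump. Qed.

Let integrable_shifted k y : leb.-integrable setT (EFin \o (fun x => mollifier k (x - y))).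
Proof. by under eq_fun do rewrite mollifier_shift; exact: integrable_bump. Qed.

(** Translating the mollifier only rotates its transforms, so as a function of the centre y the
    pairing is a combination of ordinary Fourier integrals of the integrable functions [P]. *)
Lemma pair_mollifier k y : ecst * pair f (fun x => mollifier k (x - y)) =
  (ft cos (P A k cos) y - ft sin (P A k sin) y) + (ft cos (P B k sin) y + ft sin (P B k cos) y).
Proof.
have gi := integrable_shifted k y; have mi := mollifier_integrable k.
rewrite -(transform_pair alpha_gt0 alpha_lt2 alpha_ltN c_levy b0 fG (good_shift k y) fA fB
  (transform_ft ccos cos1 gi) (transform_ft csin sin1 gi)).
have [A1 A2] := P_integrable k AL; have [B1 B2] := P_integrable k BL.
have EN xi : b * dotp (- y) xi = - (b * dotp xi y) by rewrite dotpNl dotpC mulrN.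
congr (_ + _).
  have iA := RintegralB measurableT (integrable_ft b y ccos cos1 A1) (integrable_ft b y csin sin1 A2).
  apply: etrans iA; apply: eq_Rintegral => xi _.
  by rewrite (ft_shift_cos b (- y) xi mi) EN cosN sinN /P; ring.
have iB := RintegralD measurableT (integrable_ft b y ccos cos1 B2) (integrable_ft b y csin sin1 B1).
apply: etrans iB; apply: eq_Rintegral => xi _.
by rewrite (ft_shift_sin b (- y) xi mi) EN cosN sinN /P; ring.
Qed.

(** After division by the mass, the transforms of the mollifiers are bounded by 1 and tend to
    [tr 0]; dominated convergence under the weighted product of [u] and [v] follows. *)
Let term_cvg tr u v : continuous tr -> (forall s, `|tr s| <= 1) ->
  (forall s, `|tr s - tr 0| <= `|s|) -> wL2 leb riesz u -> wL2 leb riesz v ->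
  (forall k, wL2 leb riesz (ft tr (mollifier k))) ->
  (\int[leb]_xi (v xi * P u k tr xi)) / mass k @[k --> \oo] --> tr 0 * wip leb riesz u v.
Proof.
move=> ctr tr1 trl uL vL FL.
have i := wip_integrable mriesz riesz_ge0 uL vL.
have mF k : measurable_fun setT (ft tr (mollifier k)) by have [] := FL k.
have muv : measurable_fun setT (fun xi => u xi * v xi * riesz xi).
  by apply/measurable_EFinP; exact: measurable_int i.
pose h k xi := (u xi * v xi * riesz xi) * (ft tr (mollifier k) xi / mass k).
have mh k : measurable_fun setT (h k).
  by apply: measurable_funM => //; apply: measurable_funM => //; exact: measurable_cst.
have bd k xi : `|ft tr (mollifier k) xi / mass k| <= 1.
  rewrite normrM (gtr0_norm (_ : 0 < (mass k)^-1)) ?invr_gt0 ?mollifier_mass_gt0//.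
  rewrite ler_pdivrMr ?mollifier_mass_gt0// mul1r.
  apply: le_trans (ft_bound b xi ctr tr1 (mollifier_integrable k)) _.
  rewrite (_ : \int[leb]_x _ = mass k)//.
  by apply: eq_Rintegral => x _; rewrite ger0_norm// bump_ge0.
have E k : (\int[leb]_xi (v xi * P u k tr xi)) / mass k = \int[leb]_xi h k xi.
  have hi : leb.-integrable setT (EFin \o h k).
    apply: integrable_mul_bounded i _ (bd k).
    by apply: measurable_funM => //; exact: measurable_cst.
  apply: (@mulIf _ (mass k)); first by rewrite gt_eqF// mollifier_mass_gt0.
  rewrite divfK ?gt_eqF ?mollifier_mass_gt0// mulrC -RintegralZl//.
  apply: eq_Rintegral => xi _; rewrite /h /P.
  by rewrite [RHS]mulrC -!mulrA mulVf ?gt_eqF ?mollifier_mass_gt0//; ring.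
have L xi : h k xi @[k --> \oo] --> (u xi * v xi * riesz xi) * tr 0.
  by apply: cvgM; [exact: cvg_cst|exact: ft_mollifier_cvg].
have hb k xi : `|h k xi| <= `|u xi * v xi * riesz xi|.
  by rewrite /h normrM ler_piMr.
have [_ K] := Rdominated_cvg mh (measurable_funM muv (measurable_cst _)) (nearW _ L)
  (integrable_norm i) hb.
rewrite (funext E) [X in _ --> X](_ : _ = \int[leb]_xi ((u xi * v xi * riesz xi) * tr 0)); first exact: K.
by rewrite /wip -RintegralZl//; apply: eq_Rintegral => xi _; rewrite mulrC.
Qed.

Hypothesis orth : forall k, {ae leb, forall y, pair f (fun x => mollifier k (x - y)) = 0}.

(** The pairing vanishes for almost every centre y; it is integrated against g(y), and the
    multiplication formula moves the transforms from the functions [P] to [g]. *)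
Let mollified_eq0 k g : leb.-integrable setT (EFin \o g) ->
  (\int[leb]_xi (ft cos g xi * P A k cos xi) - \int[leb]_xi (ft sin g xi * P A k sin xi)) +
  (\int[leb]_xi (ft cos g xi * P B k sin xi) + \int[leb]_xi (ft sin g xi * P B k cos xi)) = 0.
Proof.
move=> gi; have [A1 A2] := P_integrable k AL; have [B1 B2] := P_integrable k BL.
rewrite !(ft_duality b) //.
have i1 := ft_integrable ccos cos1 gi A1; have i2 := ft_integrable csin sin1 gi A2.
have i3 := ft_integrable ccos cos1 gi B2; have i4 := ft_integrable csin sin1 gi B1.
apply: etrans (Rintegral_sum4 i1 i2 i3 i4) _.
apply: Rintegral_ae0; apply: filterS (orth k) => y h.
by rewrite -mulrBr -mulrDr -mulrDr -pair_mollifier h !mulr0.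
Qed.

Lemma pair_mollifier_orth g : good g -> leb.-integrable setT (EFin \o g) -> pair f g = 0.
Proof.
move=> gG gi; have [CL SL] := ft_wL2 gG gi.
have FL k := ft_wL2 (good_bump _ _) (mollifier_integrable k).
have lc := tr_lip (@is_derive_cos R) (fun s => _ : `|- sin s| <= 1).
have ls := tr_lip (@is_derive_sin R) cos1.
have {}lc := lc (fun s => etrans (congr1 (fun r => r <= 1) (normrN _)) (sin1 s)).
have t1 := term_cvg ccos cos1 lc AL CL (fun k => (FL k).1).
have t2 := term_cvg csin sin1 ls AL SL (fun k => (FL k).2).
have t3 := term_cvg csin sin1 ls BL CL (fun k => (FL k).2).
have t4 := term_cvg ccos cos1 lc BL SL (fun k => (FL k).1).
(* In the limit the terms with a sine of the mollifier vanish and those with a cosine keep the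
   factor 1, which leaves the Fourier expression of [pair f g]. *)
rewrite cos0 sin0 !mul1r !mul0r in t1 t2 t3 t4.
have Z : (0 : R) @[_ --> \oo] --> (wip leb riesz A (ft cos g) - 0) + (0 + wip leb riesz B (ft sin g)).
  pose u k := (\int[leb]_xi (ft cos g xi * P A k cos xi) / mass k -
               \int[leb]_xi (ft sin g xi * P A k sin xi) / mass k) +
              (\int[leb]_xi (ft cos g xi * P B k sin xi) / mass k +
               \int[leb]_xi (ft sin g xi * P B k cos xi) / mass k).
  have u0 k : 0 = u k by rewrite /u -mulrBl -!mulrDl mollified_eq0// mul0r.
  rewrite (funext u0); apply: cvgD; first exact: cvgB t1 t2.
  exact: cvgD t3 t4.
rewrite subr0 add0r (transform_pair alpha_gt0 alpha_lt2 alpha_ltN c_levy b0 fG gG fA fB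
    (transform_ft ccos cos1 gi) (transform_ft csin sin1 gi)) in Z.
have E : ecst * pair f g = 0 by exact: (cvg_unique (@Rhausdorff R) Z (cvg_cst (0 : R))).
have e0 := energy_cst_gt0 alpha b0 (n := n).
by move/eqP: E; rewrite mulf_eq0 (gt_eqF e0) => /eqP.
Qed.

End slices.

Lemma pair_mollifier_eq0 f : good f ->
  (forall k, {ae leb, forall y, pair f (fun x => mollifier k (x - y)) = 0}) -> pair f f = 0.
Proof.
move=> fG orth; have [A [B [_ _ _ [fA fB] _]]] :=
  transform_good alpha_gt0 alpha_lt2 alpha_ltN c_levy b0 fG.
have Z k : pair (trunc k f) (trunc k f) = 0.
  apply/le_anti/andP; split; last exact: pair_ge0.
  apply: le_trans (pair_trunc_le alpha_gt0 alpha_ltN c_levy k fG) _.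
  rewrite (pair_mollifier_orth fG fA fB orth)//; first exact: good_trunc.
  exact: (integrable_trunc alpha_gt0 alpha_ltN k fG).
have := pair_trunc_cvg alpha_gt0 alpha_ltN c_levy fG.
by rewrite (funext Z) => /(cvg_unique (@Rhausdorff R) (cvg_cst (0 : R))) <-.
Qed.

End mollifiers.

Section ae_swap.
Context {d1 d2} {X : measurableType d1} {Y : measurableType d2} {R : realType}.
Variables (m1 : {sigma_finite_measure set X -> \bar R})
  (m2 : {sigma_finite_measure set Y -> \bar R}).

(** Each centre y comes with its own null set of times; joint measurability allows a passage to one
    null set of times good for almost every centre. *)
Lemma ae_prod_swap (P : set (X * Y)) : measurable P ->
  (forall y, {ae m1, forall x, P (x, y)}) -> {ae m1, forall x, {ae m2, forall y, P (x, y)}}.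
Proof.
move=> mP Py; apply: ae_prodW => //; exists (~` P); split => //; first exact: measurableC.
have mi : measurable_fun setT (fun p : X * Y => \1_(~` P) p : R).
  by apply: measurable_indic; exact: measurableC.
have i0 (p : X * Y) : 0 <= (\1_(~` P) p : R) by rewrite indicE ler0n.
have := tonelliE m1 m2 mi i0.
rewrite integral_indic ?setIT//; last exact: measurableC.
move=> ->; rewrite (tonelliC m1 m2 mi i0); apply: integral0_eq => y _.
rewrite (ae_eq_integral_nomeas (g := cst 0%E)) ?integral0//.
by apply: filterS (Py y) => x Pxy _; rewrite indicE memNset// => /(_ Pxy).
Qed.

End ae_swap.

(** * Uniqueness in time *)

Section line_uniqueness.
Context {R : realType}.
Local Notation lebt := (@lebesgue_measure R).
Local Notation TR := (measurableTypeR R).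
Variables (T : R) (h : TR -> R).
Hypotheses (hi : lebt.-integrable setT (EFin \o h))
  (h0 : forall t, ~ (0 < t < T) -> h t = 0)
  (orth : forall j q, 0 <= j -> q < T -> \int[lebt]_t (bump_time j (-1) q t * h t) = 0).

Let mh : measurable_fun setT h.
Proof. by apply/measurable_EFinP; exact: measurable_int hi. Qed.

Let measurable_bump_time j p q : measurable_fun [set: TR] (bump_time j p q : TR -> R).
Proof.
apply: continuous_measurable_fun; apply: continuous_mulR.
  move=> t; apply: (@continuous_comp _ _ _ (fun t : R => j * (t - p)) (flat 0)).
    by apply: continuous_scaleR; apply: continuous_subR => x; exact: cvg_id.
  exact: continuous_flat.
move=> t; apply: (@continuous_comp _ _ _ (fun t : R => j * (q - t)) (flat 0)).
  by apply: continuous_scaleR; apply: continuous_rsubR => x; exact: cvg_id.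
exact: continuous_flat.
Qed.

(** The limit of the time bumps on (-1, q) against [h]. Test functions need not vanish at t = 0, so
    the left endpoint can lie outside the support of [h], and half-lines suffice as a pi-system. *)
Let ray q (t : TR) : R := (t < q)%R%:R * h t.

Let measurable_ray q : measurable_fun setT (ray q).
Proof.
apply: measurable_funM => //.
rewrite (_ : (fun _ => _) = \1_(`]-oo, q[%classic : set TR)); first by apply: measurable_indic; exact: measurable_itv.
apply/funext => t; rewrite indicE; congr (nat_of_bool _)%:R; apply/esym.
by apply/idP/idP; rewrite inE/= in_itv.
Qed.

Let ray_le q t : `|ray q t| <= `|h t|.
Proof.
by rewrite /ray normrM ler_piMl//; case: (t < q); rewrite ?normr1 ?normr0.
Qed.

Let ray_eq0 q : q < T -> \int[lebt]_t ray q t = 0.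
Proof.
move=> qT; pose f (m : nat) (t : TR) := bump_time m%:R (-1) q t * h t.
have mf m : measurable_fun setT (f m) by exact: (measurable_funM (measurable_bump_time _ _ _) mh).
have bd m t : `|f m t| <= `|h t|.
  by rewrite /f normrM ler_piMl// ger0_norm ?bump_time_ge0// bump_time_le1.
have fc t : f m t @[m --> \oo] --> ray q t.
  have [t0|t0] := ltP (-1) t.
    rewrite (_ : ray q t = (-1 < t < q)%R%:R * h t); last by rewrite t0.
    by apply: cvgM; [exact: bump_time_cvg|exact: cvg_cst].
  have z : h t = 0 by apply: h0 => /andP[t1 _]; move: (lt_le_trans t1 t0); rewrite ltr0N1.
  rewrite /ray z mulr0 (_ : (fun m => _) = cst 0); first exact: cvg_cst.
  by apply/funext => m; rewrite /f z mulr0.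
have [_ L] := Rdominated_cvg mf (measurable_ray q) (nearW _ fc) (integrable_norm hi) bd.
have Z : (0 : R) @[_ --> \oo] --> \int[lebt]_t ray q t.
  have E m : 0 = \int[lebt]_t f m t by rewrite /f orth.
  by rewrite (funext E).
by exact: (cvg_unique (@Rhausdorff R) Z (cvg_cst (0 : R))).
Qed.

(** Bumps must end strictly before T, so the full integral is reached by letting q increase to T. *)
Let integral_h : \int[lebt]_t h t = 0.
Proof.
pose s (m : nat) := T - m.+1%:R^-1.
have fc t : ray (s m) t @[m --> \oo] --> h t.
  have [tT|tT] := ltP t T; last first.
    have z : h t = 0 by apply: h0 => /andP[_ t1]; move: (lt_le_trans t1 tT); rewrite ltxx.
    rewrite z (_ : (fun m => _) = cst 0); first exact: cvg_cst.
    by apply/funext => m; rewrite /ray z mulr0.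
  have L : (cst (h t) : nat -> R) m @[m --> \oo] --> h t by exact: cvg_cst.
  apply: cvg_trans L; apply: near_eq_cvg; near=> m.
  rewrite /ray (_ : (t < s m) = true) ?mul1r//.
  rewrite /s ltrBrDr -ltrBrDl; near: m.
  have Tt : 0 < T - t by rewrite subr_gt0.
  exact: (near_infty_natSinv_lt (PosNum Tt)).
have [_ L] := Rdominated_cvg (fun m => measurable_ray (s m)) mh (nearW _ fc)
  (integrable_norm hi) (fun m => ray_le (s m)).
have Z : (0 : R) @[_ --> \oo] --> \int[lebt]_t h t.
  have E m : 0 = \int[lebt]_t ray (s m) t by rewrite ray_eq0// /s ltrBlDr ltrDl invr_gt0.
  by rewrite (funext E).
by exact: (cvg_unique (@Rhausdorff R) Z (cvg_cst (0 : R))).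
Unshelve. all: by end_near. Qed.

Let integral_ray q : \int[lebt]_t ray q t = 0.
Proof.
have [qT|Tq] := ltP q T; first exact: ray_eq0.
rewrite -integral_h; apply: eq_Rintegral => t _; rewrite /ray.
have [tq|qt] := ltP t q; first by rewrite mul1r.
rewrite mul0r h0// => /andP[_ tT].
by have := lt_le_trans tT (le_trans Tq qt); rewrite ltxx.
Qed.

Lemma bump_time_ae_eq0 : {ae lebt, forall t, h t = 0}.
Proof.
apply: (@pi_system_ae_eq0 _ TR R lebt h (@RGenInftyO.G R)) => //.
- exact: RGenInftyO.measurableE.
- move=> _ _ [x ->] [y ->]; exists (Num.min x y); apply/seteqP.
  by split => t /=; rewrite !in_itv/= lt_min => /andP.
- by rewrite (Rintegral_EFin hi) integral_h.
move=> _ [q ->]; rewrite integral_mkcond.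
transitivity (\int[lebt]_t (ray q t)%:E)%E.
  apply: eq_integral => t _; rewrite /patch /ray.
  rewrite (_ : (t \in `]-oo, q[%classic) = (t < q)).
    by case: (t < q); rewrite ?mul1r ?mul0r.
  by apply/idP/idP; rewrite inE/= in_itv.
have ri : lebt.-integrable setT (EFin \o ray q).
  by apply: integrable_le (integrable_norm hi) _ (ray_le q).
by rewrite (Rintegral_EFin ri) integral_ray.
Qed.

End line_uniqueness.

Section density.
Context {R : realType} {n : nat}.
Variables (alpha c a b : R).
Hypotheses (alpha_gt0 : 0 < alpha) (alpha_lt2 : alpha < 2) (alpha_ltN : alpha < n%:R)
  (c_levy : @levy_normalization R n alpha c) (a_gt0 : 0 < a) (b0 : b != 0).
Variable T : R.
Hypothesis T_gt0 : 0 < T.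
Local Notation leb := (lebesgue_rV R n).
Local Notation lebt := (@lebesgue_measure R).
Local Notation V := 'rV[R]_n.
Local Notation TR := (measurableTypeR R).
Local Notation good := (@good R n alpha c).
Local Notation goodT := (@goodT R n alpha c).
Local Notation pair := (@pair R n alpha c).
Local Notation pairT := (@pairT R n alpha c).
Local Notation D := (`]0, T[%classic : set TR).
Local Notation Hdot := (@L2Hdot R n alpha c T).
Local Notation mollifier := (@mollifier R n).

Section orthogonal.
Variable h : V * R -> R.
Hypotheses (hH : Hdot h)
  (orth : forall g, @test_fun R n T g -> pairT (cut T h) (cut T g) = 0).

Let F : V * TR -> R := cut T h.
Let FG : goodT F := L2Hdot_goodT alpha_gt0 alpha_ltN c_levy hH.
Let e k y t := pair (slice F t) (fun x => mollifier k (x - y)).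

Let mF : measurable_fun setT F. Proof. by have [] := FG. Qed.

Let pair0l (g : V -> R) : pair (cst 0) g = 0.
Proof.
rewrite pairC; apply: Rintegral_ae0; apply: nearW => p.
by rewrite /increment subrr mulr0 mul0r.
Qed.

Let pairZr k (f g : V -> R) : good f -> good g -> pair f (fun x => g x * k) = k * pair f g.
Proof.
move=> fG gG; rewrite pairC (pairC alpha c f).
have m2 : measurable_fun setT (levy_density2 alpha c : V * V -> R).
  exact: (measurableT_comp (measurable_levy_density alpha c) measurable_snd).
have d0 (p : V * V) : 0 <= levy_density2 alpha c p by exact: levy_density_ge0.
rewrite -(wipZl m2 d0 k (good_increment gG) (good_increment fG)).
by congr wip; apply/funext => p; rewrite /increment -mulrBl mulrC.
Qed.

(** The mollifier as a time-independent function of space-time. It belongs to the space, and its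
    pairing with [F] exhibits [e k y] as an integrable function of time. *)
Let G k (y : V) (w : V * TR) : R := mollifier k (w.1 - y).

Let measurable_mollifier k : measurable_fun setT (mollifier k).
Proof. by apply: continuous_measurable_rV; exact: continuous_bump. Qed.

Let G_Hdot k y : Hdot (G k y).
Proof.
pose p i : R := y ord0 i - k.+1%:R^-1; pose q i : R := y ord0 i + k.+1%:R^-1.
have [C [L [C0 L0 Cb Lb]]] := @bump_bounds R n p q.
apply: (L2Hdot_lipschitz alpha_gt0 alpha_lt2 alpha_ltN c_levy T_gt0 C0 L0).
- apply: (measurableT_comp (measurable_mollifier k)).
  exact: (measurableT_comp (measurable_rV_shift (- y)) measurable_fst).
- by move=> x t; rewrite /G /= mollifier_shift.
- by move=> x z t; rewrite /G /= !mollifier_shift.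
Qed.

Let good_mollifier k y : good (fun x => mollifier k (x - y)).
Proof. by under eq_fun do rewrite mollifier_shift; exact: good_bump. Qed.

Let eE k y t : pair (slice F t) (slice (cut T (G k y)) t) = e k y t.
Proof.
have [Dt|Dt] := pselect (D t); first by rewrite slice_cut_in.
by rewrite /e /F (slice_cut_out h Dt) !pair0l.
Qed.

Let e_integrable k y : lebt.-integrable setT (EFin \o (e k y)).
Proof.
have GG := L2Hdot_goodT alpha_gt0 alpha_ltN c_levy (G_Hdot k y).
have [i _] := pairT_fubini c_levy FG GG.
by rewrite (_ : e k y = fun t => pair (slice F t) (slice (cut T (G k y)) t))//; apply/funext => t; rewrite eE.
Qed.

(** On the slice at time t the tensor test function is the mollifier multiplied by the number
    [bump_time j (-1) q t], which comes out of the pairing. *)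
Let e_orth k y j q : 0 <= j -> q < T -> \int[lebt]_t (bump_time j (-1) q t * e k y t) = 0.
Proof.
move=> j0 qT.
pose P := bumpT j (-1) q (fun i => y ord0 i - k.+1%:R^-1) (fun i => y ord0 i + k.+1%:R^-1).
have Pt : @test_fun R n T P by exact: bumpT_test_fun.
have PH := test_fun_L2Hdot alpha_gt0 alpha_lt2 alpha_ltN c_levy T_gt0 Pt.
have PG := L2Hdot_goodT alpha_gt0 alpha_ltN c_levy PH.
have [_ E] := pairT_fubini c_levy FG PG.
apply: etrans (etrans E (orth Pt)); apply: Rintegral_ae_eq.
apply: filterS (goodT_slice c_levy FG) => t ft.
have [Dt|Dt] := pselect (D t); last first.
  by rewrite /e /F !(slice_cut_out _ Dt) !pair0l mulr0.
rewrite (slice_cut_in P Dt) -(pairZr _ ft (good_mollifier k y)); congr pair.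
by apply/funext => x; rewrite mollifier_shift.
Qed.

Let e_ae0 k y : {ae lebt, forall t, e k y t = 0}.
Proof.
apply: (bump_time_ae_eq0 (T := T)); first exact: e_integrable.
  move=> t Dt; rewrite /e /F slice_cut_out ?pair0l//= in_itv/=; exact: Dt.
exact: e_orth.
Qed.

(** Joint measurability in time and centre, required for exchanging the two almost-everywhere
    quantifiers. *)
Let measurable_e k : measurable [set p : TR * V | e k p.2 p.1 = 0].
Proof.
pose f (p : (TR * V) * (V * V)) := increment3 F (p.1.1, p.2) *
  (mollifier k (p.2.1 + p.2.2 - p.1.2) - mollifier k (p.2.1 - p.1.2)) * levy_density2 alpha c p.2.
have m12 : measurable_fun setT (fun p : (TR * V) * (V * V) => - p.1.2).
  by apply: measurable_fun_opprV; exact: (measurableT_comp measurable_snd measurable_fst).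
have m21 : measurable_fun setT (fun p : (TR * V) * (V * V) => p.2.1).
  exact: (measurableT_comp measurable_fst measurable_snd).
have m22 : measurable_fun setT (fun p : (TR * V) * (V * V) => p.2.2).
  exact: (measurableT_comp measurable_snd measurable_snd).
have mf : measurable_fun setT f.
  apply: measurable_funM; last first.
    exact: (measurableT_comp (measurable_levy_density alpha c) m22).
  apply: measurable_funM.
    apply: (measurableT_comp (measurable_increment3 mF)).
    apply: measurable_fun_pair; last exact: measurable_snd.
    exact: (measurableT_comp measurable_fst measurable_fst).
  apply: measurable_funB; apply: (measurableT_comp (measurable_mollifier k)).
    by apply: measurable_fun_addrV => //; exact: measurable_fun_addrV.
  exact: measurable_fun_addrV.
have mI := measurable_Rintegral (product_sigma_finite leb leb) mf.
have -> : [set p : TR * V | e k p.2 p.1 = 0] = (fun p => e k p.2 p.1) @^-1` [set 0].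
  by [].
rewrite -[X in measurable X]setTI; apply: mI => //.
Qed.

Lemma pairT_orth_eq0 : pairT F F = 0.
Proof.
have [_ <-] := pairT_fubini c_levy FG FG; apply: Rintegral_ae0.
have ae k : {ae lebt, forall t, {ae leb, forall y, e k y t = 0}}.
  exact: (@ae_prod_swap _ _ TR V R lebt leb _ (measurable_e k) (e_ae0 k)).
have ae' : {ae lebt, forall t, forall k, {ae leb, forall y, e k y t = 0}}.
  exact: ae_foralln.
apply: filterS2 (goodT_slice c_levy FG) ae' => t ft h0.
exact: (pair_mollifier_eq0 alpha_gt0 alpha_lt2 alpha_ltN c_levy b0 ft h0).
Qed.

End orthogonal.

Lemma test_fun_dense : ip_dense Hdot (@test_fun R n T)
  (fun psi phi => complex.Re (fourier_form alpha a b T psi phi)).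
Proof.
have HH := L2Hdot_hilbert alpha_gt0 alpha_lt2 alpha_ltN c_levy a_gt0 b0 T.
have AV := test_fun_L2Hdot alpha_gt0 alpha_lt2 alpha_ltN c_levy T_gt0.
apply: (orthogonal_dense HH AV); first exact: test_fun0.
  by move=> k f g; exact: test_fun_comb.
have K0 : 0 < form_cst (n := n) alpha a b by exact: form_cst_gt0.
have FE := fourier_formE a alpha_gt0 alpha_lt2 alpha_ltN c_levy b0.
move=> h hH orth; rewrite (FE T _ _ hH hH) /= (pairT_orth_eq0 hH) ?mulr0// => g gA.
by have := orth g gA; rewrite (FE T _ _ hH (AV g gA)) /=; move=> /eqP; rewrite mulf_eq0 (gt_eqF K0) => /eqP.
Qed.

End density.

Theorem lemmaB2 (R : realType) (N : nat) (alpha c : R)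
    (alpha_gt0 : 0 < alpha) (alpha_lt2 : alpha < 2) (alpha_ltN : alpha < N%:R)
    (c_levy : @levy_normalization R N alpha c)
    (a b : R) (a_gt0 : 0 < a) (b_neq0 : b != 0) :
  exists2 kappa : R, 0 < kappa & forall T : R, 0 < T ->
  let V := @L2Hdot R N alpha c T in
  let ip psi phi := complex.Re (@fourier_form R N alpha a b T psi phi) in
  [/\ forall psi phi, V psi -> V phi ->
        [/\ fourier_form_defined alpha a b T psi phi,
            energy_T alpha c T psi phi \is a fin_num &
            fourier_form alpha a b T psi phi =
            (kappa * fine (energy_T alpha c T psi phi))%:C%C],
      hilbert_space V (@ae_eq_QT R N T) ip &
      ip_dense V (@test_fun R N T) ip].
Proof.
have K0 : 0 < form_cst (n := N) alpha a b by exact: form_cst_gt0.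
(* The energy is half of [pairT], whence the 2. The constant is fixed before T and is built from the
   dimension, alpha and the normalisation a, b alone. *)
exists (2 * form_cst (n := N) alpha a b); first by rewrite mulr_gt0.
move=> T T_gt0 V ip; split.
- move=> psi phi psiV phiV.
  have E := energy_T_pairT alpha_gt0 alpha_ltN c_levy psiV phiV.
  split; first exact: (fourier_form_definedP a alpha_gt0 alpha_lt2 alpha_ltN c_levy b_neq0 psiV phiV).
    by rewrite E.
  rewrite (fourier_formE a alpha_gt0 alpha_lt2 alpha_ltN c_levy b_neq0 psiV phiV) E /=.
  by rewrite mulrACA divff ?mul1r.
- exact: (L2Hdot_hilbert alpha_gt0 alpha_lt2 alpha_ltN c_levy a_gt0 b_neq0 T).
- exact: (test_fun_dense alpha_gt0 alpha_lt2 alpha_ltN c_levy a_gt0 b_neq0 T_gt0).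
Qed.
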